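(* Let $\Omega=[0,1[^2$ with periodic boundary conditions, and let $\mathbf D:\mathbb R^2\to S_2^+$ be $\mathbb Z^2$-periodic and Lipschitz continuous. There exist $h_0>0$ and $c>0$, depending only on $\mathbf D$, such that for every $h=1/n\le h_0$ ($n\ge 1$ an integer) the following hold. (a) $\mathcal Q_h$ is a polygonization of $\mathbb R^2$ into strictly convex polygons with vertex set $h\mathbb Z^2$, so that Anisotropic Delaunay Triangulations exist. (b) For every Anisotropic Delaunay Triangulation $\mathcal T_h$ and every $u:\Omega_h\to\mathbb R$, $$(1-ch)\,\mathcal E_h(u)\le \mathcal E'_h(u)\le (1+ch)\,\mathcal E_h(u).$$
   Context: Let $S_2^+$ be the set of symmetric positive definite $2\times2$ matrices. For $M\in S_2^+$ set $\|e\|_M:=\sqrt{\langle e,Me\rangle}$. For $u=(a,b)\in\mathbb R^2$ set $u^\perp:=(-b,a)$. A basis of $\mathbb Z^2$ is a pair $(e_1,e_2)$ of elements of $\mathbb Z^2$ with $|\det(e_1,e_2)|=1$. A superbase of $\mathbb Z^2$ is a triple $(e_0,e_1,e_2)$ of elements of $\mathbb Z^2$ with $e_0+e_1+e_2=0$ and $(e_1,e_2)$ a basis. The triple is $M$-obtuse if $\langle e_i,Me_j\rangle\le0$ for all $i\ne j$. For every $M\in S_2^+$, an $M$-obtuse superbase exists. Set $\delta(z):=\det(\mathbf D(z))^{1/2}$ and $\mathbf M(z):=\delta(z)\mathbf D(z)^{-1}$, so that $\det \mathbf M(z)=1$. AD-LBR stencil and weights at $z$: choose an $\mathbf M(z)$-obtuse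 superbase $(e_0,e_1,e_2)$ of $\mathbb Z^2$. Set $V(z):=\{\pm e_0,\pm e_1,\pm e_2\}$ and $$\gamma_z(\pm e_i):=-\tfrac12\langle e_{i+1}^\perp,\mathbf D(z)e_{i+2}^\perp\rangle,$$ with indices taken mod $3$; set $\gamma_z:=0$ on $\mathbb Z^2\setminus V(z)$. Grid and energies: $\Omega_h:=\Omega\cap h\mathbb Z^2$. Functions $u:\Omega_h\to\mathbb R$ are extended $\mathbb Z^2$-periodically to $h\mathbb Z^2$. Define $$\mathcal E_h(u):=\sum_{z\in\Omega_h}\sum_{e\in V(z)}\gamma_z(e)\,|u(z+he)-u(z)|^2 .$$ Anisotropic Delaunay Triangulation (ADT): for $p,q\in\mathbb R^2$ let $\delta_p(q):=\|q-p\|_{\mathbf M(p)}$ and $\Delta_h(q):=\min_{p\in h\mathbb Z^2}\delta_p(q)$. The Voronoi cell of $p\in h\mathbb Z^2$ is $\mathrm{Vor}_h(p):=\{q:\delta_p(q)=\Delta_h(q)\}$. A Voronoi vertex is a point $q$ lying in the Voronoi cells of at least three distinct grid points; if $p_1,\dots,p_k$ are all the grid points whose cells contain $q$, set $T_q:=\mathrm{conv}\{p_1,\dots,p_k\}$. Let $\mathcal Q_h$ be the collection of all $T_q$. When $\mathcal Q_h$ is a polygonization of $\mathbb R^2$ into strictly convex polygons with vertex set $h\mathbb Z^2$, an ADT $\mathcal T_h$ is any $\mathbb Z^2$-periodic triangulation obtained by triangulating each element of $\mathcal Q_h$ without adding vertices. Finite element energy: $\mathcal E'_h(u):=\int_\Omega\|\nabla(I_{\mathcal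 T_h}u)(z)\|^2_{\mathbf D(z)}\,dz$, where $I_{\mathcal T_h}u$ is the continuous piecewise linear interpolant of (the periodic extension of) $u$ on $\mathcal T_h$. *)

(* Defs.v *)
From Stdlib Require Import Reals Lra List ZArith.
Open Scope R_scope.

Definition pt := (R * R)%type.
Definition zpt := (Z * Z)%type.

Definition vadd (p q : pt) : pt := (fst p + fst q, snd p + snd q).
Definition vsub (p q : pt) : pt := (fst p - fst q, snd p - snd q).
Definition vscale (s : R) (p : pt) : pt := (s * fst p, s * snd p).
Definition dot (p q : pt) : R := fst p * fst q + snd p * snd q.
Definition pdist (p q : pt) : R := sqrt (dot (vsub p q) (vsub p q)).
Definition perp (u : pt) : pt := (- snd u, fst u).
Definition toR (k : zpt) : pt := (IZR (fst k), IZR (snd k)).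

(* Symmetric 2x2 matrices: (a,b,c) stands for [[a,b],[b,c]]. *)
Definition sym2 := (R * R * R)%type.
Definition bform (M : sym2) (u v : pt) : R :=
  let '(a, b, c) := M in
  a * fst u * fst v + b * (fst u * snd v + snd u * fst v) + c * snd u * snd v.
Definition mnorm (M : sym2) (e : pt) : R := sqrt (bform M e e).
Definition mdet (M : sym2) : R := let '(a, b, c) := M in a * c - b * b.
Definition SPD (M : sym2) : Prop := let '(a, b, c) := M in 0 < a /\ 0 < a * c - b * b.
Definition minv (M : sym2) : sym2 :=
  let '(a, b, c) := M in (c / mdet M, - b / mdet M, a / mdet M).
Definition mscale (s : R) (M : sym2) : sym2 := let '(a, b, c) := M in (s * a, s * b, s * c).
(* Frobenius distance between symmetric matrices *)
Definition mdist (M N : sym2) : R :=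
  let '(a, b, c) := M in let '(a', b', c') := N in
  sqrt ((a - a') ^ 2 + 2 * (b - b') ^ 2 + (c - c') ^ 2).

Definition deltaD (D : pt -> sym2) (z : pt) : R := sqrt (mdet (D z)).
Definition MM (D : pt -> sym2) (z : pt) : sym2 := mscale (deltaD D z) (minv (D z)).

Definition zbasis (e1 e2 : zpt) : Prop :=
  Z.abs (fst e1 * snd e2 - snd e1 * fst e2) = 1%Z.
Definition superbase (s : zpt * zpt * zpt) : Prop :=
  let '(e0, e1, e2) := s in
  (fst e0 + fst e1 + fst e2 = 0)%Z /\ (snd e0 + snd e1 + snd e2 = 0)%Z /\ zbasis e1 e2.
Definition obtuse (M : sym2) (s : zpt * zpt * zpt) : Prop :=
  let '(e0, e1, e2) := s in
  bform M (toR e0) (toR e1) <= 0 /\ bform M (toR e0) (toR e2) <= 0 /\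
  bform M (toR e1) (toR e2) <= 0.

(* Periodic grid functions: u(i,j) is the value at the point (i h, j h), h = 1/n. *)
Definition periodic_grid (n : nat) (u : Z -> Z -> R) : Prop :=
  forall i j, u (i + Z.of_nat n)%Z j = u i j /\ u i (j + Z.of_nat n)%Z = u i j.

(* AD-LBR local contribution at z = (i h, j h):
   sum_{e in V(z)} gamma_z(e) |u(z+he)-u(z)|^2, with the six distinct vectors +-e_k. *)
Definition stencil_term (D : pt -> sym2) (sb : pt -> zpt * zpt * zpt)
  (u : Z -> Z -> R) (z : pt) (i j : Z) : R :=
  let '(e0, e1, e2) := sb z in
  let g0 := - (1/2) * bform (D z) (perp (toR e1)) (perp (toR e2)) in
  let g1 := - (1/2) * bform (D z) (perp (toR e2)) (perp (toR e0)) in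
  let g2 := - (1/2) * bform (D z) (perp (toR e0)) (perp (toR e1)) in
  let d (e : zpt) := (u (i + fst e)%Z (j + snd e)%Z - u i j) ^ 2
                   + (u (i - fst e)%Z (j - snd e)%Z - u i j) ^ 2 in
  g0 * d e0 + g1 * d e1 + g2 * d e2.

Definition Eh (D : pt -> sym2) (sb : pt -> zpt * zpt * zpt) (n : nat)
  (u : Z -> Z -> R) : R :=
  sum_f_R0 (fun i => sum_f_R0 (fun j =>
     stencil_term D sb u (INR i / INR n, INR j / INR n) (Z.of_nat i) (Z.of_nat j))
     (n - 1)) (n - 1).

Definition hpt (n : nat) (k : zpt) : pt := (IZR (fst k) / INR n, IZR (snd k) / INR n).

Definition deltap (D : pt -> sym2) (p q : pt) : R := mnorm (MM D p) (vsub q p).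
Definition inVor (D : pt -> sym2) (n : nat) (k : zpt) (q : pt) : Prop :=
  forall k', deltap D (hpt n k) q <= deltap D (hpt n k') q.
Definition cellpts (D : pt -> sym2) (n : nat) (q : pt) : zpt -> Prop :=
  fun k => inVor D n k q.
Definition isVorVertex (D : pt -> sym2) (n : nat) (q : pt) : Prop :=
  exists k1 k2 k3, k1 <> k2 /\ k1 <> k3 /\ k2 <> k3 /\
    inVor D n k1 q /\ inVor D n k2 q /\ inVor D n k3 q.

Definition inconv (S : pt -> Prop) (x : pt) : Prop :=
  exists l : list (pt * R),
    Forall (fun pw => S (fst pw) /\ 0 <= snd pw) l /\
    fold_right (fun pw acc => snd pw + acc) 0 l = 1 /\
    fold_right (fun pw acc => vadd (vscale (snd pw) (fst pw)) acc) (0, 0) l = x.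
Definition img (n : nat) (P : zpt -> Prop) : pt -> Prop :=
  fun x => exists k, P k /\ x = hpt n k.
Definition interior (A : pt -> Prop) (x : pt) : Prop :=
  exists eps, 0 < eps /\ forall y, pdist x y < eps -> A y.

(* conv(h P) is a strictly convex polygon whose vertices are exactly h P *)
Definition strictly_convex_poly (n : nat) (P : zpt -> Prop) : Prop :=
  (exists l : list zpt, forall k, P k <-> In k l) /\
  (forall k, P k -> ~ inconv (img n (fun k' => P k' /\ k' <> k)) (hpt n k)).

(* Q_h = { T_q = conv(cellpts q) : q Voronoi vertex } is a (conforming) polygonization
   of R^2 into strictly convex polygons with vertex set h Z^2. *)
Definition Qh_polygonization (D : pt -> sym2) (n : nat) : Prop :=
  (forall q, isVorVertex D n q -> strictly_convex_poly n (cellpts D n q)) /\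
  (forall x, exists q, isVorVertex D n q /\ inconv (img n (cellpts D n q)) x) /\
  (forall q q', isVorVertex D n q -> isVorVertex D n q' ->
     (exists k, ~ (cellpts D n q k <-> cellpts D n q' k)) ->
     (~ exists x, interior (inconv (img n (cellpts D n q))) x /\
                  interior (inconv (img n (cellpts D n q'))) x) /\
     (forall x, (inconv (img n (cellpts D n q)) x /\ inconv (img n (cellpts D n q')) x) <->
                inconv (img n (fun k => cellpts D n q k /\ cellpts D n q' k)) x)) /\
  (forall k, exists q, isVorVertex D n q /\ cellpts D n q k).

Definition tri := (zpt * zpt * zpt)%type.
Definition tri_set (n : nat) (t : tri) : pt -> Prop :=
  let '(a, b, c) := t in
  inconv (fun x => x = hpt n a \/ x = hpt n b \/ x = hpt n c).
Definition tri_verts_in (t : tri) (P : zpt -> Prop) : Prop :=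
  let '(a, b, c) := t in P a /\ P b /\ P c.
Definition tri_vert (t : tri) (k : zpt) : Prop :=
  let '(a, b, c) := t in k = a \/ k = b \/ k = c.
Definition tri_nondeg (n : nat) (t : tri) : Prop :=
  let '(a, b, c) := t in
  let u := vsub (hpt n b) (hpt n a) in let v := vsub (hpt n c) (hpt n a) in
  fst u * snd v - snd u * fst v <> 0.
Definition zshift (k m : zpt) : zpt := (fst k + fst m, snd k + snd m)%Z.
Definition tri_shift (t : tri) (m : zpt) : tri :=
  let '(a, b, c) := t in (zshift a m, zshift b m, zshift c m).

Definition isADT (D : pt -> sym2) (n : nat) (T : tri -> Prop) : Prop :=
  (forall t, T t -> tri_nondeg n t /\
     exists q, isVorVertex D n q /\ tri_verts_in t (cellpts D n q)) /\
  (forall q, isVorVertex D n q ->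
     (forall x, inconv (img n (cellpts D n q)) x ->
        exists t, T t /\ tri_verts_in t (cellpts D n q) /\ tri_set n t x) /\
     (forall t t', T t -> T t' -> tri_verts_in t (cellpts D n q) ->
        tri_verts_in t' (cellpts D n q) ->
        (exists k, ~ (tri_vert t k <-> tri_vert t' k)) ->
        ~ exists x, interior (tri_set n t) x /\ interior (tri_set n t') x)) /\
  (forall t (m : zpt), T t ->
     T (tri_shift t ((Z.of_nat n * fst m)%Z, (Z.of_nat n * snd m)%Z))).

Definition tri_grad (n : nat) (u : Z -> Z -> R) (t : tri) (g : pt) : Prop :=
  let '(a, b, c) := t in
  dot g (vsub (hpt n b) (hpt n a)) = u (fst b) (snd b) - u (fst a) (snd a) /\
  dot g (vsub (hpt n c) (hpt n a)) = u (fst c) (snd c) - u (fst a) (snd a).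

(* A pointwise version of grad(I_T u): at each point, the gradient on some
   triangle containing it (the choice on edges is immaterial for the integral). *)
Definition admissible_grad (n : nat) (T : tri -> Prop) (u : Z -> Z -> R)
  (G : pt -> pt) : Prop :=
  forall x, exists t, T t /\ tri_set n t x /\ tri_grad n u t (G x).

Definition riemann_mid (f : pt -> R) (N : nat) : R :=
  sum_f_R0 (fun i => sum_f_R0 (fun j =>
     f ((INR i + / 2) / INR (S N), (INR j + / 2) / INR (S N))) N) N
  / (INR (S N)) ^ 2.

(* E'_h(u) = I : the (Riemann) integral over Omega of ||grad(I_T u)||^2_{D(z)} equals I *)
Definition Eprime_is (D : pt -> sym2) (n : nat) (T : tri -> Prop)
  (u : Z -> Z -> R) (I : R) : Prop :=
  forall G, admissible_grad n T u G ->
    Un_cv (riemann_mid (fun x => bform (D x) (G x) (G x))) I.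

(* Main.v *)
Require Import Defs.
From Stdlib Require Import Reals Lra Lia List ZArith ClassicalEpsilon FinFun.
From Coquelicot Require Compactness.
Open Scope R_scope.

(* Scale the grid to the integer lattice.  At each lattice point choose an obtuse
   superbase (e0, e1, e2) in which <e1,e2> is the product of least magnitude.  The other
   two products are then bounded away from 0 and the superbase vectors are bounded, both
   uniformly.  In the coordinates (e1, e2) the metrics at the nearby lattice points are
   O(h)-perturbations of a single form with Gram matrix [[A,-B],[-B,C]], so cells can meet
   only within a unit square, and a contraction argument locates the points equidistant
   from three corners.  The sign of an alternating sum of the four squared distances
   decides which diagonal, if any, cuts the square, and this gives the polygonization.
   The diagonal opposite to the one favoured by B is possible only if B = O(h).

   For the energies, on a triangle with edges of determinant +-1 the P1 stiffness identity
   writes the energy density as a sum over the edges, with weights that agree up to O(h)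
   with the weights of the stencil.  Sum over a lattice of sample points.  A sample point
   and its reflection through the centre of its square lie in triangles that together
   contain each side of the square exactly once, and a mass transport over the period then
   shows that every lattice edge is counted with the right total weight, up to an O(h)
   multiple of the sum of the squared increments.  That sum is in turn bounded by the
   stencil energy, because an edge of weight bounded below at one lattice point is an
   edge of weight bounded below at the neighbouring ones. *)

(** * A planar contraction principle *)

(** The obstacle is that obtuse superbases jump. Where a product of a superbase vanishes, two
    superbases are obtuse, and the stencil may use different ones at neighbouring points. Ordering
    the vectors so that the product of least magnitude is [- B], that of [e1] and [e2], confines the
    ambiguity to the choice of a diagonal of the square. The weight of the diagonal [e1 + e2] is
    proportional to [B], so wherever the ambiguity is real the edge has a weight of order h and
    either choice is harmless. No continuity of the frames in the base point is assumed: every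
    vertex examines its triangles in its own frame.

    Equidistant points solve equations perturbed by metrics that vary with the lattice point. It is
    the small Lipschitz constant of the perturbation, not just its size, that gives existence and
    uniqueness.

    The integral is a limit of midpoint sums for every admissible [G], which is an arbitrary choice
    on the edges. So the limit has to be constructed: samples within order 1/N of a lattice line of
    bounded direction are a vanishing proportion, and at the others [G] is forced. *)

Lemma contraction_fixed_point (f g : R -> R -> R) (r : R) :
  0 < r ->
  (forall s t s' t', Rabs s + Rabs t <= r -> Rabs s' + Rabs t' <= r ->
     Rabs (f s t - f s' t') + Rabs (g s t - g s' t')
       <= / 2 * (Rabs (s - s') + Rabs (t - t'))) ->
  Rabs (f 0 0) + Rabs (g 0 0) <= r / 2 ->
  exists s t, Rabs s + Rabs t <= r /\ f s t = s /\ g s t = t.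
Proof.
  intros Hr Hc H0.
  set (step := fun p : R * R => (f (fst p) (snd p), g (fst p) (snd p))).
  set (x := fun n => Nat.iter n step (0, 0)).
  assert (HS : forall n, x (S n) = (f (fst (x n)) (snd (x n)), g (fst (x n)) (snd (x n))))
    by reflexivity.
  (* The ball is invariant: the ratio 1/2 leaves room for an image of the origin of size r/2. *)
  assert (Hself : forall s t, Rabs s + Rabs t <= r -> Rabs (f s t) + Rabs (g s t) <= r).
  { intros s t H.
    assert (H00 : Rabs 0 + Rabs 0 <= r) by (rewrite Rabs_R0; lra).
    pose proof (Hc s t 0 0 H H00) as K. rewrite !Rminus_0_r in K.
    pose proof (Rabs_triang (f s t - f 0 0) (f 0 0)) as T1.
    pose proof (Rabs_triang (g s t - g 0 0) (g 0 0)) as T2.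
    replace (f s t - f 0 0 + f 0 0) with (f s t) in T1 by ring.
    replace (g s t - g 0 0 + g 0 0) with (g s t) in T2 by ring. lra. }
  assert (Hb : forall n, Rabs (fst (x n)) + Rabs (snd (x n)) <= r).
  { induction n as [|n IH].
    - unfold x; simpl. rewrite Rabs_R0; lra.
    - rewrite HS; cbn [fst snd]. apply Hself, IH. }
  assert (Hstep : forall n, Rabs (fst (x (S n)) - fst (x n)) + Rabs (snd (x (S n)) - snd (x n))
                    <= r * (/ 2) ^ S n).
  { induction n as [|n IH].
    - rewrite HS. unfold x; simpl. rewrite !Rminus_0_r. lra.
    - pose proof (Hc _ _ _ _ (Hb (S n)) (Hb n)) as K.
      replace (f (fst (x (S n))) (snd (x (S n)))) with (fst (x (S (S n)))) in K by (rewrite HS; reflexivity).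
      replace (g (fst (x (S n))) (snd (x (S n)))) with (snd (x (S (S n)))) in K by (rewrite HS; reflexivity).
      replace (f (fst (x n)) (snd (x n))) with (fst (x (S n))) in K by (rewrite HS; reflexivity).
      replace (g (fst (x n)) (snd (x n))) with (snd (x (S n))) in K by (rewrite HS; reflexivity).
      change ((/ 2) ^ S (S n)) with (/ 2 * (/ 2) ^ S n). lra. }
  (* The subtracted term makes the geometric sum exact, so that the induction on [m] closes. *)
  assert (Htail : forall n m, Rabs (fst (x (n + m)%nat) - fst (x n))
            + Rabs (snd (x (n + m)%nat) - snd (x n)) <= r * (/ 2) ^ n - r * (/ 2) ^ (n + m)).
  { intros n m; induction m as [|m IH].
    - rewrite Nat.add_0_r, !Rminus_diag, Rabs_R0. lra.
    - rewrite Nat.add_succ_r. pose proof (Hstep (n + m)%nat) as K.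
      pose proof (Rabs_triang (fst (x (S (n + m))) - fst (x (n + m)%nat)) (fst (x (n + m)%nat) - fst (x n))) as T1.
      pose proof (Rabs_triang (snd (x (S (n + m))) - snd (x (n + m)%nat)) (snd (x (n + m)%nat) - snd (x n))) as T2.
      replace (fst (x (S (n + m))) - fst (x (n + m)%nat) + (fst (x (n + m)%nat) - fst (x n)))
        with (fst (x (S (n + m))) - fst (x n)) in T1 by ring.
      replace (snd (x (S (n + m))) - snd (x (n + m)%nat) + (snd (x (n + m)%nat) - snd (x n)))
        with (snd (x (S (n + m))) - snd (x n)) in T2 by ring.
      assert (r * (/ 2) ^ S (n + m) = r * (/ 2) ^ (n + m) / 2) by (simpl; field).
      lra. }
  assert (Htail' : forall N n, (n >= N)%nat -> Rabs (fst (x n) - fst (x N))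
            + Rabs (snd (x n) - snd (x N)) <= r * (/ 2) ^ N).
  { intros N n Hn. replace n with (N + (n - N))%nat by lia.
    pose proof (Htail N (n - N)%nat).
    assert (0 < (/ 2) ^ (N + (n - N))) by (apply pow_lt; lra). nra. }
  assert (Hsm : forall e, 0 < e -> exists N, r * (/ 2) ^ N < e).
  { intros e He. destruct (pow_lt_1_zero (/ 2)) with (y := e / r) as [N HN].
    - rewrite Rabs_pos_eq; lra.
    - apply Rdiv_lt_0_compat; lra.
    - exists N. specialize (HN N (le_n _)). rewrite Rabs_pos_eq in HN.
      + apply (Rmult_lt_compat_l r) in HN; [|lra].
        replace (r * (e / r)) with e in HN by (field; lra). exact HN.
      + left; apply pow_lt; lra. }
  assert (HC : forall pr : R * R -> R, (pr = fst \/ pr = snd) -> Cauchy_crit (fun n => pr (x n))).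
  { intros pr Hpr e He. destruct (Hsm (e / 2)) as [N HN]; [lra|]. exists N.
    intros n m Hn Hm. unfold Rdist.
    pose proof (Htail' N n Hn). pose proof (Htail' N m Hm).
    assert (HP : forall k, Rabs (pr (x k) - pr (x N)) <= Rabs (fst (x k) - fst (x N))
            + Rabs (snd (x k) - snd (x N))).
    { intros k. pose proof (Rabs_pos (fst (x k) - fst (x N))).
      pose proof (Rabs_pos (snd (x k) - snd (x N))). destruct Hpr; subst pr; lra. }
    pose proof (HP n). pose proof (HP m).
    pose proof (Rabs_triang (pr (x n) - pr (x N)) (- (pr (x m) - pr (x N)))) as T.
    rewrite Rabs_Ropp in T.
    replace (pr (x n) - pr (x N) + - (pr (x m) - pr (x N))) with (pr (x n) - pr (x m)) in T by ring.
    lra. }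
  destruct (R_complete _ (HC fst (or_introl eq_refl))) as [s Hs].
  destruct (R_complete _ (HC snd (or_intror eq_refl))) as [t Ht].
  (* One index has to serve two consecutive iterates: the limit is shown to be fixed by comparing
     its image with [x (S n)], the image of [x n]. *)
  assert (Hconv : forall e, 0 < e -> exists n, Rabs (fst (x n) - s) + Rabs (snd (x n) - t) < e /\
            Rabs (fst (x (S n)) - s) + Rabs (snd (x (S n)) - t) < e).
  { intros e He. destruct (Hs (e/2)) as [N1 H1]; [lra|]. destruct (Ht (e/2)) as [N2 H2]; [lra|].
    exists (N1 + N2)%nat. unfold Rdist in *.
    pose proof (H1 (N1+N2)%nat ltac:(lia)). pose proof (H2 (N1+N2)%nat ltac:(lia)).
    pose proof (H1 (S (N1+N2))%nat ltac:(lia)). pose proof (H2 (S (N1+N2))%nat ltac:(lia)). lra. }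
  exists s, t.
  assert (Hst : Rabs s + Rabs t <= r).
  { apply Rnot_lt_le. intro Hlt. destruct (Hconv (Rabs s + Rabs t - r)) as [n [Hn _]]; [lra|].
    pose proof (Hb n).
    pose proof (Rabs_triang_inv s (fst (x n))) as I1.
    pose proof (Rabs_triang_inv t (snd (x n))) as I2.
    rewrite (Rabs_minus_sym s) in I1. rewrite (Rabs_minus_sym t) in I2. lra. }
  split; [exact Hst|].
  assert (Hz : Rabs (f s t - s) + Rabs (g s t - t) <= 0).
  { apply Rnot_lt_le. intro Hlt.
    destruct (Hconv ((Rabs (f s t - s) + Rabs (g s t - t)) / 2)) as [n [Hn Hn']]; [lra|].
    pose proof (Hc _ _ _ _ Hst (Hb n)) as K. rewrite HS in Hn'. cbn [fst snd] in Hn'.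
    set (a := fst (x n)) in *. set (b := snd (x n)) in *.
    pose proof (Rabs_triang (f s t - f a b) (f a b - s)) as T1.
    pose proof (Rabs_triang (g s t - g a b) (g a b - t)) as T2.
    replace (f s t - f a b + (f a b - s)) with (f s t - s) in T1 by ring.
    replace (g s t - g a b + (g a b - t)) with (g s t - t) in T2 by ring.
    rewrite (Rabs_minus_sym s), (Rabs_minus_sym t) in K. lra. }
  pose proof (Rabs_pos (f s t - s)). pose proof (Rabs_pos (g s t - t)).
  assert (E1 : Rabs (f s t - s) = 0) by lra. assert (E2 : Rabs (g s t - t) = 0) by lra.
  split; [destruct (Req_dec (f s t - s) 0) as [e|e] | destruct (Req_dec (g s t - t) 0) as [e|e]];
    try lra; apply Rabs_no_R0 in e; lra.
Qed.

Lemma Rabs_le_inv x e : Rabs x <= e -> - e <= x <= e.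
Proof. intros H. pose proof (Rle_abs x). pose proof (Rle_abs (- x)). rewrite Rabs_Ropp in *. lra. Qed.

(** * Almost constant metrics on the lattice *)

Definition msub (M N : sym2) : sym2 :=
  (fst (fst M) - fst (fst N), snd (fst M) - snd (fst N), snd M - snd N).
(** Entrywise closeness is paired with the l1 norm [n1]: the form of the difference is then at most
    [e] times the product of the two norms, without square roots. *)
Definition mclose (e : R) (M N : sym2) : Prop :=
  Rabs (fst (fst M) - fst (fst N)) <= e /\ Rabs (snd (fst M) - snd (fst N)) <= e /\
  Rabs (snd M - snd N) <= e.
Definition n1 (v : pt) : R := Rabs (fst v) + Rabs (snd v).

Lemma n1_pos v : 0 <= n1 v.
Proof. unfold n1. pose proof (Rabs_pos (fst v)). pose proof (Rabs_pos (snd v)). lra. Qed.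

Lemma n1_vadd u v : n1 (vadd u v) <= n1 u + n1 v.
Proof.
  unfold n1, vadd; cbn [fst snd].
  pose proof (Rabs_triang (fst u) (fst v)). pose proof (Rabs_triang (snd u) (snd v)). lra.
Qed.

Lemma bform_msub M N u v : bform (msub M N) u v = bform M u v - bform N u v.
Proof. destruct M as [[a b] c], N as [[a' b'] c']. unfold bform, msub; simpl. ring. Qed.

Lemma bform_sym M u v : bform M u v = bform M v u.
Proof. destruct M as [[a b] c]. unfold bform. ring. Qed.

Lemma bform_sq_diff M u v : bform M u u - bform M v v = bform M (vsub u v) (vadd u v).
Proof. destruct M as [[a b] c]. unfold bform, vsub, vadd; simpl. ring. Qed.

Lemma mclose_bform e M N u v :
  mclose e M N -> Rabs (bform M u v - bform N u v) <= e * n1 u * n1 v.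
Proof.
  intros [Ha [Hb Hc]]. rewrite <- bform_msub.
  destruct M as [[a b] c], N as [[a' b'] c']. cbn [fst snd] in *.
  unfold bform, msub, n1; cbn [fst snd].
  set (x := a - a') in *. set (y := b - b') in *. set (z := c - c') in *.
  destruct u as [u1 u2], v as [v1 v2]; cbn [fst snd].
  assert (T : forall w p q, Rabs w <= e -> Rabs (w * p * q) <= e * (Rabs p * Rabs q)).
  { intros w p q Hw. rewrite !Rabs_mult, Rmult_assoc. apply Rmult_le_compat_r; [|exact Hw].
    apply Rmult_le_pos; apply Rabs_pos. }
  pose proof (T x u1 v1 Ha). pose proof (T y u1 v2 Hb). pose proof (T y u2 v1 Hb).
  pose proof (T z u2 v2 Hc).
  replace (x * u1 * v1 + y * (u1 * v2 + u2 * v1) + z * u2 * v2)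
    with (x * u1 * v1 + (y * u1 * v2 + (y * u2 * v1 + z * u2 * v2))) by ring.
  pose proof (Rabs_triang (x * u1 * v1) (y * u1 * v2 + (y * u2 * v1 + z * u2 * v2))).
  pose proof (Rabs_triang (y * u1 * v2) (y * u2 * v1 + z * u2 * v2)).
  pose proof (Rabs_triang (y * u2 * v1) (z * u2 * v2)). nra.
Qed.

Lemma Rabs_IZR_le (i : Z) (k : Z) : (Z.abs i <= k)%Z -> Rabs (IZR i) <= IZR k.
Proof. intros H. rewrite <- abs_IZR. apply IZR_le, H. Qed.

Lemma square_minus_self_nonneg (i : Z) : 0 <= IZR i * IZR i - IZR i.
Proof.
  rewrite <- mult_IZR, <- minus_IZR. apply IZR_le. nia.
Qed.

Lemma square_minus_self_ge2 (i : Z) : (i < 0 \/ 1 < i)%Z -> 2 <= IZR i * IZR i - IZR i.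
Proof.
  intros H. rewrite <- mult_IZR, <- minus_IZR. apply IZR_le. nia.
Qed.

Lemma Z_unit_cases (i : Z) : (i = 0 \/ i = 1 \/ i < 0 \/ 1 < i)%Z.
Proof. lia. Qed.

(* The squared distance from the lattice point [(i, j)] to [(s, t)], in the metric of that
   lattice point. *)
Definition F (N : Z -> Z -> sym2) (i j : Z) (s t : R) : R :=
  bform (N i j) (s - IZR i, t - IZR j) (s - IZR i, t - IZR j).

Definition cell (N : Z -> Z -> sym2) (i j : Z) (s t : R) : Prop :=
  forall i' j', F N i j s t <= F N i' j' s t.

(* [P] bounds the indices and the coordinates on which the metrics [N i j] are
   compared with the reference form [(A, -B, C)]. *)
Definition Loc (N : Z -> Z -> sym2) (A B C L P eps : R) : Prop :=
  (1 <= L /\ 100 * L ^ 3 <= P /\ 0 <= eps /\ 10000 * P ^ 6 * eps <= 1) /\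
  (A * C - B * B = 1 /\ 0 <= B /\ 1 <= L * (A - B) /\ 1 <= L * (C - B) /\ A <= L /\ C <= L) /\
  (forall i j, Rabs (IZR i) <= P -> Rabs (IZR j) <= P -> mclose eps (N i j) (A, - B, C)) /\
  (forall i j s t, s * s + t * t <= L * bform (N i j) (s, t) (s, t) /\
                   bform (N i j) (s, t) (s, t) <= L * (s * s + t * t)).

Section Local.
Context (N : Z -> Z -> sym2) (A B C L P eps : R) (HL : Loc N A B C L P eps).

Definition Q (x y : R) := A * x * x - 2 * B * x * y + C * y * y.

Lemma loc_P : 100 <= P /\ L <= P /\ 100 * L * L <= P /\ 0 <= eps.
Proof using HL.
  destruct HL as [[H1 [H2 [H3 _]]] _]. simpl in H2.
  assert (1 <= L * L) by nra. assert (L * L <= L * L * L) by nra.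
  assert (1 <= L * L * L) by nra. nra.
Qed.

(** Every error in this section is a power of [P] times [eps]; smallness is required once, for the
    sixth power, and covers them all. *)
Lemma loc_eps_pow k : (k <= 6)%nat -> 10000 * (P ^ k * eps) <= 1.
Proof using HL.
  intros Hk. pose proof loc_P as [HP [_ [_ He]]].
  destruct HL as [[_ [_ [_ H]]] _].
  assert (P ^ k <= P ^ 6) by (apply Rle_pow; [lra|exact Hk]).
  nra.
Qed.

Lemma F_near i j s t :
  Rabs (IZR i) <= P -> Rabs (IZR j) <= P -> Rabs s <= P -> Rabs t <= P ->
  Rabs (F N i j s t - Q (s - IZR i) (t - IZR j)) <= 16 * (P ^ 2 * eps).
Proof using HL.
  intros Hi Hj Hs Ht.
  assert (Hc : mclose eps (N i j) (A, - B, C)) by (apply HL; assumption).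
  pose proof (mclose_bform eps _ _ (s - IZR i, t - IZR j) (s - IZR i, t - IZR j) Hc) as H.
  pose proof loc_P as [HP [_ [_ He]]].
  unfold F. replace (Q (s - IZR i) (t - IZR j))
    with (bform (A, - B, C) (s - IZR i, t - IZR j) (s - IZR i, t - IZR j))
    by (unfold bform, Q; simpl; ring).
  eapply Rle_trans; [exact H|].
  assert (Hn : n1 (s - IZR i, t - IZR j) <= 4 * P).
  { unfold n1; simpl. pose proof (Rabs_triang s (- IZR i)). pose proof (Rabs_triang t (- IZR j)).
    rewrite Rabs_Ropp in *. unfold Rminus. lra. }
  pose proof (n1_pos (s - IZR i, t - IZR j)).
  set (m := n1 (s - IZR i, t - IZR j)) in *.
  assert (m * m <= 16 * P ^ 2) by nra. nra.
Qed.

(** A difference of two squares is the product of a difference and a sum. Hence the error of [F]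
    against [Q] is not only small but Lipschitz with a constant of order [P * eps], which is what
    the contraction and the uniqueness arguments need. *)
Lemma F_near_lip i j s t s' t' :
  Rabs (IZR i) <= P -> Rabs (IZR j) <= P ->
  Rabs s <= P -> Rabs t <= P -> Rabs s' <= P -> Rabs t' <= P ->
  Rabs ((F N i j s t - Q (s - IZR i) (t - IZR j)) - (F N i j s' t' - Q (s' - IZR i) (t' - IZR j)))
   <= 8 * (P * eps) * (Rabs (s - s') + Rabs (t - t')).
Proof using HL.
  intros Hi Hj Hs Ht Hs' Ht'.
  assert (Hc : mclose eps (N i j) (A, - B, C)) by (apply HL; assumption).
  pose proof loc_P as [HP [_ [_ He]]].
  set (u := (s - IZR i, t - IZR j)). set (v := (s' - IZR i, t' - IZR j)).
  pose proof (mclose_bform eps _ _ (vsub u v) (vadd u v) Hc) as H.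
  rewrite <- !bform_sq_diff in H.
  unfold F. fold u v.
  replace (Q (s - IZR i) (t - IZR j)) with (bform (A, - B, C) u u)
    by (unfold u, bform, Q; simpl; ring).
  replace (Q (s' - IZR i) (t' - IZR j)) with (bform (A, - B, C) v v)
    by (unfold v, bform, Q; simpl; ring).
  match goal with |- Rabs ?x <= _ => match type of H with Rabs ?y <= _ =>
    replace x with y by ring end end.
  eapply Rle_trans; [exact H|].
  assert (E : n1 (vsub u v) = Rabs (s - s') + Rabs (t - t')).
  { unfold n1, vsub, u, v; simpl. f_equal; f_equal; ring. }
  rewrite E. set (d := Rabs (s - s') + Rabs (t - t')).
  assert (0 <= d) by (unfold d; pose proof (Rabs_pos (s-s')); pose proof (Rabs_pos (t-t')); lra).
  assert (Hn : n1 (vadd u v) <= 8 * P).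
  { assert (n1 u <= 4 * P /\ n1 v <= 4 * P) as [K1 K2].
    { unfold n1, u, v; simpl. pose proof (Rabs_triang s (- IZR i)). pose proof (Rabs_triang t (- IZR j)).
      pose proof (Rabs_triang s' (- IZR i)). pose proof (Rabs_triang t' (- IZR j)).
      rewrite Rabs_Ropp in *. unfold Rminus. lra. }
    pose proof (n1_vadd u v). lra. }
  pose proof (n1_pos (vadd u v)).
  assert (0 <= eps * d) by nra. nra.
Qed.

(** Each coordinate is within 1 of an integer, so some lattice point competes at squared Euclidean
    distance at most 2; ellipticity is used once on each side. *)
Lemma cell_close i j s t : cell N i j s t ->
  (s - IZR i) * (s - IZR i) + (t - IZR j) * (t - IZR j) <= 2 * L * L.
Proof using HL.
  intros Hc.
  assert (Hfl : forall x, exists k : Z, 0 <= (x - IZR k) * (x - IZR k) <= 1).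
  { intros x. exists (up x). destruct (archimed x). nra. }
  destruct (Hfl s) as [i' Hi']. destruct (Hfl t) as [j' Hj'].
  pose proof (Hc i' j') as H. unfold F in H.
  destruct HL as [[H1 _] [_ [_ He]]].
  destruct (He i j (s - IZR i) (t - IZR j)) as [E1 _].
  destruct (He i' j' (s - IZR i') (t - IZR j')) as [_ E2]. nra.
Qed.

Lemma cell_close_abs i j s t : cell N i j s t ->
  Rabs (s - IZR i) <= 2 * L /\ Rabs (t - IZR j) <= 2 * L.
Proof using HL.
  intros Hc. apply cell_close in Hc. destruct HL as [[H1 _] _].
  set (x := s - IZR i) in *. set (y := t - IZR j) in *.
  split; apply Rabs_le; split; nra.
Qed.

(* If [p' - p = v + w] with [<v, w>] bounded below, the parallelogram identity makes
   [p + v] or [p' - v] strictly closer than both [p] and [p']. *)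
Lemma cell_no_split i j i' j' v1 v2 s t :
  Rabs s <= P / 2 -> Rabs t <= P / 2 -> (Z.abs v1 <= 1)%Z -> (Z.abs v2 <= 1)%Z ->
  cell N i j s t -> cell N i' j' s t ->
  let w1 := IZR (i' - i - v1) in let w2 := IZR (j' - j - v2) in
  L * (A * IZR v1 * w1 - B * (IZR v1 * w2 + IZR v2 * w1) + C * IZR v2 * w2) < 1.
Proof using HL.
  intros Hs Ht Hv1 Hv2 Hc Hc' w1 w2.
  apply Rnot_le_lt; intro Hge.
  pose proof (cell_close_abs _ _ _ _ Hc) as [K1 K2].
  pose proof (cell_close_abs _ _ _ _ Hc') as [K3 K4].
  pose proof loc_P as [HP [HLP [HLP2 He]]].
  assert (H1L : 1 <= L) by apply HL.
  apply Rabs_IZR_le in Hv1. apply Rabs_IZR_le in Hv2.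
  assert (Hb : forall x y, Rabs (x - y) <= 2 * L -> Rabs x <= P / 2 -> Rabs y <= P - 2).
  { intros x y H H'. pose proof (Rabs_triang_inv y x). rewrite Rabs_minus_sym in H. nra. }
  assert (B1 := Hb _ _ K1 Hs). assert (B2 := Hb _ _ K2 Ht).
  assert (B3 := Hb _ _ K3 Hs). assert (B4 := Hb _ _ K4 Ht).
  assert (Ba : forall x y, Rabs x <= P - 2 -> Rabs y <= 1 -> Rabs (x + y) <= P /\ Rabs (x - y) <= P).
  { intros x y H H'. pose proof (Rabs_triang x y). pose proof (Rabs_triang x (- y)).
    rewrite Rabs_Ropp in *. unfold Rminus. lra. }
  pose proof (Ba _ _ B1 Hv1) as [C1 _]. pose proof (Ba _ _ B2 Hv2) as [C2 _].
  pose proof (Ba _ _ B3 Hv1) as [_ C3]. pose proof (Ba _ _ B4 Hv2) as [_ C4].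
  rewrite <- plus_IZR in C1, C2. rewrite <- minus_IZR in C3, C4.
  pose proof (Hc (i + v1)%Z (j + v2)%Z) as E1.
  pose proof (Hc' (i' - v1)%Z (j' - v2)%Z) as E2.
  assert (N0 : 0 <= P) by lra.
  assert (Hs' : Rabs s <= P) by lra. assert (Ht' : Rabs t <= P) by lra.
  assert (B1' : Rabs (IZR i) <= P) by lra. assert (B2' : Rabs (IZR j) <= P) by lra.
  assert (B3' : Rabs (IZR i') <= P) by lra. assert (B4' : Rabs (IZR j') <= P) by lra.
  pose proof (F_near _ _ _ _ B1' B2' Hs' Ht') as F1.
  pose proof (F_near _ _ _ _ B3' B4' Hs' Ht') as F2.
  pose proof (F_near _ _ _ _ C1 C2 Hs' Ht') as F3.
  pose proof (F_near _ _ _ _ C3 C4 Hs' Ht') as F4.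
  apply Rabs_le_inv in F1.
  apply Rabs_le_inv in F2. apply Rabs_le_inv in F3. apply Rabs_le_inv in F4.
  unfold w1, w2 in Hge. repeat rewrite minus_IZR in Hge. repeat rewrite minus_IZR in F4.
  repeat rewrite plus_IZR in F3.
  assert (Hid : Q (s - IZR i) (t - IZR j) + Q (s - IZR i') (t - IZR j')
     - Q (s - (IZR i + IZR v1)) (t - (IZR j + IZR v2))
     - Q (s - (IZR i' - IZR v1)) (t - (IZR j' - IZR v2)) =
     2 * (A * IZR v1 * (IZR i' - IZR i - IZR v1) - B * (IZR v1 * (IZR j' - IZR j - IZR v2) + IZR v2 * (IZR i' - IZR i - IZR v1)) + C * IZR v2 * (IZR j' - IZR j - IZR v2))).
  { unfold Q. ring. }
  set (W := A * IZR v1 * (IZR i' - IZR i - IZR v1) - B * (IZR v1 * (IZR j' - IZR j - IZR v2) + IZR v2 * (IZR i' - IZR i - IZR v1)) + C * IZR v2 * (IZR j' - IZR j - IZR v2)) in *.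
  assert (W <= 32 * (P ^ 2 * eps)) by lra.
  pose proof (loc_eps_pow 3 ltac:(lia)) as HE.
  assert (HX : 0 <= P ^ 2 * eps) by (apply Rmult_le_pos; [apply pow_le; lra | exact He]).
  assert (L * W <= P * (32 * (P ^ 2 * eps))).
  { apply Rle_trans with (L * (32 * (P ^ 2 * eps))).
    - apply Rmult_le_compat_l; lra.
    - apply Rmult_le_compat_r; lra. }
  replace (P * (32 * (P ^ 2 * eps))) with (32 * (P ^ 3 * eps)) in * by ring. lra.
Qed.

Lemma cell_adjacent i j i' j' s t :
  Rabs s <= P / 2 -> Rabs t <= P / 2 -> cell N i j s t -> cell N i' j' s t ->
  (Z.abs (i' - i) <= 1 /\ Z.abs (j' - j) <= 1)%Z.
Proof using HL.
  assert (H : forall i j i' j', Rabs s <= P / 2 -> Rabs t <= P / 2 -> cell N i j s t ->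
     cell N i' j' s t -> (i' - i <= 1 /\ j' - j <= 1)%Z).
  { clear i j i' j'. intros i j i' j' Hs Ht Hc Hc'.
    pose proof HL as [[H1 _] [[_ [HB [HA [HC _]]]] _]].
    set (m := (i' - i)%Z). set (n := (j' - j)%Z).
    (* The split vector is (1, 1) if both index differences are positive and a coordinate vector
       otherwise. Its product with the remainder is then at least [A - B], [C - B], [A] or [C],
       against [cell_no_split]. *)
    split; apply Z.nlt_ge; intro Hlt; destruct (Z_lt_le_dec 0 n) as [Hn|Hn];
      destruct (Z_lt_le_dec 0 m) as [Hm|Hm]; try lia.
    - pose proof (cell_no_split i j i' j' 1 1 s t Hs Ht ltac:(lia) ltac:(lia) Hc Hc') as K.
      cbv zeta in K. fold m n in K.
      assert (1 <= IZR (m - 1)) by (apply IZR_le; lia). assert (0 <= IZR (n - 1)) by (apply IZR_le; lia).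
      nra.
    - pose proof (cell_no_split i j i' j' 1 0 s t Hs Ht ltac:(lia) ltac:(lia) Hc Hc') as K.
      cbv zeta in K. fold m n in K. replace (n - 0)%Z with n in K by lia.
      assert (1 <= IZR (m - 1)) by (apply IZR_le; lia). assert (IZR n <= 0) by (apply IZR_le; lia).
      assert (0 <= L * B) by nra. assert (1 <= L * A) by nra. nra.
    - pose proof (cell_no_split i j i' j' 1 1 s t Hs Ht ltac:(lia) ltac:(lia) Hc Hc') as K.
      cbv zeta in K. fold m n in K.
      assert (1 <= IZR (n - 1)) by (apply IZR_le; lia). assert (0 <= IZR (m - 1)) by (apply IZR_le; lia).
      nra.
    - pose proof (cell_no_split i j i' j' 0 1 s t Hs Ht ltac:(lia) ltac:(lia) Hc Hc') as K.
      cbv zeta in K. fold m n in K. replace (m - 0)%Z with m in K by lia.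
      assert (1 <= IZR (n - 1)) by (apply IZR_le; lia). assert (IZR m <= 0) by (apply IZR_le; lia).
      assert (0 <= L * B) by nra. assert (1 <= L * C) by nra. nra. }
  intros Hs Ht Hc Hc'. pose proof (H _ _ _ _ Hs Ht Hc Hc'). pose proof (H _ _ _ _ Hs Ht Hc' Hc). lia.
Qed.

(* At a point equidistant from three corners of the unit square, [gap] is up to sign the
   excess of the fourth squared distance: the empty-circle test. *)
Definition gapE1 s t := F N 0 0 s t - F N 1 0 s t.
Definition gapE2 s t := F N 0 0 s t - F N 0 1 s t.
Definition gap s t := F N 0 0 s t - F N 1 0 s t + F N 1 1 s t - F N 0 1 s t.

Lemma loc_corner : Rabs 0 <= P /\ Rabs 1 <= P.
Proof using HL. pose proof loc_P. rewrite Rabs_R0, Rabs_R1. lra. Qed.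

Lemma loc_coef : 0 <= A <= L /\ 0 <= B <= L /\ 0 <= C <= L /\ 1 <= L.
Proof using HL.
  pose proof HL as [[H1 _] [[_ [HB [HA [HC [HA' HC']]]]] _]].
  assert (0 < A - B) by nra. assert (0 < C - B) by nra. lra.
Qed.

(** For the reference form the two differences are affine and [gap] is the constant [- 2 * B]. A
    nonnegative gap is thus possible only if [B] is of the order of the error. *)
Lemma gap_near s t : Rabs s <= P -> Rabs t <= P ->
  Rabs (gapE1 s t - (2 * (A * s - B * t) - A)) <= 32 * (P ^ 2 * eps) /\
  Rabs (gapE2 s t - (2 * (C * t - B * s) - C)) <= 32 * (P ^ 2 * eps) /\
  Rabs (gap s t + 2 * B) <= 64 * (P ^ 2 * eps).
Proof using HL.
  intros Hs Ht. destruct loc_corner as [c0 c1].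
  pose proof (Rabs_le_inv _ _ (F_near 0 0 s t c0 c0 Hs Ht)).
  pose proof (Rabs_le_inv _ _ (F_near 1 0 s t c1 c0 Hs Ht)).
  pose proof (Rabs_le_inv _ _ (F_near 0 1 s t c0 c1 Hs Ht)).
  pose proof (Rabs_le_inv _ _ (F_near 1 1 s t c1 c1 Hs Ht)).
  unfold gapE1, gapE2, gap.
  set (X := P ^ 2 * eps) in *. set (a := F N 0 0 s t) in *. set (b := F N 1 0 s t) in *.
  set (d := F N 0 1 s t) in *. set (c := F N 1 1 s t) in *. unfold Q in *.
  repeat split; apply Rabs_le; split; lra.
Qed.

Lemma gap_lip s t s' t' : Rabs s <= P -> Rabs t <= P -> Rabs s' <= P -> Rabs t' <= P ->
  let d := Rabs (s - s') + Rabs (t - t') in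
  Rabs (gapE1 s t - gapE1 s' t' - 2 * (A * (s - s') - B * (t - t'))) <= 16 * (P * eps) * d /\
  Rabs (gapE2 s t - gapE2 s' t' - 2 * (C * (t - t') - B * (s - s'))) <= 16 * (P * eps) * d /\
  Rabs (gap s t - gap s' t') <= 32 * (P * eps) * d.
Proof using HL.
  intros Hs Ht Hs' Ht' d. destruct loc_corner as [c0 c1].
  pose proof (Rabs_le_inv _ _ (F_near_lip 0 0 s t s' t' c0 c0 Hs Ht Hs' Ht')).
  pose proof (Rabs_le_inv _ _ (F_near_lip 1 0 s t s' t' c1 c0 Hs Ht Hs' Ht')).
  pose proof (Rabs_le_inv _ _ (F_near_lip 0 1 s t s' t' c0 c1 Hs Ht Hs' Ht')).
  pose proof (Rabs_le_inv _ _ (F_near_lip 1 1 s t s' t' c1 c1 Hs Ht Hs' Ht')).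
  fold d in H, H0, H1, H2. unfold gapE1, gapE2, gap.
  replace (8 * (P * eps) * d) with (8 * (P * eps * d)) in * by ring.
  replace (16 * (P * eps) * d) with (16 * (P * eps * d)) in * by ring.
  replace (32 * (P * eps) * d) with (32 * (P * eps * d)) in * by ring.
  set (X := P * eps * d) in *. unfold Q in *.
  repeat split; apply Rabs_le; split; lra.
Qed.

(** The linear part of the two differences is twice the Gram matrix. As its determinant is 1, the
    inverse has the entries [C], [B], [A] up to the factor 1/2, all bounded by [L]; the Lipschitz
    error is absorbed on the left. *)
Lemma gap_expand s t s' t' : Rabs s <= P -> Rabs t <= P -> Rabs s' <= P -> Rabs t' <= P ->
  Rabs (s - s') + Rabs (t - t') <=
    2 * P * (Rabs (gapE1 s t - gapE1 s' t') + Rabs (gapE2 s t - gapE2 s' t')).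
Proof using HL.
  intros Hs Ht Hs' Ht'. pose proof (gap_lip s t s' t' Hs Ht Hs' Ht') as [E1 [E2 _]].
  cbv zeta in E1, E2. set (d := Rabs (s - s') + Rabs (t - t')) in *.
  set (g1 := gapE1 s t - gapE1 s' t') in *. set (g2 := gapE2 s t - gapE2 s' t') in *.
  set (u := 2 * (A * (s - s') - B * (t - t'))) in *. set (v := 2 * (C * (t - t') - B * (s - s'))) in *.
  pose proof loc_coef as [HA [HB [HC H1]]]. pose proof loc_P as [HP [HLP [_ He]]].
  assert (Hdet : A * C - B * B = 1) by apply HL.
  assert (Hu : 2 * (s - s') = C * u + B * v).
  { unfold u, v. replace (C * (2 * (A * (s - s') - B * (t - t'))) + B * (2 * (C * (t - t') - B * (s - s'))))
      with (2 * (s - s') * (A * C - B * B)) by ring. rewrite Hdet; ring. }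
  assert (Hv : 2 * (t - t') = B * u + A * v).
  { unfold u, v. replace (B * (2 * (A * (s - s') - B * (t - t'))) + A * (2 * (C * (t - t') - B * (s - s'))))
      with (2 * (t - t') * (A * C - B * B)) by ring. rewrite Hdet; ring. }
  assert (T : forall a b x y z, 0 <= a <= L -> 0 <= b <= L -> 2 * z = a * x + b * y ->
     2 * Rabs z <= L * (Rabs x + Rabs y)).
  { intros a b x y z Ha Hb Hz. replace (2 * Rabs z) with (Rabs (a * x + b * y)).
    2:{ rewrite <- Hz, Rabs_mult, Rabs_pos_eq; lra. }
    eapply Rle_trans; [apply Rabs_triang|]. rewrite !Rabs_mult, !(Rabs_pos_eq a), !(Rabs_pos_eq b) by lra.
    pose proof (Rabs_pos x). pose proof (Rabs_pos y). nra. }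
  pose proof (T _ _ _ _ _ HC HB Hu) as T1. pose proof (T _ _ _ _ _ HB HA Hv) as T2.
  assert (Hd : d <= L * (Rabs u + Rabs v)) by (unfold d; lra).
  pose proof (Rabs_triang g1 (- (g1 - u))) as U1. pose proof (Rabs_triang g2 (- (g2 - v))) as U2.
  rewrite Rabs_Ropp in U1, U2.
  replace (g1 + - (g1 - u)) with u in U1 by ring. replace (g2 + - (g2 - v)) with v in U2 by ring.
  assert (0 <= d) by (unfold d; pose proof (Rabs_pos (s-s')); pose proof (Rabs_pos (t-t')); lra).
  assert (0 <= Rabs g1 + Rabs g2) by (pose proof (Rabs_pos g1); pose proof (Rabs_pos g2); lra).
  set (S := Rabs g1 + Rabs g2) in *.
  assert (d <= P * (S + 32 * (P * eps) * d)).
  { apply Rle_trans with (L * (S + 32 * (P * eps) * d)).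
    - eapply Rle_trans; [exact Hd|]. apply Rmult_le_compat_l; unfold S; lra.
    - apply Rmult_le_compat_r; [|exact HLP].
      assert (0 <= P * eps) by nra. nra. }
  pose proof (loc_eps_pow 2 ltac:(lia)) as K.
  assert (P * (S + 32 * (P * eps) * d) = P * S + 32 * (P ^ 2 * eps) * d) by ring.
  assert (P ^ 2 * eps * d <= / 10000 * d) by (apply Rmult_le_compat_r; lra).
  nra.
Qed.

(** [gap] is nearly constant while the pair of differences expands, so as a function of that pair
    [gap] has a small Lipschitz constant. Uniqueness of vertices and the exclusion of crossing
    diagonals both rest on this. *)
Lemma gap_vertex_lip s t s' t' : Rabs s <= P -> Rabs t <= P -> Rabs s' <= P -> Rabs t' <= P ->
  Rabs (gap s t - gap s' t') <= / 100 * (Rabs (gapE1 s t - gapE1 s' t') + Rabs (gapE2 s t - gapE2 s' t')).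
Proof using HL.
  intros Hs Ht Hs' Ht'. pose proof (gap_expand _ _ _ _ Hs Ht Hs' Ht') as He.
  destruct (gap_lip _ _ _ _ Hs Ht Hs' Ht') as [_ [_ K]].
  set (d := Rabs (s - s') + Rabs (t - t')) in *.
  set (S := Rabs (gapE1 s t - gapE1 s' t') + Rabs (gapE2 s t - gapE2 s' t')) in *.
  assert (0 <= S) by (unfold S; pose proof (Rabs_pos (gapE1 s t - gapE1 s' t'));
    pose proof (Rabs_pos (gapE2 s t - gapE2 s' t')); lra).
  pose proof loc_P as [HP [_ [_ HE]]].
  assert (0 <= P * eps) by nra.
  assert (32 * (P * eps) * d <= 32 * (P * eps) * (2 * P * S)) by (apply Rmult_le_compat_l; lra).
  pose proof (loc_eps_pow 2 ltac:(lia)).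
  replace (32 * (P * eps) * (2 * P * S)) with (64 * (P ^ 2 * eps) * S) in * by ring.
  assert (64 * (P ^ 2 * eps) * S <= 64 * / 10000 * S) by (apply Rmult_le_compat_r; lra).
  lra.
Qed.

(* The four pairs [(al, be)] of [0, 1] encode which corner of the unit square is
   omitted from the three equal distances; the omitted corner then differs by [gap]. *)
Definition isbit (x : R) := x = 0 \/ x = 1.
Definition equidistant al be s t := gapE1 s t = al * gap s t /\ gapE2 s t = be * gap s t.

Lemma equidistant_eq s t s' t' :
  Rabs s <= P -> Rabs t <= P -> Rabs s' <= P -> Rabs t' <= P ->
  gapE1 s t = gapE1 s' t' -> gapE2 s t = gapE2 s' t' -> s = s' /\ t = t'.
Proof using HL.
  intros Hs Ht Hs' Ht' E1 E2. pose proof (gap_expand _ _ _ _ Hs Ht Hs' Ht') as He.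
  rewrite E1, E2, !Rminus_diag, Rabs_R0 in He.
  pose proof (Rabs_pos (s - s')). pose proof (Rabs_pos (t - t')).
  assert (Rabs (s - s') = 0) by lra. assert (Rabs (t - t') = 0) by lra.
  split; [destruct (Req_dec (s - s') 0) as [e|e] | destruct (Req_dec (t - t') 0) as [e|e]];
    try lra; apply Rabs_no_R0 in e; lra.
Qed.

(** Between two solutions each difference changes by at most the change of [gap], whereas [gap]
    changes by at most a hundredth of the sum of these changes. So [gap] agrees, and then the points
    do. *)
Lemma equidistant_unique al be s t s' t' : isbit al -> isbit be ->
  Rabs s <= P -> Rabs t <= P -> Rabs s' <= P -> Rabs t' <= P ->
  equidistant al be s t -> equidistant al be s' t' -> s = s' /\ t = t'.
Proof using HL.
  intros Ha Hb Hs Ht Hs' Ht' [E1 E2] [E1' E2'].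
  pose proof (gap_vertex_lip _ _ _ _ Hs Ht Hs' Ht') as K.
  rewrite E1, E2, E1', E2' in K.
  assert (Hg : gap s t = gap s' t').
  { set (x := gap s t) in *. set (y := gap s' t') in *.
    assert (B1 : Rabs (al * x - al * y) <= Rabs (x - y)).
    { destruct Ha as [-> | ->]; [rewrite !Rmult_0_l, Rminus_diag, Rabs_R0; apply Rabs_pos|].
      rewrite !Rmult_1_l; lra. }
    assert (B2 : Rabs (be * x - be * y) <= Rabs (x - y)).
    { destruct Hb as [-> | ->]; [rewrite !Rmult_0_l, Rminus_diag, Rabs_R0; apply Rabs_pos|].
      rewrite !Rmult_1_l; lra. }
    pose proof (Rabs_pos (x - y)).
    destruct (Req_dec (x - y) 0) as [e|e]; [lra|]. apply Rabs_no_R0 in e; lra. }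
  apply equidistant_eq; try assumption; congruence.
Qed.

(** If x <= 0 <= y are the two gaps, each [a * x - a' * y] is at most y - x in absolute value
    whatever the bits are, so [gap_vertex_lip] forces both gaps to vanish. Vertices favouring
    different diagonals therefore coincide, and all four corners are equidistant there. *)
Lemma equidistant_opposite al be al' be' s t s' t' :
  isbit al -> isbit be -> isbit al' -> isbit be' ->
  Rabs s <= P -> Rabs t <= P -> Rabs s' <= P -> Rabs t' <= P ->
  equidistant al be s t -> equidistant al' be' s' t' ->
  gap s t <= 0 -> 0 <= gap s' t' -> s = s' /\ t = t'.
Proof using HL.
  intros Ha Hb Ha' Hb' Hs Ht Hs' Ht' [E1 E2] [E1' E2'] Hx Hy.
  pose proof (gap_vertex_lip _ _ _ _ Hs Ht Hs' Ht') as K.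
  rewrite E1, E2, E1', E2' in K.
  set (x := gap s t) in *. set (y := gap s' t') in *.
  assert (T : forall a a', isbit a -> isbit a' -> Rabs (a * x - a' * y) <= y - x).
  { intros a a' [-> | ->] [-> | ->]; rewrite ?Rmult_0_l, ?Rmult_1_l; apply Rabs_le; split; lra. }
  pose proof (T _ _ Ha Ha'). pose proof (T _ _ Hb Hb').
  rewrite (Rabs_minus_sym x y), Rabs_pos_eq in K by lra.
  assert (x = 0) by lra. assert (y = 0) by lra.
  apply equidistant_eq; try assumption; nra.
Qed.

Lemma equidistant_exists al be : isbit al -> isbit be ->
  exists s t, Rabs s <= P / 2 /\ Rabs t <= P / 2 /\ Rabs s <= 20 * L * L /\ Rabs t <= 20 * L * L /\
    equidistant al be s t.
Proof using HL.
  intros Ha Hb.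
  pose proof loc_coef as [HA [HB [HC H1]]]. pose proof loc_P as [HP [HLP [HLP2 He]]].
  assert (Hdet : A * C - B * B = 1) by apply HL.
  set (r1 := fun s t => gapE1 s t - al * gap s t). set (r2 := fun s t => gapE2 s t - be * gap s t).
  assert (Hbd : 0 <= al <= 1 /\ 0 <= be <= 1) by (destruct Ha, Hb; lra).
  assert (Hr : 0 < 20 * L * L) by nra.
  (* A Newton step with the inverse of the constant linear part, one half of [[C, B], [B, A]]. Its
     fixed points are the zeros of [r1] and [r2]. The residuals at the origin are at most 5 L, so
     the image of the origin has size at most 10 L^2, half of the radius. *)
  destruct (contraction_fixed_point (fun s t => s - / 2 * (C * r1 s t + B * r2 s t))
      (fun s t => t - / 2 * (B * r1 s t + A * r2 s t)) (20 * L * L) Hr) as [s [t [Hst [Es Et]]]].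
  - intros s t s' t' Hx Hy.
    assert (Hbx : forall x y, Rabs x + Rabs y <= 20 * L * L -> Rabs x <= P /\ Rabs y <= P).
    { intros x y H. pose proof (Rabs_pos x). pose proof (Rabs_pos y). nra. }
    destruct (Hbx _ _ Hx) as [Hs Ht]. destruct (Hbx _ _ Hy) as [Hs' Ht'].
    destruct (gap_lip s t s' t' Hs Ht Hs' Ht') as [K1 [K2 K3]].
    set (d := Rabs (s - s') + Rabs (t - t')) in *.
    assert (Hd : 0 <= d) by (unfold d; pose proof (Rabs_pos (s-s')); pose proof (Rabs_pos (t-t')); lra).
    set (X := P * eps * d).
    assert (HX0 : 0 <= X) by (unfold X; apply Rmult_le_pos; [nra|lra]).
    replace (16 * (P * eps) * d) with (16 * X) in * by (unfold X; ring).
    replace (32 * (P * eps) * d) with (32 * X) in * by (unfold X; ring).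
    set (q1 := r1 s t - r1 s' t' - 2 * (A * (s - s') - B * (t - t'))).
    set (q2 := r2 s t - r2 s' t' - 2 * (C * (t - t') - B * (s - s'))).
    assert (Hq : Rabs q1 <= 48 * X /\ Rabs q2 <= 48 * X).
    { apply Rabs_le_inv in K1. apply Rabs_le_inv in K2. apply Rabs_le_inv in K3.
      unfold q1, q2, r1, r2. split; apply Rabs_le; split; nra. }
    destruct Hq as [Hq1 Hq2].
    replace (s - / 2 * (C * r1 s t + B * r2 s t) - (s' - / 2 * (C * r1 s' t' + B * r2 s' t')))
      with (- / 2 * (C * q1 + B * q2)).
    2:{ unfold q1, q2. transitivity (s - s' - / 2 * (C * (r1 s t - r1 s' t') + B * (r2 s t - r2 s' t'))
          + (A * C - B * B - 1) * (s - s')); [|rewrite Hdet]; field. }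
    replace (t - / 2 * (B * r1 s t + A * r2 s t) - (t' - / 2 * (B * r1 s' t' + A * r2 s' t')))
      with (- / 2 * (B * q1 + A * q2)).
    2:{ unfold q1, q2. transitivity (t - t' - / 2 * (B * (r1 s t - r1 s' t') + A * (r2 s t - r2 s' t'))
          + (A * C - B * B - 1) * (t - t')); [|rewrite Hdet]; field. }
    assert (T : forall a b, 0 <= a <= L -> 0 <= b <= L -> Rabs (- / 2 * (a * q1 + b * q2)) <= 48 * L * X).
    { intros a b Ha' Hb'. apply Rabs_le_inv in Hq1. apply Rabs_le_inv in Hq2.
      apply Rabs_le; split; nra. }
    pose proof (T _ _ HC HB). pose proof (T _ _ HB HA).
    pose proof (loc_eps_pow 2 ltac:(lia)) as HE.
    assert (L * X <= P * X) by nra.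
    assert (P * X <= / 10000 * d).
    { replace (P * X) with (P ^ 2 * eps * d) by (unfold X; ring). apply Rmult_le_compat_r; lra. }
    lra.
  - assert (Hell : forall i j, bform (N i j) (0 - IZR i, 0 - IZR j) (0 - IZR i, 0 - IZR j)
        <= L * ((0 - IZR i) * (0 - IZR i) + (0 - IZR j) * (0 - IZR j)) /\
       0 <= bform (N i j) (0 - IZR i, 0 - IZR j) (0 - IZR i, 0 - IZR j)).
    { intros i j. destruct HL as [_ [_ [_ H]]]. destruct (H i j (0 - IZR i) (0 - IZR j)) as [K1 K2].
      split; [exact K2|]. nra. }
    pose proof (Hell 0%Z 0%Z). pose proof (Hell 1%Z 0%Z). pose proof (Hell 0%Z 1%Z). pose proof (Hell 1%Z 1%Z).
    assert (Hr1 : Rabs (r1 0 0) <= 5 * L /\ Rabs (r2 0 0) <= 5 * L).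
    { unfold r1, r2, gapE1, gapE2, gap, F.
      set (a := bform (N 0 0) _ _) in *. set (b := bform (N 1 0) _ _) in *.
      set (c := bform (N 1 1) _ _) in *. set (e := bform (N 0 1) _ _) in *.
      destruct Ha as [-> | ->], Hb as [-> | ->]; split; apply Rabs_le; split; lra. }
    destruct Hr1 as [R1 R2]. apply Rabs_le_inv in R1. apply Rabs_le_inv in R2.
    assert (T : forall a b, 0 <= a <= L -> 0 <= b <= L ->
       Rabs (0 - / 2 * (a * r1 0 0 + b * r2 0 0)) <= 5 * L * L).
    { intros a b Ha' Hb'. apply Rabs_le; split; nra. }
    pose proof (T _ _ HC HB). pose proof (T _ _ HB HA). lra.
  - exists s, t. pose proof (Rabs_pos s). pose proof (Rabs_pos t).
    repeat split; try nra.
    + assert (r1 s t = 0); [|unfold r1 in *; lra].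
      transitivity ((A * C - B * B) * r1 s t); [rewrite Hdet; ring|].
      replace ((A * C - B * B) * r1 s t) with (A * (C * r1 s t + B * r2 s t) - B * (B * r1 s t + A * r2 s t)) by ring.
      nra.
    + assert (r2 s t = 0); [|unfold r2 in *; lra].
      transitivity ((A * C - B * B) * r2 s t); [rewrite Hdet; ring|].
      replace ((A * C - B * B) * r2 s t) with (C * (B * r1 s t + A * r2 s t) - B * (C * r1 s t + B * r2 s t)) by ring.
      nra.
Qed.

(** * Voronoi vertices of a unit square *)

Definition insq (i : Z) := (i = 0 \/ i = 1)%Z.

(* With [2<x,e1>] and [2<x,e2>] read off the equidistance equations, the distance
   defect of [(i, j)] is [(A-B)(i^2-i) + (C-B)(j^2-j) + B m] with an integer [m]
   that is nonnegative when [al <> be]; when [al = be] the sign of [gap] forces [B = O(eps)]. *)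
Lemma equidistant_far al be s t i j : isbit al -> isbit be ->
  Rabs s <= 20 * L * L -> Rabs t <= 20 * L * L -> equidistant al be s t ->
  (al = be -> 0 <= gap s t) -> ~ (insq i /\ insq j) -> F N 0 0 s t < F N i j s t.
Proof using HL.
  intros Ha Hb Hs Ht [E1 E2] Hg Hij.
  pose proof loc_coef as [HA [HB [HC H1]]]. pose proof loc_P as [HP [HLP [HLP2 He]]].
  assert (Hs' : Rabs s <= P) by nra. assert (Ht' : Rabs t <= P) by nra.
  (* Beyond index [P] the metric is not compared with the reference form; ellipticity alone shows
     that such lattice points are too far. *)
  destruct (Rle_lt_dec (Rabs (IZR i)) P) as [Hi|Hi]; [destruct (Rle_lt_dec (Rabs (IZR j)) P) as [Hj|Hj]|].
  2,3: assert (H0 : F N 0 0 s t <= L * (2 * (20 * L * L) * (20 * L * L)))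
    by (unfold F; destruct HL as [_ [_ [_ He']]]; destruct (He' 0%Z 0%Z (s - 0) (t - 0)) as [_ K];
        apply Rabs_le_inv in Hs; apply Rabs_le_inv in Ht; eapply Rle_trans; [exact K|];
        apply Rmult_le_compat_l; [lra|]; nra).
  2,3: assert (HM : 80 * L ^ 3 <= Rabs (s - IZR i) \/ 80 * L ^ 3 <= Rabs (t - IZR j)).
  2: right; pose proof (Rabs_triang_inv (IZR j) t); rewrite (Rabs_minus_sym t).
  4: left; pose proof (Rabs_triang_inv (IZR i) s); rewrite (Rabs_minus_sym s).
  2,4: destruct HL as [[_ [HP3 _]] _]; assert (20 * L * L <= 20 * L ^ 3) by (simpl; nra); lra.
  2,3: destruct HL as [_ [_ [_ He']]]; destruct (He' i j (s - IZR i) (t - IZR j)) as [K _];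
    fold (F N i j s t) in K; clear E1 E2 Hg He' Hij;
    assert (HS : 6400 * (L ^ 3 * L ^ 3) <= (s - IZR i) * (s - IZR i) + (t - IZR j) * (t - IZR j))
     by (set (x := s - IZR i) in *; set (y := t - IZR j) in *; set (L3 := L ^ 3) in *;
         assert (0 <= L3) by (apply pow_le; lra);
         assert (Rabs x * Rabs x = x * x) by (rewrite <- Rabs_mult; apply Rabs_pos_eq; nra);
         assert (Rabs y * Rabs y = y * y) by (rewrite <- Rabs_mult; apply Rabs_pos_eq; nra);
         destruct HM; nra);
    assert (HL6 : L * (L * (2 * (20 * L * L) * (20 * L * L))) = 800 * (L ^ 3 * L ^ 3)) by ring;
    assert (1 <= L ^ 3 * L ^ 3) by (rewrite <- pow_add; apply pow_R1_Rle; lra);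
    apply Rnot_le_lt; intro Hle; nra.
  destruct (gap_near s t Hs' Ht') as [G1 [G2 G3]].
  apply Rabs_le_inv in G1. apply Rabs_le_inv in G2. apply Rabs_le_inv in G3.
  destruct loc_corner as [c0 c1].
  pose proof (Rabs_le_inv _ _ (F_near 0 0 s t c0 c0 Hs' Ht')) as F0.
  pose proof (Rabs_le_inv _ _ (F_near i j s t Hi Hj Hs' Ht')) as F1.
  rewrite E1 in G1. rewrite E2 in G2.
  set (X := P ^ 2 * eps) in *.
  assert (HX : 0 <= X) by (apply Rmult_le_pos; [apply pow_le; lra|exact He]).
  set (x := IZR i) in *. set (y := IZR j) in *.
  (* [D1] and [D2] are the defects of the equidistance equations when [gap] is replaced by its
     reference value [- 2 * B]. *)
  set (D1 := 2 * (A * s - B * t) - A + 2 * al * B).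
  set (D2 := 2 * (C * t - B * s) - C + 2 * be * B).
  assert (Hbd : 0 <= al <= 1 /\ 0 <= be <= 1) by (destruct Ha, Hb; lra).
  assert (HD1 : Rabs D1 <= 96 * X).
  { unfold D1; apply Rabs_le; split; nra. }
  assert (HD2 : Rabs D2 <= 96 * X).
  { unfold D2; apply Rabs_le; split; nra. }
  assert (HQ : Q (s - x) (t - y) - Q (s - 0) (t - 0) =
    (A - B) * (x * x - x) + (C - B) * (y * y - y)
    + B * ((x - y) * (x - y) - x - y + 2 * al * x + 2 * be * y) - x * D1 - y * D2).
  { unfold Q, D1, D2. ring. }
  assert (HxD : x * D1 + y * D2 <= 192 * (P * X)).
  { assert (T : forall z w, Rabs z <= P -> Rabs w <= 96 * X -> z * w <= 96 * (P * X)).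
    { intros z w Hz Hw. apply Rle_trans with (Rabs (z * w)); [apply Rle_abs|].
      rewrite Rabs_mult. apply Rle_trans with (P * (96 * X)); [|lra].
      apply Rmult_le_compat; try apply Rabs_pos; assumption. }
    pose proof (T _ _ Hi HD1). pose proof (T _ _ Hj HD2). lra. }
  pose proof (square_minus_self_nonneg i) as Si. pose proof (square_minus_self_nonneg j) as Sj.
  fold x in Si. fold y in Sj.
  assert (Hmain : 2 <= L * ((A - B) * (x * x - x) + (C - B) * (y * y - y))).
  { destruct HL as [_ [[_ [_ [HAB [HCB _]]]] _]].
    assert (Hor : 2 <= x * x - x \/ 2 <= y * y - y).
    { destruct (Z_unit_cases i) as [?|[?|Hc]]; [..|left; apply square_minus_self_ge2; exact Hc];
      (destruct (Z_unit_cases j) as [?|[?|Hc]]; [..|right; apply square_minus_self_ge2; exact Hc]);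
      exfalso; apply Hij; unfold insq; tauto. }
    destruct Hor; nra. }
  assert (Hm : - (256 * (P ^ 2 * X)) - 128 * (P * X) <= B * ((x - y) * (x - y) - x - y + 2 * al * x + 2 * be * y)).
  { assert (0 <= P * X) by nra. assert (0 <= P ^ 2 * X) by nra.
    assert (Hne : forall k : Z, IZR k = (x - y) * (x - y) - x - y + 2 * al * x + 2 * be * y -> (0 <= k)%Z ->
       - (256 * (P ^ 2 * X)) - 128 * (P * X) <= B * ((x - y) * (x - y) - x - y + 2 * al * x + 2 * be * y)).
    { intros k Hk Hk0. rewrite <- Hk. apply IZR_le in Hk0. nra. }
    assert (Heq : forall sg, Rabs sg <= 1 -> 0 <= gap s t ->
       - (256 * (P ^ 2 * X)) - 128 * (P * X) <= B * ((x - y) * (x - y) + sg * (x + y))).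
    { intros sg Hsg Hg0. assert (HB' : B <= 32 * X) by lra.
      apply Rabs_le_inv in Hi. apply Rabs_le_inv in Hj. apply Rabs_le_inv in Hsg.
      assert (- (2 * P) <= sg * (x + y)) by nra.
      assert (0 <= (x - y) * (x - y)) by apply Rle_0_sqr.
      assert (- (2 * P) <= (x - y) * (x - y) + sg * (x + y)) by lra.
      assert (P * B <= P * (32 * X)) by (apply Rmult_le_compat_l; lra).
      apply Rle_trans with (B * (- (2 * P))); [lra|]. apply Rmult_le_compat_l; lra. }
    destruct Ha as [Ha|Ha], Hb as [Hb|Hb]; rewrite Ha, Hb.
    - replace ((x - y) * (x - y) - x - y + 2 * 0 * x + 2 * 0 * y) with ((x - y) * (x - y) + -1 * (x + y)) by ring.
      apply Heq; [apply Rabs_le; lra|apply Hg; congruence].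
    - rewrite Ha, Hb in Hne. apply (Hne ((i - j) * (i - j) - (i - j))%Z); [|clear; generalize (i - j)%Z; intros k; destruct (Z_lt_le_dec k 0); nia].
      rewrite minus_IZR, mult_IZR, minus_IZR. fold x y. ring.
    - rewrite Ha, Hb in Hne. apply (Hne ((i - j) * (i - j) + (i - j))%Z); [|clear; generalize (i - j)%Z; intros k; destruct (Z_lt_le_dec k 0); nia].
      rewrite plus_IZR, mult_IZR, minus_IZR. fold x y. ring.
    - replace ((x - y) * (x - y) - x - y + 2 * 1 * x + 2 * 1 * y) with ((x - y) * (x - y) + 1 * (x + y)) by ring.
      apply Heq; [apply Rabs_le; lra|apply Hg; congruence]. }
  pose proof (loc_eps_pow 5 ltac:(lia)) as HE.
  assert (HE5 : P ^ 5 * eps = P * (P ^ 2 * X)) by (unfold X; ring).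
  assert (HXX : X <= P * X) by (rewrite <- (Rmult_1_l X) at 1; apply Rmult_le_compat_r; lra).
  assert (HPX : P * X <= P ^ 2 * X).
  { replace (P ^ 2 * X) with (P * (P * X)) by ring. apply Rmult_le_compat_l; lra. }
  set (Y := P ^ 2 * X) in *. assert (0 <= Y) by lra.
  set (W := (A - B) * (x * x - x) + (C - B) * (y * y - y)) in *.
  assert (HW : 2 <= P * W).
  { apply Rle_trans with (L * W); [exact Hmain|]. apply Rmult_le_compat_r; [|exact HLP].
    apply Rnot_lt_le; intro Hneg. clear - Hneg Hmain H1. nra. }
  assert (20000 * Y <= W) by (apply (Rmult_le_reg_l P); [lra|]; lra).
  assert (0 < W) by (apply (Rmult_lt_reg_l P); lra).
  lra.
Qed.

Definition cell3 (i1 j1 i2 j2 i3 j3 : Z) (s t : R) : Prop :=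
  cell N i1 j1 s t /\ cell N i2 j2 s t /\ cell N i3 j3 s t.

Lemma cell_of_corners i j s t :
  (forall i' j', insq i' -> insq j' -> F N i j s t <= F N i' j' s t) ->
  (forall i' j', ~ (insq i' /\ insq j') -> F N 0 0 s t < F N i' j' s t) -> cell N i j s t.
Proof using.
  intros H H' i' j'. destruct (classic (insq i' /\ insq j')) as [[Hi Hj]|Hn].
  - apply H; assumption.
  - left. apply Rle_lt_trans with (F N 0 0 s t); [|apply H', Hn]. apply H; left; reflexivity.
Qed.

(** The sign of [gap] at the point equidistant from (0, 0), (1, 0) and (1, 1) selects the diagonal.
    [equidistant_opposite] carries the sign over to the points attached to the chosen triangles;
    with it the omitted corner is not nearer, and [equidistant_far] disposes of all other lattice
    points. *)
Lemma square_vertices :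
  exists s t s' t',
    (cell3 0 0 1 0 1 1 s t /\ cell3 0 0 1 1 0 1 s' t') \/
    (cell3 1 0 1 1 0 1 s t /\ cell3 0 0 1 0 0 1 s' t').
Proof using HL.
  assert (b0 : isbit 0) by (left; reflexivity). assert (b1 : isbit 1) by (right; reflexivity).
  assert (Hcell : forall al be s t i j, isbit al -> isbit be ->
     Rabs s <= 20 * L * L -> Rabs t <= 20 * L * L -> equidistant al be s t ->
     (al = be -> 0 <= gap s t) ->
     F N i j s t <= F N 0 0 s t -> F N i j s t <= F N 1 0 s t ->
     F N i j s t <= F N 0 1 s t -> F N i j s t <= F N 1 1 s t -> cell N i j s t).
  { intros al be s t i j Ha Hb Hs Ht He Hg K0 K1 K2 K3. apply cell_of_corners.
    - intros i' j' [-> | ->] [-> | ->]; assumption.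
    - intros i' j' Hn. eapply equidistant_far; [exact Ha|exact Hb|..]; assumption. }
  destruct (equidistant_exists 0 1 b0 b1) as [s [t [Ps [Pt [Hs [Ht He]]]]]].
  pose proof loc_P as [HP _].
  assert (Hs' : Rabs s <= P) by lra. assert (Ht' : Rabs t <= P) by lra.
  destruct (Rle_lt_dec (gap s t) 0) as [Hg|Hg].
  - destruct (equidistant_exists 1 0 b1 b0) as [x [y [Px [Py [Hx [Hy He']]]]]].
    assert (Hx' : Rabs x <= P) by lra. assert (Hy' : Rabs y <= P) by lra.
    assert (Hg' : gap x y <= 0).
    { apply Rnot_lt_le; intro Hlt.
      destruct (equidistant_opposite 0 1 1 0 s t x y) as [<- <-]; try assumption; lra. }
    exists s, t, x, y. left. pose proof He as [E1 E2]. pose proof He' as [E1' E2'].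
    unfold gapE1, gapE2, gap in E1, E2, E1', E2', Hg, Hg'.
    split; (split; [|split]).
    1-3: apply (Hcell 0 1 s t); try assumption; lra.
    all: apply (Hcell 1 0 x y); try assumption; lra.
  - destruct (equidistant_exists 1 1 b1 b1) as [x [y [Px [Py [Hx [Hy He']]]]]].
    destruct (equidistant_exists 0 0 b0 b0) as [z [w [Pz [Pw [Hz [Hw He'']]]]]].
    assert (Hx' : Rabs x <= P) by lra. assert (Hy' : Rabs y <= P) by lra.
    assert (Hz' : Rabs z <= P) by lra. assert (Hw' : Rabs w <= P) by lra.
    assert (Hg' : 0 <= gap x y).
    { apply Rnot_lt_le; intro Hlt.
      destruct (equidistant_opposite 1 1 0 1 x y s t) as [<- <-]; try assumption; lra. }
    assert (Hg'' : 0 <= gap z w).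
    { apply Rnot_lt_le; intro Hlt.
      destruct (equidistant_opposite 0 0 0 1 z w s t) as [<- <-]; try assumption; lra. }
    exists x, y, z, w. right. pose proof He' as [E1 E2]. pose proof He'' as [E1' E2'].
    assert (Hg1 := Hg'). assert (Hg2 := Hg'').
    unfold gapE1, gapE2, gap in E1, E2, E1', E2', Hg1, Hg2.
    split; (split; [|split]).
    1-3: apply (Hcell 1 1 x y); try assumption; try (intros _; assumption); lra.
    all: apply (Hcell 0 0 z w); try assumption; try (intros _; assumption); lra.
Qed.

Definition three_corners (s t : R) : Prop :=
  cell3 0 0 1 0 1 1 s t \/ cell3 0 0 1 1 0 1 s t \/ cell3 1 0 1 1 0 1 s t \/ cell3 0 0 1 0 0 1 s t.

Lemma cell_eq i j i' j' s t : cell N i j s t -> cell N i' j' s t -> F N i j s t = F N i' j' s t.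
Proof using. intros H H'. apply Rle_antisym; [apply H|apply H']. Qed.

(** Good vertices belong to triangles on the diagonal from (0, 0) to (1, 1), which is a stencil edge
    with weight governed by [B]. Bad ones belong to triangles on the other diagonal, which the
    stencil does not contain. *)
Definition diag_good s t := cell3 0 0 1 0 1 1 s t \/ cell3 0 0 1 1 0 1 s t.
Definition diag_bad s t := cell3 1 0 1 1 0 1 s t \/ cell3 0 0 1 0 0 1 s t.

Lemma diag_good_equidistant s t : diag_good s t ->
  exists al be, isbit al /\ isbit be /\ equidistant al be s t /\ gap s t <= 0.
Proof using.
  intros [[H1 [H2 H3]]|[H1 [H2 H3]]].
  - exists 0, 1. split; [left; reflexivity|]. split; [right; reflexivity|].
    pose proof (cell_eq _ _ _ _ _ _ H1 H2). pose proof (cell_eq _ _ _ _ _ _ H1 H3).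
    pose proof (H1 0%Z 1%Z). unfold equidistant, gapE1, gapE2, gap. lra.
  - exists 1, 0. split; [right; reflexivity|]. split; [left; reflexivity|].
    pose proof (cell_eq _ _ _ _ _ _ H1 H2). pose proof (cell_eq _ _ _ _ _ _ H1 H3).
    pose proof (H1 1%Z 0%Z). unfold equidistant, gapE1, gapE2, gap. lra.
Qed.

Lemma diag_bad_equidistant s t : diag_bad s t ->
  exists al be, isbit al /\ isbit be /\ equidistant al be s t /\ 0 <= gap s t.
Proof using.
  intros [[H1 [H2 H3]]|[H1 [H2 H3]]].
  - exists 1, 1. split; [right; reflexivity|]. split; [right; reflexivity|].
    pose proof (cell_eq _ _ _ _ _ _ H1 H2). pose proof (cell_eq _ _ _ _ _ _ H1 H3).
    pose proof (H1 0%Z 0%Z). unfold equidistant, gapE1, gapE2, gap. lra.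
  - exists 0, 0. split; [left; reflexivity|]. split; [left; reflexivity|].
    pose proof (cell_eq _ _ _ _ _ _ H1 H2). pose proof (cell_eq _ _ _ _ _ _ H1 H3).
    pose proof (H1 1%Z 1%Z). unfold equidistant, gapE1, gapE2, gap. lra.
Qed.

Lemma diag_bad_small_B s t : Rabs s <= P -> Rabs t <= P -> diag_bad s t -> B <= 32 * (P ^ 2 * eps).
Proof using HL.
  intros Hs Ht H. destruct (diag_bad_equidistant _ _ H) as [_ [_ [_ [_ [_ Hg]]]]].
  destruct (gap_near s t Hs Ht) as [_ [_ K]]. apply Rabs_le_inv in K. lra.
Qed.

(** Distinct vertices of one square must favour the same diagonal. The last two cases then record
    that they miss opposite ends of the other diagonal, which is what a separating line along the
    common diagonal requires. *)
Lemma square_conform s t s' t' :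
  Rabs s <= P -> Rabs t <= P -> Rabs s' <= P -> Rabs t' <= P ->
  three_corners s t -> three_corners s' t' ->
  (s = s' /\ t = t') \/
  (diag_good s t /\ diag_good s' t' /\
     ((~ cell N 1 0 s t /\ ~ cell N 0 1 s' t') \/ (~ cell N 0 1 s t /\ ~ cell N 1 0 s' t'))) \/
  (diag_bad s t /\ diag_bad s' t' /\
     ((~ cell N 0 0 s t /\ ~ cell N 1 1 s' t') \/ (~ cell N 1 1 s t /\ ~ cell N 0 0 s' t'))).
Proof using HL.
  intros Hs Ht Hs' Ht' H H'.
  assert (Hc : forall x y, three_corners x y -> diag_good x y \/ diag_bad x y)
    by (intros x y; unfold three_corners, diag_good, diag_bad; tauto).
  assert (Hopp : diag_good s t -> diag_bad s' t' -> s = s' /\ t = t').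
  { intros G G'. destruct (diag_good_equidistant _ _ G) as [a [b [Ha [Hb [E K]]]]].
    destruct (diag_bad_equidistant _ _ G') as [a' [b' [Ha' [Hb' [E' K']]]]].
    apply (equidistant_opposite a b a' b'); assumption. }
  assert (Hopp' : diag_bad s t -> diag_good s' t' -> s = s' /\ t = t').
  { intros G G'. destruct (diag_bad_equidistant _ _ G) as [a [b [Ha [Hb [E K]]]]].
    destruct (diag_good_equidistant _ _ G') as [a' [b' [Ha' [Hb' [E' K']]]]].
    destruct (equidistant_opposite a' b' a b s' t' s t); try assumption. split; congruence. }
  assert (b0 : isbit 0) by (left; reflexivity). assert (b1 : isbit 1) by (right; reflexivity).
  assert (U : forall al be, isbit al -> isbit be -> equidistant al be s t -> equidistant al be s' t' -> s = s' /\ t = t').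
  { intros al be Ha Hb E E'. apply (equidistant_unique al be); assumption. }
  assert (e1 : forall x y, cell3 0 0 1 0 1 1 x y -> equidistant 0 1 x y).
  { intros x y [K1 [K2 K3]]. pose proof (cell_eq _ _ _ _ _ _ K1 K2). pose proof (cell_eq _ _ _ _ _ _ K1 K3).
    unfold equidistant, gapE1, gapE2, gap. lra. }
  assert (e2 : forall x y, cell3 0 0 1 1 0 1 x y -> equidistant 1 0 x y).
  { intros x y [K1 [K2 K3]]. pose proof (cell_eq _ _ _ _ _ _ K1 K2). pose proof (cell_eq _ _ _ _ _ _ K1 K3).
    unfold equidistant, gapE1, gapE2, gap. lra. }
  assert (e3 : forall x y, cell3 1 0 1 1 0 1 x y -> equidistant 1 1 x y).
  { intros x y [K1 [K2 K3]]. pose proof (cell_eq _ _ _ _ _ _ K1 K2). pose proof (cell_eq _ _ _ _ _ _ K1 K3).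
    unfold equidistant, gapE1, gapE2, gap. lra. }
  assert (e4 : forall x y, cell3 0 0 1 0 0 1 x y -> equidistant 0 0 x y).
  { intros x y [K1 [K2 K3]]. pose proof (cell_eq _ _ _ _ _ _ K1 K2). pose proof (cell_eq _ _ _ _ _ _ K1 K3).
    unfold equidistant, gapE1, gapE2, gap. lra. }
  destruct (Hc _ _ H) as [G|G], (Hc _ _ H') as [G'|G'].
  - destruct G as [G|G], G' as [G'|G'].
    + left. apply (U 0 1); auto.
    + destruct (classic (cell N 0 1 s t)) as [K|K]; [left; apply (U 1 0); auto; apply e2; unfold cell3 in *; tauto|].
      destruct (classic (cell N 1 0 s' t')) as [K'|K']; [left; apply (U 0 1); auto; apply e1; unfold cell3 in *; tauto|].
      right; left. unfold diag_good. tauto.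
    + destruct (classic (cell N 1 0 s t)) as [K|K]; [left; apply (U 0 1); auto; apply e1; unfold cell3 in *; tauto|].
      destruct (classic (cell N 0 1 s' t')) as [K'|K']; [left; apply (U 1 0); auto; apply e2; unfold cell3 in *; tauto|].
      right; left. unfold diag_good. tauto.
    + left. apply (U 1 0); auto.
  - left; apply Hopp; assumption.
  - left; apply Hopp'; assumption.
  - destruct G as [G|G], G' as [G'|G'].
    + left. apply (U 1 1); auto.
    + destruct (classic (cell N 0 0 s t)) as [K|K]; [left; apply (U 0 0); auto; apply e4; unfold cell3 in *; tauto|].
      destruct (classic (cell N 1 1 s' t')) as [K'|K']; [left; apply (U 1 1); auto; apply e3; unfold cell3 in *; tauto|].
      right; right. unfold diag_bad. tauto.
    + destruct (classic (cell N 1 1 s t)) as [K|K]; [left; apply (U 1 1); auto; apply e3; unfold cell3 in *; tauto|].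
      destruct (classic (cell N 0 0 s' t')) as [K'|K']; [left; apply (U 0 0); auto; apply e4; unfold cell3 in *; tauto|].
      right; right. unfold diag_bad. tauto.
    + left. apply (U 0 0); auto.
Qed.
End Local.

(** * Uniform bounds for a periodic Lipschitz field *)

(** The identity for [perp] holds because in dimension two the inverse of a symmetric matrix is its
    conjugate by the quarter turn divided by the determinant. It translates stencil and stiffness
    weights into products for the metric. *)
Definition uniform_bounds (D : pt -> sym2) (L : R) : Prop :=
  1 <= L /\
  (forall z, 1 <= L * deltaD D z /\ deltaD D z <= L) /\
  (forall z w, mclose (L * n1 (vsub z w)) (D z) (D w)) /\
  (forall z w, mclose (L * n1 (vsub z w)) (MM D z) (MM D w)) /\
  (forall z v, dot v v <= L * bform (MM D z) v v /\ bform (MM D z) v v <= L * dot v v) /\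
  (forall z, mdet (MM D z) = 1) /\
  (forall z u v, bform (D z) (perp u) (perp v) = deltaD D z * bform (MM D z) u v) /\
  (forall z v, 0 <= bform (D z) v v /\ bform (D z) v v <= L * dot v v).

Lemma sqrt_sum_sq_le a b c x : 0 <= b -> 0 <= c -> a * a + b + c = x -> Rabs a <= sqrt x.
Proof.
  intros Hb Hc <-. rewrite <- sqrt_Rsqr_abs. apply sqrt_le_1_alt. unfold Rsqr. lra.
Qed.

Lemma mdist_mclose M N e : mdist M N <= e -> mclose e M N.
Proof.
  destruct M as [[a b] c], N as [[a' b'] c']. unfold mdist, mclose; cbn [fst snd]. intros H.
  pose proof (pow2_ge_0 (a - a')). pose proof (pow2_ge_0 (b - b')). pose proof (pow2_ge_0 (c - c')).
  repeat split; (eapply Rle_trans; [|exact H]).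
  - apply (sqrt_sum_sq_le _ (2 * (b - b') ^ 2) ((c - c') ^ 2)); lra.
  - apply (sqrt_sum_sq_le _ ((b - b') ^ 2 + (a - a') ^ 2) ((c - c') ^ 2)); lra.
  - apply (sqrt_sum_sq_le _ (2 * (b - b') ^ 2) ((a - a') ^ 2)); lra.
Qed.

Lemma pdist_le_n1 z w : pdist z w <= n1 (vsub z w).
Proof.
  unfold pdist, dot, n1. set (v := vsub z w).
  pose proof (Rabs_pos (fst v)). pose proof (Rabs_pos (snd v)).
  rewrite <- (sqrt_Rsqr (Rabs (fst v) + Rabs (snd v))) by lra.
  apply sqrt_le_1_alt. unfold Rsqr.
  assert (Rabs (fst v) * Rabs (fst v) = fst v * fst v) by (rewrite <- Rabs_mult; apply Rabs_pos_eq; nra).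
  assert (Rabs (snd v) * Rabs (snd v) = snd v * snd v) by (rewrite <- Rabs_mult; apply Rabs_pos_eq; nra).
  nra.
Qed.

Lemma mclose_weaken e e' M N : e <= e' -> mclose e M N -> mclose e' M N.
Proof. unfold mclose. intuition lra. Qed.

Lemma vadd_toR_fractional z : exists w k, z = vadd w (toR k) /\ 0 <= fst w <= 1 /\ 0 <= snd w <= 1.
Proof.
  destruct z as [x y]. exists (frac_part x, frac_part y), (Int_part x, Int_part y).
  destruct (base_fp x), (base_fp y). split; [|simpl; lra].
  unfold vadd, toR; simpl. f_equal; unfold frac_part; ring.
Qed.

(** Over one period the Lipschitz bound controls the entries. Compactness serves only for the
    positive lower bound on the determinant; what concerns [MM] then follows from quotient
    estimates. *)
Lemma uniform_bounds_exist (D : pt -> sym2)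
  (HSPD : forall z, SPD (D z))
  (Hper : forall z (k : zpt), D (vadd z (toR k)) = D z)
  (HLip : exists L, forall z w, mdist (D z) (D w) <= L * pdist z w) :
  exists L, uniform_bounds D L.
Proof.
  destruct HLip as [L0' HL0].
  set (L0 := Rmax L0' 1).
  assert (HL0p : 1 <= L0) by apply Rmax_r.
  assert (HDl : forall z w, mclose (L0 * n1 (vsub z w)) (D z) (D w)).
  { intros z w. apply mdist_mclose. eapply Rle_trans; [apply HL0|].
    pose proof (pdist_le_n1 z w). pose proof (Rmax_l L0' 1). fold L0 in H0.
    assert (0 <= pdist z w) by apply sqrt_pos. nra. }
  set (a := fun z => fst (fst (D z))). set (b := fun z => snd (fst (D z))). set (c := fun z => snd (D z)).
  set (K := Rabs (a (0,0)) + Rabs (b (0,0)) + Rabs (c (0,0)) + 2 * L0).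
  assert (HK : forall z, Rabs (a z) <= K /\ Rabs (b z) <= K /\ Rabs (c z) <= K).
  { intros z. destruct (vadd_toR_fractional z) as [w [k [-> [Hx Hy]]]].
    unfold a, b, c. rewrite Hper. fold (a w) (b w) (c w).
    destruct (HDl w (0,0)) as [H1 [H2 H3]]. fold (a w) (b w) (c w) in *.
    fold (a (0,0)) (b (0,0)) (c (0,0)) in *.
    assert (n1 (vsub w (0,0)) <= 2).
    { unfold n1, vsub; simpl. rewrite !Rminus_0_r, !Rabs_pos_eq; lra. }
    assert (L0 * n1 (vsub w (0, 0)) <= 2 * L0) by nra.
    pose proof (Rabs_pos (a (0,0))). pose proof (Rabs_pos (b (0,0))). pose proof (Rabs_pos (c (0,0))).
    pose proof (Rabs_triang_inv (a w) (a (0,0))). pose proof (Rabs_triang_inv (b w) (b (0,0))).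
    pose proof (Rabs_triang_inv (c w) (c (0,0))). unfold K. repeat split; lra. }
  assert (HKp : 2 <= K) by (unfold K; pose proof (Rabs_pos (a (0,0))); pose proof (Rabs_pos (b (0,0)));
    pose proof (Rabs_pos (c (0,0))); lra).
  assert (Hdet : forall z, mdet (D z) = a z * c z - b z * b z).
  { intros z. unfold a, b, c. destruct (D z) as [[x y] w]. reflexivity. }
  assert (Hpos : forall z, 0 < a z /\ 0 < mdet (D z)).
  { intros z. pose proof (HSPD z). unfold SPD, a, mdet in *. destruct (D z) as [[x y] w]. exact H. }
  assert (Hmul : forall x y x' y' e, Rabs x <= K -> Rabs y' <= K -> Rabs (x - x') <= e -> Rabs (y - y') <= e ->
     Rabs (x * y - x' * y') <= 2 * K * e).
  { intros x y x' y' e H1 H2 H3 H4. replace (x * y - x' * y') with (x * (y - y') + y' * (x - x')) by ring.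
    eapply Rle_trans; [apply Rabs_triang|]. rewrite !Rabs_mult.
    pose proof (Rabs_pos x). pose proof (Rabs_pos y'). pose proof (Rabs_pos (x - x')). pose proof (Rabs_pos (y - y')).
    nra. }
  set (C := 4 * K * L0).
  assert (HC : 1 <= C) by (unfold C; nra).
  assert (Hdl : forall z w, Rabs (mdet (D z) - mdet (D w)) <= C * n1 (vsub z w)).
  { intros z w. rewrite !Hdet. destruct (HDl z w) as [H1 [H2 H3]].
    fold (a z) (b z) (c z) (a w) (b w) (c w) in *.
    destruct (HK z) as [Ka [Kb Kc]]. destruct (HK w) as [Ka' [Kb' Kc']].
    pose proof (Hmul _ _ _ _ _ Ka Kc' H1 H3) as M1. pose proof (Hmul _ _ _ _ _ Kb Kb' H2 H2) as M2.
    apply Rabs_le_inv in M1. apply Rabs_le_inv in M2. apply Rabs_le. unfold C. lra. }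
  assert (Hd0 : exists d0, 0 < d0 /\ forall z, d0 <= mdet (D z)).
  { assert (Hp : forall u v, 0 < mdet (D (u, v)) / (4 * (C + 1))).
    { intros u v. apply Rdiv_lt_0_compat; [apply Hpos|lra]. }
    (* The radius at a point is its determinant divided by 4 (C + 1). Within that radius the
       determinant loses at most half, and what is left is at least twice the radius. *)
    destruct (Compactness.compactness_value_2d 0 1 0 1 (fun u v => mkposreal _ (Hp u v))) as [d Hd].
    exists (2 * d). split; [pose proof (cond_pos d); lra|].
    intros z. destruct (vadd_toR_fractional z) as [[x y] [k [-> [Hx Hy]]]]. rewrite Hper. cbn [fst snd] in *.
    apply Rnot_lt_le; intro Hlt. apply (Hd x y Hx Hy). intros [u [v [_ [_ [Hxu [Hyv Hle]]]]]].
    simpl in Hxu, Hyv, Hle.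
    pose proof (Hdl (x, y) (u, v)) as H. unfold n1, vsub in H; cbn [fst snd] in H.
    apply Rabs_le_inv in H. set (m := mdet (D (u, v))) in *. set (dd := m / (4 * (C + 1))) in *.
    assert (m = 4 * (C + 1) * dd) by (unfold dd; field; lra).
    pose proof (cond_pos d).
    assert (C * (Rabs (x - u) + Rabs (y - v)) <= C * (2 * dd)) by (apply Rmult_le_compat_l; lra).
    nra. }
  destruct Hd0 as [d0 [Hd0p Hd0]].
  set (m := sqrt d0). assert (Hm : 0 < m) by (apply sqrt_lt_R0; exact Hd0p).
  set (de := deltaD D).
  assert (Hde : forall z, m <= de z).
  { intros z. apply sqrt_le_1_alt, Hd0. }
  assert (Hde2 : forall z, de z * de z = mdet (D z)).
  { intros z. apply sqrt_sqrt. left; apply Hpos. }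
  assert (HMM : forall z, MM D z = (c z / de z, - b z / de z, a z / de z)).
  { intros z. unfold MM, c, b, a. fold (de z). pose proof (Hde2 z) as E. pose proof (Hde z).
    destruct (D z) as [[x y] w]. unfold minv, mscale. cbn [fst snd]. rewrite <- E.
    f_equal; [f_equal|]; field; lra. }
  assert (Hac : forall z, 0 < a z /\ 0 < c z /\ a z * c z - b z * b z = de z * de z).
  { intros z. destruct (Hpos z) as [P1 P2]. rewrite Hde2, <- Hdet.
    rewrite Hdet in P2. repeat split; try assumption. nra. }
  set (im := / m). assert (Him : 0 < im) by (apply Rinv_0_lt_compat, Hm).
  assert (Hinv : forall z, 0 < / de z <= im).
  { intros z. pose proof (Hde z). split; [apply Rinv_0_lt_compat; lra|]. apply Rinv_le_contravar; lra. }
  assert (Hdel : forall z w, Rabs (de z - de w) <= C * im * n1 (vsub z w)).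
  { intros z w. pose proof (Hdl z w) as H. rewrite <- !Hde2 in H.
    replace (de z * de z - de w * de w) with ((de z - de w) * (de z + de w)) in H by ring.
    rewrite Rabs_mult, (Rabs_pos_eq (de z + de w)) in H by (pose proof (Hde z); pose proof (Hde w); lra).
    pose proof (Hde z). pose proof (Hde w). pose proof (Rabs_pos (de z - de w)).
    apply (Rmult_le_reg_l m); [exact Hm|].
    replace (m * (C * im * n1 (vsub z w))) with (C * n1 (vsub z w)) by (unfold im; field; lra).
    nra. }
  assert (Hquot : forall x y z w e, Rabs y <= K -> 0 <= e -> Rabs (x - y) <= L0 * e ->
     Rabs (de z - de w) <= C * im * e -> Rabs (x / de z - y / de w) <= (L0 * im + K * C * im * im * im) * e).
  { intros x y z w e Hy He Hxy Hzw.
    pose proof (Hde z). pose proof (Hde w).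
    replace (x / de z - y / de w) with ((x - y) * / de z + y * ((de w - de z) * (/ de z * / de w)))
      by (field; lra).
    eapply Rle_trans; [apply Rabs_triang|]. rewrite !Rabs_mult.
    rewrite (Rabs_minus_sym (de w)).
    destruct (Hinv z) as [I1 I2]. destruct (Hinv w) as [I3 I4].
    rewrite (Rabs_pos_eq (/ de z)), (Rabs_pos_eq (/ de w)) by lra.
    pose proof (Rabs_pos (x - y)). pose proof (Rabs_pos y). pose proof (Rabs_pos (de z - de w)).
    assert (Rabs (x - y) * / de z <= (L0 * e) * im) by (apply Rmult_le_compat; lra).
    assert (0 <= / de z * / de w <= im * im) by (split; [nra|apply Rmult_le_compat; lra]).
    assert (Rabs (de z - de w) * (/ de z * / de w) <= (C * im * e) * (im * im)) by (apply Rmult_le_compat; lra).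
    assert (0 <= Rabs (de z - de w) * (/ de z * / de w)) by (apply Rmult_le_pos; lra).
    assert (Rabs y * (Rabs (de z - de w) * (/ de z * / de w)) <= K * ((C * im * e) * (im * im)))
      by (apply Rmult_le_compat; lra).
    lra. }
  set (L1 := L0 * im + K * C * im * im * im).
  (* A bound on the trace of [MM D z]. Since the determinant is 1, it bounds the form from above
     and, through its inverse, from below. *)
  set (tr := 2 * K * im).
  assert (0 < L1).
  { unfold L1. assert (0 < L0 * im) by nra. assert (0 < K * C * im * im * im)
     by (repeat apply Rmult_lt_0_compat; lra). lra. }
  assert (0 < tr) by (unfold tr; nra).
  exists (1 + L0 + L1 + tr + 2 * K + im).
  set (L := 1 + L0 + L1 + tr + 2 * K + im).
  assert (Hell : forall z v, dot v v <= tr * bform (MM D z) v v /\ bform (MM D z) v v <= tr * dot v v).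
  { intros z [x y]. rewrite HMM. unfold bform, dot; cbn [fst snd].
    destruct (Hac z) as [Pa [Pc Pd]]. destruct (HK z) as [Ka [Kb Kc]]. destruct (Hinv z) as [I1 I2].
    set (i := / de z) in *. unfold Rdiv. fold i.
    assert (Hi : i * i * (a z * c z - b z * b z) = 1).
    { rewrite Pd. unfold i. field. pose proof (Hde z). lra. }
    set (p := a z * i). set (q := - b z * i). set (r := c z * i).
    assert (Hpr : p * r - q * q = 1) by (unfold p, q, r; rewrite <- Hi; ring).
    assert (0 < p) by (unfold p; nra). assert (0 < r) by (unfold r; nra).
    assert (Htr : p + r <= tr).
    { rewrite Rabs_pos_eq in Ka, Kc by lra. unfold p, r, tr. nra. }
    replace (r * x * x + q * (x * y + y * x) + p * y * y) with (r * (x * x) + 2 * q * (x * y) + p * (y * y)) by ring.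
    set (f := r * (x * x) + 2 * q * (x * y) + p * (y * y)).
    (* Cayley-Hamilton at determinant 1: the trace times <v, Mv> minus |v|^2 is |Mv|^2. *)
    assert (Hf1 : (p + r) * f - (x * x + y * y) = (r * x + q * y) * (r * x + q * y) + (q * x + p * y) * (q * x + p * y)).
    { transitivity ((p + r) * f - (p * r - q * q) * (x * x + y * y)); [rewrite Hpr; ring|]. unfold f; ring. }
    pose proof (Rle_0_sqr (r * x + q * y)). pose proof (Rle_0_sqr (q * x + p * y)). unfold Rsqr in *.
    assert (Hxy : 0 <= x * x + y * y) by nra.
    assert (0 <= f) by nra.
    assert (Hf2 : p * ((p + r) * (x * x + y * y) - f) = (p * x - q * y) * (p * x - q * y) + (p * r - q * q) * (y * y)).
    { unfold f; ring. }
    pose proof (Rle_0_sqr (p * x - q * y)). unfold Rsqr in *. rewrite Hpr in Hf2.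
    split; [nra|].
    assert (0 <= (p + r) * (x * x + y * y) - f) by (apply (Rmult_le_reg_l p); [lra|]; nra).
    nra. }
  assert (Hn1 : forall z, 0 <= n1 z) by apply n1_pos.
  assert (0 < im) by lra.
  split; [unfold L; lra|]. split; [|split; [|split; [|split; [|split; [|split]]]]].
  - intros z. fold (de z). pose proof (Hde z). split.
    + apply Rle_trans with (im * de z); [|apply Rmult_le_compat_r; unfold L; lra].
      apply Rle_trans with (im * m); [unfold im; right; field; lra|apply Rmult_le_compat_l; lra].
    + destruct (Hac z) as [Pa [Pc Pd]]. destruct (HK z) as [Ka [Kb Kc]].
      rewrite Rabs_pos_eq in Ka, Kc by lra. pose proof (Rle_0_sqr (b z)). unfold Rsqr in *.
      assert (de z * de z <= K * K) by nra. apply Rle_trans with K; [nra|unfold L; lra].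
  - intros z w. apply (mclose_weaken (L0 * n1 (vsub z w))); [|apply HDl].
    apply Rmult_le_compat_r; [apply Hn1|unfold L; lra].
  - intros z w. apply (mclose_weaken (L1 * n1 (vsub z w))); [apply Rmult_le_compat_r; [apply Hn1|unfold L; lra]|].
    rewrite !HMM. destruct (HDl z w) as [Q1 [Q2 Q3]]. destruct (HK w) as [Ka [Kb Kc]].
    fold (a z) (b z) (c z) (a w) (b w) (c w) in *.
    unfold mclose; cbn [fst snd]. repeat split; apply Hquot; auto using Hn1.
    + rewrite Rabs_Ropp; exact Kb.
    + replace (- b z - - b w) with (- (b z - b w)) by ring. rewrite Rabs_Ropp; exact Q2.
  - intros z v. destruct (Hell z v) as [E1 E2].
    assert (0 <= dot v v) by (unfold dot; nra).
    assert (0 <= bform (MM D z) v v) by (apply (Rmult_le_reg_l tr); lra).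
    assert (tr <= L) by (unfold L; lra).
    split; (eapply Rle_trans; [eassumption|apply Rmult_le_compat_r; assumption]).
  - intros z. rewrite HMM. unfold mdet. destruct (Hac z) as [Pa [Pc Pd]].
    pose proof (Hde z).
    replace (c z / de z * (a z / de z) - - b z / de z * (- b z / de z))
      with ((a z * c z - b z * b z) / (de z * de z)) by (field; lra).
    rewrite Pd. field; lra.
  - intros z u v. rewrite HMM. fold (de z). pose proof (Hde z). unfold a, b, c.
    destruct (D z) as [[x y] w]. unfold bform, perp; cbn [fst snd]. field. lra.
  - intros z [x y]. destruct (Hac z) as [Pa [Pc Pd]]. destruct (HK z) as [Ka [Kb Kc]].
    unfold a, b, c in *. destruct (D z) as [[p q] r]. unfold bform, dot; cbn [fst snd] in *.
    rewrite Rabs_pos_eq in Ka, Kc by lra. pose proof (Hde z).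
    assert (Hf2 : p * (p * x * x + q * (x * y + y * x) + r * y * y) = (p * x + q * y) * (p * x + q * y) + (p * r - q * q) * (y * y)) by ring.
    pose proof (Rle_0_sqr (p * x + q * y)). unfold Rsqr in *.
    assert (0 < p * r - q * q) by nra.
    assert (0 <= (p * r - q * q) * (y * y)) by (apply Rmult_le_pos; [lra|nra]).
    split.
    + apply (Rmult_le_reg_l p); lra.
    + assert (0 <= x * x) by nra. assert (0 <= y * y) by nra.
      assert (2 * K <= L) by (unfold L; lra).
      apply Rabs_le_inv in Kb.
      assert (q * (x * y + y * x) <= K * (x * x + y * y)).
      { pose proof (Rle_0_sqr (x - y)) as Sm. pose proof (Rle_0_sqr (x + y)) as Sp.
        unfold Rsqr in Sm, Sp. set (w := x * y + y * x) in *.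
        assert (Hw : - (x * x + y * y) <= w <= x * x + y * y) by (unfold w; lra).
        clearbody w. clear - Kb Hw HKp. nra. }
      assert (p * (x * x) <= K * (x * x)) by (apply Rmult_le_compat_r; lra).
      assert (r * (y * y) <= K * (y * y)) by (apply Rmult_le_compat_r; lra).
      assert (2 * K * (x * x + y * y) <= L * (x * x + y * y)) by (apply Rmult_le_compat_r; lra).
      lra.
Qed.

(** * Reduced superbases and lattice coordinates *)

Definition zdet (e1 e2 : zpt) : Z := (fst e1 * snd e2 - snd e1 * fst e2)%Z.
Definition zcomb (k0 e1 e2 : zpt) (i j : Z) : zpt :=
  (fst k0 + i * fst e1 + j * fst e2, snd k0 + i * snd e1 + j * snd e2)%Z.
Definition rcomb (k0 e1 e2 : zpt) (s t : R) : pt :=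
  (IZR (fst k0) + s * IZR (fst e1) + t * IZR (fst e2),
   IZR (snd k0) + s * IZR (snd e1) + t * IZR (snd e2)).
Definition pull (M : sym2) (e1 e2 : zpt) : sym2 :=
  (bform M (toR e1) (toR e1), bform M (toR e1) (toR e2), bform M (toR e2) (toR e2)).

(* An oriented obtuse superbase whose products [<e0,e1>] and [<e0,e2>] dominate [<e1,e2>];
   they are then bounded away from 0. *)
Definition Frame (M : sym2) (e1 e2 : zpt) : Prop :=
  zdet e1 e2 = 1%Z /\ bform M (toR e1) (toR e2) <= 0 /\
  - 2 * bform M (toR e1) (toR e2) <= bform M (toR e1) (toR e1) /\
  - 2 * bform M (toR e1) (toR e2) <= bform M (toR e2) (toR e2).

Lemma list_argmin {T} (f : T -> R) (l : list T) (x0 : T) : In x0 l ->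
  exists x, In x l /\ forall y, In y l -> f x <= f y.
Proof.
  revert x0. induction l as [|a l IH]; [intros x []|]. intros x0 _.
  destruct l as [|b l'].
  - exists a. split; [left; reflexivity|]. intros y [<-|[]]. lra.
  - destruct (IH b (or_introl eq_refl)) as [x [Hx Hm]].
    destruct (Rle_lt_dec (f a) (f x)).
    + exists a. split; [left; reflexivity|]. intros y [<-|Hy]; [lra|].
      pose proof (Hm y Hy). lra.
    + exists x. split; [right; exact Hx|]. intros y [<-|Hy]; [lra|apply Hm, Hy].
Qed.

Definition zrange (K : Z) : list Z := map (fun i => (Z.of_nat i - K)%Z) (List.seq 0 (Z.to_nat (2 * K + 1))).
Definition zbox (K : Z) : list zpt := list_prod (zrange K) (zrange K).

Lemma in_zrange K x : (0 <= K)%Z -> In x (zrange K) <-> (Z.abs x <= K)%Z.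
Proof.
  intros HK. unfold zrange. rewrite in_map_iff. split.
  - intros [i [<- Hi]]. apply in_seq in Hi. lia.
  - intros Hx. exists (Z.to_nat (x + K)). split; [lia|]. apply in_seq. lia.
Qed.

Lemma in_zbox K k : (0 <= K)%Z -> In k (zbox K) <-> (Z.abs (fst k) <= K /\ Z.abs (snd k) <= K)%Z.
Proof.
  intros HK. destruct k as [x y]. pose proof (in_prod_iff (zrange K) (zrange K) x y) as H.
  rewrite !in_zrange in H by exact HK. exact H.
Qed.

Lemma abs_IZR_le_iff (x : Z) (r : R) : Rabs (IZR x) <= r -> (Z.abs x <= up r)%Z.
Proof.
  intros H. rewrite <- abs_IZR in H. apply le_IZR. destruct (archimed r). lra.
Qed.

Lemma bform_toR_zshift_l M a b c : bform M (toR (zshift a b)) c = bform M (toR a) c + bform M (toR b) c.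
Proof. destruct M as [[x y] z]. unfold bform, toR, zshift; cbn [fst snd]. rewrite !plus_IZR. ring. Qed.

Definition zneg (k : zpt) : zpt := (- fst k, - snd k)%Z.
Lemma bform_toR_zneg_l M a c : bform M (toR (zneg a)) c = - bform M (toR a) c.
Proof. destruct M as [[x y] z]. unfold bform, toR, zneg; cbn [fst snd]. rewrite !opp_IZR. ring. Qed.

Lemma bform_toR_zshift_r M a b c : bform M c (toR (zshift a b)) = bform M c (toR a) + bform M c (toR b).
Proof. rewrite bform_sym, bform_toR_zshift_l, !(bform_sym M c). reflexivity. Qed.
Lemma bform_toR_zneg_r M a c : bform M c (toR (zneg a)) = - bform M c (toR a).
Proof. rewrite bform_sym, bform_toR_zneg_l, (bform_sym M c). reflexivity. Qed.

(** Minimise the sum of the two squared norms over oriented bases; ellipticity confines the bases no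
    worse than the standard one to a finite box. Comparison with the four elementary shears shows
    that twice the product is at most either squared norm in absolute value. If the product is
    positive, (e2, -e1) has the right sign and the same orientation. *)
Lemma frame_exists M L : 1 <= L -> (forall v, dot v v <= L * bform M v v) ->
  exists e1 e2, Frame M e1 e2.
Proof.
  intros HL Hell.
  set (E := fun e : zpt * zpt => bform M (toR (fst e)) (toR (fst e)) + bform M (toR (snd e)) (toR (snd e))).
  set (std := ((1, 0)%Z, (0, 1)%Z) : zpt * zpt).
  assert (Hpos : forall v, 0 <= bform M v v).
  { intros v. pose proof (Hell v). assert (0 <= dot v v) by (unfold dot; nra).
    apply (Rmult_le_reg_l L); lra. }
  set (b := 1 + L * E std).
  assert (Hb : 1 <= b) by (unfold b, E; pose proof (Hpos (toR (fst std))); pose proof (Hpos (toR (snd std))); nra).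
  set (K := up b).
  assert (HK : (0 <= K)%Z).
  { apply le_IZR. unfold K. destruct (archimed b). lra. }
  set (l := filter (fun e : zpt * zpt => Z.eqb (zdet (fst e) (snd e)) 1) (list_prod (zbox K) (zbox K))).
  assert (Hbox : forall e1 e2, E (e1, e2) <= E std -> zdet e1 e2 = 1%Z -> In (e1, e2) l).
  { intros e1 e2 Hle Hd. unfold l. apply filter_In. split.
    - assert (T : forall e, L * bform M (toR e) (toR e) <= b -> In e (zbox K)).
      { intros e He. apply in_zbox; [exact HK|]. pose proof (Hell (toR e)) as H.
        unfold dot, toR in H; cbn [fst snd] in H.
        assert (forall x, x * x <= b -> Rabs x <= b).
        { intros x Hx. apply Rabs_le. split; nra. }
        fold (toR e) in H.
        split; apply abs_IZR_le_iff; apply H0; unfold toR in *; nra. }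
      unfold E in Hle; cbn [fst snd] in Hle. pose proof (Hpos (toR e1)). pose proof (Hpos (toR e2)).
      fold (E std) in Hle. unfold b in T.
      apply in_prod; apply T; nra.
    - simpl. apply Z.eqb_eq, Hd. }
  destruct (list_argmin E l std) as [[e1 e2] [Hin Hmin]].
  { apply Hbox; [apply Rle_refl|reflexivity]. }
  assert (Hd : zdet e1 e2 = 1%Z).
  { apply filter_In in Hin. destruct Hin as [_ H]. apply Z.eqb_eq in H. exact H. }
  assert (Hglob : forall f1 f2, zdet f1 f2 = 1%Z -> E (e1, e2) <= E (f1, f2)).
  { intros f1 f2 Hf. destruct (Rle_lt_dec (E (f1, f2)) (E std)) as [H|H].
    - apply Hmin, Hbox; assumption.
    - pose proof (Hmin std (Hbox _ _ (Rle_refl _) eq_refl)). lra. }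
  pose proof (Hglob e1 (zshift e2 e1) ltac:(unfold zdet, zshift in *; cbn [fst snd] in *; lia)) as G1.
  pose proof (Hglob e1 (zshift e2 (zneg e1)) ltac:(unfold zdet, zshift, zneg in *; cbn [fst snd] in *; lia)) as G2.
  pose proof (Hglob (zshift e1 e2) e2 ltac:(unfold zdet, zshift in *; cbn [fst snd] in *; lia)) as G3.
  pose proof (Hglob (zshift e1 (zneg e2)) e2 ltac:(unfold zdet, zshift, zneg in *; cbn [fst snd] in *; lia)) as G4.
  unfold E in G1, G2, G3, G4; cbn [fst snd] in G1, G2, G3, G4.
  rewrite ?bform_toR_zshift_l, ?bform_toR_zshift_r, ?bform_toR_zneg_l, ?bform_toR_zneg_r in G1.
  rewrite ?bform_toR_zshift_l, ?bform_toR_zshift_r, ?bform_toR_zneg_l, ?bform_toR_zneg_r in G2.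
  rewrite ?bform_toR_zshift_l, ?bform_toR_zshift_r, ?bform_toR_zneg_l, ?bform_toR_zneg_r in G3.
  rewrite ?bform_toR_zshift_l, ?bform_toR_zshift_r, ?bform_toR_zneg_l, ?bform_toR_zneg_r in G4.
  rewrite (bform_sym M (toR e2) (toR e1)) in *.
  destruct (Rle_lt_dec (bform M (toR e1) (toR e2)) 0) as [H|H].
  - exists e1, e2. unfold Frame. split; [exact Hd|]. lra.
  - exists e2, (zneg e1). unfold Frame.
    rewrite !bform_toR_zneg_r, !bform_toR_zneg_l, (bform_sym M (toR e2) (toR e1)).
    split; [unfold zdet, zneg in *; cbn [fst snd] in *; lia|]. lra.
Qed.

Lemma lagrange_identity M u v :
  bform M u u * bform M v v - bform M u v * bform M u v =
  mdet M * ((fst u * snd v - snd u * fst v) * (fst u * snd v - snd u * fst v)).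
Proof. destruct M as [[a b] c]. unfold bform, mdet. ring. Qed.

(** From AC - B^2 = 1 and 4 B^2 <= AC the product AC is at most 4/3, while A and C are at least 1/L
    because the vectors are integral and nonzero. Hence the upper bounds; the lower ones use A - B
    >= A / 2. *)
Lemma frame_bounds M L e1 e2 : 1 <= L -> mdet M = 1 ->
  (forall v, dot v v <= L * bform M v v /\ bform M v v <= L * dot v v) -> Frame M e1 e2 ->
  let A := bform M (toR e1) (toR e1) in let B := - bform M (toR e1) (toR e2) in
  let C := bform M (toR e2) (toR e2) in
  A * C - B * B = 1 /\ 0 <= B /\ 1 <= 2 * L * (A - B) /\ 1 <= 2 * L * (C - B) /\
  A <= 2 * L /\ C <= 2 * L /\
  dot (toR e1) (toR e1) <= 2 * L * L /\ dot (toR e2) (toR e2) <= 2 * L * L /\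
  n1 (toR e1) <= 4 * L /\ n1 (toR e2) <= 4 * L.
Proof.
  intros HL Hdet Hell [Hd [F1 [F2 F3]]] A B C.
  pose proof (lagrange_identity M (toR e1) (toR e2)) as Hlag. rewrite Hdet in Hlag.
  assert (Hd1 : fst (toR e1) * snd (toR e2) - snd (toR e1) * fst (toR e2) = 1).
  { unfold toR; cbn [fst snd]. rewrite <- !mult_IZR, <- minus_IZR. f_equal. exact Hd. }
  rewrite Hd1 in Hlag.
  fold A C in Hlag, F2, F3.
  assert (HB : bform M (toR e1) (toR e2) = - B) by (unfold B; ring). rewrite HB in *.
  destruct (Hell (toR e1)) as [E1 E1']. destruct (Hell (toR e2)) as [E2 E2']. fold A in E1, E1'. fold C in E2, E2'.
  assert (Hsq : forall x, Rabs x * Rabs x = x * x)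
    by (intros x; rewrite <- Rabs_mult; apply Rabs_pos_eq; nra).
  assert (Hint : forall e, (fst e <> 0 \/ snd e <> 0)%Z -> 1 <= dot (toR e) (toR e)).
  { intros [x y] H. unfold dot, toR; cbn [fst snd] in *. rewrite <- !mult_IZR, <- plus_IZR.
    apply IZR_le. nia. }
  assert (I1 : 1 <= dot (toR e1) (toR e1)) by (apply Hint; unfold zdet in Hd; lia).
  assert (I2 : 1 <= dot (toR e2) (toR e2)) by (apply Hint; unfold zdet in Hd; lia).
  assert (0 < A) by nra. assert (0 < C) by nra.
  assert (K1 : 1 <= L * A) by lra. assert (K2 : 1 <= L * C) by lra.
  assert (HBB : 4 * (B * B) <= A * C) by nra.
  assert (HA : A <= 2 * L).
  { apply (Rmult_le_reg_l C); [lra|]. nra. }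
  assert (HC : C <= 2 * L).
  { apply (Rmult_le_reg_l A); [lra|]. nra. }
  assert (D1 : dot (toR e1) (toR e1) <= 2 * L * L) by nra.
  assert (D2 : dot (toR e2) (toR e2) <= 2 * L * L) by nra.
  assert (Hn : forall e, dot (toR e) (toR e) <= 2 * L * L -> n1 (toR e) <= 4 * L).
  { intros e. unfold dot, n1. rewrite <- (Hsq (fst (toR e))), <- (Hsq (snd (toR e))).
    pose proof (Rabs_pos (fst (toR e))). pose proof (Rabs_pos (snd (toR e))).
    set (x := Rabs (fst (toR e))) in *. set (y := Rabs (snd (toR e))) in *. intros Hxy.
    clear - H1 H2 HL Hxy. pose proof (Rle_0_sqr (x - y)) as S. unfold Rsqr in S.
    apply Rnot_lt_le; intro Hlt. nra. }
  assert (0 <= L * (A - 2 * B)) by (apply Rmult_le_pos; lra).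
  assert (0 <= L * (C - 2 * B)) by (apply Rmult_le_pos; lra).
  repeat split; try assumption; try lra; apply Hn; assumption.
Qed.

(** The metric varies with the lattice point but is always read in the frame chosen at [k0], so that
    all nearby metrics are compared with one Gram matrix. *)
Definition locN (D : pt -> sym2) (n : nat) (k0 e1 e2 : zpt) (i j : Z) : sym2 :=
  pull (MM D (hpt n (zcomb k0 e1 e2 i j))) e1 e2.

Lemma pull_bform M e1 e2 s t s' t' :
  bform (pull M e1 e2) (s, t) (s', t') =
  bform M (s * IZR (fst e1) + t * IZR (fst e2), s * IZR (snd e1) + t * IZR (snd e2))
          (s' * IZR (fst e1) + t' * IZR (fst e2), s' * IZR (snd e1) + t' * IZR (snd e2)).
Proof. destruct M as [[a b] c]. unfold pull, bform, toR; cbn [fst snd]. ring. Qed.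

Lemma n1_hpt_sub n k k' : (1 <= n)%nat ->
  n1 (vsub (hpt n k) (hpt n k')) = (Rabs (IZR (fst k - fst k')) + Rabs (IZR (snd k - snd k'))) / INR n.
Proof.
  intros Hn. assert (0 < INR n) by (apply lt_0_INR; lia).
  unfold n1, vsub, hpt; cbn [fst snd]. rewrite !minus_IZR.
  replace (IZR (fst k) / INR n - IZR (fst k') / INR n) with ((IZR (fst k) - IZR (fst k')) * / INR n) by (field; lra).
  replace (IZR (snd k) / INR n - IZR (snd k') / INR n) with ((IZR (snd k) - IZR (snd k')) * / INR n) by (field; lra).
  rewrite !Rabs_mult, !(Rabs_pos_eq (/ INR n)) by (left; apply Rinv_0_lt_compat; lra). field. lra.
Qed.

(** Frame vectors have l1 norm at most 4 L, so indices up to [P] move the point by 8 L P / n and the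
    metric by L times that; pairing two frame vectors costs (4 L)^2, which makes 128 L^4 P / n.
    Changing between frame and Euclidean coordinates costs 4 L^2 in squared norm, whence the
    ellipticity constant 4 L^3. *)
Lemma frame_loc D L n k0 e1 e2 P : uniform_bounds D L -> (1 <= n)%nat ->
  100 * (4 * L ^ 3) ^ 3 <= P -> 10000 * P ^ 6 * (128 * L ^ 4 * P / INR n) <= 1 ->
  let M := MM D (hpt n k0) in Frame M e1 e2 ->
  Loc (locN D n k0 e1 e2) (bform M (toR e1) (toR e1)) (- bform M (toR e1) (toR e2))
    (bform M (toR e2) (toR e2)) (4 * L ^ 3) P (128 * L ^ 4 * P / INR n).
Proof.
  intros [HL [_ [_ [Hlip [Hell [Hdet _]]]]]] Hn HP Heps M HF.
  assert (Hnp : 0 < INR n) by (apply lt_0_INR; lia).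
  destruct (frame_bounds M L e1 e2 HL (Hdet _) (Hell _) HF) as [B1 [B2 [B3 [B4 [B5 [B6 [B7 [B8 [B9 B10]]]]]]]]].
  assert (HL2 : 1 <= L * L) by nra. assert (HL3 : L * L <= L ^ 3) by (simpl; nra).
  assert (HP0 : 1 <= P). { assert (1 <= (4 * L ^ 3) ^ 3) by (apply pow_R1_Rle; lra). lra. }
  split; [|split; [|split]].
  - split; [lra|]. split; [exact HP|]. split; [|exact Heps].
    apply Rmult_le_pos; [|left; apply Rinv_0_lt_compat; lra].
    assert (0 <= L ^ 4) by (apply pow_le; lra). nra.
  - split; [exact B1|]. split; [exact B2|].
    assert (2 * L <= 4 * L ^ 3) by nra.
    split; [|split; [|split; lra]].
    + eapply Rle_trans; [exact B3|]. apply Rmult_le_compat_r; [|lra]. nra.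
    + eapply Rle_trans; [exact B4|]. apply Rmult_le_compat_r; [|lra]. nra.
  - intros i j Hi Hj. unfold locN. set (k := zcomb k0 e1 e2 i j).
    pose proof (Hlip (hpt n k) (hpt n k0)) as Hc. fold M in Hc.
    set (e := L * n1 (vsub (hpt n k) (hpt n k0))) in *.
    assert (He : e <= 8 * L * L * P / INR n).
    { unfold e. rewrite n1_hpt_sub by exact Hn. unfold k, zcomb; cbn [fst snd].
      replace (fst k0 + i * fst e1 + j * fst e2 - fst k0)%Z with (i * fst e1 + j * fst e2)%Z by ring.
      replace (snd k0 + i * snd e1 + j * snd e2 - snd k0)%Z with (i * snd e1 + j * snd e2)%Z by ring.
      rewrite !plus_IZR, !mult_IZR.
      pose proof (Rabs_triang (IZR i * IZR (fst e1)) (IZR j * IZR (fst e2))) as T1.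
      pose proof (Rabs_triang (IZR i * IZR (snd e1)) (IZR j * IZR (snd e2))) as T2.
      rewrite !Rabs_mult in T1, T2. unfold n1, toR in B9, B10; cbn [fst snd] in B9, B10.
      set (X := Rabs (IZR i * IZR (fst e1) + IZR j * IZR (fst e2)) + Rabs (IZR i * IZR (snd e1) + IZR j * IZR (snd e2))) in *.
      assert (X <= 8 * L * P).
      { pose proof (Rabs_pos (IZR (fst e1))). pose proof (Rabs_pos (IZR (snd e1))).
        pose proof (Rabs_pos (IZR (fst e2))). pose proof (Rabs_pos (IZR (snd e2))).
        pose proof (Rabs_pos (IZR i)). pose proof (Rabs_pos (IZR j)).
        assert (Rabs (IZR i) * (Rabs (IZR (fst e1)) + Rabs (IZR (snd e1))) <= P * (4 * L)) by (apply Rmult_le_compat; lra).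
        assert (Rabs (IZR j) * (Rabs (IZR (fst e2)) + Rabs (IZR (snd e2))) <= P * (4 * L)) by (apply Rmult_le_compat; lra).
        unfold X. nra. }
      unfold Rdiv. rewrite <- Rmult_assoc. apply Rmult_le_compat_r; [left; apply Rinv_0_lt_compat; lra|]. nra. }
    assert (He0 : 0 <= e) by (unfold e; pose proof (n1_pos (vsub (hpt n k) (hpt n k0))); nra).
    assert (T : forall u v, n1 u <= 4 * L -> n1 v <= 4 * L ->
      Rabs (bform (MM D (hpt n k)) u v - bform M u v) <= 128 * L ^ 4 * P / INR n).
    { intros u v Hu Hv. eapply Rle_trans; [apply mclose_bform, Hc|].
      pose proof (n1_pos u). pose proof (n1_pos v).
      apply Rle_trans with (e * (4 * L) * (4 * L)).
      - apply Rmult_le_compat; try assumption; [nra|]. apply Rmult_le_compat_l; assumption.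
      - apply Rle_trans with ((8 * L * L * P / INR n) * (4 * L) * (4 * L)); [|right; field; lra].
        apply Rmult_le_compat_r; [lra|]. apply Rmult_le_compat_r; lra. }
    unfold mclose, pull; cbn [fst snd]. rewrite Ropp_involutive.
    repeat split; apply T; assumption.
  - intros i j s t. unfold locN. set (Mk := MM D _). rewrite pull_bform.
    set (v := (s * IZR (fst e1) + t * IZR (fst e2), s * IZR (snd e1) + t * IZR (snd e2))).
    destruct (Hell (hpt n (zcomb k0 e1 e2 i j)) v) as [E1 E2]. fold Mk in E1, E2.
    assert (Hd1 : IZR (fst e1) * IZR (snd e2) - IZR (snd e1) * IZR (fst e2) = 1).
    { rewrite <- !mult_IZR, <- minus_IZR. f_equal. apply HF. }
    unfold dot, toR in B7, B8; cbn [fst snd] in B7, B8.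
    unfold dot, v in E1, E2; cbn [fst snd] in E1, E2. fold v in E1, E2.
    set (a1 := IZR (fst e1)) in *. set (a2 := IZR (snd e1)) in *.
    set (b1 := IZR (fst e2)) in *. set (b2 := IZR (snd e2)) in *.
    set (x := s * a1 + t * b1) in *. set (y := s * a2 + t * b2) in *.
    assert (Hs : s = x * b2 - y * b1) by (transitivity (s * (a1 * b2 - a2 * b1)); [rewrite Hd1|unfold x, y]; ring).
    assert (Ht : t = y * a1 - x * a2) by (transitivity (t * (a1 * b2 - a2 * b1)); [rewrite Hd1|unfold x, y]; ring).
    assert (CS : forall p q r w, (p * q + r * w) * (p * q + r * w) <= (p * p + r * r) * (q * q + w * w)).
    { intros p q r w. pose proof (Rle_0_sqr (p * w - r * q)). unfold Rsqr in *. lra. }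
    set (f := bform Mk v v) in *.
    assert (Hxy0 : 0 <= x * x + y * y) by nra.
    split.
    + pose proof (CS x b2 y (- b1)) as C1. pose proof (CS y a1 x (- a2)) as C2.
      replace (x * b2 + y * - b1) with s in C1 by (rewrite Hs; ring).
      replace (y * a1 + x * - a2) with t in C2 by (rewrite Ht; ring).
      assert (s * s + t * t <= (x * x + y * y) * (4 * (L * L))).
      { assert ((x * x + y * y) * (b1 * b1 + b2 * b2) <= (x * x + y * y) * (2 * L * L)) by (apply Rmult_le_compat_l; lra).
        assert ((x * x + y * y) * (a1 * a1 + a2 * a2) <= (x * x + y * y) * (2 * L * L)) by (apply Rmult_le_compat_l; lra).
        lra. }
      apply Rle_trans with ((x * x + y * y) * (4 * (L * L))); [assumption|].
      replace (4 * L ^ 3 * f) with ((L * f) * (4 * (L * L))) by ring. apply Rmult_le_compat_r; lra.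
    + pose proof (CS s a1 t b1) as C1. pose proof (CS s a2 t b2) as C2. fold x in C1. fold y in C2.
      assert (0 <= s * s + t * t) by nra.
      assert (x * x + y * y <= (s * s + t * t) * (4 * (L * L))).
      { replace ((s * s + t * t) * (a1 * a1 + b1 * b1)) with ((s * s + t * t) * (a1 * a1 + b1 * b1)) in C1 by ring.
        assert ((s * s + t * t) * (a1 * a1 + b1 * b1 + a2 * a2 + b2 * b2) <= (s * s + t * t) * (4 * (L * L)))
          by (apply Rmult_le_compat_l; lra).
        lra. }
      apply Rle_trans with (L * (x * x + y * y)); [exact E2|].
      replace (4 * L ^ 3 * (s * s + t * t)) with (L * ((s * s + t * t) * (4 * (L * L)))) by ring.
      apply Rmult_le_compat_l; lra.
Qed.

(** The reference form stays that of the old base point, so that several squares can be treated in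
    one frame; the price is a smaller radius. *)
Lemma loc_shift N A B C L P P' eps i0 j0 : Loc N A B C L P eps -> 100 * L ^ 3 <= P' ->
  Rabs (IZR i0) + P' <= P -> Rabs (IZR j0) + P' <= P ->
  Loc (fun i j => N (i + i0)%Z (j + j0)%Z) A B C L P' eps.
Proof.
  intros [[H1 [H2 [H3 H4]]] [HB [Hc He]]] HP' Hi0 Hj0.
  split; [|split; [exact HB|split]].
  - split; [exact H1|]. split; [exact HP'|]. split; [exact H3|].
    assert (0 <= P') by (assert (0 <= L ^ 3) by (apply pow_le; lra); lra).
    assert (P' ^ 6 <= P ^ 6) by (apply pow_incr; pose proof (Rabs_pos (IZR i0)); lra).
    nra.
  - intros i j Hi Hj. apply Hc; rewrite plus_IZR.
    + pose proof (Rabs_triang (IZR i) (IZR i0)). lra.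
    + pose proof (Rabs_triang (IZR j) (IZR j0)). lra.
  - intros i j. apply He.
Qed.

Lemma F_shift N i0 j0 i j s t :
  F (fun i j => N (i + i0)%Z (j + j0)%Z) i j s t = F N (i + i0) (j + j0) (s + IZR i0) (t + IZR j0).
Proof.
  unfold F. rewrite !plus_IZR.
  replace (s + IZR i0 - (IZR i + IZR i0)) with (s - IZR i) by ring.
  replace (t + IZR j0 - (IZR j + IZR j0)) with (t - IZR j) by ring. reflexivity.
Qed.

Lemma cell_shift N i0 j0 i j s t :
  cell (fun i j => N (i + i0)%Z (j + j0)%Z) i j s t <-> cell N (i + i0) (j + j0) (s + IZR i0) (t + IZR j0).
Proof.
  unfold cell. split; intros H i' j'.
  - pose proof (H (i' - i0)%Z (j' - j0)%Z) as K. rewrite !F_shift in K.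
    replace (i' - i0 + i0)%Z with i' in K by ring. replace (j' - j0 + j0)%Z with j' in K by ring. exact K.
  - rewrite !F_shift. apply H.
Qed.

Lemma zcomb_surj k0 e1 e2 k : zdet e1 e2 = 1%Z -> exists i j, k = zcomb k0 e1 e2 i j.
Proof.
  intros Hd. exists ((fst k - fst k0) * snd e2 - (snd k - snd k0) * fst e2)%Z,
    ((snd k - snd k0) * fst e1 - (fst k - fst k0) * snd e1)%Z.
  destruct k as [x y], k0 as [x0 y0], e1 as [a b], e2 as [c d]. unfold zdet, zcomb in *; cbn [fst snd] in *.
  f_equal.
  - transitivity (x0 + (x - x0) * (a * d - b * c))%Z; [rewrite Hd|]; ring.
  - transitivity (y0 + (y - y0) * (a * d - b * c))%Z; [rewrite Hd|]; ring.
Qed.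

Lemma zcomb_inj k0 e1 e2 i j i' j' : zdet e1 e2 = 1%Z ->
  zcomb k0 e1 e2 i j = zcomb k0 e1 e2 i' j' -> i = i' /\ j = j'.
Proof.
  intros Hd. destruct k0 as [x0 y0], e1 as [a b], e2 as [c d]. unfold zdet, zcomb in *; cbn [fst snd] in *.
  intros H. injection H as H1 H2.
  assert (U : ((i - i') * a + (j - j') * c = 0)%Z) by lia.
  assert (V : ((i - i') * b + (j - j') * d = 0)%Z) by lia.
  split; apply Zminus_eq.
  - transitivity ((i - i') * (a * d - b * c))%Z; [rewrite Hd; ring|].
    transitivity (((i - i') * a + (j - j') * c) * d - ((i - i') * b + (j - j') * d) * c)%Z; [ring|].
    rewrite U, V; ring.
  - transitivity ((j - j') * (a * d - b * c))%Z; [rewrite Hd; ring|].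
    transitivity (((i - i') * b + (j - j') * d) * a - ((i - i') * a + (j - j') * c) * b)%Z; [ring|].
    rewrite U, V; ring.
Qed.

Lemma rcomb_surj k0 e1 e2 X : zdet e1 e2 = 1%Z -> exists s t, X = rcomb k0 e1 e2 s t /\
  s = (fst X - IZR (fst k0)) * IZR (snd e2) - (snd X - IZR (snd k0)) * IZR (fst e2) /\
  t = (snd X - IZR (snd k0)) * IZR (fst e1) - (fst X - IZR (fst k0)) * IZR (snd e1).
Proof.
  intros Hd. assert (Hd1 : IZR (fst e1) * IZR (snd e2) - IZR (snd e1) * IZR (fst e2) = 1).
  { rewrite <- !mult_IZR, <- minus_IZR. f_equal. exact Hd. }
  eexists _, _. split; [|split; reflexivity].
  destruct X as [x y], k0 as [x0 y0], e1 as [a b], e2 as [c d]. unfold rcomb; cbn [fst snd] in *.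
  f_equal.
  - transitivity (IZR x0 + (x - IZR x0) * (IZR a * IZR d - IZR b * IZR c)); [rewrite Hd1|]; ring.
  - transitivity (IZR y0 + (y - IZR y0) * (IZR a * IZR d - IZR b * IZR c)); [rewrite Hd1|]; ring.
Qed.

Lemma rcomb_inj k0 e1 e2 s t s' t' : zdet e1 e2 = 1%Z ->
  rcomb k0 e1 e2 s t = rcomb k0 e1 e2 s' t' -> s = s' /\ t = t'.
Proof.
  intros Hd H. assert (Hd1 : IZR (fst e1) * IZR (snd e2) - IZR (snd e1) * IZR (fst e2) = 1).
  { rewrite <- !mult_IZR, <- minus_IZR. f_equal. exact Hd. }
  unfold rcomb in H. injection H as H1 H2.
  set (a := IZR (fst e1)) in *. set (b := IZR (snd e1)) in *. set (c := IZR (fst e2)) in *. set (d := IZR (snd e2)) in *.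
  assert (U : (s - s') * a + (t - t') * c = 0) by lra. assert (V : (s - s') * b + (t - t') * d = 0) by lra.
  assert (s - s' = 0).
  { transitivity ((s - s') * (a * d - b * c)); [rewrite Hd1; ring|].
    transitivity (((s - s') * a + (t - t') * c) * d - ((s - s') * b + (t - t') * d) * c); [ring|rewrite U, V; ring]. }
  assert (t - t' = 0).
  { transitivity ((t - t') * (a * d - b * c)); [rewrite Hd1; ring|].
    transitivity (((s - s') * b + (t - t') * d) * a - ((s - s') * a + (t - t') * c) * b); [ring|rewrite U, V; ring]. }
  lra.
Qed.

(** Squared distance after scaling the grid to the integer lattice. The scaling factor is common to
    all grid points and does not affect which of them is nearest. *)
Definition gdist2 (D : pt -> sym2) (n : nat) (k : zpt) (X : pt) : R :=
  bform (MM D (hpt n k)) (vsub X (toR k)) (vsub X (toR k)).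

Lemma F_locN D n k0 e1 e2 i j s t :
  F (locN D n k0 e1 e2) i j s t = gdist2 D n (zcomb k0 e1 e2 i j) (rcomb k0 e1 e2 s t).
Proof.
  unfold F, locN, gdist2. rewrite pull_bform.
  assert (E : vsub (rcomb k0 e1 e2 s t) (toR (zcomb k0 e1 e2 i j)) =
    ((s - IZR i) * IZR (fst e1) + (t - IZR j) * IZR (fst e2), (s - IZR i) * IZR (snd e1) + (t - IZR j) * IZR (snd e2))).
  { unfold vsub, rcomb, toR, zcomb; cbn [fst snd]. rewrite !plus_IZR, !mult_IZR. f_equal; ring. }
  rewrite E. reflexivity.
Qed.

Lemma inVor_gdist2 D L n k q : uniform_bounds D L -> (1 <= n)%nat ->
  inVor D n k q <-> forall k', gdist2 D n k (vscale (INR n) q) <= gdist2 D n k' (vscale (INR n) q).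
Proof.
  intros [HL [_ [_ [_ [Hell _]]]]] Hn. assert (Hnp : 0 < INR n) by (apply lt_0_INR; lia).
  assert (E : forall k, bform (MM D (hpt n k)) (vsub q (hpt n k)) (vsub q (hpt n k)) = gdist2 D n k (vscale (INR n) q) * (/ INR n * / INR n)).
  { intros k'. unfold gdist2. destruct (MM D (hpt n k')) as [[a b] c].
    unfold bform, vsub, vscale, hpt, toR; cbn [fst snd]. field. lra. }
  assert (Hpos : forall k, 0 <= gdist2 D n k (vscale (INR n) q)).
  { intros k'. unfold gdist2. set (v := vsub _ _). destruct (Hell (hpt n k') v) as [H _].
    assert (0 <= dot v v) by (unfold dot; nra). apply (Rmult_le_reg_l L); lra. }
  assert (Hi : 0 < / INR n * / INR n) by (assert (0 < / INR n) by (apply Rinv_0_lt_compat; lra); nra).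
  unfold inVor, deltap, mnorm. split; intros H k'; specialize (H k'); rewrite !E in *.
  - apply sqrt_le_0 in H; try (apply Rmult_le_pos; [apply Hpos|lra]).
    apply Rmult_le_reg_r in H; assumption.
  - apply sqrt_le_1_alt. apply Rmult_le_compat_r; [lra|exact H].
Qed.

Lemma cell_inVor D L n k0 e1 e2 i j s t q : uniform_bounds D L -> (1 <= n)%nat -> zdet e1 e2 = 1%Z ->
  vscale (INR n) q = rcomb k0 e1 e2 s t ->
  cell (locN D n k0 e1 e2) i j s t <-> inVor D n (zcomb k0 e1 e2 i j) q.
Proof.
  intros HU Hn Hd Hq. rewrite (inVor_gdist2 _ _ _ _ _ HU Hn), Hq. unfold cell. split; intros H.
  - intros k'. destruct (zcomb_surj k0 e1 e2 k' Hd) as [i' [j' ->]]. rewrite <- !F_locN. apply H.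
  - intros i' j'. rewrite !F_locN. apply H.
Qed.

(** * Convex hulls and separating lines *)

Definition aff (l : R * R * R) (x : pt) : R :=
  fst (fst l) * fst x + snd (fst l) * snd x + snd l.

Definition wsum (l : list (pt * R)) : R := fold_right (fun pw acc => snd pw + acc) 0 l.
Definition wpt (l : list (pt * R)) : pt :=
  fold_right (fun pw acc => vadd (vscale (snd pw) (fst pw)) acc) (0, 0) l.

Lemma aff_wpt a l : aff a (wpt l) - snd a = fold_right (fun pw acc => snd pw * aff a (fst pw) + acc) 0 l - snd a * wsum l.
Proof.
  induction l as [|pw l IH]; unfold aff in *; simpl; [ring|].
  fold (wpt l) (wsum l). lra.
Qed.

Lemma inconv_aff_nonneg (S : pt -> Prop) a x : (forall p, S p -> 0 <= aff a p) -> inconv S x -> 0 <= aff a x.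
Proof.
  intros H [l [Hf [Hw Hx]]]. fold (wsum l) in Hw. fold (wpt l) in Hx. subst x.
  pose proof (aff_wpt a l) as E. rewrite Hw in E.
  assert (0 <= fold_right (fun pw acc => snd pw * aff a (fst pw) + acc) 0 l); [|lra].
  clear E Hw. induction Hf as [|pw l [Hp Hn] _ IH]; simpl; [lra|]. specialize (H _ Hp). nra.
Qed.

Lemma inconv_mono (S S' : pt -> Prop) x : (forall p, S p -> S' p) -> inconv S x -> inconv S' x.
Proof.
  intros H [l [Hf [Hw Hx]]]. exists l. split; [|split; assumption].
  eapply Forall_impl; [|exact Hf]. intros pw [Hp Hn]. split; [apply H, Hp|exact Hn].
Qed.

(** A convex combination of nonnegative values vanishes only if every point of positive weight has
    value 0; the points of weight 0 are dropped from the list. *)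
Lemma inconv_face (S : pt -> Prop) a x : (forall p, S p -> 0 <= aff a p) -> inconv S x -> aff a x = 0 ->
  inconv (fun p => S p /\ aff a p = 0) x.
Proof.
  intros H [l [Hf [Hw Hx]]] H0. fold (wsum l) in Hw. fold (wpt l) in Hx. subst x.
  pose proof (aff_wpt a l) as E. rewrite Hw, H0 in E.
  assert (E0 : fold_right (fun pw acc => snd pw * aff a (fst pw) + acc) 0 l = 0) by lra.
  assert (G : Forall (fun pw => (S (fst pw) /\ 0 <= snd pw) /\ (snd pw = 0 \/ aff a (fst pw) = 0)) l).
  { clear E Hw H0. induction Hf as [|pw l [Hp Hn] Hf IH]; [constructor|]. simpl in E0.
    assert (0 <= fold_right (fun pw acc => snd pw * aff a (fst pw) + acc) 0 l).
    { clear E0 IH. induction Hf as [|pw' l [Hp' Hn'] _ IH]; simpl; [lra|]. specialize (H _ Hp'). nra. }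
    pose proof (H _ Hp). assert (0 <= snd pw * aff a (fst pw)) by nra.
    constructor; [|apply IH; lra]. split; [tauto|].
    apply Rmult_integral. lra. }
  clear E E0 H0.
  assert (K : exists l', Forall (fun pw => (S (fst pw) /\ aff a (fst pw) = 0) /\ 0 <= snd pw) l' /\
     wsum l' = wsum l /\ wpt l' = wpt l).
  { clear Hf Hw. induction G as [|pw l [[Hp Hn] Hor] _ IH]; [exists nil; repeat split; constructor|].
    destruct IH as [l' [F' [W' P']]]. destruct Hor as [Hz|Hz].
    - exists l'. split; [exact F'|]. simpl. fold (wsum l) (wpt l). rewrite Hz, W', P'.
      split; [ring|]. unfold vadd, vscale; cbn [fst snd]. destruct (wpt l); simpl. f_equal; ring.
    - exists (pw :: l'). split; [constructor; tauto|]. simpl. fold (wsum l) (wpt l) (wsum l') (wpt l').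
      rewrite W', P'. split; reflexivity. }
  destruct K as [l' [F' [W' P']]]. exists l'. split; [|split].
  - eapply Forall_impl; [|exact F']. simpl. tauto.
  - fold (wsum l'). congruence.
  - exact P'.
Qed.

Lemma inconv_singleton (S : pt -> Prop) p x : (forall y, S y -> y = p) -> inconv S x -> x = p.
Proof.
  intros H Hx.
  assert (T : forall a, aff a p = 0 -> 0 <= aff a x).
  { intros a Ha. apply (inconv_aff_nonneg S); [|exact Hx]. intros y Hy. rewrite (H y Hy). lra. }
  pose proof (T (1, 0, - fst p) ltac:(unfold aff; simpl; ring)) as T1.
  pose proof (T (-1, 0, fst p) ltac:(unfold aff; simpl; ring)) as T2.
  pose proof (T (0, 1, - snd p) ltac:(unfold aff; simpl; ring)) as T3.
  pose proof (T (0, -1, snd p) ltac:(unfold aff; simpl; ring)) as T4.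
  unfold aff in *; cbn [fst snd] in *. destruct x, p; cbn [fst snd] in *. f_equal; lra.
Qed.

Lemma inconv_three (S : pt -> Prop) p q r a b c :
  S p -> S q -> S r -> 0 <= a -> 0 <= b -> 0 <= c -> a + b + c = 1 ->
  inconv S (vadd (vscale a p) (vadd (vscale b q) (vscale c r))).
Proof.
  intros Hp Hq Hr Ha Hb Hc H. exists ((p, a) :: (q, b) :: (r, c) :: nil). split; [|split].
  - repeat (apply Forall_cons; [split; assumption|]). apply Forall_nil.
  - simpl. lra.
  - simpl. unfold vadd, vscale; cbn [fst snd]. f_equal; ring.
Qed.

Lemma aff_eq_of_collinear a x y e : aff a (x + e * fst (fst a), y + e * snd (fst a)) =
  aff a (x, y) + e * (fst (fst a) * fst (fst a) + snd (fst a) * snd (fst a)).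
Proof. unfold aff; simpl. ring. Qed.

(** A small step against the gradient of [a] stays in the set and strictly lowers the value, which
    must remain nonnegative. *)
Lemma interior_aff_pos (S : pt -> Prop) a x : (forall p, S p -> 0 <= aff a p) -> fst a <> (0, 0) ->
  Defs.interior S x -> 0 < aff a x.
Proof.
  intros H Ha [e [He Hb]]. set (g := fst (fst a) * fst (fst a) + snd (fst a) * snd (fst a)).
  assert (Hg : 0 < g).
  { unfold g. destruct a as [[u v] w]; cbn [fst snd] in *. destruct (Req_dec u 0) as [->|Hu].
    - destruct (Req_dec v 0) as [->|Hv]; [congruence|]. nra.
    - nra. }
  set (m := Rabs (fst (fst a)) + Rabs (snd (fst a)) + 1).
  assert (Hm : 1 <= m) by (unfold m; pose proof (Rabs_pos (fst (fst a))); pose proof (Rabs_pos (snd (fst a))); lra).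
  set (d := e / (2 * m)). assert (Hd : 0 < d) by (apply Rdiv_lt_0_compat; lra).
  destruct x as [x y].
  assert (Hy : S (x + - d * fst (fst a), y + - d * snd (fst a))).
  { apply Hb. eapply Rle_lt_trans; [apply pdist_le_n1|]. unfold n1, vsub; cbn [fst snd].
    replace (x - (x + - d * fst (fst a))) with (d * fst (fst a)) by ring.
    replace (y - (y + - d * snd (fst a))) with (d * snd (fst a)) by ring.
    rewrite !Rabs_mult, !(Rabs_pos_eq d) by lra.
    replace e with (d * (2 * m)) by (unfold d; field; lra). unfold m in *. nra. }
  apply H in Hy. rewrite aff_eq_of_collinear in Hy. fold g in Hy. nra.
Qed.

Definition hull (n : nat) (S : zpt -> Prop) : pt -> Prop := inconv (img n S).
(** The inclusion that is not automatic in the common-face condition of [Qh_polygonization]. *)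
Definition conform (n : nat) (S S' : zpt -> Prop) : Prop :=
  forall x, hull n S x -> hull n S' x -> hull n (fun k => S k /\ S' k) x.
Definition separated (n : nat) (S S' : zpt -> Prop) : Prop :=
  exists a, fst a <> (0, 0) /\ (forall k, S k -> 0 <= aff a (hpt n k)) /\ (forall k, S' k -> aff a (hpt n k) <= 0).

Definition aff_opp (a : R * R * R) := (- fst (fst a), - snd (fst a), - snd a).
Lemma aff_aff_opp a x : aff (aff_opp a) x = - aff a x.
Proof. unfold aff, aff_opp; cbn [fst snd]. ring. Qed.

Lemma hull_mono n (S S' : zpt -> Prop) x : (forall k, S k -> S' k) -> hull n S x -> hull n S' x.
Proof. intros H. apply inconv_mono. intros p [k [Hk E]]. exists k. auto. Qed.

Lemma hull_aff_nonneg n (S : zpt -> Prop) a x : (forall k, S k -> 0 <= aff a (hpt n k)) -> hull n S x -> 0 <= aff a x.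
Proof. intros H. apply inconv_aff_nonneg. intros p [k [Hk ->]]. apply H, Hk. Qed.

Lemma hull_face n (S : zpt -> Prop) a x : (forall k, S k -> 0 <= aff a (hpt n k)) -> hull n S x -> aff a x = 0 ->
  hull n (fun k => S k /\ aff a (hpt n k) = 0) x.
Proof.
  intros H Hx H0. eapply inconv_mono; [|apply (inconv_face _ a _ ) in Hx; [exact Hx| |exact H0]].
  - intros p [[k [Hk ->]] E]. exists k. auto.
  - intros p [k [Hk ->]]. apply H, Hk.
Qed.

Lemma conform_sym n S S' : conform n S S' -> conform n S' S.
Proof. intros H x Hx Hx'. eapply hull_mono; [|apply (H x Hx' Hx)]. simpl; tauto. Qed.

Lemma separated_sym n S S' : separated n S S' -> separated n S' S.
Proof.
  intros [a [Ha [H H']]]. exists (aff_opp a). split; [|split].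
  - unfold aff_opp; simpl. destruct a as [[u v] w]; cbn [fst snd] in *. intros E. apply Ha.
    injection E as E1 E2. f_equal; lra.
  - intros k Hk. rewrite aff_aff_opp. specialize (H' k Hk). lra.
  - intros k Hk. rewrite aff_aff_opp. specialize (H k Hk). lra.
Qed.

Lemma conform_sub n (S S' : zpt -> Prop) : (forall k, S k -> S' k) -> conform n S S'.
Proof. intros H x Hx _. eapply hull_mono; [|exact Hx]. simpl; auto. Qed.

(** Common points lie on the separating line, where each hull is spanned by its own points on that
    line; conformity is thereby reduced to dimension one. *)
Lemma conform_sep n (S S' : zpt -> Prop) a :
  (forall k, S k -> 0 <= aff a (hpt n k)) -> (forall k, S' k -> aff a (hpt n k) <= 0) ->
  conform n (fun k => S k /\ aff a (hpt n k) = 0) (fun k => S' k /\ aff a (hpt n k) = 0) ->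
  conform n S S'.
Proof.
  intros H H' Hc x Hx Hx'.
  assert (H'' : forall k, S' k -> 0 <= aff (aff_opp a) (hpt n k)).
  { intros k Hk. rewrite aff_aff_opp. specialize (H' k Hk). lra. }
  pose proof (hull_aff_nonneg _ _ _ _ H Hx) as E1. pose proof (hull_aff_nonneg _ _ _ _ H'' Hx') as E2.
  rewrite aff_aff_opp in E2. assert (E : aff a x = 0) by lra.
  pose proof (hull_face _ _ _ _ H Hx E) as F1.
  pose proof (hull_face _ _ _ _ H'' Hx' ltac:(rewrite aff_aff_opp; lra)) as F2.
  eapply hull_mono; [|apply (Hc x F1)].
  - simpl. tauto.
  - eapply hull_mono; [|exact F2]. simpl. intros k [Hk E']. rewrite aff_aff_opp in E'. split; [exact Hk|lra].
Qed.

Lemma hpt_inj n k k' : (1 <= n)%nat -> hpt n k = hpt n k' -> k = k'.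
Proof.
  intros Hn H. assert (0 < INR n) by (apply lt_0_INR; lia).
  unfold hpt in H. injection H as H1 H2. destruct k, k'; cbn [fst snd] in *.
  apply Rmult_eq_reg_r in H1; [|apply Rinv_neq_0_compat; lra].
  apply Rmult_eq_reg_r in H2; [|apply Rinv_neq_0_compat; lra].
  apply eq_IZR in H1. apply eq_IZR in H2. congruence.
Qed.

(** If neither set contains the other, they are two different singletons and their hulls are
    disjoint. *)
Lemma conform_two_points n (S S' : zpt -> Prop) p p' : (1 <= n)%nat ->
  (forall k, S k -> k = p \/ k = p') -> (forall k, S' k -> k = p \/ k = p') -> conform n S S'.
Proof.
  intros Hn H H'.
  destruct (classic (forall k, S k -> S' k)) as [Hs|Hs]; [apply conform_sub, Hs|].
  destruct (classic (forall k, S' k -> S k)) as [Hs'|Hs']; [apply conform_sym, conform_sub, Hs'|].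
  apply not_all_ex_not in Hs. destruct Hs as [a Ha]. apply imply_to_and in Ha. destruct Ha as [Ha Ha'].
  apply not_all_ex_not in Hs'. destruct Hs' as [b Hb]. apply imply_to_and in Hb. destruct Hb as [Hb Hb'].
  intros x Hx Hx'. exfalso.
  assert (Hab : a <> b) by congruence.
  assert (E1 : x = hpt n a).
  { apply (inconv_singleton (img n S)); [|exact Hx]. intros y [k [Hk ->]]. f_equal.
    destruct (H k Hk), (H a Ha), (H' b Hb); subst; congruence. }
  assert (E2 : x = hpt n b).
  { apply (inconv_singleton (img n S')); [|exact Hx']. intros y [k [Hk ->]]. f_equal.
    destruct (H' k Hk), (H a Ha), (H' b Hb); subst; congruence. }
  apply Hab, (hpt_inj n); congruence.
Qed.

Lemma separated_no_common_interior n S S' : separated n S S' ->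
  ~ exists x, Defs.interior (hull n S) x /\ Defs.interior (hull n S') x.
Proof.
  intros [a [Ha [H H']]] [x [Hx Hx']].
  assert (H'' : forall k, S' k -> 0 <= aff (aff_opp a) (hpt n k)).
  { intros k Hk. rewrite aff_aff_opp. specialize (H' k Hk). lra. }
  assert (Ha' : fst (aff_opp a) <> (0, 0)).
  { unfold aff_opp; simpl. destruct a as [[u v] w]; cbn [fst snd] in *. intros E. apply Ha.
    injection E as E1 E2. f_equal; lra. }
  pose proof (interior_aff_pos _ a x (fun p => hull_aff_nonneg n S a p H) Ha Hx) as E1.
  pose proof (interior_aff_pos _ _ x (fun p => hull_aff_nonneg n S' _ p H'') Ha' Hx') as E2.
  rewrite aff_aff_opp in E2. lra.
Qed.

(* The affine function on the plane equal to [al s + be t + ga] in the lattice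
   coordinates [(s, t)] of the basis [(e1, e2)] at [k0]. *)
Definition coord_aff (n : nat) (k0 e1 e2 : zpt) (al be ga : R) : R * R * R :=
  let sx := INR n * IZR (snd e2) in let sy := - INR n * IZR (fst e2) in
  let tx := - INR n * IZR (snd e1) in let ty := INR n * IZR (fst e1) in
  (al * sx + be * tx, al * sy + be * ty,
   ga - al * (IZR (fst k0) * IZR (snd e2) - IZR (snd k0) * IZR (fst e2))
      - be * (IZR (snd k0) * IZR (fst e1) - IZR (fst k0) * IZR (snd e1))).

Lemma coord_aff_rcomb n k0 e1 e2 al be ga x s t : zdet e1 e2 = 1%Z ->
  vscale (INR n) x = rcomb k0 e1 e2 s t -> aff (coord_aff n k0 e1 e2 al be ga) x = al * s + be * t + ga.
Proof.
  intros Hd Hx. assert (Hd1 : IZR (fst e1) * IZR (snd e2) - IZR (snd e1) * IZR (fst e2) = 1).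
  { rewrite <- !mult_IZR, <- minus_IZR. f_equal. exact Hd. }
  destruct x as [x y]. unfold vscale, rcomb in Hx; cbn [fst snd] in Hx. injection Hx as H1 H2.
  unfold aff, coord_aff; cbn [fst snd].
  transitivity (al * ((INR n * x - IZR (fst k0)) * IZR (snd e2) - (INR n * y - IZR (snd k0)) * IZR (fst e2))
     + be * ((INR n * y - IZR (snd k0)) * IZR (fst e1) - (INR n * x - IZR (fst k0)) * IZR (snd e1)) + ga); [ring|].
  rewrite H1, H2.
  transitivity (al * s * (IZR (fst e1) * IZR (snd e2) - IZR (snd e1) * IZR (fst e2))
     + be * t * (IZR (fst e1) * IZR (snd e2) - IZR (snd e1) * IZR (fst e2)) + ga); [ring|rewrite Hd1; ring].
Qed.

Lemma vscale_hpt n k : (1 <= n)%nat -> vscale (INR n) (hpt n k) = toR k.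
Proof.
  intros Hn. assert (0 < INR n) by (apply lt_0_INR; lia).
  unfold vscale, hpt, toR; cbn [fst snd]. f_equal; field; lra.
Qed.

Lemma toR_zcomb k0 e1 e2 i j : toR (zcomb k0 e1 e2 i j) = rcomb k0 e1 e2 (IZR i) (IZR j).
Proof. unfold toR, zcomb, rcomb; cbn [fst snd]. rewrite !plus_IZR, !mult_IZR. reflexivity. Qed.

Lemma coord_aff_zcomb n k0 e1 e2 al be ga i j : (1 <= n)%nat -> zdet e1 e2 = 1%Z ->
  aff (coord_aff n k0 e1 e2 al be ga) (hpt n (zcomb k0 e1 e2 i j)) = al * IZR i + be * IZR j + ga.
Proof.
  intros Hn Hd. apply coord_aff_rcomb; [exact Hd|]. rewrite vscale_hpt by exact Hn. apply toR_zcomb.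
Qed.

Lemma coord_aff_nonzero n k0 e1 e2 al be ga : (1 <= n)%nat -> zdet e1 e2 = 1%Z -> (al <> 0 \/ be <> 0) ->
  fst (coord_aff n k0 e1 e2 al be ga) <> (0, 0).
Proof.
  intros Hn Hd Hab H. assert (Hnp : 0 < INR n) by (apply lt_0_INR; lia).
  assert (Hd1 : IZR (fst e1) * IZR (snd e2) - IZR (snd e1) * IZR (fst e2) = 1).
  { rewrite <- !mult_IZR, <- minus_IZR. f_equal. exact Hd. }
  unfold coord_aff in H; cbn [fst snd] in H. injection H as H1 H2.
  set (a := IZR (fst e1)) in *. set (b := IZR (snd e1)) in *. set (c := IZR (fst e2)) in *. set (d := IZR (snd e2)) in *.
  assert (E1 : INR n * al = 0).
  { transitivity (INR n * al * (a * d - b * c)); [rewrite Hd1; ring|].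
    transitivity (a * (al * (INR n * d) + be * (- INR n * b)) + b * (al * (- INR n * c) + be * (INR n * a))); [ring|].
    rewrite H1, H2. ring. }
  assert (E2 : INR n * be = 0).
  { transitivity (INR n * be * (a * d - b * c)); [rewrite Hd1; ring|].
    transitivity (c * (al * (INR n * d) + be * (- INR n * b)) + d * (al * (- INR n * c) + be * (INR n * a))); [ring|].
    rewrite H1, H2. ring. }
  apply Rmult_integral in E1. apply Rmult_integral in E2. destruct E1, E2, Hab; lra.
Qed.

(** * Separation of lattice squares and of the halves of one square *)

Definition in_square (k0 e1 e2 : zpt) (i0 j0 : Z) (S : zpt -> Prop) : Prop :=
  forall k, S k -> exists a b, insq a /\ insq b /\ k = zcomb k0 e1 e2 (a + i0) (b + j0).

Section Squares.
Context (n : nat) (k0 e1 e2 : zpt) (Hn : (1 <= n)%nat) (Hd : zdet e1 e2 = 1%Z).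

Lemma coord_sep_le (S : zpt -> Prop) al be ga (i0 j0 : Z) : in_square k0 e1 e2 i0 j0 S ->
  (forall a b, insq a -> insq b -> S (zcomb k0 e1 e2 (a + i0) (b + j0)) ->
     0 <= al * IZR (a + i0) + be * IZR (b + j0) + ga) ->
  forall k, S k -> 0 <= aff (coord_aff n k0 e1 e2 al be ga) (hpt n k).
Proof using Hn Hd.
  intros HS H k Hk. destruct (HS k Hk) as [a [b [Ha [Hb ->]]]].
  rewrite coord_aff_zcomb by assumption. apply H; assumption.
Qed.

Lemma coord_sep_ge (S : zpt -> Prop) al be ga (i0 j0 : Z) : in_square k0 e1 e2 i0 j0 S ->
  (forall a b, insq a -> insq b -> S (zcomb k0 e1 e2 (a + i0) (b + j0)) ->
     al * IZR (a + i0) + be * IZR (b + j0) + ga <= 0) ->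
  forall k, S k -> aff (coord_aff n k0 e1 e2 al be ga) (hpt n k) <= 0.
Proof using Hn Hd.
  intros HS H k Hk. destruct (HS k Hk) as [a [b [Ha [Hb ->]]]].
  rewrite coord_aff_zcomb by assumption. apply H; assumption.
Qed.

(** Squares in adjacent columns meet along a lattice line at heights that need not agree. On that
    line two unit segments share a segment, an endpoint or nothing. *)
Lemma conform_column (S S' : zpt -> Prop) c j0 j1 :
  (forall k, S k -> exists b, insq b /\ k = zcomb k0 e1 e2 c (b + j0)) ->
  (forall k, S' k -> exists b, insq b /\ k = zcomb k0 e1 e2 c (b + j1)) -> conform n S S'.
Proof using Hn Hd.
  assert (W : forall (S S' : zpt -> Prop) j0 j1, (j0 < j1)%Z ->
    (forall k, S k -> exists b, insq b /\ k = zcomb k0 e1 e2 c (b + j0)) ->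
    (forall k, S' k -> exists b, insq b /\ k = zcomb k0 e1 e2 c (b + j1)) -> conform n S S').
  { clear S S' j0 j1. intros S S' j0 j1 Hlt HS HS'.
    apply conform_sym, (conform_sep n S' S (coord_aff n k0 e1 e2 0 1 (- IZR (j0 + 1)))).
    - intros k Hk. destruct (HS' k Hk) as [b [Hb ->]]. rewrite coord_aff_zcomb by assumption.
      assert (IZR (j0 + 1) <= IZR (b + j1)) by (apply IZR_le; unfold insq in Hb; lia). lra.
    - intros k Hk. destruct (HS k Hk) as [b [Hb ->]]. rewrite coord_aff_zcomb by assumption.
      assert (IZR (b + j0) <= IZR (j0 + 1)) by (apply IZR_le; unfold insq in Hb; lia). lra.
    - apply (conform_two_points n _ _ (zcomb k0 e1 e2 c (j0 + 1)) (zcomb k0 e1 e2 c (j0 + 1)) Hn).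
      + intros k [Hk E]. destruct (HS' k Hk) as [b [Hb ->]]. rewrite coord_aff_zcomb in E by assumption.
        left. f_equal. apply eq_IZR. lra.
      + intros k [Hk E]. destruct (HS k Hk) as [b [Hb ->]]. rewrite coord_aff_zcomb in E by assumption.
        left. f_equal. apply eq_IZR. lra. }
  intros HS HS'. destruct (Z.lt_trichotomy j0 j1) as [Hlt|[->|Hlt]].
  - apply (W _ _ _ _ Hlt HS HS').
  - apply (conform_two_points n _ _ (zcomb k0 e1 e2 c (0 + j1)) (zcomb k0 e1 e2 c (1 + j1)) Hn).
    + intros k Hk. destruct (HS k Hk) as [b [[-> | ->] ->]]; auto.
    + intros k Hk. destruct (HS' k Hk) as [b [[-> | ->] ->]]; auto.
  - apply conform_sym, (W _ _ _ _ Hlt HS' HS).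
Qed.

(** The squares are ordered lexicographically: a column line separates them if their columns differ,
    otherwise a row line does. *)
Lemma distinct_squares (S S' : zpt -> Prop) i0 j0 i1 j1 :
  in_square k0 e1 e2 i0 j0 S -> in_square k0 e1 e2 i1 j1 S' -> (i0 <> i1 \/ j0 <> j1) ->
  conform n S S' /\ separated n S S'.
Proof using Hn Hd.
  assert (W : forall (S S' : zpt -> Prop) i0 j0 i1 j1,
    in_square k0 e1 e2 i0 j0 S -> in_square k0 e1 e2 i1 j1 S' -> (i0 < i1 \/ (i0 = i1 /\ j0 < j1))%Z ->
    conform n S' S /\ separated n S' S).
  { clear S S' i0 j0 i1 j1. intros S S' i0 j0 i1 j1 HS HS' [Hlt|[-> Hlt]].
    - set (a := coord_aff n k0 e1 e2 1 0 (- IZR (i0 + 1))).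
      assert (H1 : forall k, S' k -> 0 <= aff a (hpt n k)).
      { apply (coord_sep_le S' _ _ _ i1 j1 HS'). intros x y Hx Hy _.
        assert (IZR (i0 + 1) <= IZR (x + i1)) by (apply IZR_le; unfold insq in Hx; lia). lra. }
      assert (H2 : forall k, S k -> aff a (hpt n k) <= 0).
      { apply (coord_sep_ge S _ _ _ i0 j0 HS). intros x y Hx Hy _.
        assert (IZR (x + i0) <= IZR (i0 + 1)) by (apply IZR_le; unfold insq in Hx; lia). lra. }
      split.
      + apply (conform_sep n _ _ a H1 H2). apply (conform_column _ _ (i0 + 1) j1 j0).
        * intros k [Hk E]. destruct (HS' k Hk) as [x [y [Hx [Hy ->]]]]. exists y. split; [exact Hy|].
          unfold a in E. rewrite coord_aff_zcomb in E by assumption. f_equal. apply eq_IZR. lra.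
        * intros k [Hk E]. destruct (HS k Hk) as [x [y [Hx [Hy ->]]]]. exists y. split; [exact Hy|].
          unfold a in E. rewrite coord_aff_zcomb in E by assumption. f_equal. apply eq_IZR. lra.
      + exists a. split; [apply coord_aff_nonzero; try assumption; left; lra|]. split; assumption.
    - set (a := coord_aff n k0 e1 e2 0 1 (- IZR (j0 + 1))).
      assert (H1 : forall k, S' k -> 0 <= aff a (hpt n k)).
      { apply (coord_sep_le S' _ _ _ i1 j1 HS'). intros x y Hx Hy _.
        assert (IZR (j0 + 1) <= IZR (y + j1)) by (apply IZR_le; unfold insq in Hy; lia). lra. }
      assert (H2 : forall k, S k -> aff a (hpt n k) <= 0).
      { apply (coord_sep_ge S _ _ _ i1 j0 HS). intros x y Hx Hy _.
        assert (IZR (y + j0) <= IZR (j0 + 1)) by (apply IZR_le; unfold insq in Hy; lia). lra. }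
      split.
      + apply (conform_sep n _ _ a H1 H2).
        apply (conform_two_points n _ _ (zcomb k0 e1 e2 (0 + i1) (j0 + 1)) (zcomb k0 e1 e2 (1 + i1) (j0 + 1)) Hn).
        * intros k [Hk E]. destruct (HS' k Hk) as [x [y [Hx [Hy ->]]]].
          unfold a in E. rewrite coord_aff_zcomb in E by assumption.
          assert (Ey : (y + j1 = j0 + 1)%Z) by (apply eq_IZR; lra). rewrite Ey. destruct Hx as [-> | ->]; auto.
        * intros k [Hk E]. destruct (HS k Hk) as [x [y [Hx [Hy ->]]]].
          unfold a in E. rewrite coord_aff_zcomb in E by assumption.
          assert (Ey : (y + j0 = j0 + 1)%Z) by (apply eq_IZR; lra). rewrite Ey. destruct Hx as [-> | ->]; auto.
      + exists a. split; [apply coord_aff_nonzero; try assumption; right; lra|]. split; assumption. }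
  intros HS HS' Hne.
  assert (Hc : ((i0 < i1 \/ (i0 = i1 /\ j0 < j1)) \/ (i1 < i0 \/ (i1 = i0 /\ j1 < j0)))%Z) by lia.
  destruct Hc as [Hc|Hc].
  - destruct (W _ _ _ _ _ _ HS HS' Hc) as [W1 W2]. split; [apply conform_sym, W1|apply separated_sym, W2].
  - apply (W _ _ _ _ _ _ HS' HS Hc).
Qed.

Lemma diagonal_split_good (S S' : zpt -> Prop) i0 j0 :
  in_square k0 e1 e2 i0 j0 S -> in_square k0 e1 e2 i0 j0 S' ->
  ~ S (zcomb k0 e1 e2 (0 + i0) (1 + j0)) -> ~ S' (zcomb k0 e1 e2 (1 + i0) (0 + j0)) ->
  conform n S S' /\ separated n S S'.
Proof using Hn Hd.
  intros HS HS' Hb Hb'. set (a := coord_aff n k0 e1 e2 1 (-1) (- IZR i0 + IZR j0)).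
  assert (H1 : forall k, S k -> 0 <= aff a (hpt n k)).
  { apply (coord_sep_le S _ _ _ i0 j0 HS). intros x y [-> | ->] [-> | ->] Hk; try contradiction;
    rewrite !plus_IZR; lra. }
  assert (H2 : forall k, S' k -> aff a (hpt n k) <= 0).
  { apply (coord_sep_ge S' _ _ _ i0 j0 HS'). intros x y [-> | ->] [-> | ->] Hk; try contradiction;
    rewrite !plus_IZR; lra. }
  split.
  - apply (conform_sep n _ _ a H1 H2).
    apply (conform_two_points n _ _ (zcomb k0 e1 e2 (0 + i0) (0 + j0)) (zcomb k0 e1 e2 (1 + i0) (1 + j0)) Hn);
    [clear HS' Hb'; rename HS into HS'|]; intros k [Hk E]; destruct (HS' k Hk) as [x [y [Hx [Hy ->]]]];
    unfold a in E; rewrite coord_aff_zcomb in E by assumption;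
    destruct Hx as [-> | ->], Hy as [-> | ->]; auto; rewrite !plus_IZR in E; exfalso; lra.
  - exists a. split; [apply coord_aff_nonzero; try assumption; left; lra|]. split; assumption.
Qed.

Lemma diagonal_split_bad (S S' : zpt -> Prop) i0 j0 :
  in_square k0 e1 e2 i0 j0 S -> in_square k0 e1 e2 i0 j0 S' ->
  ~ S (zcomb k0 e1 e2 (0 + i0) (0 + j0)) -> ~ S' (zcomb k0 e1 e2 (1 + i0) (1 + j0)) ->
  conform n S S' /\ separated n S S'.
Proof using Hn Hd.
  intros HS HS' Hb Hb'. set (a := coord_aff n k0 e1 e2 1 1 (- IZR i0 - IZR j0 - 1)).
  assert (H1 : forall k, S k -> 0 <= aff a (hpt n k)).
  { apply (coord_sep_le S _ _ _ i0 j0 HS). intros x y [-> | ->] [-> | ->] Hk; try contradiction;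
    rewrite !plus_IZR; lra. }
  assert (H2 : forall k, S' k -> aff a (hpt n k) <= 0).
  { apply (coord_sep_ge S' _ _ _ i0 j0 HS'). intros x y [-> | ->] [-> | ->] Hk; try contradiction;
    rewrite !plus_IZR; lra. }
  split.
  - apply (conform_sep n _ _ a H1 H2).
    apply (conform_two_points n _ _ (zcomb k0 e1 e2 (1 + i0) (0 + j0)) (zcomb k0 e1 e2 (0 + i0) (1 + j0)) Hn);
    [clear HS' Hb'; rename HS into HS'|]; intros k [Hk E]; destruct (HS' k Hk) as [x [y [Hx [Hy ->]]]];
    unfold a in E; rewrite coord_aff_zcomb in E by assumption;
    destruct Hx as [-> | ->], Hy as [-> | ->]; auto; rewrite !plus_IZR in E; exfalso; lra.
  - exists a. split; [apply coord_aff_nonzero; try assumption; left; lra|]. split; assumption.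
Qed.
End Squares.

(** * Meshes fine enough for a frame to serve its whole neighbourhood *)

Definition big (L : R) : R := 100 * (4 * L ^ 3) ^ 3.
Definition loceps (L : R) (n : nat) : R := 128 * L ^ 4 * (4 * big L) / INR n.
(** In frame coordinates the ellipticity constant is 4 L^3, for which [big L] is the least radius
    that [Loc] admits. Closeness is required up to four times this radius, so that recentring at an
    index of size up to [3 * big L] leaves the radius [big L]. *)
Definition fine (D : pt -> sym2) (L : R) (n : nat) : Prop :=
  uniform_bounds D L /\ (1 <= n)%nat /\ 10000 * (4 * big L) ^ 6 * loceps L n <= 1.
Definition FrameAt (D : pt -> sym2) (n : nat) (k0 e1 e2 : zpt) := Frame (MM D (hpt n k0)) e1 e2.
Definition shiftN (N : Z -> Z -> sym2) (i0 j0 : Z) : Z -> Z -> sym2 := fun i j => N (i + i0)%Z (j + j0)%Z.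
Definition coefA D n k0 e1 := bform (MM D (hpt n k0)) (toR e1) (toR e1).
Definition coefB D n k0 e1 e2 := - bform (MM D (hpt n k0)) (toR e1) (toR e2).

Lemma big_bounds L : 1 <= L -> 1 <= L ^ 3 /\ 6400 * L ^ 3 <= big L.
Proof.
  intros HL. assert (1 <= L ^ 3) by (apply pow_R1_Rle; exact HL). split; [assumption|].
  unfold big. set (x := L ^ 3) in *. replace ((4 * x) ^ 3) with (64 * x * (x * x)) by ring.
  assert (1 <= x * x) by nra. nra.
Qed.

Section Fine.
Context (D : pt -> sym2) (L : R) (n : nat) (HF : fine D L n).

Lemma fine_L : 1 <= L.
Proof using HF. apply HF. Qed.

Lemma frame_exists_at k0 : exists e1 e2, FrameAt D n k0 e1 e2.
Proof using HF.
  destruct HF as [[HL [_ [_ [_ [Hell _]]]]] _]. apply (frame_exists _ L HL). intros v. apply Hell.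
Qed.

Lemma fine_loc k0 e1 e2 : FrameAt D n k0 e1 e2 ->
  Loc (locN D n k0 e1 e2) (coefA D n k0 e1) (coefB D n k0 e1 e2) (coefA D n k0 e2) (4 * L ^ 3) (4 * big L) (loceps L n).
Proof using HF.
  intros HFr. destruct HF as [HU [Hn He]]. pose proof fine_L as HL. apply (frame_loc D L n); try assumption.
  destruct (big_bounds L HL). fold (big L). lra.
Qed.

Lemma fine_loc_shift k0 e1 e2 i0 j0 : FrameAt D n k0 e1 e2 ->
  Rabs (IZR i0) <= 3 * big L -> Rabs (IZR j0) <= 3 * big L ->
  Loc (shiftN (locN D n k0 e1 e2) i0 j0) (coefA D n k0 e1) (coefB D n k0 e1 e2) (coefA D n k0 e2)
    (4 * L ^ 3) (big L) (loceps L n).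
Proof using HF.
  intros HFr Hi Hj. eapply loc_shift; [apply fine_loc, HFr|unfold big; lra|lra|lra].
Qed.

Lemma square_cell k0 e1 e2 i0 j0 s t q a b : FrameAt D n k0 e1 e2 -> vscale (INR n) q = rcomb k0 e1 e2 s t ->
  cell (shiftN (locN D n k0 e1 e2) i0 j0) a b (s - IZR i0) (t - IZR j0)
  <-> inVor D n (zcomb k0 e1 e2 (a + i0) (b + j0)) q.
Proof using HF.
  intros HFr Hq. unfold shiftN. rewrite cell_shift.
  replace (s - IZR i0 + IZR i0) with s by ring. replace (t - IZR j0 + IZR j0) with t by ring.
  apply (cell_inVor D L); try apply HF; [apply HFr|exact Hq].
Qed.

Lemma gdist2_bounds k X :
  let a := fst X - IZR (fst k) in let b := snd X - IZR (snd k) in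
  a * a + b * b <= L * gdist2 D n k X /\ gdist2 D n k X <= L * (a * a + b * b).
Proof using HF.
  destruct HF as [[HL [_ [_ [_ [Hell _]]]]] _]. apply (Hell (hpt n k) (vsub X (toR k))).
Qed.

Lemma inVor_near k q : inVor D n k q ->
  Rabs (INR n * fst q - IZR (fst k)) <= 2 * L /\ Rabs (INR n * snd q - IZR (snd k)) <= 2 * L.
Proof using HF.
  intros H. pose proof HF as [HU [Hn _]]. pose proof fine_L as HL.
  pose proof (proj1 (inVor_gdist2 D L n k q HU Hn) H) as Hk. clear H.
  set (X := vscale (INR n) q) in *.
  assert (Hfl : forall x, exists k : Z, 0 <= (x - IZR k) * (x - IZR k) <= 1).
  { intros z. exists (up z). destruct (archimed z). nra. }
  destruct (Hfl (fst X)) as [i Hi]. destruct (Hfl (snd X)) as [j Hj]. specialize (Hk (i, j)).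
  destruct (gdist2_bounds k X) as [E1 _]. destruct (gdist2_bounds (i, j) X) as [_ E2].
  cbn [fst snd] in E2.
  change (INR n * fst q) with (fst X). change (INR n * snd q) with (snd X).
  set (a := fst X - IZR (fst k)) in *. set (b := snd X - IZR (snd k)) in *.
  assert (Hd : a * a + b * b <= 2 * L * L).
  { apply Rle_trans with (1 := E1). replace (2 * L * L) with (L * (L * 2)) by ring.
    apply Rmult_le_compat_l; [lra|]. apply Rle_trans with (1 := Hk). apply Rle_trans with (1 := E2).
    apply Rmult_le_compat_l; lra. }
  clear - Hd HL. split; apply Rabs_le; split; nra.
Qed.

Lemma hull_near q x : hull n (cellpts D n q) x ->
  Rabs (INR n * fst q - INR n * fst x) <= 2 * L /\ Rabs (INR n * snd q - INR n * snd x) <= 2 * L.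
Proof using HF.
  intros Hx. pose proof HF as [_ [Hn _]]. assert (Hnp : 0 < INR n) by (apply lt_0_INR; lia).
  assert (T : forall a, (forall k, cellpts D n q k -> 0 <= aff a (hpt n k)) -> 0 <= aff a x)
    by (intros a Ha; apply (hull_aff_nonneg n (cellpts D n q)); assumption).
  assert (E : forall k, cellpts D n q k ->
     (- (2 * L) <= INR n * fst q - INR n * fst (hpt n k) <= 2 * L) /\
     (- (2 * L) <= INR n * snd q - INR n * snd (hpt n k) <= 2 * L)).
  { intros k Hk. destruct (inVor_near k q Hk) as [H1 H2]. apply Rabs_le_inv in H1. apply Rabs_le_inv in H2.
    unfold hpt; cbn [fst snd].
    replace (INR n * (IZR (fst k) / INR n)) with (IZR (fst k)) by (field; lra).
    replace (INR n * (IZR (snd k) / INR n)) with (IZR (snd k)) by (field; lra). lra. }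
  assert (T1 := T (- INR n, 0, INR n * fst q + 2 * L)). assert (T2 := T (INR n, 0, - INR n * fst q + 2 * L)).
  assert (T3 := T (0, - INR n, INR n * snd q + 2 * L)). assert (T4 := T (0, INR n, - INR n * snd q + 2 * L)).
  unfold aff in T1, T2, T3, T4; cbn [fst snd] in *.
  split; apply Rabs_le; split.
  - assert (K := T1 ltac:(intros k Hk; specialize (E k Hk); lra)); lra.
  - assert (K := T2 ltac:(intros k Hk; specialize (E k Hk); lra)); lra.
  - assert (K := T3 ltac:(intros k Hk; specialize (E k Hk); lra)); lra.
  - assert (K := T4 ltac:(intros k Hk; specialize (E k Hk); lra)); lra.
Qed.

Lemma coords_bound k0 e1 e2 X s t r : FrameAt D n k0 e1 e2 -> X = rcomb k0 e1 e2 s t ->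
  Rabs (fst X - IZR (fst k0)) <= r -> Rabs (snd X - IZR (snd k0)) <= r ->
  Rabs s <= 4 * L * r /\ Rabs t <= 4 * L * r.
Proof using HF.
  intros HFr HX H1 H2. pose proof HF as [HU [Hn _]]. pose proof HU as [HL [_ [_ [_ [Hell [Hdet _]]]]]].
  destruct (frame_bounds _ L e1 e2 HL (Hdet _) (Hell _) HFr) as [_ [_ [_ [_ [_ [_ [_ [_ [B1 B2]]]]]]]]].
  unfold n1, toR in B1, B2; cbn [fst snd] in B1, B2.
  destruct (rcomb_surj k0 e1 e2 X (proj1 HFr)) as [s' [t' [HX' [Es Et]]]].
  assert (Hst : s = s' /\ t = t') by (apply (rcomb_inj k0 e1 e2); [apply HFr|congruence]).
  destruct Hst as [<- <-]. clear HX'.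
  set (x := fst X - IZR (fst k0)) in *. set (y := snd X - IZR (snd k0)) in *.
  assert (T : forall a b, Rabs a + Rabs b <= 4 * L -> Rabs (x * b - y * a) <= 4 * L * r).
  { intros a b Hab. pose proof (Rabs_triang (x * b) (- (y * a))) as K. rewrite Rabs_Ropp, !Rabs_mult in K.
    pose proof (Rabs_pos a). pose proof (Rabs_pos b). pose proof (Rabs_pos x). pose proof (Rabs_pos y).
    unfold Rminus. assert (Rabs x * Rabs b <= r * Rabs b) by (apply Rmult_le_compat_r; lra).
    assert (Rabs y * Rabs a <= r * Rabs a) by (apply Rmult_le_compat_r; lra).
    assert (r * (Rabs a + Rabs b) <= r * (4 * L)) by (apply Rmult_le_compat_l; lra). lra. }
  rewrite Es, Et. split; [apply T; lra|].
  replace (y * IZR (fst e1) - x * IZR (snd e1)) with (- (x * IZR (snd e1) - y * IZR (fst e1))) by ring.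
  rewrite Rabs_Ropp. apply T; lra.
Qed.

Lemma cells_in_square k0 e1 e2 q s t k1 : FrameAt D n k0 e1 e2 -> vscale (INR n) q = rcomb k0 e1 e2 s t ->
  Rabs s <= 2 * big L -> Rabs t <= 2 * big L -> inVor D n k1 q ->
  exists i0 j0, in_square k0 e1 e2 i0 j0 (cellpts D n q) /\
    Rabs (s - IZR i0) <= big L /\ Rabs (t - IZR j0) <= big L /\
    Rabs (IZR i0) <= 3 * big L /\ Rabs (IZR j0) <= 3 * big L.
Proof using HF.
  intros HFr Hq Hs Ht Hk1. pose proof HF as [HU [Hn _]]. pose proof fine_L as HL.
  pose proof (fine_loc k0 e1 e2 HFr) as Hloc.
  assert (Hcell : forall i j, cell (locN D n k0 e1 e2) i j s t <-> inVor D n (zcomb k0 e1 e2 i j) q).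
  { intros i j. apply (cell_inVor D L); try assumption. apply HFr. }
  destruct (zcomb_surj k0 e1 e2 k1 (proj1 HFr)) as [i1 [j1 ->]]. apply Hcell in Hk1.
  assert (Hadj : forall i j i' j', cell (locN D n k0 e1 e2) i j s t -> cell (locN D n k0 e1 e2) i' j' s t ->
     (Z.abs (i' - i) <= 1 /\ Z.abs (j' - j) <= 1)%Z).
  { intros i j i' j'. apply (cell_adjacent _ _ _ _ _ _ _ Hloc); lra. }
  (* Occupied columns differ by at most 1. If the column [i1 - 1] is occupied then [i1 + 1] is not,
     so two consecutive columns suffice in either case. *)
  assert (Hi : exists i0, (i1 = i0 \/ i1 = i0 + 1)%Z /\ forall i j, cell (locN D n k0 e1 e2) i j s t -> (i = i0 \/ i = i0 + 1)%Z).
  { destruct (classic (exists j, cell (locN D n k0 e1 e2) (i1 - 1) j s t)) as [[j Hj]|Hno].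
    - exists (i1 - 1)%Z. split; [lia|]. intros i j' Hc. pose proof (Hadj _ _ _ _ Hj Hc). pose proof (Hadj _ _ _ _ Hk1 Hc). lia.
    - exists i1. split; [lia|]. intros i j' Hc. pose proof (Hadj _ _ _ _ Hk1 Hc).
      assert (i <> i1 - 1)%Z by (intros ->; eauto). lia. }
  assert (Hj : exists j0, (j1 = j0 \/ j1 = j0 + 1)%Z /\ forall i j, cell (locN D n k0 e1 e2) i j s t -> (j = j0 \/ j = j0 + 1)%Z).
  { destruct (classic (exists i, cell (locN D n k0 e1 e2) i (j1 - 1) s t)) as [[j Hj]|Hno].
    - exists (j1 - 1)%Z. split; [lia|]. intros i j' Hc. pose proof (Hadj _ _ _ _ Hj Hc). pose proof (Hadj _ _ _ _ Hk1 Hc). lia.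
    - exists j1. split; [lia|]. intros i j' Hc. pose proof (Hadj _ _ _ _ Hk1 Hc).
      assert (j' <> j1 - 1)%Z by (intros ->; eauto). lia. }
  destruct Hi as [i0 [Hi1 Hi]]. destruct Hj as [j0 [Hj1 Hj]]. exists i0, j0.
  destruct (cell_close_abs _ _ _ _ _ _ _ Hloc i1 j1 s t Hk1) as [C1 C2].
  destruct (big_bounds L HL) as [Hb1 Hb2].
  assert (Hnear : forall x (i i' : Z), (i' = i \/ i' = i + 1)%Z -> Rabs (x - IZR i') <= 2 * (4 * L ^ 3) -> Rabs x <= 2 * big L ->
     Rabs (x - IZR i) <= big L /\ Rabs (IZR i) <= 3 * big L).
  { intros x i i' Hi' Hx Hx'. apply Rabs_le_inv in Hx. apply Rabs_le_inv in Hx'.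
    assert (IZR i' = IZR i \/ IZR i' = IZR i + 1) by (destruct Hi' as [-> | ->]; [left|right; rewrite plus_IZR]; reflexivity).
    split; apply Rabs_le; lra. }
  split; [|destruct (Hnear s i0 i1 Hi1 C1 Hs), (Hnear t j0 j1 Hj1 C2 Ht); tauto].
  intros k Hk. destruct (zcomb_surj k0 e1 e2 k (proj1 HFr)) as [i [j ->]]. apply Hcell in Hk.
  specialize (Hi _ _ Hk). specialize (Hj _ _ Hk).
  exists (i - i0)%Z, (j - j0)%Z. unfold insq. split; [lia|]. split; [lia|]. f_equal; ring.
Qed.

Lemma three_corners_of_vertex k0 e1 e2 q s t i0 j0 : FrameAt D n k0 e1 e2 ->
  vscale (INR n) q = rcomb k0 e1 e2 s t -> in_square k0 e1 e2 i0 j0 (cellpts D n q) -> isVorVertex D n q ->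
  three_corners (shiftN (locN D n k0 e1 e2) i0 j0) (s - IZR i0) (t - IZR j0).
Proof using HF.
  intros HFr Hq Hsq [k1 [k2 [k3 [N12 [N13 [N23 [H1 [H2 H3]]]]]]]].
  unfold three_corners, cell3. rewrite !(square_cell k0 e1 e2 i0 j0 s t q _ _ HFr Hq).
  destruct (Hsq k1 H1) as [a1 [b1 [[-> | ->] [[-> | ->] E1]]]];
  destruct (Hsq k2 H2) as [a2 [b2 [[-> | ->] [[-> | ->] E2]]]]; try congruence;
  destruct (Hsq k3 H3) as [a3 [b3 [[-> | ->] [[-> | ->] E3]]]]; try congruence;
  subst k1 k2 k3; tauto.
Qed.
End Fine.

(** A lattice point of the hull is a corner of the square, and the linear form with signs pointing
    from it into the square exceeds its value there by at least 1 at every other corner. This yields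
    both strict convexity and the fact that a grid point covered by a polygon is one of its
    vertices. *)
Lemma hull_lattice_point n k0 e1 e2 i0 j0 (S : zpt -> Prop) k : (1 <= n)%nat -> zdet e1 e2 = 1%Z ->
  in_square k0 e1 e2 i0 j0 S -> hull n S (hpt n k) -> S k.
Proof.
  intros Hn Hd HS Hh. apply NNPP. intros Hk.
  destruct (zcomb_surj k0 e1 e2 k Hd) as [i [j Ek]].
  assert (T : forall al be ga, (forall a b, insq a -> insq b -> S (zcomb k0 e1 e2 (a + i0) (b + j0)) ->
     0 <= al * IZR (a + i0) + be * IZR (b + j0) + ga) -> 0 <= al * IZR i + be * IZR j + ga).
  { intros al be ga H. rewrite <- (coord_aff_zcomb n k0 e1 e2 al be ga i j Hn Hd), <- Ek.
    apply (hull_aff_nonneg n S); [|exact Hh]. apply (coord_sep_le n k0 e1 e2 Hn Hd S al be ga i0 j0 HS H). }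
  assert (Hi : (i0 <= i <= i0 + 1)%Z).
  { split; apply le_IZR; rewrite ?plus_IZR.
    - enough (0 <= 1 * IZR i + 0 * IZR j + - IZR i0) by lra. apply T.
      intros a b [-> | ->] _ _; rewrite !plus_IZR; lra.
    - enough (0 <= -1 * IZR i + 0 * IZR j + (IZR i0 + 1)) by lra. apply T.
      intros a b [-> | ->] _ _; rewrite !plus_IZR; lra. }
  assert (Hj : (j0 <= j <= j0 + 1)%Z).
  { split; apply le_IZR; rewrite ?plus_IZR.
    - enough (0 <= 0 * IZR i + 1 * IZR j + - IZR j0) by lra. apply T.
      intros a b _ [-> | ->] _; rewrite !plus_IZR; lra.
    - enough (0 <= 0 * IZR i + -1 * IZR j + (IZR j0 + 1)) by lra. apply T.
      intros a b _ [-> | ->] _; rewrite !plus_IZR; lra. }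
  assert (Hc : exists al be, forall a b, insq a -> insq b -> S (zcomb k0 e1 e2 (a + i0) (b + j0)) ->
     1 <= al * (IZR (a + i0) - IZR i) + be * (IZR (b + j0) - IZR j)).
  { assert (Ci : i = (0 + i0)%Z \/ i = (1 + i0)%Z) by lia. assert (Cj : j = (0 + j0)%Z \/ j = (1 + j0)%Z) by lia.
    exists (if Z.eq_dec i i0 then 1 else -1), (if Z.eq_dec j j0 then 1 else -1).
    intros a b Ha Hb HSab.
    assert (Hne : (a + i0 <> i \/ b + j0 <> j)%Z).
    { destruct (Z.eq_dec (a + i0) i) as [E1|]; [|left; assumption].
      destruct (Z.eq_dec (b + j0) j) as [E2|]; [|right; assumption].
      exfalso. apply Hk. rewrite Ek, <- E1, <- E2. exact HSab. }
    rewrite <- !minus_IZR.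
    assert (G : (forall x x0 a, (x = 0 + x0 \/ x = 1 + x0) -> insq a ->
       (0 <= (if Z.eq_dec x x0 then 1 else -1) * (a + x0 - x)) /\ (a + x0 <> x -> 1 <= (if Z.eq_dec x x0 then 1 else -1) * (a + x0 - x)))%Z).
    { clear. unfold insq. intros x x0 a. destruct (Z.eq_dec x x0); lia. }
    destruct (G i i0 a Ci Ha) as [G1 G2]. destruct (G j j0 b Cj Hb) as [G3 G4].
    replace (if Z.eq_dec i i0 then 1 else -1) with (IZR (if Z.eq_dec i i0 then 1 else -1)) by (destruct (Z.eq_dec i i0); reflexivity).
    replace (if Z.eq_dec j j0 then 1 else -1) with (IZR (if Z.eq_dec j j0 then 1 else -1)) by (destruct (Z.eq_dec j j0); reflexivity).
    rewrite <- !mult_IZR, <- plus_IZR. apply IZR_le.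
    destruct Hne as [Hne|Hne]; [specialize (G2 Hne)|specialize (G4 Hne)]; lia. }
  destruct Hc as [al [be Hc]].
  assert (K : 0 <= al * IZR i + be * IZR j + (- al * IZR i - be * IZR j - 1)); [|lra].
  apply T. intros a b Ha Hb Hab. specialize (Hc a b Ha Hb Hab). lra.
Qed.

Lemma finite_subset {T} (P : T -> Prop) (l : list T) : (forall x, P x -> In x l) ->
  exists l', forall x, P x <-> In x l'.
Proof.
  intros H. assert (K : exists l', forall x, In x l' <-> (In x l /\ P x)).
  { clear H. induction l as [|a l [l' IH]].
    - exists nil. intros x. simpl. tauto.
    - destruct (classic (P a)) as [Pa|Pa].
      + exists (a :: l'). intros x. simpl. rewrite IH. split; [intros [<-|[H1 H2]]; auto|intros [[E|H1] H2]; auto].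
      + exists l'. intros x. rewrite IH. simpl. split; [intros [H1 H2]; auto|intros [[<-|H1] H2]; [contradiction|auto]]. }
  destruct K as [l' K]. exists l'. intros x. rewrite K. split; [auto|tauto].
Qed.

(** * Polygonization *)

Section Polygonization.
Context (D : pt -> sym2) (L : R) (n : nat) (HF : fine D L n).

Lemma fine_n : (1 <= n)%nat /\ 0 < INR n.
Proof using HF. destruct HF as [_ [Hn _]]. split; [exact Hn|apply lt_0_INR; lia]. Qed.

Lemma vscale_inj q q' : vscale (INR n) q = vscale (INR n) q' -> q = q'.
Proof using HF.
  intros H. destruct fine_n as [_ Hn]. destruct q, q'. unfold vscale in H; cbn [fst snd] in H.
  injection H as H1 H2. f_equal; (eapply Rmult_eq_reg_l; [eassumption|lra]).
Qed.

Lemma vertex_near_frame k0 e1 e2 q r : FrameAt D n k0 e1 e2 -> r <= 20 * L ->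
  Rabs (INR n * fst q - IZR (fst k0)) <= r -> Rabs (INR n * snd q - IZR (snd k0)) <= r ->
  exists s t, vscale (INR n) q = rcomb k0 e1 e2 s t /\ Rabs s <= 2 * big L /\ Rabs t <= 2 * big L.
Proof using HF.
  intros HFr Hr H1 H2. destruct (rcomb_surj k0 e1 e2 (vscale (INR n) q) (proj1 HFr)) as [s [t [Hq _]]].
  exists s, t. split; [exact Hq|].
  destruct (coords_bound D L n HF k0 e1 e2 (vscale (INR n) q) s t r HFr Hq H1 H2) as [B1 B2].
  pose proof (fine_L D L n HF) as HL. destruct (big_bounds L HL) as [Hb1 Hb2].
  assert (L * L <= L ^ 3) by (simpl; nra).
  assert (4 * L * r <= 2 * big L); [|lra].
  apply Rle_trans with (4 * L * (20 * L)); [apply Rmult_le_compat_l; lra|lra].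
Qed.

Lemma vertex_cells k0 e1 e2 q r : FrameAt D n k0 e1 e2 -> r <= 20 * L -> isVorVertex D n q ->
  Rabs (INR n * fst q - IZR (fst k0)) <= r -> Rabs (INR n * snd q - IZR (snd k0)) <= r ->
  exists s t i0 j0, vscale (INR n) q = rcomb k0 e1 e2 s t /\ in_square k0 e1 e2 i0 j0 (cellpts D n q) /\
    Rabs (s - IZR i0) <= big L /\ Rabs (t - IZR j0) <= big L /\
    Rabs (IZR i0) <= 3 * big L /\ Rabs (IZR j0) <= 3 * big L /\
    three_corners (shiftN (locN D n k0 e1 e2) i0 j0) (s - IZR i0) (t - IZR j0).
Proof using HF.
  intros HFr Hr Hq H1 H2. destruct (vertex_near_frame k0 e1 e2 q r HFr Hr H1 H2) as [s [t [E [Hs Ht]]]].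
  pose proof Hq as [k1 [_ [_ [_ [_ [_ [Hk1 _]]]]]]].
  destruct (cells_in_square D L n HF k0 e1 e2 q s t k1 HFr E Hs Ht Hk1) as [i0 [j0 [B1 [B2 [B3 [B4 B5]]]]]].
  exists s, t, i0, j0. repeat (split; [assumption|]).
  apply (three_corners_of_vertex D L n HF k0 e1 e2 q); assumption.
Qed.

(** The common point [x] makes the vertices close: [q] is within 2 L of a cell point [k0], [x]
    within 2 L of [q], and [q'] within 2 L of [x]. Hence the frame at [k0] describes both, and
    either the squares differ or [square_conform] decides. *)
Lemma vertices_conform q q' x : isVorVertex D n q -> isVorVertex D n q' ->
  hull n (cellpts D n q) x -> hull n (cellpts D n q') x ->
  q = q' \/ (conform n (cellpts D n q) (cellpts D n q') /\ separated n (cellpts D n q) (cellpts D n q')).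
Proof using HF.
  intros Hq Hq' Hx Hx'. destruct fine_n as [Hn Hnp]. pose proof (fine_L D L n HF) as HL.
  pose proof Hq as [k0 [_ [_ [_ [_ [_ [Hk0 _]]]]]]].
  destruct (frame_exists_at D L n HF k0) as [e1 [e2 HFr]].
  destruct (inVor_near D L n HF k0 q Hk0) as [A1 A2].
  destruct (hull_near D L n HF q x Hx) as [A3 A4]. destruct (hull_near D L n HF q' x Hx') as [A5 A6].
  apply Rabs_le_inv in A1. apply Rabs_le_inv in A2. apply Rabs_le_inv in A3.
  apply Rabs_le_inv in A4. apply Rabs_le_inv in A5. apply Rabs_le_inv in A6.
  destruct (vertex_cells k0 e1 e2 q (2 * L) HFr ltac:(lra) Hq ltac:(apply Rabs_le; lra) ltac:(apply Rabs_le; lra))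
    as [s [t [i0 [j0 [E [S1 [S2 [S3 [S4 [S5 S6]]]]]]]]]].
  destruct (vertex_cells k0 e1 e2 q' (6 * L) HFr ltac:(lra) Hq' ltac:(apply Rabs_le; lra) ltac:(apply Rabs_le; lra))
    as [s' [t' [i1 [j1 [E' [S1' [S2' [S3' [S4' [S5' S6']]]]]]]]]].
  destruct (classic (i0 = i1 /\ j0 = j1)) as [[<- <-]|Hne].
  - pose proof (fine_loc_shift D L n HF k0 e1 e2 i0 j0 HFr S4 S5) as Hloc.
    assert (Hc := fun a b => square_cell D L n HF k0 e1 e2 i0 j0 s t q a b HFr E).
    assert (Hc' := fun a b => square_cell D L n HF k0 e1 e2 i0 j0 s' t' q' a b HFr E').
    destruct (square_conform _ _ _ _ _ _ _ Hloc _ _ _ _ S2 S3 S2' S3' S6 S6') as [[Es Et]|[[_ [_ Hor]]|[_ [_ Hor]]]].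
    + left. apply vscale_inj. rewrite E, E'. f_equal; lra.
    + right. rewrite !Hc, !Hc' in Hor. destruct Hor as [[H1 H2]|[H1 H2]].
      * destruct (diagonal_split_good n k0 e1 e2 Hn (proj1 HFr) _ _ i0 j0 S1' S1 H2 H1) as [W1 W2].
        split; [apply conform_sym, W1|apply separated_sym, W2].
      * apply (diagonal_split_good n k0 e1 e2 Hn (proj1 HFr) _ _ i0 j0 S1 S1' H1 H2).
    + right. rewrite !Hc, !Hc' in Hor. destruct Hor as [[H1 H2]|[H1 H2]].
      * apply (diagonal_split_bad n k0 e1 e2 Hn (proj1 HFr) _ _ i0 j0 S1 S1' H1 H2).
      * destruct (diagonal_split_bad n k0 e1 e2 Hn (proj1 HFr) _ _ i0 j0 S1' S1 H2 H1) as [W1 W2].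
        split; [apply conform_sym, W1|apply separated_sym, W2].
  - right. apply (distinct_squares n k0 e1 e2 Hn (proj1 HFr) _ _ i0 j0 i1 j1 S1 S1').
    apply not_and_or in Hne. exact Hne.
Qed.

Lemma hull_of_three k0 e1 e2 (S : zpt -> Prop) x s t i1 j1 i2 j2 i3 j3 a b c :
  vscale (INR n) x = rcomb k0 e1 e2 s t ->
  S (zcomb k0 e1 e2 i1 j1) -> S (zcomb k0 e1 e2 i2 j2) -> S (zcomb k0 e1 e2 i3 j3) ->
  0 <= a -> 0 <= b -> 0 <= c -> a + b + c = 1 ->
  s = a * IZR i1 + b * IZR i2 + c * IZR i3 -> t = a * IZR j1 + b * IZR j2 + c * IZR j3 -> hull n S x.
Proof using HF.
  intros Hx H1 H2 H3 Ha Hb Hc Hs Es Et. destruct fine_n as [Hn Hnp].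
  assert (E : x = vadd (vscale a (hpt n (zcomb k0 e1 e2 i1 j1)))
     (vadd (vscale b (hpt n (zcomb k0 e1 e2 i2 j2))) (vscale c (hpt n (zcomb k0 e1 e2 i3 j3))))).
  { apply vscale_inj. rewrite Hx.
    transitivity (vadd (vscale a (vscale (INR n) (hpt n (zcomb k0 e1 e2 i1 j1))))
     (vadd (vscale b (vscale (INR n) (hpt n (zcomb k0 e1 e2 i2 j2)))) (vscale c (vscale (INR n) (hpt n (zcomb k0 e1 e2 i3 j3)))))).
    - rewrite !vscale_hpt, !toR_zcomb by exact Hn. replace a with (1 - b - c) in * by lra. subst s t.
      unfold rcomb, vadd, vscale; cbn [fst snd]. f_equal; ring.
    - unfold vadd, vscale; cbn [fst snd]. f_equal; ring. }
  rewrite E. apply inconv_three; try assumption.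
  - exists (zcomb k0 e1 e2 i1 j1). auto.
  - exists (zcomb k0 e1 e2 i2 j2). auto.
  - exists (zcomb k0 e1 e2 i3 j3). auto.
Qed.

Lemma Int_part_bounds x : 0 <= x - IZR (Int_part x) < 1.
Proof using. destruct (base_fp x). unfold frac_part in *. lra. Qed.

Lemma three_vertex q i1 j1 i2 j2 i3 j3 k0 e1 e2 : zdet e1 e2 = 1%Z ->
  (i1 <> i2 \/ j1 <> j2)%Z -> (i1 <> i3 \/ j1 <> j3)%Z -> (i2 <> i3 \/ j2 <> j3)%Z ->
  inVor D n (zcomb k0 e1 e2 i1 j1) q -> inVor D n (zcomb k0 e1 e2 i2 j2) q ->
  inVor D n (zcomb k0 e1 e2 i3 j3) q -> isVorVertex D n q.
Proof using.
  intros Hd N12 N13 N23 H1 H2 H3. eexists _, _, _.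
  split; [|split; [|split; [|split; [exact H1|split; [exact H2|exact H3]]]]];
  intros E; apply (zcomb_inj _ _ _ _ _ _ _ Hd) in E; intuition.
Qed.

(** In the frame at the integer part of the scaled point, the point lies in a unit square that the
    two triangles of [square_vertices] fill; the weights are its barycentric coordinates in one of
    them. *)
Lemma vertices_cover x : exists q, isVorVertex D n q /\ hull n (cellpts D n q) x.
Proof using HF.
  destruct fine_n as [Hn Hnp]. pose proof (fine_L D L n HF) as HL. destruct (big_bounds L HL) as [Hb1 Hb2].
  set (X := vscale (INR n) x). set (k0 := (Int_part (fst X), Int_part (snd X))).
  destruct (frame_exists_at D L n HF k0) as [e1 [e2 HFr]].
  destruct (rcomb_surj k0 e1 e2 X (proj1 HFr)) as [s [t [HX _]]].
  destruct (coords_bound D L n HF k0 e1 e2 X s t 1 HFr HX) as [Bs Bt].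
  { unfold k0; cbn [fst snd]. pose proof (Int_part_bounds (fst X)). apply Rabs_le; lra. }
  { unfold k0; cbn [fst snd]. pose proof (Int_part_bounds (snd X)). apply Rabs_le; lra. }
  set (i0 := Int_part s). set (j0 := Int_part t).
  pose proof (Int_part_bounds s) as Is. pose proof (Int_part_bounds t) as It. fold i0 in Is. fold j0 in It.
  apply Rabs_le_inv in Bs. apply Rabs_le_inv in Bt. assert (L <= L ^ 3) by (simpl; nra).
  assert (Hi : Rabs (IZR i0) <= 3 * big L) by (apply Rabs_le; lra).
  assert (Hj : Rabs (IZR j0) <= 3 * big L) by (apply Rabs_le; lra).
  pose proof (fine_loc_shift D L n HF k0 e1 e2 i0 j0 HFr Hi Hj) as Hloc.
  set (pos := fun s1 t1 : R => vscale (/ INR n) (rcomb k0 e1 e2 (s1 + IZR i0) (t1 + IZR j0))).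
  assert (Hpos : forall s1 t1 a b, cell (shiftN (locN D n k0 e1 e2) i0 j0) a b s1 t1 ->
     inVor D n (zcomb k0 e1 e2 (a + i0) (b + j0)) (pos s1 t1)).
  { intros s1 t1 a b Hc.
    assert (E : vscale (INR n) (pos s1 t1) = rcomb k0 e1 e2 (s1 + IZR i0) (t1 + IZR j0)).
    { unfold pos, vscale, rcomb; cbn [fst snd]. f_equal; field; lra. }
    apply (square_cell D L n HF k0 e1 e2 i0 j0 _ _ _ a b HFr E).
    replace (s1 + IZR i0 - IZR i0) with s1 by ring. replace (t1 + IZR j0 - IZR j0) with t1 by ring. exact Hc. }
  set (sg := s - IZR i0) in *. set (ta := t - IZR j0) in *.
  destruct (square_vertices _ _ _ _ _ _ _ Hloc) as [s1 [t1 [s2 [t2 [[[A1 [A2 A3]] [B1 [B2 B3]]]|[[A1 [A2 A3]] [B1 [B2 B3]]]]]]]];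
  apply Hpos in A1; apply Hpos in A2; apply Hpos in A3; apply Hpos in B1; apply Hpos in B2; apply Hpos in B3.
  - destruct (Rle_lt_dec ta sg) as [Hle|Hlt].
    + exists (pos s1 t1). split; [eapply (three_vertex _ _ _ _ _ _ _ _ _ _ (proj1 HFr)); [..|exact A1|exact A2|exact A3]; lia|].
      apply (hull_of_three k0 e1 e2 _ x s t _ _ _ _ _ _ (1 - sg) (sg - ta) ta HX A1 A2 A3); try lra;
      unfold sg, ta; rewrite !plus_IZR; ring.
    + exists (pos s2 t2). split; [eapply (three_vertex _ _ _ _ _ _ _ _ _ _ (proj1 HFr)); [..|exact B1|exact B2|exact B3]; lia|].
      apply (hull_of_three k0 e1 e2 _ x s t _ _ _ _ _ _ (1 - ta) sg (ta - sg) HX B1 B2 B3); try lra;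
      unfold sg, ta; rewrite !plus_IZR; ring.
  - destruct (Rle_lt_dec 1 (sg + ta)) as [Hle|Hlt].
    + exists (pos s1 t1). split; [eapply (three_vertex _ _ _ _ _ _ _ _ _ _ (proj1 HFr)); [..|exact A1|exact A2|exact A3]; lia|].
      apply (hull_of_three k0 e1 e2 _ x s t _ _ _ _ _ _ (1 - ta) (sg + ta - 1) (1 - sg) HX A1 A2 A3); try lra;
      unfold sg, ta; rewrite !plus_IZR; ring.
    + exists (pos s2 t2). split; [eapply (three_vertex _ _ _ _ _ _ _ _ _ _ (proj1 HFr)); [..|exact B1|exact B2|exact B3]; lia|].
      apply (hull_of_three k0 e1 e2 _ x s t _ _ _ _ _ _ (1 - sg - ta) sg ta HX B1 B2 B3); try lra;
      unfold sg, ta; rewrite !plus_IZR; ring.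
Qed.

Lemma vertex_own_square q : isVorVertex D n q -> exists k0 e1 e2 i0 j0,
  zdet e1 e2 = 1%Z /\ in_square k0 e1 e2 i0 j0 (cellpts D n q).
Proof using HF.
  intros Hq. pose proof Hq as [k0 [_ [_ [_ [_ [_ [Hk0 _]]]]]]]. pose proof (fine_L D L n HF) as HL.
  destruct (frame_exists_at D L n HF k0) as [e1 [e2 HFr]].
  destruct (inVor_near D L n HF k0 q Hk0) as [A1 A2].
  destruct (vertex_cells k0 e1 e2 q (2 * L) HFr ltac:(lra) Hq A1 A2) as [s [t [i0 [j0 [E [S1 _]]]]]].
  exists k0, e1, e2, i0, j0. split; [apply HFr|exact S1].
Qed.

Lemma interior_subset (A : pt -> Prop) x : Defs.interior A x -> A x.
Proof using.
  intros [e [He H]]. apply H. unfold pdist, vsub, dot; cbn [fst snd].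
  rewrite !Rminus_diag, Rmult_0_l, Rplus_0_l, sqrt_0. exact He.
Qed.

Lemma polygonization : Qh_polygonization D n.
Proof using HF.
  destruct fine_n as [Hn Hnp].
  split; [|split; [|split]].
  - intros q Hq. destruct (vertex_own_square q Hq) as [k0 [e1 [e2 [i0 [j0 [Hd HS]]]]]]. split.
    + destruct (finite_subset (cellpts D n q) (zcomb k0 e1 e2 (0 + i0) (0 + j0) :: zcomb k0 e1 e2 (0 + i0) (1 + j0)
        :: zcomb k0 e1 e2 (1 + i0) (0 + j0) :: zcomb k0 e1 e2 (1 + i0) (1 + j0) :: nil)) as [l Hl]; [|exists l; exact Hl].
      intros k Hk. destruct (HS k Hk) as [a [b [[-> | ->] [[-> | ->] ->]]]]; simpl; tauto.
    + intros k Hk Hh.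
      (* The lemma is applied to the vertices other than [k]: if [k] lay in their hull it would be
         one of them. *)
      assert (K : cellpts D n q k /\ k <> k); [|tauto].
      apply (hull_lattice_point n k0 e1 e2 i0 j0 (fun k' => cellpts D n q k' /\ k' <> k) k Hn Hd); [|exact Hh].
      intros k' [Hk' _]. apply HS, Hk'.
  - intros x. apply vertices_cover.
  - intros q q' Hq Hq' [k Hk].
    assert (Hne : q <> q') by (intros ->; apply Hk; tauto).
    split.
    + intros [x [Hx Hx']].
      destruct (vertices_conform q q' x Hq Hq' (interior_subset _ _ Hx) (interior_subset _ _ Hx')) as [E|[_ Hs]]; [contradiction|].
      apply (separated_no_common_interior _ _ _ Hs). exists x. split; assumption.
    + intros x. split.
      * intros [Hx Hx']. destruct (vertices_conform q q' x Hq Hq' Hx Hx') as [E|[Hc _]]; [contradiction|].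
        apply Hc; assumption.
      * intros Hx. split; (eapply hull_mono; [|exact Hx]); simpl; tauto.
  - intros k. destruct (vertices_cover (hpt n k)) as [q [Hq Hx]]. exists q. split; [exact Hq|].
    destruct (vertex_own_square q Hq) as [k0 [e1 [e2 [i0 [j0 [Hd HS]]]]]].
    apply (hull_lattice_point n k0 e1 e2 i0 j0 _ k Hn Hd HS Hx).
Qed.
End Polygonization.

(** * Finite and periodic sums *)

(** The upper end is exclusive, unlike in [sum_f_R0], so that concatenating and multiplying index
    ranges needs no correction by one. *)
Fixpoint Sum (N : nat) (f : nat -> R) : R :=
  match N with O => 0 | S N' => Sum N' f + f N' end.
Definition Sum2 (N : nat) (f : nat -> nat -> R) : R := Sum N (fun i => Sum N (fun j => f i j)).
Definition ZS (n : nat) (f : zpt -> R) : R := Sum2 n (fun i j => f (Z.of_nat i, Z.of_nat j)).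
Fixpoint lsum {T} (l : list T) (f : T -> R) : R :=
  match l with nil => 0 | x :: l' => f x + lsum l' f end.
Definition ind (P : Prop) : R := if excluded_middle_informative P then 1 else 0.

Lemma ind_true (P : Prop) : P -> ind P = 1.
Proof. intros H. unfold ind. destruct (excluded_middle_informative P); [reflexivity|contradiction]. Qed.
Lemma ind_false (P : Prop) : ~ P -> ind P = 0.
Proof. intros H. unfold ind. destruct (excluded_middle_informative P); [contradiction|reflexivity]. Qed.
Lemma ind_bounds (P : Prop) : 0 <= ind P <= 1.
Proof. unfold ind. destruct (excluded_middle_informative P); lra. Qed.
Lemma ind_iff (P Q : Prop) : (P <-> Q) -> ind P = ind Q.
Proof.
  intros H. destruct (classic P) as [HP|HP].
  - rewrite !ind_true; tauto.
  - rewrite !ind_false; tauto.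
Qed.

Lemma sum_f_R0_Sum f N : sum_f_R0 f N = Sum (S N) f.
Proof. induction N as [|N IH]; [simpl; ring|]. simpl sum_f_R0. rewrite IH. reflexivity. Qed.

Lemma Sum_ext N f g : (forall i, (i < N)%nat -> f i = g i) -> Sum N f = Sum N g.
Proof. induction N as [|N IH]; intros H; [reflexivity|]. simpl. rewrite IH, H by (try intros; try apply H; lia). reflexivity. Qed.
Lemma Sum_le N f g : (forall i, (i < N)%nat -> f i <= g i) -> Sum N f <= Sum N g.
Proof.
  induction N as [|N IH]; intros H; [simpl; lra|]. simpl.
  pose proof (H N ltac:(lia)). assert (Sum N f <= Sum N g) by (apply IH; intros; apply H; lia). lra.
Qed.
Lemma Sum_plus N f g : Sum N (fun i => f i + g i) = Sum N f + Sum N g.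
Proof. induction N as [|N IH]; simpl; [ring|]. rewrite IH. ring. Qed.
Lemma Sum_scal N a f : Sum N (fun i => a * f i) = a * Sum N f.
Proof. induction N as [|N IH]; simpl; [ring|]. rewrite IH. ring. Qed.
Lemma Sum_const N a : Sum N (fun _ => a) = INR N * a.
Proof. induction N as [|N IH]; [simpl; ring|]. simpl Sum. rewrite IH, S_INR. ring. Qed.
Lemma Sum_exchange N M (f : nat -> nat -> R) : Sum N (fun i => Sum M (fun j => f i j)) = Sum M (fun j => Sum N (fun i => f i j)).
Proof.
  induction N as [|N IH]; simpl.
  - rewrite Sum_const. ring.
  - rewrite IH, <- Sum_plus. reflexivity.
Qed.
Lemma Sum_app N M f : Sum (N + M) f = Sum N f + Sum M (fun i => f (N + i)%nat).
Proof. induction M as [|M IH]; [rewrite Nat.add_0_r; simpl; ring|]. rewrite Nat.add_succ_r. simpl. rewrite IH. ring. Qed.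
Lemma Sum_mul N M f : Sum (N * M) f = Sum N (fun i => Sum M (fun j => f (i * M + j)%nat)).
Proof.
  induction N as [|N IH]; [reflexivity|]. replace (S N * M)%nat with (N * M + M)%nat by (simpl; lia).
  rewrite Sum_app, IH. reflexivity.
Qed.
Lemma Sum_rev N f : Sum N f = Sum N (fun i => f (N - 1 - i)%nat).
Proof.
  induction N as [|N IH]; [reflexivity|].
  change (Sum (S N) f) with (Sum N f + f N). rewrite IH.
  replace (S N) with (1 + N)%nat by lia. rewrite Sum_app, Rplus_comm. f_equal.
  - unfold Sum. rewrite Rplus_0_l. f_equal. lia.
  - apply Sum_ext. intros i Hi. f_equal. lia.
Qed.
Lemma Sum_lsum {T} N (l : list T) (f : nat -> T -> R) : Sum N (fun i => lsum l (f i)) = lsum l (fun x => Sum N (fun i => f i x)).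
Proof.
  induction l as [|x l IH]; simpl; [rewrite Sum_const; ring|]. rewrite Sum_plus, IH. reflexivity.
Qed.

Lemma lsum_ext {T} (l : list T) f g : (forall x, In x l -> f x = g x) -> lsum l f = lsum l g.
Proof. induction l as [|x l IH]; intros H; [reflexivity|]. simpl. rewrite H, IH by (try (intros; apply H); simpl; auto). reflexivity. Qed.
Lemma lsum_le {T} (l : list T) f g : (forall x, In x l -> f x <= g x) -> lsum l f <= lsum l g.
Proof.
  induction l as [|x l IH]; intros H; [simpl; lra|]. simpl. pose proof (H x (or_introl eq_refl)).
  assert (lsum l f <= lsum l g) by (apply IH; intros; apply H; right; assumption). lra.
Qed.
Lemma lsum_plus {T} (l : list T) f g : lsum l (fun x => f x + g x) = lsum l f + lsum l g.
Proof. induction l as [|x l IH]; simpl; [ring|]. rewrite IH. ring. Qed.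
Lemma lsum_scal {T} (l : list T) a f : lsum l (fun x => a * f x) = a * lsum l f.
Proof. induction l as [|x l IH]; simpl; [ring|]. rewrite IH. ring. Qed.
Lemma lsum_const {T} (l : list T) a : lsum l (fun _ => a) = INR (length l) * a.
Proof. induction l as [|x l IH]; [simpl; ring|]. simpl lsum. rewrite IH. simpl length. rewrite S_INR. ring. Qed.
Lemma lsum_nonneg {T} (l : list T) f : (forall x, In x l -> 0 <= f x) -> 0 <= lsum l f.
Proof. intros H. replace 0 with (lsum l (fun _ => 0)) by (rewrite lsum_const; ring). apply lsum_le, H. Qed.
Lemma lsum_exchange {T U} (l : list T) (l' : list U) (f : T -> U -> R) :
  lsum l (fun x => lsum l' (f x)) = lsum l' (fun y => lsum l (fun x => f x y)).
Proof.
  induction l as [|x l IH]; simpl; [rewrite lsum_const; ring|]. rewrite IH, <- lsum_plus. reflexivity.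
Qed.
Lemma lsum_ge_term {T} (l : list T) f x : (forall y, In y l -> 0 <= f y) -> In x l -> f x <= lsum l f.
Proof.
  induction l as [|a l IH]; [intros _ []|]. intros H [-> | Hx]; simpl.
  - pose proof (lsum_nonneg l f (fun y Hy => H y (or_intror Hy))). lra.
  - pose proof (H a (or_introl eq_refl)). pose proof (IH (fun y Hy => H y (or_intror Hy)) Hx). lra.
Qed.
Lemma lsum_one {T} (l : list T) f x : NoDup l -> In x l -> (forall y, In y l -> y <> x -> f y = 0) -> lsum l f = f x.
Proof.
  induction l as [|a l IH]; [intros _ []|]. intros Hnd [-> | Hx] H; simpl; inversion Hnd; subst.
  - rewrite (lsum_ext l f (fun _ => 0)); [rewrite lsum_const; ring|].
    intros y Hy. apply H; [right; exact Hy|]. intros ->. contradiction.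
  - rewrite IH; try assumption; [|intros; apply H; [right|]; assumption].
    rewrite (H a); [ring|left; reflexivity|]. intros ->. contradiction.
Qed.
Lemma lsum_split {T} (l : list T) f g : lsum l f = lsum l g + lsum l (fun x => f x - g x).
Proof. rewrite <- lsum_plus. apply lsum_ext. intros; ring. Qed.

Lemma Sum_abs N f : Rabs (Sum N f) <= Sum N (fun i => Rabs (f i)).
Proof.
  induction N as [|N IH]; simpl; [rewrite Rabs_R0; lra|].
  eapply Rle_trans; [apply Rabs_triang|]. lra.
Qed.

Lemma Sum2_ext N f g : (forall i j, (i < N)%nat -> (j < N)%nat -> f i j = g i j) -> Sum2 N f = Sum2 N g.
Proof. intros H. apply Sum_ext. intros i Hi. apply Sum_ext. intros j Hj. apply H; assumption. Qed.
Lemma Sum2_le N f g : (forall i j, (i < N)%nat -> (j < N)%nat -> f i j <= g i j) -> Sum2 N f <= Sum2 N g.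
Proof. intros H. apply Sum_le. intros i Hi. apply Sum_le. intros j Hj. apply H; assumption. Qed.
Lemma Sum2_plus N f g : Sum2 N (fun i j => f i j + g i j) = Sum2 N f + Sum2 N g.
Proof. unfold Sum2. rewrite <- Sum_plus. apply Sum_ext. intros. apply Sum_plus. Qed.
Lemma Sum2_scal N a f : Sum2 N (fun i j => a * f i j) = a * Sum2 N f.
Proof. unfold Sum2. rewrite <- Sum_scal. apply Sum_ext. intros. apply Sum_scal. Qed.
Lemma Sum2_const N a : Sum2 N (fun _ _ => a) = INR N * INR N * a.
Proof. unfold Sum2. rewrite Sum_const, Sum_const. ring. Qed.
Lemma Sum2_minus N f g : Sum2 N (fun i j => f i j - g i j) = Sum2 N f - Sum2 N g.
Proof.
  replace (Sum2 N f - Sum2 N g) with (Sum2 N f + -1 * Sum2 N g) by ring.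
  rewrite <- Sum2_scal, <- Sum2_plus. apply Sum2_ext. intros; ring.
Qed.
Lemma Sum2_abs N f : Rabs (Sum2 N f) <= Sum2 N (fun i j => Rabs (f i j)).
Proof. unfold Sum2. eapply Rle_trans; [apply Sum_abs|]. apply Sum_le. intros. apply Sum_abs. Qed.
Lemma Sum2_lsum {T} N (l : list T) (f : nat -> nat -> T -> R) :
  Sum2 N (fun i j => lsum l (f i j)) = lsum l (fun x => Sum2 N (fun i j => f i j x)).
Proof.
  unfold Sum2. rewrite <- Sum_lsum. apply Sum_ext. intros. apply Sum_lsum.
Qed.
Lemma Sum2_rev N f : Sum2 N f = Sum2 N (fun i j => f (N - 1 - i)%nat (N - 1 - j)%nat).
Proof. unfold Sum2. rewrite Sum_rev. apply Sum_ext. intros. apply Sum_rev. Qed.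
Lemma Sum2_mul N M f : Sum2 (N * M) f =
  Sum2 N (fun i j => Sum2 M (fun i' j' => f (i * M + i')%nat (j * M + j')%nat)).
Proof.
  unfold Sum2. rewrite Sum_mul. apply Sum_ext. intros i Hi.
  rewrite (Sum_exchange N M). apply Sum_ext. intros i' Hi'. rewrite Sum_mul. reflexivity.
Qed.

Lemma ZS_Sum2_exchange n m (f : zpt -> nat -> nat -> R) :
  ZS n (fun k => Sum2 m (f k)) = Sum2 m (fun i j => ZS n (fun k => f k i j)).
Proof.
  unfold ZS, Sum2.
  transitivity (Sum n (fun i => Sum m (fun a => Sum n (fun j => Sum m (fun b => f (Z.of_nat i, Z.of_nat j) a b))))).
  { apply Sum_ext. intros. apply Sum_exchange. }
  rewrite Sum_exchange. apply Sum_ext. intros a Ha.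
  transitivity (Sum n (fun i => Sum m (fun b => Sum n (fun j => f (Z.of_nat i, Z.of_nat j) a b)))).
  { apply Sum_ext. intros. apply Sum_exchange. }
  apply Sum_exchange.
Qed.

Definition zper (n : nat) (f : zpt -> R) : Prop :=
  forall k m, f (zshift k (Z.of_nat n * fst m, Z.of_nat n * snd m)%Z) = f k.

Lemma Sum_shift1 n (g : Z -> R) : (forall i, g (i + Z.of_nat n)%Z = g i) ->
  Sum n (fun i => g (Z.of_nat i + 1)%Z) = Sum n (fun i => g (Z.of_nat i)).
Proof.
  intros H. destruct n as [|n]; [reflexivity|].
  replace (S n) with (1 + n)%nat at 2 by lia. rewrite Sum_app. simpl Sum at 1. simpl (Sum 1 _).
  assert (E : g (Z.of_nat n + 1)%Z = g 0%Z).
  { rewrite <- (H 0%Z). f_equal. lia. }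
  rewrite E. rewrite Rplus_0_l, Rplus_comm. f_equal. apply Sum_ext. intros i Hi. f_equal. lia.
Qed.

Lemma Sum_shift n (g : Z -> R) (r : Z) : (forall i, g (i + Z.of_nat n)%Z = g i) ->
  Sum n (fun i => g (Z.of_nat i + r)%Z) = Sum n (fun i => g (Z.of_nat i)).
Proof.
  intros H.
  assert (P : forall r : nat, forall g : Z -> R, (forall i, g (i + Z.of_nat n)%Z = g i) ->
     Sum n (fun i => g (Z.of_nat i + Z.of_nat r)%Z) = Sum n (fun i => g (Z.of_nat i))).
  { clear. induction r as [|r IH]; intros g H.
    - apply Sum_ext. intros. f_equal. lia.
    - rewrite <- (IH g H).
      rewrite <- (Sum_shift1 n (fun z => g (z + Z.of_nat r)%Z)).
      + apply Sum_ext. intros. f_equal. lia.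
      + intros i. rewrite <- (H (i + Z.of_nat r)%Z). f_equal. lia. }
  destruct (Z_lt_le_dec r 0) as [Hr|Hr].
  - rewrite <- (P (Z.to_nat (- r)) (fun z => g (z + r)%Z)).
    + apply Sum_ext. intros. f_equal. lia.
    + intros i. rewrite <- (H (i + r)%Z). f_equal. lia.
  - rewrite <- (P (Z.to_nat r) g H). apply Sum_ext. intros. f_equal. lia.
Qed.

Lemma ZS_shift n f r : zper n f -> ZS n (fun k => f (zshift k r)) = ZS n f.
Proof.
  intros H. unfold ZS, Sum2, zshift; cbn [fst snd].
  rewrite (Sum_shift n (fun i => Sum n (fun j => f (i, (Z.of_nat j + snd r)%Z))) (fst r)).
  - apply Sum_ext. intros i Hi. apply (Sum_shift n (fun j => f (Z.of_nat i, j)) (snd r)).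
    intros j. rewrite <- (H (Z.of_nat i, j) (0, 1)%Z). unfold zshift; cbn [fst snd]. f_equal. f_equal; lia.
  - intros i. apply Sum_ext. intros j Hj. rewrite <- (H (i, (Z.of_nat j + snd r)%Z) (1, 0)%Z).
    unfold zshift; cbn [fst snd]. f_equal. f_equal; lia.
Qed.

Lemma ZS_ext n f g : (forall k, f k = g k) -> ZS n f = ZS n g.
Proof. intros H. apply Sum2_ext. intros; apply H. Qed.
Lemma ZS_le n f g : (forall k, f k <= g k) -> ZS n f <= ZS n g.
Proof. intros H. apply Sum2_le. intros; apply H. Qed.
Lemma ZS_lsum {T} n (l : list T) (f : zpt -> T -> R) : ZS n (fun k => lsum l (f k)) = lsum l (fun x => ZS n (fun k => f k x)).
Proof. apply Sum2_lsum. Qed.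
Lemma ZS_scal n a f : ZS n (fun k => a * f k) = a * ZS n f.
Proof. apply Sum2_scal. Qed.
Lemma Sum_count N (Pr : nat -> Prop) (M : nat) :
  (forall i j, Pr i -> Pr j -> (i <= j + M)%nat) -> Sum N (fun i => ind (Pr i)) <= INR M + 1.
Proof.
  intros H. induction N as [|N IH]; [simpl; pose proof (pos_INR M); lra|].
  destruct (classic (Pr N)) as [HN|HN].
  - destruct (le_lt_dec (S N) (S M)) as [Hle|Hlt].
    + apply Rle_trans with (Sum (S N) (fun _ => 1)).
      * apply Sum_le. intros. apply ind_bounds.
      * rewrite Sum_const, Rmult_1_r, <- S_INR. apply le_INR, Hle.
    + replace (S N) with ((N - M) + S M)%nat by lia. rewrite Sum_app.
      assert (E : Sum (N - M) (fun i => ind (Pr i)) <= Sum (N - M) (fun _ => 0)).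
      { apply Sum_le. intros i Hi. rewrite ind_false; [lra|]. intros Hp. pose proof (H _ _ HN Hp). lia. }
      rewrite Sum_const, Rmult_0_r in E.
      assert (Sum (S M) (fun i => ind (Pr (N - M + i)%nat)) <= Sum (S M) (fun _ => 1)) by (apply Sum_le; intros; apply ind_bounds).
      rewrite Sum_const, S_INR in H0. lra.
  - simpl. rewrite (ind_false _ HN). lra.
Qed.

(** * Sample points away from lattice lines *)

Definition crossv (v : zpt) (X : pt) : R := IZR (fst v) * snd X - IZR (snd v) * fst X.

(* The lattice lines of direction [v] are the sets [crossv v X = c] with [c] an integer. *)
Definition Good (V : Z) (ka : R) (X : pt) : Prop :=
  forall v c, v <> (0, 0)%Z -> (Z.abs (fst v) <= V)%Z -> (Z.abs (snd v) <= V)%Z -> ka < Rabs (crossv v X - IZR c).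
Definition sample (n N i j : nat) : pt :=
  (INR n * ((INR i + / 2) / INR N), INR n * ((INR j + / 2) / INR N)).

(** Some component of [v] is a nonzero integer. Along the corresponding rows of samples, the cross
    product advances in steps of at least n / N, so a strip of half-width K0 n / N contains at most
    M + 1 samples of each row. *)
Lemma line_count n N v c K0 M : (1 <= n)%nat -> (1 <= N)%nat -> v <> (0, 0)%Z -> 2 * K0 <= INR M ->
  Sum2 N (fun i j => ind (Rabs (crossv v (sample n N i j) - IZR c) <= K0 * INR n / INR N)) <= (INR M + 1) * INR N.
Proof.
  intros Hn HN Hv HM. assert (Hnp : 0 < INR n) by (apply lt_0_INR; lia). assert (HNp : 0 < INR N) by (apply lt_0_INR; lia).
  set (h := INR n / INR N). assert (Hh : 0 < h) by (apply Rdiv_lt_0_compat; assumption).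
  assert (E : forall i j, crossv v (sample n N i j) - IZR c =
     IZR (fst v) * h * INR j - IZR (snd v) * h * INR i + ((IZR (fst v) - IZR (snd v)) * h / 2 - IZR c)).
  { intros i j. unfold crossv, sample, h; cbn [fst snd]. field. lra. }
  assert (W : forall (w : Z) be (i j : nat), w <> 0%Z -> Rabs (IZR w * h * INR i + be) <= K0 * INR n / INR N ->
     Rabs (IZR w * h * INR j + be) <= K0 * INR n / INR N -> (i <= j + M)%nat).
  { intros w be i j Hw Hi Hj. apply INR_le. rewrite plus_INR.
    replace (K0 * INR n / INR N) with (K0 * h) in * by (unfold h; field; lra).
    pose proof (Rabs_triang (IZR w * h * INR i + be) (- (IZR w * h * INR j + be))) as T. rewrite Rabs_Ropp in T.
    replace (IZR w * h * INR i + be + - (IZR w * h * INR j + be)) with (IZR w * (h * (INR i - INR j))) in T by ring.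
    rewrite Rabs_mult, Rabs_mult, (Rabs_pos_eq h) in T by lra.
    assert (1 <= Rabs (IZR w)) by (rewrite <- abs_IZR; apply IZR_le; lia).
    pose proof (Rle_abs (INR i - INR j)). pose proof (Rabs_pos (INR i - INR j)).
    assert (1 * (h * Rabs (INR i - INR j)) <= Rabs (IZR w) * (h * Rabs (INR i - INR j))) by (apply Rmult_le_compat_r; nra).
    assert (h * Rabs (INR i - INR j) <= h * (2 * K0)) by lra.
    apply Rmult_le_reg_l in H3; lra. }
  rewrite (Rmult_comm (INR M + 1)), <- Sum_const.
  destruct (Z.eq_dec (fst v) 0) as [E1|E1].
  - assert (E2 : snd v <> 0%Z) by (intros E2; apply Hv; destruct v; cbn [fst snd] in *; congruence).
    unfold Sum2. rewrite Sum_exchange. apply Sum_le. intros j Hj. apply Sum_count.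
    intros i i' Hi Hi'. rewrite E in Hi, Hi'.
    apply (W (- snd v)%Z (IZR (fst v) * h * INR j + ((IZR (fst v) - IZR (snd v)) * h / 2 - IZR c))); [lia|..]; rewrite opp_IZR.
    + replace (- IZR (snd v) * h * INR i + (IZR (fst v) * h * INR j + ((IZR (fst v) - IZR (snd v)) * h / 2 - IZR c)))
       with (IZR (fst v) * h * INR j - IZR (snd v) * h * INR i + ((IZR (fst v) - IZR (snd v)) * h / 2 - IZR c)) by ring. exact Hi.
    + replace (- IZR (snd v) * h * INR i' + (IZR (fst v) * h * INR j + ((IZR (fst v) - IZR (snd v)) * h / 2 - IZR c)))
       with (IZR (fst v) * h * INR j - IZR (snd v) * h * INR i' + ((IZR (fst v) - IZR (snd v)) * h / 2 - IZR c)) by ring. exact Hi'.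
  - unfold Sum2. apply Sum_le. intros i Hi. apply Sum_count.
    intros j j' Hj Hj'. rewrite E in Hj, Hj'.
    apply (W (fst v) (- (IZR (snd v) * h * INR i) + ((IZR (fst v) - IZR (snd v)) * h / 2 - IZR c))); [exact E1|..].
    + rewrite <- Rplus_assoc. exact Hj.
    + rewrite <- Rplus_assoc. exact Hj'.
Qed.

(** On the sampled period the cross products with directions bounded by [V] are bounded, so only
    finitely many lattice lines matter, and each takes O(N) of the N^2 samples. *)
Lemma bad_count V K0 n : (0 <= V)%Z -> (1 <= n)%nat -> exists C, 0 <= C /\ forall N, (1 <= N)%nat ->
  Sum2 N (fun i j => ind (~ Good V (K0 * INR n / INR N) (sample n N i j))) <= C * INR N.
Proof.
  intros HV Hn. assert (Hnp : 0 < INR n) by (apply lt_0_INR; lia).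
  destruct (INR_unbounded (2 * K0)) as [M HM].
  set (Kc := up (2 * IZR V * INR n + Rabs K0 * INR n)).
  assert (HKc : (0 <= Kc)%Z).
  { apply le_IZR. unfold Kc. destruct (archimed (2 * IZR V * INR n + Rabs K0 * INR n)).
    assert (0 <= IZR V) by (apply IZR_le; exact HV). pose proof (Rabs_pos K0). nra. }
  set (l := list_prod (zbox V) (zrange Kc)).
  exists (INR (length l) * (INR M + 1)). split; [apply Rmult_le_pos; [apply pos_INR|pose proof (pos_INR M); lra]|].
  intros N HN. assert (HNp : 1 <= INR N) by (apply (le_INR 1); exact HN).
  set (ka := K0 * INR n / INR N).
  apply Rle_trans with (Sum2 N (fun i j => lsum l (fun vc => ind (fst vc <> (0, 0)%Z /\ Rabs (crossv (fst vc) (sample n N i j) - IZR (snd vc)) <= ka)))).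
  - apply Sum2_le. intros i j Hi Hj. destruct (classic (Good V ka (sample n N i j))) as [Hg|Hg].
    + rewrite ind_false by tauto. apply lsum_nonneg. intros. apply ind_bounds.
    + rewrite ind_true by exact Hg. apply NNPP. intros Hlt. apply Hg. intros v c Hv H1 H2.
      apply Rnot_le_lt. intros Hle. apply Hlt.
      assert (Hin : In (v, c) l).
      { unfold l. apply in_prod; [apply in_zbox; auto|]. apply in_zrange; [exact HKc|].
        apply abs_IZR_le_iff. apply Rabs_IZR_le in H1. apply Rabs_IZR_le in H2.
        assert (HX : forall a, (a < N)%nat -> Rabs (INR n * ((INR a + / 2) / INR N)) <= INR n).
        { intros a Ha. assert (0 <= INR a) by apply pos_INR. assert (INR a + 1 <= INR N) by (rewrite <- S_INR; apply le_INR; lia).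
          rewrite Rabs_pos_eq.
          - rewrite <- (Rmult_1_r (INR n)) at 2. apply Rmult_le_compat_l; [lra|].
            apply (Rmult_le_reg_r (INR N)); [lra|]. unfold Rdiv. rewrite Rmult_assoc, Rinv_l by lra. lra.
          - apply Rmult_le_pos; [lra|]. apply Rmult_le_pos; [lra|]. left. apply Rinv_0_lt_compat. lra. }
        pose proof (HX i Hi) as X1. pose proof (HX j Hj) as X2.
        assert (HC : Rabs (crossv v (sample n N i j)) <= 2 * IZR V * INR n).
        { unfold crossv, sample; cbn [fst snd]. eapply Rle_trans; [apply Rabs_triang|]. rewrite Rabs_Ropp, !Rabs_mult.
          assert (forall a b, Rabs (IZR a) <= IZR V -> Rabs b <= INR n -> Rabs (IZR a) * Rabs b <= IZR V * INR n)
            by (intros; apply Rmult_le_compat; try apply Rabs_pos; assumption).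
          pose proof (H _ _ H1 X2). pose proof (H _ _ H2 X1). rewrite !Rabs_mult in *. lra. }
        assert (Hka : ka <= Rabs K0 * INR n).
        { unfold ka, Rdiv. apply Rle_trans with (Rabs K0 * INR n * / INR N).
          - apply Rmult_le_compat_r; [left; apply Rinv_0_lt_compat; lra|]. apply Rmult_le_compat_r; [lra|apply Rle_abs].
          - rewrite <- (Rmult_1_r (Rabs K0 * INR n)) at 2. apply Rmult_le_compat_l.
            + apply Rmult_le_pos; [apply Rabs_pos|lra].
            + rewrite <- Rinv_1. apply Rinv_le_contravar; lra. }
        pose proof (Rabs_triang_inv (IZR c) (crossv v (sample n N i j))) as T. rewrite (Rabs_minus_sym (IZR c)) in T. lra. }
      eapply Rle_trans; [|apply (lsum_ge_term l _ (v, c)); [intros; apply ind_bounds|exact Hin]].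
      cbn [fst snd]. rewrite ind_true by (split; assumption). lra.
  - rewrite Sum2_lsum, Rmult_assoc, <- lsum_const. apply lsum_le. intros [v c] _. cbn [fst snd].
    destruct (classic (v = (0, 0)%Z)) as [Hv|Hv].
    + rewrite (Sum2_ext _ _ (fun _ _ => 0)) by (intros; apply ind_false; tauto). rewrite Sum2_const, Rmult_0_r.
      apply Rmult_le_pos; [pose proof (pos_INR M); lra|lra].
    + eapply Rle_trans; [|apply (line_count n N v c K0 M Hn HN Hv); lra]. apply Sum2_le. intros i j _ _.
      right. apply ind_iff. unfold ka. tauto.
Qed.

Lemma Good_shift V ka X r : Good V ka (vadd X (toR r)) <-> Good V ka X.
Proof.
  assert (E : forall v X r, crossv v (vadd X (toR r)) = crossv v X + IZR (fst v * snd r - snd v * fst r)).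
  { intros v Y s. unfold crossv, vadd, toR; cbn [fst snd]. rewrite minus_IZR, !mult_IZR. ring. }
  unfold Good. split; intros H v c Hv H1 H2.
  - specialize (H v (c + (fst v * snd r - snd v * fst r))%Z Hv H1 H2). rewrite E, plus_IZR in H.
    replace (crossv v X - IZR c) with (crossv v X + IZR (fst v * snd r - snd v * fst r) - (IZR c + IZR (fst v * snd r - snd v * fst r))) by ring. exact H.
  - specialize (H v (c - (fst v * snd r - snd v * fst r))%Z Hv H1 H2). rewrite minus_IZR in H. rewrite E.
    replace (crossv v X + IZR (fst v * snd r - snd v * fst r) - IZR c) with (crossv v X - (IZR c - IZR (fst v * snd r - snd v * fst r))) by ring. exact H.
Qed.

Lemma Good_opp V ka X r : Good V ka X -> Good V ka (vsub (toR r) X).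
Proof.
  intros H v c Hv H1 H2. specialize (H v ((fst v * snd r - snd v * fst r) - c)%Z Hv H1 H2).
  rewrite !minus_IZR, !mult_IZR in H. rewrite <- Rabs_Ropp. unfold crossv, vsub, toR in *; cbn [fst snd] in *.
  match goal with |- ka < Rabs ?a => match type of H with _ < Rabs ?b => replace a with b by ring end end. exact H.
Qed.

Lemma Good_weaken V ka ka' X : ka' <= ka -> Good V ka X -> Good V ka' X.
Proof. intros Hk H v c Hv H1 H2. specialize (H v c Hv H1 H2). lra. Qed.

(** * The stencil energy *)

(** Besides the six stencil directions this lists the other diagonal. It has weight 0 in the stencil
    but can be an edge of the triangulation, and its increments enter the error terms. *)
Definition dirs8 : list zpt :=
  ((1, 0) :: (-1, 0) :: (0, 1) :: (0, -1) :: (1, 1) :: (-1, -1) :: (1, -1) :: (-1, 1) :: nil)%Z.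

(* The weight, relative to [delta / 2], of the edge [dx e1 + dy e2] for a metric with
   Gram matrix [(A, -B, C)] in the frame. *)
Definition gc (A B C : R) (d : zpt) : R :=
  if Z.eqb (fst d * snd d) 1 then B else
  if Z.eqb (snd d) 0 then C - B else
  if Z.eqb (fst d) 0 then A - B else 0.

Lemma gc_values A B C :
  (gc A B C (1, 0)%Z = C - B /\ gc A B C (-1, 0)%Z = C - B) /\ (gc A B C (0, 1)%Z = A - B /\ gc A B C (0, -1)%Z = A - B) /\
  (gc A B C (1, 1)%Z = B /\ gc A B C (-1, -1)%Z = B) /\ (gc A B C (1, -1)%Z = 0 /\ gc A B C (-1, 1)%Z = 0).
Proof. repeat split. Qed.

Definition edge_sum (de A B C : R) (U : zpt -> R) (k e1 e2 : zpt) : R :=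
  lsum dirs8 (fun d => / 2 * de * gc A B C d * (U (zcomb k e1 e2 (fst d) (snd d)) - U k) ^ 2).

(** The superbase is relabelled cyclically until the product nearest to 0 is that of [e1] and [e2],
    and these are exchanged if the orientation is wrong. Since e0 = - e1 - e2, the product of [e2]
    and [e0] is B - C, so that [e1] has weight delta (C - B) / 2; this is the origin of [gc]. *)
Lemma stencil_frame D L sb z : uniform_bounds D L -> superbase (sb z) -> obtuse (MM D z) (sb z) ->
  exists e1 e2, Frame (MM D z) e1 e2 /\ forall u i j,
    stencil_term D sb u z i j = edge_sum (deltaD D z) (bform (MM D z) (toR e1) (toR e1))
      (- bform (MM D z) (toR e1) (toR e2)) (bform (MM D z) (toR e2) (toR e2)) (fun k => u (fst k) (snd k)) (i, j) e1 e2.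
Proof.
  intros HU Hs Ho. unfold stencil_term. destruct (sb z) as [[e0 e1] e2].
  destruct HU as [_ [_ [_ [_ [_ [_ [Hperp _]]]]]]].
  rewrite !Hperp.
  destruct Hs as [Hx [Hy Hb]]. unfold obtuse in Ho. destruct Ho as [O1 [O2 O3]].
  set (M := MM D z) in *. set (de := deltaD D z) in *. clearbody M de. clear Hperp.
  assert (Hgen : forall f1 f2 : zpt, zdet f1 f2 = 1%Z ->
    (bform M (toR f1) (toR f2) <= 0) ->
    (bform M (toR f1) (toR f1) + 2 * bform M (toR f1) (toR f2) >= 0) ->
    (bform M (toR f2) (toR f2) + 2 * bform M (toR f1) (toR f2) >= 0) ->
    Frame M f1 f2).
  { intros f1 f2 Hd H1 H2 H3. unfold Frame. split; [exact Hd|]. lra. }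
  assert (E : forall f0 f1 f2 : zpt, (fst f0 + fst f1 + fst f2 = 0)%Z -> (snd f0 + snd f1 + snd f2 = 0)%Z ->
     toR f0 = (- IZR (fst f1) - IZR (fst f2), - IZR (snd f1) - IZR (snd f2))).
  { intros f0 f1 f2 H1 H2. unfold toR. rewrite <- !opp_IZR, <- !minus_IZR. f_equal; f_equal; lia. }
  assert (B1 : forall f0 f1 f2 : zpt, (fst f0 + fst f1 + fst f2 = 0)%Z -> (snd f0 + snd f1 + snd f2 = 0)%Z ->
     bform M (toR f0) (toR f1) = - bform M (toR f1) (toR f1) - bform M (toR f1) (toR f2) /\
     bform M (toR f0) (toR f2) = - bform M (toR f2) (toR f2) - bform M (toR f1) (toR f2)).
  { intros f0 f1 f2 H1 H2. rewrite (E f0 f1 f2 H1 H2). destruct M as [[a b] c]. unfold bform, toR; cbn [fst snd]. split; ring. }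
  assert (Hmain : forall f0 f1 f2 : zpt, (fst f0 + fst f1 + fst f2 = 0)%Z -> (snd f0 + snd f1 + snd f2 = 0)%Z ->
    Z.abs (fst f1 * snd f2 - snd f1 * fst f2) = 1%Z ->
    bform M (toR f1) (toR f2) <= 0 ->
    bform M (toR f0) (toR f1) <= bform M (toR f1) (toR f2) ->
    bform M (toR f0) (toR f2) <= bform M (toR f1) (toR f2) ->
    exists g1 g2, Frame M g1 g2 /\ forall u i j,
     (- (1 / 2) * (de * bform M (toR f1) (toR f2))) * ((u (i + fst f0)%Z (j + snd f0)%Z - u i j) ^ 2 + (u (i - fst f0)%Z (j - snd f0)%Z - u i j) ^ 2) +
     (- (1 / 2) * (de * bform M (toR f2) (toR f0))) * ((u (i + fst f1)%Z (j + snd f1)%Z - u i j) ^ 2 + (u (i - fst f1)%Z (j - snd f1)%Z - u i j) ^ 2) +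
     (- (1 / 2) * (de * bform M (toR f0) (toR f1))) * ((u (i + fst f2)%Z (j + snd f2)%Z - u i j) ^ 2 + (u (i - fst f2)%Z (j - snd f2)%Z - u i j) ^ 2) =
     edge_sum de (bform M (toR g1) (toR g1)) (- bform M (toR g1) (toR g2)) (bform M (toR g2) (toR g2)) (fun k => u (fst k) (snd k)) (i, j) g1 g2).
  { intros f0 f1 f2 H1 H2 H3 H4 H5 H6. destruct (B1 f0 f1 f2 H1 H2) as [E1 E2].
    assert (Hz1 : fst f0 = (- fst f1 - fst f2)%Z) by lia. assert (Hz2 : snd f0 = (- snd f1 - snd f2)%Z) by lia.
    assert (Hd : zdet f1 f2 = 1%Z \/ zdet f2 f1 = 1%Z) by (unfold zdet; lia).
    destruct Hd as [Hd|Hd]; [exists f1, f2|exists f2, f1].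
    - split; [apply Hgen; try assumption; lra|]. intros u i j.
      rewrite (bform_sym M (toR f2) (toR f0)), E1, E2, Hz1, Hz2.
      unfold edge_sum, dirs8, lsum.
      match goal with |- context [gc ?a ?b ?c _] =>
        destruct (gc_values a b c) as [[V1 V2] [[V3 V4] [[V5 V6] [V7 V8]]]]; rewrite V1, V2, V3, V4, V5, V6, V7, V8 end.
      unfold zcomb; cbn [fst snd].
      replace (i + (- fst f1 - fst f2))%Z with (i + -1 * fst f1 + -1 * fst f2)%Z by ring.
      replace (j + (- snd f1 - snd f2))%Z with (j + -1 * snd f1 + -1 * snd f2)%Z by ring.
      replace (i - (- fst f1 - fst f2))%Z with (i + 1 * fst f1 + 1 * fst f2)%Z by ring.
      replace (j - (- snd f1 - snd f2))%Z with (j + 1 * snd f1 + 1 * snd f2)%Z by ring.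
      replace (i + fst f1)%Z with (i + 1 * fst f1 + 0 * fst f2)%Z by ring.
      replace (j + snd f1)%Z with (j + 1 * snd f1 + 0 * snd f2)%Z by ring.
      replace (i - fst f1)%Z with (i + -1 * fst f1 + 0 * fst f2)%Z by ring.
      replace (j - snd f1)%Z with (j + -1 * snd f1 + 0 * snd f2)%Z by ring.
      replace (i + fst f2)%Z with (i + 0 * fst f1 + 1 * fst f2)%Z by ring.
      replace (j + snd f2)%Z with (j + 0 * snd f1 + 1 * snd f2)%Z by ring.
      replace (i - fst f2)%Z with (i + 0 * fst f1 + -1 * fst f2)%Z by ring.
      replace (j - snd f2)%Z with (j + 0 * snd f1 + -1 * snd f2)%Z by ring.
      field.
    - split; [apply Hgen; try assumption; rewrite (bform_sym M (toR f2) (toR f1)); lra|]. intros u i j.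
      rewrite (bform_sym M (toR f2) (toR f0)), E1, E2, Hz1, Hz2, (bform_sym M (toR f2) (toR f1)).
      unfold edge_sum, dirs8, lsum.
      match goal with |- context [gc ?a ?b ?c _] =>
        destruct (gc_values a b c) as [[V1 V2] [[V3 V4] [[V5 V6] [V7 V8]]]]; rewrite V1, V2, V3, V4, V5, V6, V7, V8 end.
      unfold zcomb; cbn [fst snd].
      replace (i + (- fst f1 - fst f2))%Z with (i + -1 * fst f2 + -1 * fst f1)%Z by ring.
      replace (j + (- snd f1 - snd f2))%Z with (j + -1 * snd f2 + -1 * snd f1)%Z by ring.
      replace (i - (- fst f1 - fst f2))%Z with (i + 1 * fst f2 + 1 * fst f1)%Z by ring.
      replace (j - (- snd f1 - snd f2))%Z with (j + 1 * snd f2 + 1 * snd f1)%Z by ring.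
      replace (i + fst f1)%Z with (i + 0 * fst f2 + 1 * fst f1)%Z by ring.
      replace (j + snd f1)%Z with (j + 0 * snd f2 + 1 * snd f1)%Z by ring.
      replace (i - fst f1)%Z with (i + 0 * fst f2 + -1 * fst f1)%Z by ring.
      replace (j - snd f1)%Z with (j + 0 * snd f2 + -1 * snd f1)%Z by ring.
      replace (i + fst f2)%Z with (i + 1 * fst f2 + 0 * fst f1)%Z by ring.
      replace (j + snd f2)%Z with (j + 1 * snd f2 + 0 * snd f1)%Z by ring.
      replace (i - fst f2)%Z with (i + -1 * fst f2 + 0 * fst f1)%Z by ring.
      replace (j - snd f2)%Z with (j + -1 * snd f2 + 0 * snd f1)%Z by ring.
      field. }
  unfold zbasis in Hb.
  assert (Hb1 : Z.abs (fst e2 * snd e0 - snd e2 * fst e0) = 1%Z).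
  { replace (fst e0) with (- fst e1 - fst e2)%Z by lia. replace (snd e0) with (- snd e1 - snd e2)%Z by lia.
    rewrite <- Hb. f_equal. ring. }
  assert (Hb2 : Z.abs (fst e0 * snd e1 - snd e0 * fst e1) = 1%Z).
  { replace (fst e0) with (- fst e1 - fst e2)%Z by lia. replace (snd e0) with (- snd e1 - snd e2)%Z by lia.
    rewrite <- Hb. f_equal. ring. }
  set (p0 := bform M (toR e1) (toR e2)) in *. set (p1 := bform M (toR e0) (toR e2)) in *. set (p2 := bform M (toR e0) (toR e1)) in *.
  assert (Hc : (p1 <= p0 /\ p2 <= p0) \/ (p0 <= p1 /\ p2 <= p1) \/ (p0 <= p2 /\ p1 <= p2)) by lra.
  destruct Hc as [[C1 C2]|[[C1 C2]|[C1 C2]]].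
  - destruct (Hmain e0 e1 e2 Hx Hy Hb O3 C2 C1) as [g1 [g2 [G1 G2]]]. exists g1, g2. split; [exact G1|].
    intros u i j. rewrite <- G2. fold p0 p2. reflexivity.
  - destruct (Hmain e1 e2 e0 ltac:(lia) ltac:(lia) Hb1) as [g1 [g2 [G1 G2]]];
    rewrite ?(bform_sym M (toR e2) (toR e0)), ?(bform_sym M (toR e1) (toR e0)); fold p0 p1 p2; try assumption.
    exists g1, g2. split; [exact G1|].
    intros u i j. rewrite <- G2. rewrite ?(bform_sym M (toR e2) (toR e0)), ?(bform_sym M (toR e1) (toR e0)). fold p0 p1 p2. ring.
  - destruct (Hmain e2 e0 e1 ltac:(lia) ltac:(lia) Hb2) as [g1 [g2 [G1 G2]]];
    rewrite ?(bform_sym M (toR e2) (toR e0)), ?(bform_sym M (toR e2) (toR e1)); fold p0 p1 p2; try assumption.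
    exists g1, g2. split; [exact G1|].
    intros u i j. rewrite <- G2. rewrite ?(bform_sym M (toR e2) (toR e0)), ?(bform_sym M (toR e2) (toR e1)). fold p0 p1 p2. ring.
Qed.

Lemma zcomb_zshift k r e1 e2 i j : zcomb (zshift k r) e1 e2 i j = zshift (zcomb k e1 e2 i j) r.
Proof. unfold zcomb, zshift; cbn [fst snd]. f_equal; ring. Qed.

Section Edges.
Context (D : pt -> sym2) (L : R) (n : nat) (HF : fine D L n).
Context (fr : zpt -> zpt * zpt) (Hfr : forall k, FrameAt D n k (fst (fr k)) (snd (fr k))).
(** Directions are read in the frame of [k]. The same lattice edge may have other coordinates, and
    another weight, at its other end. *)
Definition nb (k d : zpt) : zpt := zcomb k (fst (fr k)) (snd (fr k)) (fst d) (snd d).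
Definition cA k := coefA D n k (fst (fr k)).
Definition cB k := coefB D n k (fst (fr k)) (snd (fr k)).
Definition cC k := coefA D n k (snd (fr k)).
Definition de k := deltaD D (hpt n k).
Definition gam (k d : zpt) : R := / 2 * de k * gc (cA k) (cB k) (cC k) d.
Definition hh : R := / INR n.

Lemma frame_coefs k :
  cA k * cC k - cB k * cB k = 1 /\ 0 <= cB k /\ 1 <= 2 * L * (cA k - cB k) /\ 1 <= 2 * L * (cC k - cB k) /\
  cA k <= 2 * L /\ cC k <= 2 * L /\ n1 (toR (fst (fr k))) <= 4 * L /\ n1 (toR (snd (fr k))) <= 4 * L.
Proof using HF Hfr.
  pose proof HF as [HU _]. pose proof HU as [HL [_ [_ [_ [Hell [Hdet _]]]]]].
  pose proof (frame_bounds _ L _ _ HL (Hdet _) (Hell _) (Hfr k)) as H. cbv zeta in H.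
  unfold cA, cB, cC, coefA, coefB. tauto.
Qed.

Lemma de_bounds k : 1 <= L * de k /\ de k <= L.
Proof using HF. destruct HF as [[_ [H _]] _]. apply H. Qed.

Lemma gam_nonneg k d : 0 <= gam k d.
Proof using HF Hfr.
  pose proof (fine_L D L n HF). destruct (de_bounds k). destruct (frame_coefs k) as [_ [HB [HA [HC _]]]].
  unfold gam. apply Rmult_le_pos; [nra|]. unfold gc.
  destruct (_ =? _)%Z; [exact HB|]. destruct (_ =? _)%Z; [nra|]. destruct (_ =? _)%Z; [nra|lra].
Qed.

Lemma hh_small : 0 < hh /\ 10000 * L ^ 8 * hh <= 1.
Proof using HF.
  pose proof (fine_L D L n HF) as HL. destruct (fine_n D L n HF) as [Hn Hnp].
  split; [apply Rinv_0_lt_compat; exact Hnp|].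
  destruct HF as [_ [_ He]]. unfold loceps in He. destruct (big_bounds L HL) as [Hb1 Hb2].
  assert (0 < hh) by (apply Rinv_0_lt_compat; exact Hnp). unfold Rdiv in He. fold hh in He.
  assert (Hb : L <= big L) by (assert (L <= L ^ 3) by (simpl; nra); lra).
  assert (P6 : L ^ 6 <= (4 * big L) ^ 6) by (apply pow_incr; lra).
  assert (0 <= L ^ 6) by (apply pow_le; lra). assert (1 <= L ^ 4) by (apply pow_R1_Rle; lra).
  eapply Rle_trans; [|exact He].
  assert (L ^ 2 <= 128 * L ^ 4 * (4 * big L)).
  { assert (L ^ 2 <= L ^ 4) by (apply Rle_pow; [lra|lia]). nra. }
  replace (10000 * L ^ 8 * hh) with (10000 * L ^ 6 * (L ^ 2 * hh)) by ring.
  apply Rmult_le_compat.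
  - lra.
  - apply Rmult_le_pos; [apply pow_le; lra|lra].
  - lra.
  - apply Rmult_le_compat_r; lra.
Qed.

Lemma metric_shift k r u v : n1 (toR r) <= 8 * L ->
  Rabs (bform (MM D (hpt n (zshift k r))) u v - bform (MM D (hpt n k)) u v) <= 8 * L * L * hh * n1 u * n1 v.
Proof using HF.
  intros Hr. pose proof HF as [[HL [_ [_ [Hlip _]]]] [Hn _]].
  eapply Rle_trans; [apply mclose_bform, Hlip|]. pose proof (n1_pos u). pose proof (n1_pos v).
  apply Rmult_le_compat_r; [assumption|]. apply Rmult_le_compat_r; [assumption|].
  rewrite n1_hpt_sub by exact Hn. unfold zshift; cbn [fst snd].
  replace (fst k + fst r - fst k)%Z with (fst r) by ring. replace (snd k + snd r - snd k)%Z with (snd r) by ring.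
  unfold n1, toR in Hr; cbn [fst snd] in Hr. destruct hh_small as [Hh _]. unfold Rdiv. fold hh.
  replace (8 * L * L * hh) with (L * (8 * L * hh)) by ring. apply Rmult_le_compat_l; [lra|].
  apply Rmult_le_compat_r; lra.
Qed.

Definition evec (k d : zpt) : zpt :=
  (fst d * fst (fst (fr k)) + snd d * fst (snd (fr k)), fst d * snd (fst (fr k)) + snd d * snd (snd (fr k)))%Z.

Lemma nb_evec k d : nb k d = zshift k (evec k d).
Proof using. unfold nb, evec, zcomb, zshift; cbn [fst snd]. f_equal; ring. Qed.

Lemma bform_evec k d d' : bform (MM D (hpt n k)) (toR (evec k d)) (toR (evec k d')) =
  cA k * IZR (fst d) * IZR (fst d') - cB k * (IZR (fst d) * IZR (snd d') + IZR (snd d) * IZR (fst d')) + cC k * IZR (snd d) * IZR (snd d').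
Proof using.
  unfold cA, cB, cC, coefA, coefB. destruct (MM D (hpt n k)) as [[a b] c].
  unfold evec, bform, toR; cbn [fst snd]. rewrite !plus_IZR, !mult_IZR. ring.
Qed.

Lemma evec_surj k v : exists d, v = evec k d.
Proof using Hfr.
  destruct (zcomb_surj (0, 0)%Z (fst (fr k)) (snd (fr k)) v (proj1 (Hfr k))) as [i [j E]].
  exists (i, j). rewrite E. unfold zcomb, evec; cbn [fst snd]. f_equal; ring.
Qed.

Lemma evec_inj k d d' : evec k d = evec k d' -> d = d'.
Proof using Hfr.
  intros E. destruct d as [i j], d' as [i' j'].
  destruct (zcomb_inj (0, 0)%Z (fst (fr k)) (snd (fr k)) i j i' j' (proj1 (Hfr k))) as [-> ->]; [|reflexivity].
  unfold evec in E; cbn [fst snd] in E. unfold zcomb; cbn [fst snd]. injection E as E1 E2. f_equal; lia.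
Qed.

Lemma n1_evec k d : n1 (toR (evec k d)) <= 4 * L * n1 (toR d).
Proof using HF Hfr.
  destruct (frame_coefs k) as [_ [_ [_ [_ [_ [_ [H1 H2]]]]]]].
  unfold n1, evec, toR in *; cbn [fst snd] in *. rewrite !plus_IZR, !mult_IZR.
  set (a := IZR (fst d)). set (b := IZR (snd d)).
  set (x := IZR (fst (fst (fr k)))) in *. set (y := IZR (snd (fst (fr k)))) in *.
  set (z := IZR (fst (snd (fr k)))) in *. set (w := IZR (snd (snd (fr k)))) in *.
  pose proof (Rabs_triang (a * x) (b * z)) as T1. pose proof (Rabs_triang (a * y) (b * w)) as T2.
  rewrite !Rabs_mult in T1, T2. pose proof (Rabs_pos a). pose proof (Rabs_pos b). nra.
Qed.

(* [0] and the endpoint are the only lattice points near the midpoint of a strong edge. *)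
Lemma strong_edge_gap k d v : In d ((1, 0) :: (-1, 0) :: (0, 1) :: (0, -1) :: nil)%Z -> v <> (0, 0)%Z -> v <> d ->
  1 <= 2 * L * (bform (MM D (hpt n k)) (toR (evec k v)) (toR (evec k v)) - bform (MM D (hpt n k)) (toR (evec k v)) (toR (evec k d))).
Proof using HF Hfr.
  intros Hd Hv Hvd. rewrite !bform_evec. destruct (frame_coefs k) as [_ [HB [HA [HC _]]]].
  pose proof (fine_L D L n HF) as HL.
  set (A := cA k) in *. set (B := cB k) in *. set (C := cC k) in *. clearbody A B C.
  destruct v as [i j]. cbn [fst snd].
  assert (Sq : forall z : Z, 0 <= IZR z * IZR z - IZR z /\ 0 <= IZR z * IZR z + IZR z).
  { intros z. rewrite <- mult_IZR, <- minus_IZR, <- plus_IZR. split; apply IZR_le; nia. }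
  (* For each of the four edges the difference is [(A - B) * X + (C - B) * Y + B * Z0] with
     nonnegative integers, the first or the second being at least 1. *)
  assert (K : forall (X Y Z0 : R), 0 <= X -> 0 <= Y -> 0 <= Z0 -> 1 <= X \/ 1 <= Y ->
     1 <= 2 * L * ((A - B) * X + (C - B) * Y + B * Z0)).
  { clear - HA HC HB HL. intros X Y Z0 H1 H2 H3 H4.
    assert (0 <= 2 * L * (B * Z0)) by (apply Rmult_le_pos; [lra|apply Rmult_le_pos; lra]).
    assert (0 <= 2 * L * (A - B) * X) by (apply Rmult_le_pos; lra).
    assert (0 <= 2 * L * (C - B) * Y) by (apply Rmult_le_pos; lra).
    destruct H4; nra. }
  assert (Z2 : forall z : Z, z <> 0%Z -> 1 <= IZR z * IZR z) by (intros z Hz; rewrite <- mult_IZR; apply IZR_le; nia).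
  assert (Z3 : forall z : Z, z <> 0%Z -> z <> 1%Z -> 1 <= IZR z * IZR z - IZR z) by (intros z Hz Hz'; rewrite <- mult_IZR, <- minus_IZR; apply IZR_le; nia).
  assert (Z4 : forall z : Z, z <> 0%Z -> z <> (-1)%Z -> 1 <= IZR z * IZR z + IZR z) by (intros z Hz Hz'; rewrite <- mult_IZR, <- plus_IZR; apply IZR_le; nia).
  destruct (Sq i) as [I1 I2]. destruct (Sq j) as [J1 J2]. destruct (Sq (i - j)%Z) as [D1 D2]. rewrite minus_IZR in D1, D2.
  assert (S1 : 0 <= IZR i * IZR i) by nra. assert (S2 : 0 <= IZR j * IZR j) by nra.
  destruct Hd as [<-|[<-|[<-|[<-|[]]]]]; cbn [fst snd].
  - replace (A * IZR i * IZR i - B * (IZR i * IZR j + IZR j * IZR i) + C * IZR j * IZR j - (A * IZR i * 1 - B * (IZR i * 0 + IZR j * 1) + C * IZR j * 0))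
      with ((A - B) * (IZR i * IZR i - IZR i) + (C - B) * (IZR j * IZR j) + B * ((IZR i - IZR j) * (IZR i - IZR j) - (IZR i - IZR j))) by ring.
    apply K; try assumption. destruct (Z.eq_dec j 0) as [->|Hj]; [left; apply Z3; congruence|right; apply Z2, Hj].
  - replace (A * IZR i * IZR i - B * (IZR i * IZR j + IZR j * IZR i) + C * IZR j * IZR j - (A * IZR i * -1 - B * (IZR i * 0 + IZR j * -1) + C * IZR j * 0))
      with ((A - B) * (IZR i * IZR i + IZR i) + (C - B) * (IZR j * IZR j) + B * ((IZR i - IZR j) * (IZR i - IZR j) + (IZR i - IZR j))) by ring.
    apply K; try assumption. destruct (Z.eq_dec j 0) as [->|Hj]; [left; apply Z4; congruence|right; apply Z2, Hj].
  - replace (A * IZR i * IZR i - B * (IZR i * IZR j + IZR j * IZR i) + C * IZR j * IZR j - (A * IZR i * 0 - B * (IZR i * 1 + IZR j * 0) + C * IZR j * 1))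
      with ((A - B) * (IZR i * IZR i) + (C - B) * (IZR j * IZR j - IZR j) + B * ((IZR i - IZR j) * (IZR i - IZR j) + (IZR i - IZR j))) by ring.
    apply K; try assumption. destruct (Z.eq_dec i 0) as [->|Hi]; [right; apply Z3; congruence|left; apply Z2, Hi].
  - replace (A * IZR i * IZR i - B * (IZR i * IZR j + IZR j * IZR i) + C * IZR j * IZR j - (A * IZR i * 0 - B * (IZR i * -1 + IZR j * 0) + C * IZR j * -1))
      with ((A - B) * (IZR i * IZR i) + (C - B) * (IZR j * IZR j + IZR j) + B * ((IZR i - IZR j) * (IZR i - IZR j) - (IZR i - IZR j))) by ring.
    apply K; try assumption. destruct (Z.eq_dec i 0) as [->|Hi]; [right; apply Z4; congruence|left; apply Z2, Hi].
Qed.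

(** The gap of [strong_edge_gap] survives a change of the metric of order h. Tested in the new frame
    against its six superbase vectors, it forces the old edge to be one of these, with a weight
    bounded below. The edge may become a diagonal of the new frame, which is why [d'] ranges over
    more than the four sides. *)
Lemma strong_edge_persists k r d : In d ((1, 0) :: (-1, 0) :: (0, 1) :: (0, -1) :: nil)%Z -> n1 (toR r) <= 8 * L ->
  exists d', In d' dirs8 /\ evec (zshift k r) d' = evec k d /\ 1 <= 8 * L * L * gam (zshift k r) d'.
Proof using HF Hfr.
  intros Hd Hr. set (k' := zshift k r). destruct (evec_surj k' (evec k d)) as [[i j] E].
  pose proof (fine_L D L n HF) as HL. destruct (de_bounds k') as [De1 De2].
  destruct (frame_coefs k') as [_ [HB [HA [HC _]]]].
  destruct hh_small as [Hh1 Hh2].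
  assert (Hgap : forall v, In v ((1, 0) :: (-1, 0) :: (0, 1) :: (0, -1) :: (1, 1) :: (-1, -1) :: nil)%Z -> v <> (i, j) ->
    1 <= 4 * L * (bform (MM D (hpt n k')) (toR (evec k' v)) (toR (evec k' v)) - bform (MM D (hpt n k')) (toR (evec k' v)) (toR (evec k' (i, j))))).
  { intros v Hv Hne. rewrite <- E. destruct (evec_surj k (evec k' v)) as [w Ew].
    assert (Hw0 : w <> (0, 0)%Z).
    { intros ->. assert (v = (0, 0)%Z) by (apply (evec_inj k'); rewrite Ew; unfold evec; cbn [fst snd]; f_equal; ring).
      subst v. simpl in Hv. intuition congruence. }
    assert (Hwd : w <> d).
    { intros ->. apply Hne. apply (evec_inj k'). congruence. }
    pose proof (strong_edge_gap k d w Hd Hw0 Hwd) as G. rewrite <- Ew in G.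
    set (p := toR (evec k' v)) in *. set (q := toR (evec k d)) in *.
    assert (Np : n1 p <= 8 * L).
    { unfold p. eapply Rle_trans; [apply n1_evec|].
      assert (n1 (toR v) <= 2); [|nra].
      unfold n1, toR. simpl in Hv. destruct Hv as [<-|[<-|[<-|[<-|[<-|[<-|[]]]]]]]; cbn [fst snd];
       rewrite ?Rabs_R0, ?Rabs_R1, ?(Rabs_left (-1)) by lra; lra. }
    assert (Nq : n1 q <= 4 * L).
    { unfold q. eapply Rle_trans; [apply n1_evec|].
      assert (n1 (toR d) <= 1); [|nra].
      unfold n1, toR. simpl in Hd. destruct Hd as [<-|[<-|[<-|[<-|[]]]]]; cbn [fst snd];
       rewrite ?Rabs_R0, ?Rabs_R1, ?(Rabs_left (-1)) by lra; lra. }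
    pose proof (metric_shift k r p p Hr) as M1. pose proof (metric_shift k r p q Hr) as M2. fold k' in M1, M2.
    apply Rabs_le_inv in M1. apply Rabs_le_inv in M2. pose proof (n1_pos p). pose proof (n1_pos q).
    assert (HL2h : 0 < 8 * L * L * hh) by (repeat apply Rmult_lt_0_compat; lra).
    assert (T : forall x y, 0 <= x <= 8 * L -> 0 <= y <= 8 * L -> 8 * L * L * hh * x * y <= 512 * L ^ 4 * hh).
    { intros x y [X1 X2] [Y1 Y2]. replace (512 * L ^ 4 * hh) with (8 * L * L * hh * (8 * L) * (8 * L)) by ring.
      apply Rmult_le_compat; try lra; [apply Rmult_le_pos; lra|]. apply Rmult_le_compat_l; lra. }
    pose proof (T (n1 p) (n1 p) ltac:(lra) ltac:(lra)). pose proof (T (n1 p) (n1 q) ltac:(lra) ltac:(lra)).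
    assert (Hsm : 4 * L * (1024 * L ^ 4 * hh) <= 1).
    { replace (4 * L * (1024 * L ^ 4 * hh)) with (4096 * L ^ 5 * hh) by ring.
      assert (L ^ 5 <= L ^ 8) by (apply Rle_pow; [lra|lia]). assert (1 <= L ^ 5) by (apply pow_R1_Rle; lra).
      assert (L ^ 5 * hh <= L ^ 8 * hh) by (apply Rmult_le_compat_r; lra). nra. }
    set (g := bform (MM D (hpt n k)) p p - bform (MM D (hpt n k)) p q) in *.
    set (g' := bform (MM D (hpt n k')) p p - bform (MM D (hpt n k')) p q).
    assert (g - 1024 * L ^ 4 * hh <= g') by (unfold g, g'; lra).
    nra. }
  assert (Hform : forall a b, In (a, b) ((1, 0) :: (-1, 0) :: (0, 1) :: (0, -1) :: (1, 1) :: (-1, -1) :: nil)%Z -> (a, b) <> (i, j) ->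
    1 <= 4 * L * - (cA k' * IZR a * (IZR i - IZR a) - cB k' * (IZR a * (IZR j - IZR b) + IZR b * (IZR i - IZR a)) + cC k' * IZR b * (IZR j - IZR b))).
  { intros a b Hin Hne. specialize (Hgap _ Hin Hne). rewrite !bform_evec in Hgap. cbn [fst snd] in Hgap.
    replace (- (cA k' * IZR a * (IZR i - IZR a) - cB k' * (IZR a * (IZR j - IZR b) + IZR b * (IZR i - IZR a)) + cC k' * IZR b * (IZR j - IZR b)))
    with (cA k' * IZR a * IZR a - cB k' * (IZR a * IZR b + IZR b * IZR a) + cC k' * IZR b * IZR b -
      (cA k' * IZR a * IZR i - cB k' * (IZR a * IZR j + IZR b * IZR i) + cC k' * IZR b * IZR j)) by ring. exact Hgap. }
  clear Hgap.
  set (A := cA k') in *. set (B := cB k') in *. set (C := cC k') in *.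
  assert (PA : 0 < A - B) by (clear - HA HL; nra). assert (PC : 0 < C - B) by (clear - HC HL; nra).
  assert (Hneg : forall x, 1 <= 4 * L * - x -> 0 <= x -> False) by (clear - HL; intros; nra).
  assert (Hmul : forall x y, 0 <= x -> 0 <= y -> 0 <= x * y) by (intros; apply Rmult_le_pos; assumption).
  assert (Hij : (i, j) <> (0, 0)%Z).
  { intros E0. injection E0 as -> ->. assert (d = (0, 0)%Z).
    { apply (evec_inj k). rewrite E. unfold evec; cbn [fst snd]. f_equal; ring. }
    subst d. simpl in Hd. intuition congruence. }
  assert (Hin : forall a b, (a, b) <> (i, j) -> (i, j) <> (a, b)) by congruence.
  (* For any other (i, j) the signs of i and j select one of the six vectors whose product with the
     remainder is nonnegative, which contradicts the gap. *)
  assert (Hcases : ((i = 1 /\ j = 0) \/ (i = -1 /\ j = 0) \/ (i = 0 /\ j = 1) \/ (i = 0 /\ j = -1) \/ (i = 1 /\ j = 1) \/ (i = -1 /\ j = -1))%Z).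
  { apply NNPP. intros Hno.
    assert (Hg : forall a b, In (a, b) ((1, 0) :: (-1, 0) :: (0, 1) :: (0, -1) :: (1, 1) :: (-1, -1) :: nil)%Z ->
       0 <= A * IZR a * (IZR i - IZR a) - B * (IZR a * (IZR j - IZR b) + IZR b * (IZR i - IZR a)) + C * IZR b * (IZR j - IZR b) -> False).
    { intros a b Hi. apply Hneg, Hform; [exact Hi|]. intros Heq. injection Heq as <- <-. apply Hno.
      simpl in Hi. destruct Hi as [Hi|[Hi|[Hi|[Hi|[Hi|[Hi|[]]]]]]]; injection Hi as <- <-; tauto. }
    assert (IZl : forall x y : Z, (x <= y)%Z -> IZR x <= IZR y) by (intros; apply IZR_le; assumption).
    destruct (Z_lt_le_dec 0 i) as [Hi|Hi].
    - pose proof (IZl 1%Z i ltac:(lia)). destruct (Z_lt_le_dec 0 j) as [Hj|Hj].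
      + pose proof (IZl 1%Z j ltac:(lia)). apply (Hg 1%Z 1%Z); [simpl; tauto|].
        pose proof (Hmul (A - B) (IZR i - 1) ltac:(lra) ltac:(lra)). pose proof (Hmul (C - B) (IZR j - 1) ltac:(lra) ltac:(lra)). lra.
      + pose proof (IZl j 0%Z ltac:(lia)). apply (Hg 1%Z 0%Z); [simpl; tauto|].
        pose proof (Hmul A (IZR i - 1) ltac:(lra) ltac:(lra)). pose proof (Hmul B (- IZR j) ltac:(lra) ltac:(lra)). lra.
    - destruct (Z_lt_le_dec i 0) as [Hi'|Hi'].
      + pose proof (IZl i (-1)%Z ltac:(lia)). destruct (Z_lt_le_dec j 0) as [Hj|Hj].
        * pose proof (IZl j (-1)%Z ltac:(lia)). apply (Hg (-1)%Z (-1)%Z); [simpl; tauto|].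
          pose proof (Hmul (A - B) (- IZR i - 1) ltac:(lra) ltac:(lra)). pose proof (Hmul (C - B) (- IZR j - 1) ltac:(lra) ltac:(lra)). lra.
        * pose proof (IZl 0%Z j ltac:(lia)). apply (Hg (-1)%Z 0%Z); [simpl; tauto|].
          pose proof (Hmul A (- IZR i - 1) ltac:(lra) ltac:(lra)). pose proof (Hmul B (IZR j) ltac:(lra) ltac:(lra)). lra.
      + assert (i = 0%Z) by lia. subst i. destruct (Z_lt_le_dec 0 j) as [Hj|Hj].
        * pose proof (IZl 1%Z j ltac:(lia)). apply (Hg 0%Z 1%Z); [simpl; tauto|].
          pose proof (Hmul C (IZR j - 1) ltac:(lra) ltac:(lra)). lra.
        * assert (Hj' : (j <> 0)%Z) by (intros ->; apply Hij; reflexivity).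
          pose proof (IZl j (-1)%Z ltac:(lia)). apply (Hg 0%Z (-1)%Z); [simpl; tauto|].
          pose proof (Hmul C (- IZR j - 1) ltac:(lra) ltac:(lra)). lra. }
  exists (i, j). split; [simpl; destruct Hcases as [[-> ->]|[[-> ->]|[[-> ->]|[[-> ->]|[[-> ->]|[-> ->]]]]]]; tauto|].
  split; [symmetry; exact E|].
  assert (Hg : 1 <= 4 * L * gc A B C (i, j)).
  { destruct Hcases as [[-> ->]|[[-> ->]|[[-> ->]|[[-> ->]|[[-> ->]|[-> ->]]]]]]; unfold gc; cbn [fst snd Z.eqb Z.mul Pos.mul Pos.eqb].
    1-4: lra.
    (* For the diagonal, the test against (1, 0) reads 1 <= 4 L B. *)
    - pose proof (Hform 1%Z 0%Z ltac:(simpl; tauto) ltac:(congruence)). lra.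
    - pose proof (Hform (-1)%Z 0%Z ltac:(simpl; tauto) ltac:(congruence)). lra. }
  unfold gam. fold A B C. set (g := gc A B C (i, j)) in *. clear - Hg De1 HL.
  set (a := L * de k') in *. replace (8 * L * L * (/ 2 * de k' * g)) with (a * (4 * L * g)) by (unfold a; field). nra.
Qed.

Context (U : zpt -> R).
Definition dU (k d : zpt) : R := (U (nb k d) - U k) ^ 2.
Definition sten (k : zpt) : R := lsum dirs8 (fun d => gam k d * dU k d).

Lemma dU_nonneg k d : 0 <= dU k d.
Proof using. apply pow2_ge_0. Qed.

Lemma sten_nonneg k : 0 <= sten k.
Proof using HF Hfr. apply lsum_nonneg. intros. apply Rmult_le_pos; [apply gam_nonneg|apply dU_nonneg]. Qed.

Lemma strong_diff_bound k r d : In d ((1, 0) :: (-1, 0) :: (0, 1) :: (0, -1) :: nil)%Z -> n1 (toR r) <= 8 * L ->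
  (U (zshift (zshift k r) (evec k d)) - U (zshift k r)) ^ 2 <= 8 * L * L * sten (zshift k r).
Proof using HF Hfr.
  intros Hd Hr. destruct (strong_edge_persists k r d Hd Hr) as [d' [Hin [E Hg]]].
  rewrite <- E, <- nb_evec. fold (dU (zshift k r) d').
  pose proof (lsum_ge_term dirs8 (fun d => gam (zshift k r) d * dU (zshift k r) d) d'
    (fun y _ => Rmult_le_pos _ _ (gam_nonneg _ y) (dU_nonneg _ y)) Hin) as T. fold (sten (zshift k r)) in T.
  pose proof (dU_nonneg (zshift k r) d'). pose proof (fine_L D L n HF).
  apply Rle_trans with (8 * L * L * (gam (zshift k r) d' * dU (zshift k r) d')).
  - replace (8 * L * L * (gam (zshift k r) d' * dU (zshift k r) d')) with ((8 * L * L * gam (zshift k r) d') * dU (zshift k r) d') by ring. nra.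
  - apply Rmult_le_compat_l; [nra|exact T].
Qed.

Definition boxL : list zpt := zbox (up (8 * L)).

Lemma in_boxL r : n1 (toR r) <= 8 * L -> In r boxL.
Proof using HF.
  intros Hr. pose proof (fine_L D L n HF). unfold boxL. apply in_zbox.
  - apply le_IZR. destruct (archimed (8 * L)). lra.
  - unfold n1, toR in Hr; cbn [fst snd] in Hr. pose proof (Rabs_pos (IZR (fst r))). pose proof (Rabs_pos (IZR (snd r))).
    split; apply abs_IZR_le_iff; lra.
Qed.

(** The weight of a diagonal may vanish, so its increment is split into two side increments. The
    second starts at a neighbour, where by [strong_edge_persists] it is again controlled by the
    stencil there; hence the sum over a box. Four sides cost 8 L^2 each and four diagonals 32 L^2
    each. *)
Lemma local_energy_bound k : lsum dirs8 (dU k) <= 250 * L * L * lsum boxL (fun r => sten (zshift k r)).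
Proof using HF Hfr.
  pose proof (fine_L D L n HF) as HL.
  set (S := lsum boxL (fun r => sten (zshift k r))).
  assert (HS : forall r, n1 (toR r) <= 8 * L -> sten (zshift k r) <= S).
  { intros r Hr. apply (lsum_ge_term boxL (fun r => sten (zshift k r))); [intros; apply sten_nonneg|apply in_boxL, Hr]. }
  assert (H1 : forall r d, In d ((1, 0) :: (-1, 0) :: (0, 1) :: (0, -1) :: nil)%Z -> n1 (toR r) <= 8 * L ->
    (U (zshift (zshift k r) (evec k d)) - U (zshift k r)) ^ 2 <= 8 * L * L * S).
  { intros r d Hd Hr. eapply Rle_trans; [apply (strong_diff_bound k r d Hd Hr)|]. apply Rmult_le_compat_l; [nra|apply HS, Hr]. }
  assert (Z0 : n1 (toR (0, 0)%Z) <= 8 * L) by (unfold n1, toR; cbn [fst snd]; rewrite Rabs_R0; lra).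
  assert (Sh0 : zshift k (0, 0)%Z = k) by (destruct k; unfold zshift; cbn [fst snd]; f_equal; ring).
  assert (H0 : forall d, In d ((1, 0) :: (-1, 0) :: (0, 1) :: (0, -1) :: nil)%Z -> dU k d <= 8 * L * L * S).
  { intros d Hd. unfold dU. rewrite nb_evec. pose proof (H1 (0, 0)%Z d Hd Z0) as K. rewrite Sh0 in K. exact K. }
  assert (Hs : forall d, In d ((1, 0) :: (-1, 0) :: (0, 1) :: (0, -1) :: nil)%Z -> n1 (toR (evec k d)) <= 8 * L).
  { intros d Hd. eapply Rle_trans; [apply n1_evec|]. assert (n1 (toR d) <= 1); [|nra].
    unfold n1, toR. simpl in Hd. destruct Hd as [<-|[<-|[<-|[<-|[]]]]]; cbn [fst snd];
       rewrite ?Rabs_R0, ?Rabs_R1, ?(Rabs_left (-1)) by lra; lra. }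
  assert (H2 : forall d d' e, In d ((1, 0) :: (-1, 0) :: (0, 1) :: (0, -1) :: nil)%Z -> In d' ((1, 0) :: (-1, 0) :: (0, 1) :: (0, -1) :: nil)%Z ->
     e = zshift d d' -> dU k e <= 32 * L * L * S).
  { intros d d' e Hd Hd' ->. pose proof (H0 d Hd) as K1. pose proof (H1 (evec k d) d' Hd' (Hs d Hd)) as K2.
    unfold dU in *. rewrite nb_evec in *.
    replace (zshift k (evec k (zshift d d'))) with (zshift (zshift k (evec k d)) (evec k d')) by
      (unfold zshift, evec; cbn [fst snd]; f_equal; ring).
    set (x := U (zshift (zshift k (evec k d)) (evec k d'))) in *. set (y := U (zshift k (evec k d))) in *.
    pose proof (pow2_ge_0 ((x - y) - (y - U k))). nra. }
  unfold dirs8, lsum.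
  pose proof (H0 (1, 0)%Z ltac:(simpl; tauto)). pose proof (H0 (-1, 0)%Z ltac:(simpl; tauto)).
  pose proof (H0 (0, 1)%Z ltac:(simpl; tauto)). pose proof (H0 (0, -1)%Z ltac:(simpl; tauto)).
  pose proof (H2 (1, 0)%Z (0, 1)%Z (1, 1)%Z ltac:(simpl; tauto) ltac:(simpl; tauto) eq_refl).
  pose proof (H2 (-1, 0)%Z (0, -1)%Z (-1, -1)%Z ltac:(simpl; tauto) ltac:(simpl; tauto) eq_refl).
  pose proof (H2 (1, 0)%Z (0, -1)%Z (1, -1)%Z ltac:(simpl; tauto) ltac:(simpl; tauto) eq_refl).
  pose proof (H2 (-1, 0)%Z (0, 1)%Z (-1, 1)%Z ltac:(simpl; tauto) ltac:(simpl; tauto) eq_refl).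
  assert (0 <= S) by (apply lsum_nonneg; intros; apply sten_nonneg).
  assert (0 <= L * L * S) by (apply Rmult_le_pos; nra).
  lra.
Qed.
End Edges.

(** * Lattice triangles *)

Definition zsub (k k' : zpt) : zpt := (fst k - fst k', snd k - snd k')%Z.

Definition area2 (p p' : zpt) (X : pt) : R := crossv (zsub p' p) (vsub X (toR p)).
Definition tdet (a b c : zpt) : Z := zdet (zsub b a) (zsub c a).

Lemma area2_line p p' X : area2 p p' X = crossv (zsub p' p) X - IZR (zdet (zsub p' p) p).
Proof. unfold area2, crossv, zsub, zdet, vsub, toR; cbn [fst snd]. rewrite !minus_IZR, !mult_IZR, !minus_IZR. ring. Qed.

Lemma area2_sum a b c X : area2 b c X + area2 c a X + area2 a b X = IZR (tdet a b c).
Proof. unfold area2, tdet, crossv, zsub, zdet, vsub, toR; cbn [fst snd]. rewrite !minus_IZR, !mult_IZR, !minus_IZR. ring. Qed.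

Lemma area2_combination a b c X :
  vadd (vscale (area2 b c X) (toR a)) (vadd (vscale (area2 c a X) (toR b)) (vscale (area2 a b X) (toR c))) =
  vscale (IZR (tdet a b c)) X.
Proof.
  unfold area2, tdet, crossv, zsub, zdet, vsub, vadd, vscale, toR; cbn [fst snd].
  rewrite !minus_IZR, !mult_IZR, !minus_IZR. f_equal; ring.
Qed.

Lemma area2_move p p' X Y r : Rabs (fst X - fst Y) <= r -> Rabs (snd X - snd Y) <= r ->
  Rabs (area2 p p' X - area2 p p' Y) <= n1 (toR (zsub p' p)) * r.
Proof.
  intros H1 H2. unfold area2, n1, crossv, toR, vsub; cbn [fst snd]. set (v := zsub p' p).
  replace (IZR (fst v) * (snd X - IZR (snd p)) - IZR (snd v) * (fst X - IZR (fst p)) -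
    (IZR (fst v) * (snd Y - IZR (snd p)) - IZR (snd v) * (fst Y - IZR (fst p))))
   with (IZR (fst v) * (snd X - snd Y) + - (IZR (snd v) * (fst X - fst Y))) by ring.
  eapply Rle_trans; [apply Rabs_triang|]. rewrite Rabs_Ropp, !Rabs_mult, Rmult_plus_distr_r.
  apply Rplus_le_compat; apply Rmult_le_compat_l; try apply Rabs_pos; assumption.
Qed.

Lemma lsum_two {T} (l : list T) f x y : NoDup l -> In x l -> In y l -> x <> y ->
  (forall z, In z l -> z <> x -> z <> y -> f z = 0) -> lsum l f = f x + f y.
Proof.
  intros Hnd Hx Hy Hxy H.
  rewrite (lsum_split l f (fun z => if excluded_middle_informative (z = x) then f x else 0)).
  rewrite (lsum_one l _ x Hnd Hx).
  - destruct (excluded_middle_informative (x = x)); [|congruence]. f_equal.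
    rewrite (lsum_one l _ y Hnd Hy).
    + destruct (excluded_middle_informative (y = x)); [congruence|ring].
    + intros z Hz Hzy. destruct (excluded_middle_informative (z = x)) as [->|Hzx]; [ring|]. rewrite H by assumption. ring.
  - intros z Hz Hzx. destruct (excluded_middle_informative (z = x)); [contradiction|reflexivity].
Qed.

Lemma dirs8_NoDup : NoDup dirs8.
Proof. unfold dirs8. repeat constructor; simpl; intuition congruence. Qed.

Lemma in_dirs8 x y : (Z.abs x <= 1)%Z -> (Z.abs y <= 1)%Z -> (x, y) <> (0, 0)%Z -> In (x, y) dirs8.
Proof.
  intros Hx Hy Hn. assert (Cx : (x = 0 \/ x = 1 \/ x = -1)%Z) by lia. assert (Cy : (y = 0 \/ y = 1 \/ y = -1)%Z) by lia.
  unfold dirs8. simpl. destruct Cx as [->|[->| ->]], Cy as [->|[->| ->]]; tauto.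
Qed.

Lemma perp_n1 u : n1 (perp u) = n1 u.
Proof. unfold n1, perp; cbn [fst snd]. rewrite Rabs_Ropp. ring. Qed.

(* The P1 stiffness identity on a lattice triangle of determinant +-1. *)
Lemma gradient_energy (S : sym2) (g : pt) (a b c : zpt) ua ub uc : (tdet a b c * tdet a b c = 1)%Z ->
  dot g (toR (zsub b a)) = ub - ua -> dot g (toR (zsub c a)) = uc - ua ->
  bform S g g =
   bform S (perp (toR (zsub b a))) (perp (toR (zsub c a))) * (uc - ub) ^ 2 +
   bform S (perp (toR (zsub a b))) (perp (toR (zsub c b))) * (uc - ua) ^ 2 +
   bform S (perp (toR (zsub a c))) (perp (toR (zsub b c))) * (ub - ua) ^ 2.
Proof.
  intros Hd H1 H2. apply (f_equal IZR) in Hd. rewrite mult_IZR in Hd.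
  replace (uc - ub) with ((uc - ua) - (ub - ua)) by ring. rewrite <- H1, <- H2.
  assert (E : IZR (tdet a b c) = IZR (fst b - fst a) * IZR (snd c - snd a) - IZR (snd b - snd a) * IZR (fst c - fst a)).
  { unfold tdet, zdet, zsub; cbn [fst snd]. rewrite minus_IZR, !mult_IZR. reflexivity. }
  rewrite E in Hd. destruct S as [[p q] r], g as [g1 g2].
  unfold bform, perp, dot, toR, zsub; cbn [fst snd] in *.
  replace (fst a - fst b)%Z with (- (fst b - fst a))%Z by ring. replace (snd a - snd b)%Z with (- (snd b - snd a))%Z by ring.
  replace (fst a - fst c)%Z with (- (fst c - fst a))%Z by ring. replace (snd a - snd c)%Z with (- (snd c - snd a))%Z by ring.
  replace (fst c - fst b)%Z with ((fst c - fst a) - (fst b - fst a))%Z by ring. replace (snd c - snd b)%Z with ((snd c - snd a) - (snd b - snd a))%Z by ring.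
  replace (fst b - fst c)%Z with ((fst b - fst a) - (fst c - fst a))%Z by ring. replace (snd b - snd c)%Z with ((snd b - snd a) - (snd c - snd a))%Z by ring.
  rewrite !opp_IZR, (minus_IZR (fst c - fst a)), (minus_IZR (snd c - snd a)), (minus_IZR (fst b - fst a) (fst c - fst a)), (minus_IZR (snd b - snd a) (snd c - snd a)).
  set (x1 := IZR (fst b - fst a)) in *. set (y1 := IZR (snd b - snd a)) in *. set (x2 := IZR (fst c - fst a)) in *. set (y2 := IZR (snd c - snd a)) in *.
  transitivity ((p * g1 * g1 + q * (g1 * g2 + g2 * g1) + r * g2 * g2) * ((x1 * y2 - y1 * x2) * (x1 * y2 - y1 * x2))); [rewrite Hd; ring|ring].
Qed.

Section Triangles.
Context (D : pt -> sym2) (L : R) (n : nat) (HF : fine D L n).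
Context (T : tri -> Prop) (HT : isADT D n T).

Definition unscale (X : pt) : pt := vscale (/ INR n) X.
Definition inTri (t : tri) (X : pt) : Prop := tri_set n t (unscale X).
(** Edge vectors of the triangulation have coordinates at most 4 L in absolute value, so a point
    that is [Good] for this bound is off every edge. *)
Definition VL : Z := up (4 * L).

Lemma unscale_vscale x : unscale (vscale (INR n) x) = x.
Proof using HF.
  destruct (fine_n D L n HF) as [_ Hn]. destruct x. unfold unscale, vscale; cbn [fst snd]. f_equal; field; lra.
Qed.
Lemma vscale_unscale X : vscale (INR n) (unscale X) = X.
Proof using HF.
  destruct (fine_n D L n HF) as [_ Hn]. destruct X. unfold unscale, vscale; cbn [fst snd]. f_equal; field; lra.
Qed.

Lemma insq_det_cases (a1 b1 a2 b2 a3 b3 : Z) : insq a1 -> insq b1 -> insq a2 -> insq b2 -> insq a3 -> insq b3 ->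
  ((a2 - a1) * (b3 - b1) - (b2 - b1) * (a3 - a1) <> 0 ->
   ((a2 - a1) * (b3 - b1) - (b2 - b1) * (a3 - a1)) * ((a2 - a1) * (b3 - b1) - (b2 - b1) * (a3 - a1)) = 1)%Z.
Proof using.
  intros [-> | ->] [-> | ->] [-> | ->] [-> | ->] [-> | ->] [-> | ->]; simpl; congruence.
Qed.

Lemma tdet_zcomb k0 e1 e2 i1 j1 i2 j2 i3 j3 : zdet e1 e2 = 1%Z ->
  tdet (zcomb k0 e1 e2 i1 j1) (zcomb k0 e1 e2 i2 j2) (zcomb k0 e1 e2 i3 j3) =
  ((i2 - i1) * (j3 - j1) - (j2 - j1) * (i3 - i1))%Z.
Proof using.
  intros Hd. transitivity (((i2 - i1) * (j3 - j1) - (j2 - j1) * (i3 - i1)) * zdet e1 e2)%Z; [|rewrite Hd; ring].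
  unfold tdet, zdet, zsub, zcomb; cbn [fst snd]. ring.
Qed.

Lemma tri_nondeg_tdet a b c : tri_nondeg n (a, b, c) -> tdet a b c <> 0%Z.
Proof using HF.
  destruct (fine_n D L n HF) as [_ Hn]. unfold tri_nondeg. intros H E. apply H.
  apply (f_equal IZR) in E. unfold tdet, zdet, zsub in E; cbn [fst snd] in E. rewrite minus_IZR, !mult_IZR, !minus_IZR in E.
  unfold vsub, hpt; cbn [fst snd].
  match type of E with ?l = _ => transitivity (l / (INR n * INR n)); [field; lra|rewrite E; field; lra] end.
Qed.

Lemma tri_owner a b c : T (a, b, c) -> exists q, isVorVertex D n q /\ inVor D n a q /\ inVor D n b q /\ inVor D n c q.
Proof using HT. intros Ht. destruct HT as [H _]. destruct (H _ Ht) as [_ [q [Hq Hv]]]. exists q. split; [exact Hq|exact Hv]. Qed.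

(** The vertices are corners of one unit square of a lattice basis, and a nondegenerate triangle
    among such corners has determinant 1 or -1. *)
Lemma tri_unimodular a b c : T (a, b, c) -> (tdet a b c * tdet a b c = 1)%Z.
Proof using HT HF.
  intros Ht. destruct (tri_owner _ _ _ Ht) as [q [Hq [Ha [Hb Hc]]]].
  destruct (vertex_own_square D L n HF q Hq) as [k0 [e1 [e2 [i0 [j0 [Hd HS]]]]]].
  pose proof (tri_nondeg_tdet a b c (proj1 (proj1 HT _ Ht))) as Hne.
  destruct (HS a Ha) as [a1 [b1 [A1 [B1 ->]]]]. destruct (HS b Hb) as [a2 [b2 [A2 [B2 ->]]]]. destruct (HS c Hc) as [a3 [b3 [A3 [B3 ->]]]].
  rewrite tdet_zcomb in * by exact Hd.
  pose proof (insq_det_cases a1 b1 a2 b2 a3 b3 A1 B1 A2 B2 A3 B3) as K.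
  replace (a2 + i0 - (a1 + i0))%Z with (a2 - a1)%Z in * by ring. replace (b3 + j0 - (b1 + j0))%Z with (b3 - b1)%Z in * by ring.
  replace (b2 + j0 - (b1 + j0))%Z with (b2 - b1)%Z in * by ring. replace (a3 + i0 - (a1 + i0))%Z with (a3 - a1)%Z in * by ring.
  exact (K Hne).
Qed.

Lemma cell_diff k k' q : inVor D n k q -> inVor D n k' q ->
  Rabs (IZR (fst (zsub k' k))) <= 4 * L /\ Rabs (IZR (snd (zsub k' k))) <= 4 * L.
Proof using HF.
  intros H H'. destruct (inVor_near D L n HF k q H) as [A1 A2]. destruct (inVor_near D L n HF k' q H') as [A3 A4].
  apply Rabs_le_inv in A1. apply Rabs_le_inv in A2. apply Rabs_le_inv in A3. apply Rabs_le_inv in A4.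
  unfold zsub; cbn [fst snd]. rewrite !minus_IZR. split; apply Rabs_le; lra.
Qed.

Lemma tri_edge a b c p p' : T (a, b, c) -> tri_vert (a, b, c) p -> tri_vert (a, b, c) p' ->
  Rabs (IZR (fst (zsub p' p))) <= 4 * L /\ Rabs (IZR (snd (zsub p' p))) <= 4 * L.
Proof using HT HF.
  intros Ht Hp Hp'. destruct (tri_owner _ _ _ Ht) as [q [Hq [Ha [Hb Hc]]]].
  apply (cell_diff p p' q); [destruct Hp as [->|[->| ->]]|destruct Hp' as [->|[->| ->]]]; assumption.
Qed.

Lemma inTri_hull a b c q X : inVor D n a q -> inVor D n b q -> inVor D n c q -> inTri (a, b, c) X -> hull n (cellpts D n q) (unscale X).
Proof using.
  intros Ha Hb Hc HX. eapply inconv_mono; [|exact HX]. intros p [->|[->| ->]]; [exists a|exists b|exists c]; auto.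
Qed.

Lemma tri_near a b c p X : T (a, b, c) -> inTri (a, b, c) X -> tri_vert (a, b, c) p ->
  Rabs (fst X - IZR (fst p)) <= 4 * L /\ Rabs (snd X - IZR (snd p)) <= 4 * L.
Proof using HT HF.
  intros Ht HX Hp. destruct (tri_owner _ _ _ Ht) as [q [Hq [Ha [Hb Hc]]]].
  destruct (hull_near D L n HF q _ (inTri_hull _ _ _ _ _ Ha Hb Hc HX)) as [A1 A2].
  assert (Hpq : inVor D n p q) by (destruct Hp as [->|[->| ->]]; assumption).
  destruct (inVor_near D L n HF p q Hpq) as [A3 A4].
  pose proof (vscale_unscale X) as E.
  change (INR n * fst (unscale X)) with (fst (vscale (INR n) (unscale X))) in A1.
  change (INR n * snd (unscale X)) with (snd (vscale (INR n) (unscale X))) in A2. rewrite E in A1, A2.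
  apply Rabs_le_inv in A1. apply Rabs_le_inv in A2. apply Rabs_le_inv in A3. apply Rabs_le_inv in A4.
  split; apply Rabs_le; lra.
Qed.

(** Multiplication by the determinant stands for division by it, as it is 1 or -1; the sign makes
    the coordinates independent of the orientation. *)
Definition bary (a b c : zpt) (X : pt) : R := IZR (tdet a b c) * area2 b c X.
Definition pos_bary (t : tri) (X : pt) : Prop :=
  let '(a, b, c) := t in 0 < bary a b c X /\ 0 < bary b c a X /\ 0 < bary c a b X.

Lemma tdet_rot a b c : tdet b c a = tdet a b c.
Proof using. unfold tdet, zdet, zsub; cbn [fst snd]. ring. Qed.

Lemma bary_sum a b c X : (tdet a b c * tdet a b c = 1)%Z -> bary a b c X + bary b c a X + bary c a b X = 1.
Proof using.
  intros Hd. apply (f_equal IZR) in Hd. rewrite mult_IZR in Hd. unfold bary.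
  rewrite (tdet_rot a b c), <- (tdet_rot c a b).
  transitivity (IZR (tdet a b c) * (area2 b c X + area2 c a X + area2 a b X)); [ring|].
  rewrite area2_sum. exact Hd.
Qed.

Lemma bary_combination a b c X : (tdet a b c * tdet a b c = 1)%Z ->
  X = vadd (vscale (bary a b c X) (toR a)) (vadd (vscale (bary b c a X) (toR b)) (vscale (bary c a b X) (toR c))).
Proof using.
  intros Hd. apply (f_equal IZR) in Hd. rewrite mult_IZR in Hd.
  pose proof (area2_combination a b c X) as E.
  unfold bary. rewrite (tdet_rot a b c), <- (tdet_rot c a b).
  destruct X as [x y]. unfold vadd, vscale in *; cbn [fst snd] in *. injection E as E1 E2.
  set (d := IZR (tdet a b c)) in *. set (p := area2 b c (x, y)) in *. set (q := area2 c a (x, y)) in *. set (r := area2 a b (x, y)) in *.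
  f_equal.
  - transitivity (d * (d * x)); [rewrite <- Rmult_assoc, Hd; ring|]. rewrite <- E1. unfold toR; cbn [fst snd]. ring.
  - transitivity (d * (d * y)); [rewrite <- Rmult_assoc, Hd; ring|]. rewrite <- E2. unfold toR; cbn [fst snd]. ring.
Qed.

Lemma bary_inTri a b c X : (tdet a b c * tdet a b c = 1)%Z ->
  0 <= bary a b c X -> 0 <= bary b c a X -> 0 <= bary c a b X -> inTri (a, b, c) X.
Proof using HF.
  intros Hd Ha Hb Hc. destruct (fine_n D L n HF) as [_ Hn]. unfold inTri, tri_set.
  replace (unscale X) with (vadd (vscale (bary a b c X) (hpt n a)) (vadd (vscale (bary b c a X) (hpt n b)) (vscale (bary c a b X) (hpt n c)))).
  - apply inconv_three; auto. apply bary_sum, Hd.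
  - pose proof (bary_combination a b c X Hd) as E. rewrite E at 4.
    unfold unscale, vadd, vscale, hpt, toR; cbn [fst snd]. f_equal; field; lra.
Qed.

Lemma bary_vertex a b c : (tdet a b c * tdet a b c = 1)%Z ->
  bary a b c (toR a) = 1 /\ bary a b c (toR b) = 0 /\ bary a b c (toR c) = 0.
Proof using.
  intros Hd. apply (f_equal IZR) in Hd. rewrite mult_IZR in Hd. unfold bary.
  assert (E : area2 b c (toR a) = IZR (tdet a b c)).
  { unfold area2, tdet, crossv, zdet, zsub, vsub, toR; cbn [fst snd]. rewrite !minus_IZR, !mult_IZR, !minus_IZR. ring. }
  rewrite E. split; [exact Hd|].
  split; (replace (area2 b c _) with 0; [ring|]; unfold area2, crossv, zsub, vsub, toR; cbn [fst snd]; rewrite !minus_IZR; ring).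
Qed.

Lemma inTri_bary1 a b c X : (tdet a b c * tdet a b c = 1)%Z -> inTri (a, b, c) X -> 0 <= bary a b c X.
Proof using HF.
  intros Hd HX. destruct (fine_n D L n HF) as [Hn1 Hn].
  set (v := zsub c b). set (dt := IZR (tdet a b c)).
  set (l := (- dt * IZR (snd v) * INR n, dt * IZR (fst v) * INR n, dt * - crossv v (toR b))).
  assert (E : forall x, aff l x = bary a b c (vscale (INR n) x)).
  { intros x. unfold aff, l, bary, area2, crossv, vsub, vscale, toR; cbn [fst snd]. fold v dt. ring. }
  rewrite <- (vscale_unscale X), <- E. eapply (inconv_aff_nonneg _ l); [|exact HX].
  intros p Hp. rewrite E. destruct (bary_vertex a b c Hd) as [B1 [B2 B3]].
  destruct Hp as [->|[->| ->]]; rewrite vscale_hpt by exact Hn1; lra.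
Qed.

Lemma inTri_rot a b c X : inTri (a, b, c) X -> inTri (b, c, a) X.
Proof using. apply inconv_mono. tauto. Qed.

Lemma inTri_bary a b c X : (tdet a b c * tdet a b c = 1)%Z -> inTri (a, b, c) X ->
  0 <= bary a b c X /\ 0 <= bary b c a X /\ 0 <= bary c a b X.
Proof using HF.
  intros Hd HX. split; [|split].
  - apply inTri_bary1; assumption.
  - apply inTri_bary1; [rewrite (tdet_rot a b c); exact Hd|apply inTri_rot, HX].
  - apply inTri_bary1; [rewrite <- (tdet_rot c a b); exact Hd|apply inTri_rot, inTri_rot, HX].
Qed.

Lemma tdet_abs a b c : (tdet a b c * tdet a b c = 1)%Z -> Rabs (IZR (tdet a b c)) = 1.
Proof using. intros H. rewrite <- abs_IZR. f_equal. nia. Qed.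

Lemma bary_move a b c X Y r : (tdet a b c * tdet a b c = 1)%Z -> n1 (toR (zsub c b)) <= 8 * L ->
  Rabs (fst X - fst Y) <= r -> Rabs (snd X - snd Y) <= r -> 0 <= r -> bary a b c X <= bary a b c Y + 8 * L * r.
Proof using.
  intros Hd Hn H1 H2 Hr. pose proof (area2_move b c X Y r H1 H2) as K.
  assert (Rabs (bary a b c X - bary a b c Y) <= 8 * L * r).
  { unfold bary. rewrite <- Rmult_minus_distr_l, Rabs_mult, tdet_abs, Rmult_1_l by exact Hd.
    eapply Rle_trans; [exact K|]. apply Rmult_le_compat_r; assumption. }
  apply Rabs_le_inv in H. lra.
Qed.

Lemma pos_bary_interior t X : T t -> pos_bary t X -> Defs.interior (tri_set n t) (unscale X).
Proof using HF HT.
  destruct t as [[a b] c]. intros Ht [Pa [Pb Pc]]. destruct (fine_n D L n HF) as [Hn1 Hn]. pose proof (fine_L D L n HF) as HL.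
  pose proof (tri_unimodular a b c Ht) as Hd.
  set (m := Rmin (bary a b c X) (Rmin (bary b c a X) (bary c a b X))).
  assert (Hm : 0 < m) by (unfold m; repeat apply Rmin_pos; assumption).
  assert (Hm1 : m <= bary a b c X) by apply Rmin_l.
  assert (Hm2 : m <= bary b c a X) by (unfold m; eapply Rle_trans; [apply Rmin_r|apply Rmin_l]).
  assert (Hm3 : m <= bary c a b X) by (unfold m; eapply Rle_trans; [apply Rmin_r|apply Rmin_r]).
  set (r := m / (8 * L)). assert (Hr : 0 < r) by (apply Rdiv_lt_0_compat; lra).
  assert (Hr8 : 8 * L * r = m) by (unfold r; field; lra).
  exists (r / INR n). split; [apply Rdiv_lt_0_compat; assumption|]. intros y Hy.
  rewrite <- (unscale_vscale y). set (Y := vscale (INR n) y). fold (inTri (a, b, c) Y).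
  assert (Hsq : forall z, Rabs (fst (unscale X) - fst z) <= pdist (unscale X) z /\ Rabs (snd (unscale X) - snd z) <= pdist (unscale X) z).
  { intros z. unfold pdist, dot, vsub; cbn [fst snd]. split.
    - eapply sqrt_sum_sq_le; [|apply Rle_refl|rewrite Rplus_0_r; reflexivity]. apply (Rle_0_sqr (snd (unscale X) - snd z)).
    - eapply sqrt_sum_sq_le; [|apply Rle_refl|rewrite Rplus_0_r; apply Rplus_comm]. apply (Rle_0_sqr (fst (unscale X) - fst z)). }
  destruct (Hsq y) as [S1 S2].
  assert (Hmul : forall x z, Rabs (x - z) <= pdist (unscale X) y -> Rabs (INR n * x - INR n * z) <= r).
  { intros x z H. rewrite <- Rmult_minus_distr_l, Rabs_mult, (Rabs_pos_eq (INR n)) by lra.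
    apply Rle_trans with (INR n * (r / INR n)); [apply Rmult_le_compat_l; lra|right; field; lra]. }
  pose proof (Hmul _ _ S1) as R1. pose proof (Hmul _ _ S2) as R2.
  change (INR n * fst (unscale X)) with (fst (vscale (INR n) (unscale X))) in R1.
  change (INR n * snd (unscale X)) with (snd (vscale (INR n) (unscale X))) in R2. rewrite vscale_unscale in R1, R2.
  change (INR n * fst y) with (fst Y) in R1. change (INR n * snd y) with (snd Y) in R2.
  assert (He : forall p p', tri_vert (a, b, c) p -> tri_vert (a, b, c) p' -> n1 (toR (zsub p' p)) <= 8 * L).
  { intros p p' Hp Hp'. destruct (tri_edge a b c p p' Ht Hp Hp'). unfold n1, toR; cbn [fst snd]. lra. }
  pose proof (bary_move a b c X Y r Hd (He b c ltac:(unfold tri_vert; tauto) ltac:(unfold tri_vert; tauto)) R1 R2 ltac:(lra)).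
  pose proof (bary_move b c a X Y r ltac:(rewrite (tdet_rot a b c); exact Hd) (He c a ltac:(unfold tri_vert; tauto) ltac:(unfold tri_vert; tauto)) R1 R2 ltac:(lra)).
  pose proof (bary_move c a b X Y r ltac:(rewrite <- (tdet_rot c a b); exact Hd) (He a b ltac:(unfold tri_vert; tauto) ltac:(unfold tri_vert; tauto)) R1 R2 ltac:(lra)).
  apply bary_inTri; [exact Hd|lra..].
Qed.

Lemma VL_bound x : Rabs (IZR x) <= 4 * L -> (Z.abs x <= VL)%Z.
Proof using. apply abs_IZR_le_iff. Qed.

(** Up to sign a barycentric coordinate is [crossv] of the opposite edge minus an integer, and this
    is what [Good] keeps away from 0. *)
Lemma good_bary a b c ka X : (tdet a b c * tdet a b c = 1)%Z -> b <> c ->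
  Rabs (IZR (fst (zsub c b))) <= 4 * L -> Rabs (IZR (snd (zsub c b))) <= 4 * L ->
  Good VL ka X -> 0 <= bary a b c X -> ka < bary a b c X.
Proof using.
  intros Hd Hne H1 H2 HG Hb.
  assert (E : Rabs (bary a b c X) = Rabs (crossv (zsub c b) X - IZR (zdet (zsub c b) b))).
  { unfold bary. rewrite Rabs_mult, tdet_abs, Rmult_1_l, area2_line by exact Hd. reflexivity. }
  rewrite Rabs_pos_eq in E by exact Hb. rewrite E. apply HG; try (apply VL_bound; assumption).
  intros E0. apply Hne. unfold zsub in E0. injection E0 as E1 E2. destruct b, c; cbn [fst snd] in *. f_equal; lia.
Qed.

Lemma tdet_distinct a b c : (tdet a b c * tdet a b c = 1)%Z -> a <> b /\ b <> c /\ c <> a.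
Proof using.
  intros H. split; [|split]; intros ->; unfold tdet, zdet, zsub in H; cbn [fst snd] in H; lia.
Qed.

(** Barycentric coordinates have Lipschitz constant at most 8 L. With [r] equal to 0 this puts a
    good point inside its triangle; with a positive [r] it does the same for all points nearby. *)
Lemma good_interior t ka r X Y : T t -> inTri t X -> Good VL ka X -> 0 <= r -> 8 * L * r <= ka ->
  Rabs (fst X - fst Y) <= r -> Rabs (snd X - snd Y) <= r -> pos_bary t Y.
Proof using HF HT.
  destruct t as [[a b] c]. intros Ht HX HG Hr Hk R1 R2. pose proof (tri_unimodular a b c Ht) as Hd.
  destruct (tdet_distinct a b c Hd) as [N1 [N2 N3]].
  assert (He : forall p p', tri_vert (a, b, c) p -> tri_vert (a, b, c) p' -> n1 (toR (zsub p' p)) <= 8 * L).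
  { intros p p' Hp Hp'. destruct (tri_edge a b c p p' Ht Hp Hp'). unfold n1, toR; cbn [fst snd]. lra. }
  assert (He' : forall p p', tri_vert (a, b, c) p -> tri_vert (a, b, c) p' -> Rabs (IZR (fst (zsub p' p))) <= 4 * L /\ Rabs (IZR (snd (zsub p' p))) <= 4 * L)
    by (intros; apply (tri_edge a b c); assumption).
  assert (Hd2 : (tdet b c a * tdet b c a = 1)%Z) by (rewrite (tdet_rot a b c); exact Hd).
  assert (Hd3 : (tdet c a b * tdet c a b = 1)%Z) by (rewrite <- (tdet_rot c a b); exact Hd).
  assert (va : tri_vert (a, b, c) a) by (unfold tri_vert; tauto).
  assert (vb : tri_vert (a, b, c) b) by (unfold tri_vert; tauto).
  assert (vc : tri_vert (a, b, c) c) by (unfold tri_vert; tauto).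
  destruct (inTri_bary a b c X Hd HX) as [B1 [B2 B3]].
  pose proof (good_bary a b c ka X Hd N2 (proj1 (He' b c vb vc)) (proj2 (He' b c vb vc)) HG B1).
  pose proof (good_bary b c a ka X Hd2 N3 (proj1 (He' c a vc va)) (proj2 (He' c a vc va)) HG B2).
  pose proof (good_bary c a b ka X Hd3 N1 (proj1 (He' a b va vb)) (proj2 (He' a b va vb)) HG B3).
  pose proof (bary_move a b c X Y r Hd (He b c vb vc) R1 R2 Hr).
  pose proof (bary_move b c a X Y r Hd2 (He c a vc va) R1 R2 Hr).
  pose proof (bary_move c a b X Y r Hd3 (He a b va vb) R1 R2 Hr).
  unfold pos_bary. lra.
Qed.

Lemma interior_mono (S S' : pt -> Prop) x : (forall y, S y -> S' y) -> Defs.interior S x -> Defs.interior S' x.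
Proof using. intros H [e [He Hb]]. exists e. split; [exact He|]. intros y Hy. apply H, Hb, Hy. Qed.

Lemma tri_set_hull t q y : tri_verts_in t (cellpts D n q) -> tri_set n t y -> hull n (cellpts D n q) y.
Proof using.
  destruct t as [[a b] c]. intros [Ha [Hb Hc]]. apply inconv_mono. intros p [->|[->| ->]]; [exists a|exists b|exists c]; auto.
Qed.

(** Inside one polygon this is the condition on [T], and between two polygons it is the
    polygonization. Only vertex sets can be compared, since [T] may list a triangle with its
    vertices in several orders. *)
Lemma overlap_same_vertices t t' x : T t -> T t' -> Defs.interior (tri_set n t) x -> Defs.interior (tri_set n t') x ->
  forall k, tri_vert t k <-> tri_vert t' k.
Proof using HF HT.
  intros Ht Ht' Hx Hx'. apply NNPP. intros Hno. apply not_all_ex_not in Hno.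
  destruct HT as [H1 [H2 _]]. destruct (H1 t Ht) as [_ [q [Hq Hv]]]. destruct (H1 t' Ht') as [_ [q' [Hq' Hv']]].
  destruct (classic (forall k, cellpts D n q k <-> cellpts D n q' k)) as [Hs|Hs].
  - destruct (H2 q Hq) as [_ H3]. apply (H3 t t' Ht Ht' Hv); [|exact Hno|exists x; split; assumption].
    destruct t' as [[a b] c]. destruct Hv' as [V1 [V2 V3]]. repeat split; apply Hs; assumption.
  - apply not_all_ex_not in Hs. destruct (polygonization D L n HF) as [_ [_ [P _]]].
    destruct (P q q' Hq Hq' Hs) as [P1 _]. apply P1. exists x. split.
    + eapply interior_mono; [|exact Hx]. intros y. apply tri_set_hull, Hv.
    + eapply interior_mono; [|exact Hx']. intros y. apply tri_set_hull, Hv'.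
Qed.

Lemma tri_cover X : exists t, T t /\ inTri t X.
Proof using HF HT.
  destruct (polygonization D L n HF) as [_ [P _]]. destruct (P (unscale X)) as [q [Hq Hx]].
  destruct HT as [_ [H2 _]]. destruct (H2 q Hq) as [H3 _]. destruct (H3 _ Hx) as [t [Ht [_ Hin]]]. exists t. split; assumption.
Qed.

(** A vertex set instead of a chosen triangle, so that it inherits the periodicity of [T]. At a good
    point it consists of the vertices of the one triangle there. *)
Definition Vt (X : pt) (k : zpt) : Prop := exists t, T t /\ inTri t X /\ tri_vert t k.

Lemma Vt_good t X k : T t -> inTri t X -> Good VL 0 X -> Vt X k <-> tri_vert t k.
Proof using HF HT.
  intros Ht HX HG. split; [|intros Hk; exists t; auto].
  intros [t' [Ht' [HX' Hk]]].
  assert (Z0 : forall x, Rabs (x - x) <= 0) by (intros x; rewrite Rminus_diag, Rabs_R0; lra).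
  pose proof (good_interior t 0 0 X X Ht HX HG ltac:(lra) ltac:(lra) (Z0 _) (Z0 _)) as P.
  pose proof (good_interior t' 0 0 X X Ht' HX' HG ltac:(lra) ltac:(lra) (Z0 _) (Z0 _)) as P'.
  apply (overlap_same_vertices t t' (unscale X) Ht Ht' (pos_bary_interior t X Ht P) (pos_bary_interior t' X Ht' P')), Hk.
Qed.

Lemma inTri_shift t X m : inTri t X ->
  inTri (tri_shift t (Z.of_nat n * fst m, Z.of_nat n * snd m)%Z) (vadd X (toR (Z.of_nat n * fst m, Z.of_nat n * snd m)%Z)).
Proof using HF.
  destruct t as [[a b] c]. destruct (fine_n D L n HF) as [_ Hn]. set (r := (Z.of_nat n * fst m, Z.of_nat n * snd m)%Z).
  unfold inTri, tri_set, tri_shift. intros [l [Hf [Hw Hx]]].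
  set (w := toR m).
  assert (Ew : forall k, hpt n (zshift k r) = vadd (hpt n k) w).
  { intros k. unfold hpt, zshift, r, vadd, w, toR; cbn [fst snd]. rewrite !plus_IZR, !mult_IZR, <- INR_IZR_INZ. f_equal; field; lra. }
  assert (EX : unscale (vadd X (toR r)) = vadd (unscale X) w).
  { unfold unscale, vadd, vscale, r, w, toR; cbn [fst snd]. rewrite !mult_IZR, <- INR_IZR_INZ. f_equal; field; lra. }
  exists (map (fun pw => (vadd (fst pw) w, snd pw)) l). split; [|split].
  - apply Forall_map. eapply Forall_impl; [|exact Hf]. intros [p wt] [Hp Hn']. cbn [fst snd] in *. split; [|exact Hn'].
    rewrite !Ew. destruct Hp as [->|[->| ->]]; tauto.
  - rewrite <- Hw. clear. induction l as [|pw l IH]; [reflexivity|]. simpl. f_equal. exact IH.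
  - rewrite EX, <- Hx. fold (wsum l) in Hw. transitivity (vadd (wpt l) (vscale (wsum l) w)).
    + clear. induction l as [|pw l IH]; simpl.
      * unfold vadd, vscale; cbn [fst snd]. f_equal; ring.
      * fold (wsum l) (wpt l). rewrite IH. unfold vadd, vscale; cbn [fst snd]. f_equal; ring.
    + rewrite Hw. fold (wpt l). unfold vadd, vscale; cbn [fst snd]. f_equal; ring.
Qed.

Lemma Vt_shift1 X k m : Vt X k ->
  Vt (vadd X (toR (Z.of_nat n * fst m, Z.of_nat n * snd m)%Z)) (zshift k (Z.of_nat n * fst m, Z.of_nat n * snd m)%Z).
Proof using HF HT.
  intros [t [Ht [HX Hk]]]. exists (tri_shift t (Z.of_nat n * fst m, Z.of_nat n * snd m)%Z).
  split; [apply HT, Ht|]. split; [apply inTri_shift, HX|].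
  destruct t as [[a b] c]. simpl in *. destruct Hk as [->|[->| ->]]; tauto.
Qed.

Lemma Vt_shift X k m :
  Vt (vadd X (toR (Z.of_nat n * fst m, Z.of_nat n * snd m)%Z)) (zshift k (Z.of_nat n * fst m, Z.of_nat n * snd m)%Z) <-> Vt X k.
Proof using HF HT.
  split; [|apply Vt_shift1]. intros H. apply (Vt_shift1 _ _ (- fst m, - snd m)%Z) in H. cbn [fst snd] in H.
  replace (vadd (vadd X (toR (Z.of_nat n * fst m, Z.of_nat n * snd m)%Z)) (toR (Z.of_nat n * - fst m, Z.of_nat n * - snd m)%Z)) with X in H.
  - replace (zshift (zshift k (Z.of_nat n * fst m, Z.of_nat n * snd m)%Z) (Z.of_nat n * - fst m, Z.of_nat n * - snd m)%Z) with k in H; [exact H|].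
    destruct k; unfold zshift; cbn [fst snd]. f_equal; ring.
  - destruct X; unfold vadd, toR; cbn [fst snd]. rewrite !mult_IZR, !opp_IZR. f_equal; ring.
Qed.

Lemma tri_grad_same_vertices u t t' G G' : T t -> T t' -> (forall k, tri_vert t k <-> tri_vert t' k) ->
  tri_grad n u t G -> tri_grad n u t' G' -> G = G'.
Proof using HF HT.
  destruct t as [[a b] c], t' as [[a' b'] c']. intros Ht Ht' Hv [G1 G2] [G1' G2'].
  assert (Hall : forall k k', tri_vert (a, b, c) k -> tri_vert (a, b, c) k' ->
     dot G (vsub (hpt n k') (hpt n k)) = u (fst k') (snd k') - u (fst k) (snd k)).
  { unfold dot, vsub in *; cbn [fst snd] in *. intros k k' [->|[->| ->]] [->|[->| ->]]; lra. }
  pose proof (Hall a' b' (proj2 (Hv a') ltac:(simpl; tauto)) (proj2 (Hv b') ltac:(simpl; tauto))) as E1.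
  pose proof (Hall a' c' (proj2 (Hv a') ltac:(simpl; tauto)) (proj2 (Hv c') ltac:(simpl; tauto))) as E2.
  rewrite <- G1' in E1. rewrite <- G2' in E2.
  pose proof (proj1 (proj1 HT _ Ht')) as Hnd. unfold tri_nondeg in Hnd.
  set (p := vsub (hpt n b') (hpt n a')) in *. set (q := vsub (hpt n c') (hpt n a')) in *. cbv zeta in Hnd.
  destruct G as [x y], G' as [x' y']. unfold dot in E1, E2; cbn [fst snd] in *.
  assert (U1 : (x - x') * (fst p * snd q - snd p * fst q) = 0).
  { transitivity (((x - x') * fst p + (y - y') * snd p) * snd q - ((x - x') * fst q + (y - y') * snd q) * snd p); [ring|].
    replace ((x - x') * fst p + (y - y') * snd p) with 0 by lra. replace ((x - x') * fst q + (y - y') * snd q) with 0 by lra. ring. }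
  assert (U2 : (y - y') * (fst p * snd q - snd p * fst q) = 0).
  { transitivity (((x - x') * fst q + (y - y') * snd q) * fst p - ((x - x') * fst p + (y - y') * snd p) * fst q); [ring|].
    replace ((x - x') * fst p + (y - y') * snd p) with 0 by lra. replace ((x - x') * fst q + (y - y') * snd q) with 0 by lra. ring. }
  apply Rmult_integral in U1. apply Rmult_integral in U2. f_equal; [destruct U1|destruct U2]; lra.
Qed.
End Triangles.

Definition gram (A B C : R) (x y x' y' : Z) : R :=
  A * IZR x * IZR x' - B * (IZR x * IZR y' + IZR y * IZR x') + C * IZR y * IZR y'.

Definition mem3 (p q r c : zpt) : Prop := p = c \/ q = c \/ r = c.

(** The product on the left is the stiffness weight of the edge opposite the third corner. On the
    two triangles of the favoured diagonal it equals the stencil weight exactly; the error occurs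
    only if the triple contains both ends of the other diagonal, and is then a multiple of [B]. *)
Lemma gram_gc A B C a b a' b' a'' b'' : 0 <= B ->
  insq a -> insq b -> insq a' -> insq b' -> insq a'' -> insq b'' ->
  (a, b) <> (a', b') -> (a, b) <> (a'', b'') -> (a', b') <> (a'', b'') ->
  let g := gram A B C (a - a'') (b - b'') (a' - a'') (b' - b'') - gc A B C (a' - a, b' - b)%Z in
  g = 0 \/ (Rabs g <= 2 * B /\ mem3 (a, b) (a', b') (a'', b'') (1, 0)%Z /\ mem3 (a, b) (a', b') (a'', b'') (0, 1)%Z /\
    (mem3 (a, b) (a', b') (a'', b'') (0, 0)%Z \/ mem3 (a, b) (a', b') (a'', b'') (1, 1)%Z)).
Proof.
  intros HB. destruct (gc_values A B C) as [[V1 V2] [[V3 V4] [[V5 V6] [V7 V8]]]]. unfold mem3.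
  intros [-> | ->] [-> | ->] [-> | ->] [-> | ->] [-> | ->] [-> | ->] N1 N2 N3; try congruence; clear N1 N2 N3;
  unfold gram; cbn [Z.sub Z.add Z.opp Z.pos_sub]; rewrite ?V1, ?V2, ?V3, ?V4, ?V5, ?V6, ?V7, ?V8;
  first [left; ring | right; split; [apply Rabs_le; split; lra|tauto]].
Qed.

Lemma zsub_zcomb_evec k e1 e2 i j i' j' :
  zsub (zcomb k e1 e2 i j) (zcomb k e1 e2 i' j') =
  ((i - i') * fst e1 + (j - j') * fst e2, (i - i') * snd e1 + (j - j') * snd e2)%Z.
Proof. unfold zsub, zcomb; cbn [fst snd]. f_equal; ring. Qed.

(** * Edge weights on the triangles *)

Section Weights.
Context (D : pt -> sym2) (L : R) (n : nat) (HF : fine D L n).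
Context (fr : zpt -> zpt * zpt) (Hfr : forall k, FrameAt D n k (fst (fr k)) (snd (fr k))).

(** The bound of [diag_bad_small_B] at radius [big L]. In [wtol] the first term is the effect of
    replacing the field at a point of the triangle by that at the vertex, the second the effect of a
    bad diagonal. *)
Definition bsmall : R := 32 * (big L ^ 2 * loceps L n).
Definition wtol : R := 256 * L ^ 4 * hh n + L * bsmall.

Lemma bsmall_nonneg : 0 <= bsmall.
Proof using HF.
  pose proof (fine_L D L n HF) as HL. destruct (fine_n D L n HF) as [_ Hn]. destruct (big_bounds L HL) as [Hb1 Hb2].
  unfold bsmall, loceps, Rdiv. assert (0 <= / INR n) by (left; apply Rinv_0_lt_compat; exact Hn).
  assert (0 <= L ^ 4) by (apply pow_le; lra). assert (0 <= big L ^ 2) by (apply pow_le; lra).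
  repeat apply Rmult_le_pos; lra.
Qed.

Lemma wtol_hh : exists K, 0 <= K /\ wtol = K * hh n /\ K = 256 * L ^ 4 + L * (32 * big L ^ 2 * (128 * L ^ 4 * (4 * big L))).
Proof using HF.
  pose proof (fine_L D L n HF) as HL. destruct (big_bounds L HL) as [Hb1 Hb2].
  eexists. split; [|split; [|reflexivity]].
  - assert (0 <= L ^ 4) by (apply pow_le; lra). assert (0 <= big L ^ 2) by (apply pow_le; lra).
    assert (0 <= L * (32 * big L ^ 2 * (128 * L ^ 4 * (4 * big L)))) by (repeat apply Rmult_le_pos; lra). lra.
  - unfold wtol, bsmall, loceps, hh, Rdiv. ring.
Qed.

Lemma bad_triple_small k q i0 j0 s t : vscale (INR n) q = rcomb k (fst (fr k)) (snd (fr k)) s t ->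
  Rabs (s - IZR i0) <= big L -> Rabs (t - IZR j0) <= big L -> Rabs (IZR i0) <= 3 * big L -> Rabs (IZR j0) <= 3 * big L ->
  let c a b := zcomb k (fst (fr k)) (snd (fr k)) (a + i0) (b + j0) in
  inVor D n (c 1%Z 0%Z) q -> inVor D n (c 0%Z 1%Z) q -> (inVor D n (c 0%Z 0%Z) q \/ inVor D n (c 1%Z 1%Z) q) ->
  cB D n fr k <= bsmall.
Proof using HF Hfr.
  intros Hq Hs Ht Hi Hj c H1 H2 H3.
  pose proof (fine_loc_shift D L n HF k _ _ i0 j0 (Hfr k) Hi Hj) as Hloc.
  assert (Hc := fun a b => square_cell D L n HF k _ _ i0 j0 s t q a b (Hfr k) Hq).
  apply (diag_bad_small_B _ _ _ _ _ _ _ Hloc (s - IZR i0) (t - IZR j0) Hs Ht).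
  unfold diag_bad, cell3. rewrite !Hc. unfold c in *. tauto.
Qed.

(** All is read in the frame of [p]: after replacing [S] by the field at [p], the [perp] identity
    gives a product of edge vectors in the metric at [p], and [gram_gc] compares it with the stencil
    weight. If the two differ, the triple is bad and [B] is small. *)
Lemma vertex_weight q p p' r S : isVorVertex D n q -> inVor D n p q -> inVor D n p' q -> inVor D n r q ->
  p <> p' -> p <> r -> p' <> r -> mclose (8 * L * L * hh n) S (D (hpt n p)) ->
  exists d, In d dirs8 /\ p' = nb fr p d /\
    Rabs (/ 2 * bform S (perp (toR (zsub p r))) (perp (toR (zsub p' r))) - gam D n fr p d) <= wtol.
Proof using HF Hfr.
  intros Hq Hp Hp' Hr N1 N2 N3 HS. pose proof (fine_L D L n HF) as HL.
  destruct (inVor_near D L n HF p q Hp) as [A1 A2].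
  destruct (vertex_cells D L n HF p _ _ q (2 * L) (Hfr p) ltac:(lra) Hq A1 A2)
    as [s [t [i0 [j0 [E [S1 [S2 [S3 [S4 [S5 S6]]]]]]]]]].
  set (e1 := fst (fr p)) in *. set (e2 := snd (fr p)) in *. assert (Hd : zdet e1 e2 = 1%Z) by apply (Hfr p).
  destruct (S1 p Hp) as [a [b [Ha [Hb Ep]]]]. destruct (S1 p' Hp') as [a' [b' [Ha' [Hb' Ep']]]]. destruct (S1 r Hr) as [a'' [b'' [Ha'' [Hb'' Er]]]].
  assert (Hab : (a + i0 = 0 /\ b + j0 = 0)%Z).
  { apply (zcomb_inj p e1 e2 _ _ 0 0 Hd). rewrite <- Ep. unfold zcomb. destruct p; cbn [fst snd]. f_equal; ring. }
  destruct Hab as [Hai Hbj].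
  exists (a' - a, b' - b)%Z.
  assert (En : p' = nb fr p (a' - a, b' - b)%Z).
  { rewrite Ep' at 1. unfold nb. fold e1 e2. cbn [fst snd]. f_equal; lia. }
  split; [|split; [exact En|]].
  { apply in_dirs8.
    - unfold insq in *; lia.
    - unfold insq in *; lia.
    - intros E0. apply N1. rewrite En, E0. unfold nb, zcomb; destruct p; cbn [fst snd]. f_equal; ring. }
  assert (K : cB D n fr p <= bsmall \/ gram (cA D n fr p) (cB D n fr p) (cC D n fr p) (a - a'') (b - b'') (a' - a'') (b' - b'') =
       gc (cA D n fr p) (cB D n fr p) (cC D n fr p) (a' - a, b' - b)%Z).
  { destruct (gram_gc (cA D n fr p) (cB D n fr p) (cC D n fr p) a b a' b' a'' b'') as [G|[_ [G1 [G2 G3]]]]; try assumption.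
    - apply (frame_coefs D L n HF fr Hfr p).
    - intros E0. injection E0 as -> ->. apply N1. congruence.
    - intros E0. injection E0 as -> ->. apply N2. congruence.
    - intros E0. injection E0 as -> ->. apply N3. congruence.
    - right. lra.
    - left. assert (W : forall x y, mem3 (a, b) (a', b') (a'', b'') (x, y) -> inVor D n (zcomb p e1 e2 (x + i0) (y + j0)) q).
      { intros x y [E0|[E0|E0]]; injection E0 as <- <-; [rewrite <- Ep|rewrite <- Ep'|rewrite <- Er]; assumption. }
      apply (bad_triple_small p q i0 j0 s t E S2 S3 S4 S5); [apply W, G1|apply W, G2|].
      destruct G3 as [G3|G3]; [left|right]; apply W, G3. }
  assert (Kd : Rabs (gram (cA D n fr p) (cB D n fr p) (cC D n fr p) (a - a'') (b - b'') (a' - a'') (b' - b'') -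
       gc (cA D n fr p) (cB D n fr p) (cC D n fr p) (a' - a, b' - b)%Z) <= 2 * bsmall).
  { pose proof bsmall_nonneg as Hbs. destruct K as [K|K]; [|rewrite K, Rminus_diag, Rabs_R0; lra].
    destruct (gram_gc (cA D n fr p) (cB D n fr p) (cC D n fr p) a b a' b' a'' b'') as [G|[G _]]; try assumption.
    - apply (frame_coefs D L n HF fr Hfr p).
    - intros E0. injection E0 as -> ->. apply N1. congruence.
    - intros E0. injection E0 as -> ->. apply N2. congruence.
    - intros E0. injection E0 as -> ->. apply N3. congruence.
    - rewrite G, Rabs_R0. lra.
    - lra. }
  set (u := toR (zsub p r)). set (v := toR (zsub p' r)).
  assert (Nu : n1 u <= 8 * L).
  { destruct (cell_diff D L n HF r p q Hr Hp). unfold u, n1, toR; cbn [fst snd]. lra. }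
  assert (Nv : n1 v <= 8 * L).
  { destruct (cell_diff D L n HF r p' q Hr Hp'). unfold v, n1, toR; cbn [fst snd]. lra. }
  pose proof (mclose_bform _ _ _ (perp u) (perp v) HS) as M. rewrite !perp_n1 in M.
  destruct (hh_small D L n HF) as [Hh _].
  assert (M' : Rabs (bform S (perp u) (perp v) - bform (D (hpt n p)) (perp u) (perp v)) <= 512 * L ^ 4 * hh n).
  { eapply Rle_trans; [exact M|]. replace (512 * L ^ 4 * hh n) with (8 * L * L * hh n * (8 * L) * (8 * L)) by ring.
    pose proof (n1_pos u). pose proof (n1_pos v). assert (0 <= 8 * L * L * hh n) by (repeat apply Rmult_le_pos; lra).
    apply Rmult_le_compat; try assumption; [apply Rmult_le_pos; assumption|]. apply Rmult_le_compat_l; assumption. }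
  destruct HF as [[_ [_ [_ [_ [_ [_ [Hperp _]]]]]]] _]. rewrite Hperp in M'.
  fold (de D n p) in M'.
  assert (Eg : bform (MM D (hpt n p)) u v = gram (cA D n fr p) (cB D n fr p) (cC D n fr p) (a - a'') (b - b'') (a' - a'') (b' - b'')).
  { assert (Z1 : zsub p r = evec fr p (a - a'', b - b'')%Z).
    { transitivity (zsub (zcomb p e1 e2 (a + i0) (b + j0)) r); [f_equal; exact Ep|]. rewrite Er, zsub_zcomb_evec.
      unfold evec; cbn [fst snd]. fold e1 e2. f_equal; ring. }
    assert (Z2 : zsub p' r = evec fr p (a' - a'', b' - b'')%Z).
    { rewrite Ep', Er, zsub_zcomb_evec. unfold evec; cbn [fst snd]. fold e1 e2. f_equal; ring. }
    unfold u, v. rewrite Z1, Z2, bform_evec. reflexivity. }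
  rewrite Eg in M'. unfold gam.
  set (G := gram _ _ _ _ _ _ _) in *. set (c := gc _ _ _ _) in *. set (d := de D n p) in *.
  assert (HdL : 0 <= d <= L) by (unfold d; destruct (de_bounds D L n HF p); split; [nra|assumption]).
  set (f := bform S (perp u) (perp v)) in *.
  replace (/ 2 * f - / 2 * d * c) with (/ 2 * (f - d * G) + / 2 * (d * (G - c))) by ring.
  eapply Rle_trans; [apply Rabs_triang|]. rewrite !Rabs_mult, (Rabs_pos_eq (/ 2)), (Rabs_pos_eq d) by lra.
  assert (d * Rabs (G - c) <= L * (2 * bsmall)) by (apply Rmult_le_compat; try lra; apply Rabs_pos).
  unfold wtol. lra.
Qed.

Lemma nb_inj k d d' : nb fr k d = nb fr k d' -> d = d'.
Proof using Hfr.
  unfold nb. intros E. destruct (zcomb_inj _ _ _ _ _ _ _ (proj1 (Hfr k)) E). destruct d, d'; cbn [fst snd] in *. congruence.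
Qed.

Lemma nb_dirs8 k d : In d dirs8 -> nb fr k d <> k.
Proof using Hfr.
  intros Hd E. assert (Z0 : d = (0, 0)%Z).
  { apply (nb_inj k). rewrite E. unfold nb, zcomb; destruct k; cbn [fst snd]. f_equal; ring. }
  subst d. unfold dirs8 in Hd. simpl in Hd. intuition congruence.
Qed.

Context (T : tri -> Prop) (HT : isADT D n T) (U : zpt -> R).

(** The part of the stencil at [k] carried by edges of the triangle at [X]. Its companion [psi] has
    unit weights and measures the error. *)
Definition phi (X : pt) (k : zpt) : R :=
  lsum dirs8 (fun d => ind (Vt n T X k /\ Vt n T X (nb fr k d)) * (gam D n fr k d * dU fr U k d)).
Definition psi (X : pt) (k : zpt) : R :=
  lsum dirs8 (fun d => ind (Vt n T X k /\ Vt n T X (nb fr k d)) * dU fr U k d).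

Lemma vertex_lsum p p' r d d' X (f : zpt -> R) : In d dirs8 -> In d' dirs8 -> p' = nb fr p d -> r = nb fr p d' -> p' <> r ->
  (forall k, Vt n T X k <-> (k = p \/ k = p' \/ k = r)) ->
  lsum dirs8 (fun d => ind (Vt n T X p /\ Vt n T X (nb fr p d)) * f d) = f d + f d'.
Proof using Hfr.
  clear U.
  intros Hd Hd' Ep Er Hne HV.
  rewrite (lsum_two dirs8 _ d d' dirs8_NoDup Hd Hd').
  - rewrite !ind_true; [ring|rewrite !HV, <- Er; tauto|rewrite !HV, <- Ep; tauto].
  - intros ->. congruence.
  - intros z Hz N1 N2. rewrite ind_false; [ring|]. rewrite !HV. intros [_ [E|[E|E]]].
    + apply (nb_dirs8 p z Hz E).
    + rewrite Ep in E. apply nb_inj in E. congruence.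
    + rewrite Er in E. apply nb_inj in E. congruence.
Qed.

(** Half of each edge term is charged to either end, which matches the factor 1/2 of the stencil and
    lets every vertex work in its own frame. *)
Lemma vertex_contribution q p p' r S X : isVorVertex D n q -> inVor D n p q -> inVor D n p' q -> inVor D n r q ->
  p <> p' -> p <> r -> p' <> r -> mclose (8 * L * L * hh n) S (D (hpt n p)) ->
  (forall k, Vt n T X k <-> (k = p \/ k = p' \/ k = r)) ->
  Rabs (/ 2 * bform S (perp (toR (zsub p r))) (perp (toR (zsub p' r))) * (U p' - U p) ^ 2 +
        / 2 * bform S (perp (toR (zsub p p'))) (perp (toR (zsub r p'))) * (U r - U p) ^ 2 - phi X p) <= wtol * psi X p.
Proof using HF Hfr.
  intros Hq Hp Hp' Hr N1 N2 N3 HS HV.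
  destruct (vertex_weight q p p' r S Hq Hp Hp' Hr N1 N2 N3 HS) as [d [Hd [Ed Wd]]].
  destruct (vertex_weight q p r p' S Hq Hp Hr Hp' N2 N1 (not_eq_sym N3) HS) as [d' [Hd' [Ed' Wd']]].
  unfold phi, psi. rewrite (vertex_lsum p p' r d d' X (fun d => gam D n fr p d * dU fr U p d) Hd Hd' Ed Ed' N3 HV).
  rewrite (vertex_lsum p p' r d d' X (fun d => dU fr U p d) Hd Hd' Ed Ed' N3 HV).
  unfold dU. rewrite <- Ed, <- Ed'.
  set (x := (U p' - U p) ^ 2). set (y := (U r - U p) ^ 2).
  assert (0 <= x) by apply pow2_ge_0. assert (0 <= y) by apply pow2_ge_0.
  set (w := / 2 * bform S (perp (toR (zsub p r))) (perp (toR (zsub p' r)))) in *.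
  set (w' := / 2 * bform S (perp (toR (zsub p p'))) (perp (toR (zsub r p')))) in *.
  set (g := gam D n fr p d) in *. set (g' := gam D n fr p d') in *.
  replace (w * x + w' * y - (g * x + g' * y)) with ((w - g) * x + (w' - g') * y) by ring.
  eapply Rle_trans; [apply Rabs_triang|]. rewrite !Rabs_mult, (Rabs_pos_eq x), (Rabs_pos_eq y) by assumption. nra.
Qed.

Lemma mclose_at_point p X : Rabs (fst X - IZR (fst p)) <= 4 * L -> Rabs (snd X - IZR (snd p)) <= 4 * L ->
  mclose (8 * L * L * hh n) (D (unscale n X)) (D (hpt n p)).
Proof using HF.
  intros H1 H2. pose proof (fine_L D L n HF) as HL. destruct (hh_small D L n HF) as [Hh _].
  destruct HF as [[_ [_ [Hlip _]]] _]. eapply mclose_weaken; [|apply Hlip].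
  replace (n1 (vsub (unscale n X) (hpt n p))) with ((Rabs (fst X - IZR (fst p)) + Rabs (snd X - IZR (snd p))) * hh n).
  - replace (8 * L * L * hh n) with (L * (8 * L * hh n)) by ring. apply Rmult_le_compat_l; [lra|]. apply Rmult_le_compat_r; lra.
  - unfold n1, vsub, unscale, vscale, hpt; cbn [fst snd]. unfold Rdiv. fold (hh n).
    replace (hh n * fst X - IZR (fst p) * hh n) with ((fst X - IZR (fst p)) * hh n) by ring.
    replace (hh n * snd X - IZR (snd p) * hh n) with ((snd X - IZR (snd p)) * hh n) by ring.
    rewrite !Rabs_mult, !(Rabs_pos_eq (hh n)) by lra. ring.
Qed.

Lemma pointwise_energy a b c X g : T (a, b, c) -> inTri n (a, b, c) X -> Good (VL L) 0 X ->
  dot g (toR (zsub b a)) = U b - U a -> dot g (toR (zsub c a)) = U c - U a ->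
  Rabs (bform (D (unscale n X)) g g - (phi X a + phi X b + phi X c)) <= wtol * (psi X a + psi X b + psi X c).
Proof using HF Hfr HT.
  intros Ht HX HG G1 G2. set (S := D (unscale n X)).
  pose proof (tri_unimodular D L n HF T HT a b c Ht) as Hd.
  rewrite (gradient_energy S g a b c (U a) (U b) (U c) Hd G1 G2).
  destruct (tdet_distinct a b c Hd) as [N1 [N2 N3]].
  destruct (tri_owner D n T HT a b c Ht) as [q [Hq [Ha [Hb Hc]]]].
  assert (HV := fun k => Vt_good D L n HF T HT (a, b, c) X k Ht HX HG).
  assert (Hm : forall p, tri_vert (a, b, c) p -> mclose (8 * L * L * hh n) S (D (hpt n p))).
  { intros p Hp. destruct (tri_near D L n HF T HT a b c p X Ht HX Hp). apply mclose_at_point; assumption. }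
  simpl in HV.
  pose proof (vertex_contribution q a b c S X Hq Ha Hb Hc N1 (not_eq_sym N3) N2 (Hm a ltac:(simpl; tauto)) HV) as Ka.
  pose proof (vertex_contribution q b c a S X Hq Hb Hc Ha N2 (not_eq_sym N1) N3 (Hm b ltac:(simpl; tauto)) ltac:(intros k; rewrite HV; tauto)) as Kb.
  pose proof (vertex_contribution q c a b S X Hq Hc Ha Hb N3 (not_eq_sym N2) N1 (Hm c ltac:(simpl; tauto)) ltac:(intros k; rewrite HV; tauto)) as Kc.
  rewrite (bform_sym S (perp (toR (zsub c b))) (perp (toR (zsub a b)))) in Kc.
  set (wa := bform S (perp (toR (zsub b a))) (perp (toR (zsub c a)))) in *.
  set (wb := bform S (perp (toR (zsub a b))) (perp (toR (zsub c b)))) in *.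
  set (wc := bform S (perp (toR (zsub a c))) (perp (toR (zsub b c)))) in *.
  assert (Sa : bform S (perp (toR (zsub c a))) (perp (toR (zsub b a))) = wa) by apply bform_sym. rewrite ?Sa in *.
  assert (Sb : bform S (perp (toR (zsub c b))) (perp (toR (zsub a b))) = wb) by apply bform_sym. rewrite ?Sb in *.
  assert (Sc : bform S (perp (toR (zsub b c))) (perp (toR (zsub a c))) = wc) by apply bform_sym. rewrite ?Sc in *.
  apply Rabs_le_inv in Ka. apply Rabs_le_inv in Kb. apply Rabs_le_inv in Kc.
  apply Rabs_le.
  replace (U a - U b) with (- (U b - U a)) in * by ring. replace (U b - U c) with (- (U c - U b)) in * by ring.
  replace (U a - U c) with (- (U c - U a)) in * by ring.
  set (x := U b - U a) in *. set (y := U c - U a) in *. set (z := U c - U b) in *.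
  replace ((- x) ^ 2) with (x ^ 2) in * by ring. replace ((- y) ^ 2) with (y ^ 2) in * by ring. replace ((- z) ^ 2) with (z ^ 2) in * by ring.
  lra.
Qed.

End Weights.

(** * Edges of the triangulation in a unit square *)

Section SquareTriangles.
Context (D : pt -> sym2) (L : R) (n : nat) (HF : fine D L n).
Context (fr : zpt -> zpt * zpt) (Hfr : forall k, FrameAt D n k (fst (fr k)) (snd (fr k))).
Context (T : tri -> Prop) (HT : isADT D n T).

Definition corner (k : zpt) (i0 j0 a b : Z) : zpt := zcomb k (fst (fr k)) (snd (fr k)) (a + i0) (b + j0).
Definition sqpt (k : zpt) (i0 j0 : Z) (s t : R) : pt := rcomb k (fst (fr k)) (snd (fr k)) (s + IZR i0) (t + IZR j0).

Lemma corner_inj k i0 j0 a b a' b' : corner k i0 j0 a b = corner k i0 j0 a' b' -> a = a' /\ b = b'.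
Proof using Hfr. intros E. apply (zcomb_inj _ _ _ _ _ _ _ (proj1 (Hfr k))) in E. lia. Qed.

Lemma toR_corner k i0 j0 a b : toR (corner k i0 j0 a b) = sqpt k i0 j0 (IZR a) (IZR b).
Proof using. unfold corner, sqpt. rewrite toR_zcomb, !plus_IZR. reflexivity. Qed.

Lemma sqpt_combination k i0 j0 a1 b1 a2 b2 a3 b3 l1 l2 l3 : l1 + l2 + l3 = 1 ->
  vadd (vscale l1 (toR (corner k i0 j0 a1 b1))) (vadd (vscale l2 (toR (corner k i0 j0 a2 b2))) (vscale l3 (toR (corner k i0 j0 a3 b3)))) =
  sqpt k i0 j0 (l1 * IZR a1 + l2 * IZR a2 + l3 * IZR a3) (l1 * IZR b1 + l2 * IZR b2 + l3 * IZR b3).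
Proof using.
  intros H. rewrite !toR_corner. replace l1 with (1 - l2 - l3) by lra.
  unfold sqpt, rcomb, vadd, vscale; cbn [fst snd]. f_equal; ring.
Qed.

Definition verts_are (t : tri) (p q r : zpt) : Prop := forall k, tri_vert t k <-> (k = p \/ k = q \/ k = r).

Lemma pos_bary_combination t p q r X lp lq lr : T t -> verts_are t p q r ->
  0 < lp -> 0 < lq -> 0 < lr -> lp + lq + lr = 1 ->
  X = vadd (vscale lp (toR p)) (vadd (vscale lq (toR q)) (vscale lr (toR r))) -> pos_bary t X.
Proof using HF HT.
  destruct t as [[a b] c]. intros Ht Hv Hp Hq Hr Hs EX.
  pose proof (tri_unimodular D L n HF T HT a b c Ht) as Hd. destruct (tdet_distinct a b c Hd) as [N1 [N2 N3]].
  assert (W : forall la lb lc, 0 < la -> 0 < lb -> 0 < lc -> la + lb + lc = 1 ->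
     X = vadd (vscale la (toR a)) (vadd (vscale lb (toR b)) (vscale lc (toR c))) -> pos_bary (a, b, c) X).
  { intros la lb lc Ha Hb Hc Hsum E.
    assert (Haff : forall a b c, (tdet a b c * tdet a b c = 1)%Z -> forall la lb lc, la + lb + lc = 1 ->
      bary a b c (vadd (vscale la (toR a)) (vadd (vscale lb (toR b)) (vscale lc (toR c)))) = la).
    { clear. intros a b c Hd la lb lc Hsum. destruct (bary_vertex a b c Hd) as [B1 [B2 B3]].
      transitivity (la * bary a b c (toR a) + lb * bary a b c (toR b) + lc * bary a b c (toR c)); [|rewrite B1, B2, B3; ring].
      replace la with (1 - lb - lc) by lra.
      unfold bary, area2, crossv, vadd, vsub, vscale; cbn [fst snd]. ring. }
    assert (Erot : forall x y z : pt, vadd x (vadd y z) = vadd y (vadd z x)).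
    { intros x y z. unfold vadd; cbn [fst snd]. f_equal; ring. }
    unfold pos_bary. rewrite E. rewrite (Haff a b c Hd la lb lc Hsum).
    rewrite (Erot (vscale la (toR a))). rewrite (Haff b c a ltac:(rewrite (tdet_rot a b c); exact Hd) lb lc la ltac:(lra)).
    rewrite (Erot (vscale lb (toR b))). rewrite (Haff c a b ltac:(rewrite <- (tdet_rot c a b); exact Hd) lc la lb ltac:(lra)). auto. }
  assert (Esw : forall x y z : pt, vadd x (vadd y z) = vadd x (vadd z y) /\ vadd x (vadd y z) = vadd y (vadd x z) /\
      vadd x (vadd y z) = vadd y (vadd z x) /\ vadd x (vadd y z) = vadd z (vadd x y) /\ vadd x (vadd y z) = vadd z (vadd y x)).
  { intros x y z. unfold vadd; cbn [fst snd]. repeat split; f_equal; ring. }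
  destruct (Esw (vscale lp (toR p)) (vscale lq (toR q)) (vscale lr (toR r))) as [E1 [E2 [E3 [E4 E5]]]].
  destruct (proj1 (Hv a) ltac:(simpl; tauto)) as [Ea|[Ea|Ea]]; destruct (proj1 (Hv b) ltac:(simpl; tauto)) as [Eb|[Eb|Eb]]; try congruence;
  destruct (proj1 (Hv c) ltac:(simpl; tauto)) as [Ec|[Ec|Ec]]; try congruence; rewrite <- Ea, <- Eb, <- Ec in *.
  - apply (W lp lq lr); try assumption; lra.
  - apply (W lp lr lq); try assumption; try lra. congruence.
  - apply (W lq lp lr); try assumption; try lra. congruence.
  - apply (W lq lr lp); try assumption; try lra. congruence.
  - apply (W lr lp lq); try assumption; try lra. congruence.
  - apply (W lr lq lp); try assumption; try lra. congruence.
Qed.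

(** The square touches [k], so the owner of the triangle is within reach of the frame at [k] and its
    cell points are corners of some square of that frame. Comparing integer parts shows it is the
    given square. Four triples remain, and positivity of the barycentric coordinates places (s, t)
    relative to the diagonal. *)
Lemma square_triangle k i0 j0 s t : (-1 <= i0 <= 0)%Z -> (-1 <= j0 <= 0)%Z -> 0 < s < 1 -> 0 < t < 1 ->
  let X := sqpt k i0 j0 s t in let c := corner k i0 j0 in Good (VL L) 0 X ->
  exists tr, T tr /\ inTri n tr X /\
   ((verts_are tr (c 0 0)%Z (c 1 0)%Z (c 1 1)%Z /\ t < s) \/ (verts_are tr (c 0 0)%Z (c 1 1)%Z (c 0 1)%Z /\ s < t) \/
    (cB D n fr k <= bsmall L n /\ verts_are tr (c 1 0)%Z (c 1 1)%Z (c 0 1)%Z /\ 1 < s + t) \/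
    (cB D n fr k <= bsmall L n /\ verts_are tr (c 0 0)%Z (c 1 0)%Z (c 0 1)%Z /\ s + t < 1)).
Proof using HF HT Hfr.
  intros Hi Hj Hs Ht X c HG. destruct (tri_cover D L n HF T HT X) as [tr [HTr HX]]. exists tr. split; [exact HTr|]. split; [exact HX|].
  destruct tr as [[p1 p2] p3]. pose proof (tri_unimodular D L n HF T HT _ _ _ HTr) as Hd.
  destruct (tdet_distinct _ _ _ Hd) as [N1 [N2 N3]].
  assert (Z0 : forall x, Rabs (x - x) <= 0) by (intros x; rewrite Rminus_diag, Rabs_R0; lra).
  pose proof (good_interior D L n HF T HT _ 0 0 X X HTr HX HG ltac:(lra) ltac:(lra) (Z0 _) (Z0 _)) as [L1 [L2 L3]].
  pose proof (bary_sum p1 p2 p3 X Hd) as Lsum. pose proof (bary_combination p1 p2 p3 X Hd) as EX.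
  set (l1 := bary p1 p2 p3 X) in *. set (l2 := bary p2 p3 p1 X) in *. set (l3 := bary p3 p1 p2 X) in *.
  destruct (tri_owner D n T HT _ _ _ HTr) as [q [Hq [H1 [H2 H3]]]].
  pose proof (fine_L D L n HF) as HL.
  destruct (hull_near D L n HF q _ (inTri_hull D n p1 p2 p3 q X H1 H2 H3 HX)) as [A1 A2].
  pose proof (vscale_unscale D L n HF X) as EU.
  change (INR n * fst (unscale n X)) with (fst (vscale (INR n) (unscale n X))) in A1.
  change (INR n * snd (unscale n X)) with (snd (vscale (INR n) (unscale n X))) in A2. rewrite EU in A1, A2.
  assert (Hk : Rabs (fst X - IZR (fst k)) <= 8 * L /\ Rabs (snd X - IZR (snd k)) <= 8 * L).
  { destruct (frame_coefs D L n HF fr Hfr k) as [_ [_ [_ [_ [_ [_ [F1 F2]]]]]]]. unfold n1, toR in F1, F2; cbn [fst snd] in F1, F2.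
    assert (-1 <= IZR i0 <= 0) by (split; apply IZR_le; lia). assert (-1 <= IZR j0 <= 0) by (split; apply IZR_le; lia).
    unfold X, sqpt, rcomb; cbn [fst snd].
    set (x1 := IZR (fst (fst (fr k)))) in *. set (x2 := IZR (fst (snd (fr k)))) in *.
    set (y1 := IZR (snd (fst (fr k)))) in *. set (y2 := IZR (snd (snd (fr k)))) in *.
    assert (Tm : forall z w x y, -1 <= z <= 1 -> -1 <= w <= 1 -> Rabs x <= 4 * L -> Rabs y <= 4 * L -> forall b, Rabs (b + z * x + w * y - b) <= 8 * L).
    { intros z w x y Hz Hw Hx Hy b. replace (b + z * x + w * y - b) with (z * x + w * y) by ring.
      eapply Rle_trans; [apply Rabs_triang|]. rewrite !Rabs_mult.
      assert (Rabs z <= 1) by (apply Rabs_le; lra). assert (Rabs w <= 1) by (apply Rabs_le; lra).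
      assert (Rabs z * Rabs x <= 1 * (4 * L)) by (apply Rmult_le_compat; try apply Rabs_pos; assumption).
      assert (Rabs w * Rabs y <= 1 * (4 * L)) by (apply Rmult_le_compat; try apply Rabs_pos; assumption). lra. }
    pose proof (Rabs_pos x1). pose proof (Rabs_pos x2). pose proof (Rabs_pos y1). pose proof (Rabs_pos y2).
    split; apply Tm; lra. }
  destruct Hk as [K1 K2].
  destruct (vertex_cells D L n HF k _ _ q (10 * L) (Hfr k) ltac:(lra) Hq) as [s' [t' [i1 [j1 [E [S1 [S2 [S3 [S4 [S5 S6]]]]]]]]]].
  { apply Rabs_le_inv in A1. apply Rabs_le_inv in K1. apply Rabs_le; lra. }
  { apply Rabs_le_inv in A2. apply Rabs_le_inv in K2. apply Rabs_le; lra. }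
  destruct (S1 p1 H1) as [a1 [b1 [Ha1 [Hb1 E1]]]]. destruct (S1 p2 H2) as [a2 [b2 [Ha2 [Hb2 E2]]]]. destruct (S1 p3 H3) as [a3 [b3 [Ha3 [Hb3 E3]]]].
  fold (corner k i1 j1 a1 b1) in E1. fold (corner k i1 j1 a2 b2) in E2. fold (corner k i1 j1 a3 b3) in E3.
  assert (Ec : s + IZR i0 = (l1 * IZR a1 + l2 * IZR a2 + l3 * IZR a3) + IZR i1 /\ t + IZR j0 = (l1 * IZR b1 + l2 * IZR b2 + l3 * IZR b3) + IZR j1).
  { apply (rcomb_inj k _ _ _ _ _ _ (proj1 (Hfr k))). fold (sqpt k i0 j0 s t). fold X.
    rewrite EX, E1, E2, E3. apply sqpt_combination. lra. }
  destruct Ec as [Es Et].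
  assert (Hconv : forall x1 x2 x3 : Z, insq x1 -> insq x2 -> insq x3 -> 0 <= l1 * IZR x1 + l2 * IZR x2 + l3 * IZR x3 <= 1).
  { intros x1 x2 x3 [-> | ->] [-> | ->] [-> | ->]; lra. }
  pose proof (Hconv a1 a2 a3 Ha1 Ha2 Ha3) as Ca. pose proof (Hconv b1 b2 b3 Hb1 Hb2 Hb3) as Cb.
  assert (Heq : forall (x y : Z) u w, u + IZR x = w + IZR y -> 0 < u < 1 -> 0 <= w <= 1 -> x = y).
  { intros x y u w Hu Hu1 Hw. assert (IZR x < IZR y + 1) by lra. assert (IZR y < IZR x + 1) by lra.
    rewrite <- plus_IZR in *. apply lt_IZR in H, H0. lia. }
  assert (i1 = i0) by (symmetry; apply (Heq i0 i1 _ _ Es); lra). assert (j1 = j0) by (symmetry; apply (Heq j0 j1 _ _ Et); lra). subst i1 j1.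
  assert (Es' : s = l1 * IZR a1 + l2 * IZR a2 + l3 * IZR a3) by lra. assert (Et' : t = l1 * IZR b1 + l2 * IZR b2 + l3 * IZR b3) by lra.
  fold (c a1 b1) in E1. fold (c a2 b2) in E2. fold (c a3 b3) in E3.
  assert (M1 : (a1, b1) <> (a2, b2)) by (intros E0; injection E0 as -> ->; apply N1; congruence).
  assert (M2 : (a2, b2) <> (a3, b3)) by (intros E0; injection E0 as -> ->; apply N2; congruence).
  assert (M3 : (a3, b3) <> (a1, b1)) by (intros E0; injection E0 as -> ->; apply N3; congruence).
  assert (Hbad : forall x y z : Z * Z, x = (1, 0)%Z -> y = (0, 1)%Z -> (z = (0, 0)%Z \/ z = (1, 1)%Z) ->
     inVor D n (c (fst x) (snd x)) q -> inVor D n (c (fst y) (snd y)) q -> inVor D n (c (fst z) (snd z)) q -> cB D n fr k <= bsmall L n).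
  { intros x y z -> -> Hz V1 V2 V3. apply (bad_triple_small D L n HF fr Hfr k q i0 j0 s' t' E S2 S3 S4 S5); [exact V1|exact V2|].
    destruct Hz as [-> | ->]; [left|right]; exact V3. }
  rewrite E1 in H1. rewrite E2 in H2. rewrite E3 in H3.
  assert (Hv : verts_are (p1, p2, p3) (c a1 b1) (c a2 b2) (c a3 b3)).
  { intros k'. simpl. rewrite <- E1, <- E2, <- E3. tauto. }
  clear E1 E2 E3 EX Es Et Hconv Heq Ca Cb S1 S6.
  assert (Hperm : forall p q r p' q' r', verts_are (p1, p2, p3) p q r -> (forall k, (k = p \/ k = q \/ k = r) <-> (k = p' \/ k = q' \/ k = r')) -> verts_are (p1, p2, p3) p' q' r').
  { intros x1 x2 x3 y1 y2 y3 V0 P0 k'. exact (iff_trans (V0 k') (P0 k')). }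
  assert (HB : forall a b a' b' a'' b'', (a, b) = (1, 0)%Z -> (a', b') = (0, 1)%Z -> ((a'', b'') = (0, 0)%Z \/ (a'', b'') = (1, 1)%Z) ->
     inVor D n (c a b) q -> inVor D n (c a' b') q -> inVor D n (c a'' b'') q -> cB D n fr k <= bsmall L n).
  { intros a b a' b' a'' b'' X1 X2 X3. apply (Hbad (a, b) (a', b') (a'', b'') X1 X2 X3). }
  clear Hbad N1 N2 N3 Hd E A1 A2 K1 K2 S2 S3 S4 S5 EU.
  destruct Ha1 as [-> | ->], Hb1 as [-> | ->], Ha2 as [-> | ->], Hb2 as [-> | ->]; try congruence;
  destruct Ha3 as [-> | ->], Hb3 as [-> | ->]; try congruence; clear M1 M2 M3;
  first [ left; split; [eapply Hperm; [exact Hv|intros; tauto]|lra]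
        | right; left; split; [eapply Hperm; [exact Hv|intros; tauto]|lra]
        | right; right; left; split; [eapply HB; [reflexivity|reflexivity|right; reflexivity|eassumption..]|split; [eapply Hperm; [exact Hv|intros; tauto]|lra]]
        | right; right; right; split; [eapply HB; [reflexivity|reflexivity|left; reflexivity|eassumption..]|split; [eapply Hperm; [exact Hv|intros; tauto]|lra]] ].
Qed.
End SquareTriangles.

Lemma lsum_support {T} (l l' : list T) f : NoDup l -> NoDup l' -> incl l' l ->
  (forall x, In x l -> ~ In x l' -> f x = 0) -> lsum l f = lsum l' f.
Proof.
  intros Hl. revert f. induction l' as [|a l' IH]; intros f Hl' Hi Hf.
  - rewrite (lsum_ext l f (fun _ => 0)); [rewrite lsum_const; simpl; ring|]. intros x Hx. apply Hf; [exact Hx|auto].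
  - inversion Hl' as [|? ? Ha Hnd]; subst.
    set (g := fun x => if excluded_middle_informative (x = a) then f x else 0).
    rewrite (lsum_split l f g), (lsum_one l g a Hl (Hi a (or_introl eq_refl))).
    + simpl. f_equal; [unfold g; destruct (excluded_middle_informative (a = a)); [reflexivity|congruence]|].
      rewrite IH; [|exact Hnd|intros x Hx; apply Hi; right; exact Hx|].
      * apply lsum_ext. intros x Hx. unfold g. destruct (excluded_middle_informative (x = a)) as [->|]; [contradiction|ring].
      * intros x Hx Hn. unfold g. destruct (excluded_middle_informative (x = a)) as [->|Hne]; [ring|].
        rewrite Hf; [ring|exact Hx|]. intros [->|H]; [congruence|contradiction].
    + intros y _ Hy. unfold g. destruct (excluded_middle_informative (y = a)); [contradiction|reflexivity].
Qed.

Lemma lsum_map {T U} (l : list T) (h : T -> U) f : lsum (map h l) f = lsum l (fun x => f (h x)).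
Proof. induction l as [|a l IH]; simpl; [reflexivity|]. rewrite IH. reflexivity. Qed.

Lemma NoDup_zbox K : NoDup (zbox K).
Proof.
  assert (Hr : NoDup (zrange K)) by (apply FinFun.Injective_map_NoDup; [intros x y E; lia|apply seq_NoDup]).
  assert (Hp : forall l l' : list Z, NoDup l -> NoDup l' -> NoDup (list_prod l l')); [|apply Hp; assumption].
  clear. intros l l' Hl Hl'. induction Hl as [|a l Ha Hl IH]; simpl; [constructor|].
  apply NoDup_app; [apply FinFun.Injective_map_NoDup; [intros x y E; congruence|exact Hl']|exact IH|].
  intros [x y] H H'. apply in_map_iff in H. destruct H as [z [E _]]. injection E as <- _.
  apply in_prod_iff in H'. tauto.
Qed.

(** * Counting the samples that see a given edge *)

Section Counts.
Context (D : pt -> sym2) (L : R) (n : nat) (HF : fine D L n).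
Context (fr : zpt -> zpt * zpt) (Hfr : forall k, FrameAt D n k (fst (fr k)) (snd (fr k))).
Context (T : tri -> Prop) (HT : isADT D n T).

Notation crn := (corner fr).
Notation sqp := (sqpt fr).

Lemma same_square_overlap t t' p q r p' q' r' X l1 l2 l3 m1 m2 m3 : T t -> T t' ->
  verts_are t p q r -> verts_are t' p' q' r' ->
  0 < l1 -> 0 < l2 -> 0 < l3 -> l1 + l2 + l3 = 1 -> 0 < m1 -> 0 < m2 -> 0 < m3 -> m1 + m2 + m3 = 1 ->
  vadd (vscale l1 (toR p)) (vadd (vscale l2 (toR q)) (vscale l3 (toR r))) = X ->
  vadd (vscale m1 (toR p')) (vadd (vscale m2 (toR q')) (vscale m3 (toR r'))) = X ->
  forall k, tri_vert t k <-> tri_vert t' k.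
Proof using HF HT.
  intros Ht Ht' Hv Hv' P1 P2 P3 Ps Q1 Q2 Q3 Qs E E'.
  apply (overlap_same_vertices D L n HF T HT t t' (unscale n X) Ht Ht').
  - apply (pos_bary_interior D L n HF T HT t X Ht).
    apply (pos_bary_combination D L n HF T HT t p q r X l1 l2 l3); auto.
  - apply (pos_bary_interior D L n HF T HT t' X Ht').
    apply (pos_bary_combination D L n HF T HT t' p' q' r' X m1 m2 m3); auto.
Qed.

Definition good_verts k i0 j0 t := let c := crn k i0 j0 in
  verts_are t (c 0 0)%Z (c 1 0)%Z (c 1 1)%Z \/ verts_are t (c 0 0)%Z (c 1 1)%Z (c 0 1)%Z.
Definition bad_verts k i0 j0 t := let c := crn k i0 j0 in
  verts_are t (c 1 0)%Z (c 1 1)%Z (c 0 1)%Z \/ verts_are t (c 0 0)%Z (c 1 0)%Z (c 0 1)%Z.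

(** Triangles on different diagonals overlap, as an explicit interior point shows in each of the
    four cases. They would then have the same vertices, but a bad triple contains a corner that the
    good one omits. *)
Lemma no_mixed_diagonals k i0 j0 t t' : T t -> T t' -> good_verts k i0 j0 t -> bad_verts k i0 j0 t' -> False.
Proof using HF HT Hfr.
  intros Ht Ht' Hg Hb.
  assert (W : (forall k', tri_vert t k' <-> tri_vert t' k')).
  { destruct Hg as [Hg|Hg], Hb as [Hb|Hb].
    - apply (same_square_overlap t t' _ _ _ _ _ _ (sqp k i0 j0 (3/4) (1/2)) (1/4) (1/4) (1/2) (1/2) (1/4) (1/4) Ht Ht' Hg Hb); try lra;
      (rewrite sqpt_combination by lra; f_equal; lra).
    - apply (same_square_overlap t t' _ _ _ _ _ _ (sqp k i0 j0 (1/2) (1/4)) (1/2) (1/4) (1/4) (1/4) (1/2) (1/4) Ht Ht' Hg Hb); try lra;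
      (rewrite sqpt_combination by lra; f_equal; lra).
    - apply (same_square_overlap t t' _ _ _ _ _ _ (sqp k i0 j0 (1/2) (3/4)) (1/4) (1/2) (1/4) (1/4) (1/4) (1/2) Ht Ht' Hg Hb); try lra;
      (rewrite sqpt_combination by lra; f_equal; lra).
    - apply (same_square_overlap t t' _ _ _ _ _ _ (sqp k i0 j0 (1/4) (1/2)) (1/2) (1/4) (1/4) (1/4) (1/4) (1/2) Ht Ht' Hg Hb); try lra;
      (rewrite sqpt_combination by lra; f_equal; lra). }
  assert (Hc := corner_inj D n fr Hfr k i0 j0).
  destruct Hg as [Hg|Hg], Hb as [Hb|Hb]; unfold verts_are in *.
  - pose proof (proj1 (Hg _) (proj2 (W _) (proj2 (Hb (crn k i0 j0 0 1)%Z) ltac:(tauto)))) as K.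
    destruct K as [K|[K|K]]; apply Hc in K; lia.
  - pose proof (proj1 (Hg _) (proj2 (W _) (proj2 (Hb (crn k i0 j0 0 1)%Z) ltac:(tauto)))) as K.
    destruct K as [K|[K|K]]; apply Hc in K; lia.
  - pose proof (proj1 (Hg _) (proj2 (W _) (proj2 (Hb (crn k i0 j0 1 0)%Z) ltac:(tauto)))) as K.
    destruct K as [K|[K|K]]; apply Hc in K; lia.
  - pose proof (proj1 (Hg _) (proj2 (W _) (proj2 (Hb (crn k i0 j0 1 0)%Z) ltac:(tauto)))) as K.
    destruct K as [K|[K|K]]; apply Hc in K; lia.
Qed.

Definition edge_ind (X : pt) (p p' : zpt) : R := ind (Vt n T X p /\ Vt n T X p').

(** The boolean form turns the finite verifications below into computation. *)
Lemma edge_ind_verts tr X k i0 j0 a1 b1 a2 b2 a3 b3 x y x' y' : T tr -> inTri n tr X -> Good (VL L) 0 X ->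
  verts_are tr (crn k i0 j0 a1 b1) (crn k i0 j0 a2 b2) (crn k i0 j0 a3 b3) ->
  edge_ind X (crn k i0 j0 x y) (crn k i0 j0 x' y') =
  (if ((Z.eqb x a1 && Z.eqb y b1 || Z.eqb x a2 && Z.eqb y b2 || Z.eqb x a3 && Z.eqb y b3) &&
      (Z.eqb x' a1 && Z.eqb y' b1 || Z.eqb x' a2 && Z.eqb y' b2 || Z.eqb x' a3 && Z.eqb y' b3))%bool then 1 else 0).
Proof using HF HT Hfr.
  intros Ht HX HG Hv.
  assert (K : forall x y, Vt n T X (crn k i0 j0 x y) <->
    (Z.eqb x a1 && Z.eqb y b1 || Z.eqb x a2 && Z.eqb y b2 || Z.eqb x a3 && Z.eqb y b3)%bool = true).
  { clear x y x' y'. intros x y. rewrite (Vt_good D L n HF T HT tr X _ Ht HX HG), (Hv _).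
    rewrite !Bool.orb_true_iff, !Bool.andb_true_iff, !Z.eqb_eq.
    split; [intros [E|[E|E]]; apply (corner_inj D n fr Hfr) in E; tauto|].
    intros [[[-> ->]|[-> ->]]|[-> ->]]; tauto. }
  unfold edge_ind. set (b := (_ && _)%bool).
  assert (Eb : (Vt n T X (crn k i0 j0 x y) /\ Vt n T X (crn k i0 j0 x' y')) <-> b = true).
  { unfold b. rewrite Bool.andb_true_iff, !K. reflexivity. }
  destruct b; [apply ind_true, Eb; reflexivity|apply ind_false]. rewrite Eb. discriminate.
Qed.

Definition side (x y x' y' : Z) : Prop :=
  insq x /\ insq y /\ insq x' /\ insq y' /\ ((x = x' /\ y <> y') \/ (x <> x' /\ y = y'))%Z.

Lemma side_pair k i0 j0 s t x y x' y' : (-1 <= i0 <= 0)%Z -> (-1 <= j0 <= 0)%Z -> 0 < s < 1 -> 0 < t < 1 ->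
  Good (VL L) 0 (sqp k i0 j0 s t) -> Good (VL L) 0 (sqp k i0 j0 (1 - s) (1 - t)) -> side x y x' y' ->
  edge_ind (sqp k i0 j0 s t) (crn k i0 j0 x y) (crn k i0 j0 x' y') +
  edge_ind (sqp k i0 j0 (1 - s) (1 - t)) (crn k i0 j0 x y) (crn k i0 j0 x' y') = 1.
Proof using HF HT Hfr.
  intros Hi Hj Hs Ht HG HG' Hside.
  destruct (square_triangle D L n HF fr Hfr T HT k i0 j0 s t Hi Hj Hs Ht HG) as [tr [Tr [Xr Hr]]].
  destruct (square_triangle D L n HF fr Hfr T HT k i0 j0 (1 - s) (1 - t) Hi Hj ltac:(lra) ltac:(lra) HG') as [tr' [Tr' [Xr' Hr']]].
  assert (Hm := no_mixed_diagonals k i0 j0 tr tr' Tr Tr'). assert (Hm' := no_mixed_diagonals k i0 j0 tr' tr Tr' Tr).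
  unfold good_verts, bad_verts in Hm, Hm'.
  destruct Hside as [Hx [Hy [Hx' [Hy' Hd]]]].
  (* Of the sixteen combinations, two points in the same triangle contradict the strict
     inequalities, and triangles on different diagonals contradict [no_mixed_diagonals]. *)
  destruct Hr as [[V I]|[[V I]|[[_ [V I]]|[_ [V I]]]]]; destruct Hr' as [[V' I']|[[V' I']|[[_ [V' I']]|[_ [V' I']]]]];
    try (exfalso; lra); try (exfalso; apply Hm; tauto); try (exfalso; apply Hm'; tauto);
    rewrite (edge_ind_verts _ _ _ _ _ _ _ _ _ _ _ x y x' y' Tr Xr HG V), (edge_ind_verts _ _ _ _ _ _ _ _ _ _ _ x y x' y' Tr' Xr' HG' V');
    clear - Hx Hy Hx' Hy' Hd; destruct Hx as [-> | ->], Hy as [-> | ->], Hx' as [-> | ->], Hy' as [-> | ->]; try (exfalso; lia); simpl; lra.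
Qed.

Lemma diagonal_edge k i0 j0 s t : (-1 <= i0 <= 0)%Z -> (-1 <= j0 <= 0)%Z -> 0 < s < 1 -> 0 < t < 1 ->
  Good (VL L) 0 (sqp k i0 j0 s t) ->
  cB D n fr k <= bsmall L n \/
  (edge_ind (sqp k i0 j0 s t) (crn k i0 j0 0 0) (crn k i0 j0 1 1) = 1 /\
   edge_ind (sqp k i0 j0 s t) (crn k i0 j0 1 1) (crn k i0 j0 0 0) = 1).
Proof using HF HT Hfr.
  intros Hi Hj Hs Ht HG.
  destruct (square_triangle D L n HF fr Hfr T HT k i0 j0 s t Hi Hj Hs Ht HG) as [tr [Tr [Xr Hr]]].
  destruct Hr as [[V I]|[[V I]|[[Hb _]|[Hb _]]]]; try (left; exact Hb); right;
  split; rewrite (edge_ind_verts _ _ _ _ _ _ _ _ _ _ _ _ _ _ _ Tr Xr HG V); reflexivity.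
Qed.

Lemma no_edge k i0 j0 s t x y x' y' : (-1 <= i0 <= 0)%Z -> (-1 <= j0 <= 0)%Z -> 0 < s < 1 -> 0 < t < 1 ->
  Good (VL L) 0 (sqp k i0 j0 s t) -> ~ (insq x' /\ insq y') ->
  edge_ind (sqp k i0 j0 s t) (crn k i0 j0 x y) (crn k i0 j0 x' y') = 0.
Proof using HF HT Hfr.
  intros Hi Hj Hs Ht HG Hn. unfold edge_ind. apply ind_false. intros [_ H].
  destruct (square_triangle D L n HF fr Hfr T HT k i0 j0 s t Hi Hj Hs Ht HG) as [tr [Tr [Xr Hr]]].
  apply (Vt_good D L n HF T HT tr _ _ Tr Xr HG) in H. unfold verts_are in Hr. apply Hn. unfold insq.
  destruct Hr as [[V I]|[[V I]|[[_ [V I]]|[_ [V I]]]]]; rewrite V in H; destruct H as [H|[H|H]]; apply (corner_inj D n fr Hfr) in H; lia.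
Qed.

(** A vertex of the triangle at an interior point of a square is a corner of that square; [k] is the
    origin of its own coordinates, so only the four squares around it remain. *)
Lemma vertex_square k i j s t : 0 < s < 1 -> 0 < t < 1 -> Vt n T (sqp k i j s t) k -> (-1 <= i <= 0)%Z /\ (-1 <= j <= 0)%Z.
Proof using HF HT Hfr.
  intros Hs Ht [[[p1 p2] p3] [HTr [HX Hk]]].
  destruct (tri_owner D n T HT _ _ _ HTr) as [q [Hq [H1 [H2 H3]]]].
  assert (Hkq : inVor D n k q) by (destruct Hk as [->|[->| ->]]; assumption).
  destruct (inVor_near D L n HF k q Hkq) as [A1 A2]. pose proof (fine_L D L n HF) as HL.
  destruct (vertex_cells D L n HF k _ _ q (2 * L) (Hfr k) ltac:(lra) Hq A1 A2) as [s' [t' [i1 [j1 [E [S1 _]]]]]].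
  destruct (fine_n D L n HF) as [Hn _]. pose proof (proj1 (Hfr k)) as Hd.
  destruct (S1 k Hkq) as [a [b [Ha [Hb Ek]]]].
  assert (Hab : (a + i1 = 0 /\ b + j1 = 0)%Z).
  { apply (zcomb_inj k _ _ _ _ 0 0 Hd). rewrite <- Ek. unfold zcomb. destruct k; cbn [fst snd]. f_equal; ring. }
  pose proof (inTri_hull D n p1 p2 p3 q _ H1 H2 H3 HX) as Hh.
  assert (W : forall al be ga, (forall a b, insq a -> insq b -> 0 <= al * IZR (a + i1) + be * IZR (b + j1) + ga) ->
     0 <= al * (s + IZR i) + be * (t + IZR j) + ga).
  { intros al be ga H. rewrite <- (coord_aff_rcomb n k _ _ al be ga (unscale n (sqp k i j s t)) _ _ Hd (vscale_unscale D L n HF _)).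
    apply (hull_aff_nonneg n (cellpts D n q)); [|exact Hh]. apply (coord_sep_le n k _ _ Hn Hd _ al be ga i1 j1 S1). intros; apply H; assumption. }
  assert (W1 : 0 <= 1 * (s + IZR i) + 0 * (t + IZR j) + - IZR i1) by (apply W; intros x y [-> | ->] _; rewrite !plus_IZR; lra).
  assert (W2 : 0 <= -1 * (s + IZR i) + 0 * (t + IZR j) + (IZR i1 + 1)) by (apply W; intros x y [-> | ->] _; rewrite !plus_IZR; lra).
  assert (W3 : 0 <= 0 * (s + IZR i) + 1 * (t + IZR j) + - IZR j1) by (apply W; intros x y _ [-> | ->]; rewrite !plus_IZR; lra).
  assert (W4 : 0 <= 0 * (s + IZR i) + -1 * (t + IZR j) + (IZR j1 + 1)) by (apply W; intros x y _ [-> | ->]; rewrite !plus_IZR; lra).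
  assert (I1 : (i1 < i + 1)%Z) by (apply lt_IZR; rewrite plus_IZR; lra). assert (I2 : (i < i1 + 1)%Z) by (apply lt_IZR; rewrite plus_IZR; lra).
  assert (J1 : (j1 < j + 1)%Z) by (apply lt_IZR; rewrite plus_IZR; lra). assert (J2 : (j < j1 + 1)%Z) by (apply lt_IZR; rewrite plus_IZR; lra).
  unfold insq in *. lia.
Qed.

Definition boxC : list zpt := zbox (up (8 * L + 1)).
Definition shifted (k : zpt) (s : pt) (p : zpt) : pt := vadd (toR k) (vsub s (toR p)).
(* The number of sample points near [k], at the offset [s] in their own lattice cells,
   whose triangle has the edge from [k] in the direction [d]. *)
Definition cnt (k : zpt) (s : pt) (d : zpt) : R := lsum boxC (fun p => edge_ind (shifted k s p) k (nb fr k d)).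
Definition squares4 : list zpt := ((0, 0) :: (0, -1) :: (-1, 0) :: (-1, -1) :: nil)%Z.

Lemma in_squares4 i j : In (i, j) squares4 <-> (-1 <= i <= 0)%Z /\ (-1 <= j <= 0)%Z.
Proof using.
  unfold squares4. simpl. split.
  - intros [E|[E|[E|[E|[]]]]]; injection E as <- <-; lia.
  - intros [Hi Hj]. assert (Ci : (i = 0 \/ i = -1)%Z) by lia. assert (Cj : (j = 0 \/ j = -1)%Z) by lia.
    destruct Ci as [-> | ->], Cj as [-> | ->]; tauto.
Qed.

(** The lattice translates of a point meet each square of the frame exactly once, always at the same
    relative position, given by the fractional parts of its frame coordinates. Goodness in the
    directions [e1] and [e2] excludes fractional part 0. *)
Lemma sample_coords k s : Good (VL L) 0 s -> exists m1 m2 x y, 0 < x < 1 /\ 0 < y < 1 /\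
  forall i j, shifted k s (evec fr k (m1 - i, m2 - j)%Z) = sqp k i j x y.
Proof using HF Hfr.
  intros HG. pose proof (proj1 (Hfr k)) as Hd. set (e1 := fst (fr k)) in *. set (e2 := snd (fr k)) in *.
  destruct (rcomb_surj k e1 e2 (vadd (toR k) s) Hd) as [s' [t' [E _]]].
  destruct (frame_coefs D L n HF fr Hfr k) as [_ [_ [_ [_ [_ [_ [F1 F2]]]]]]]. fold e1 in F1. fold e2 in F2.
  assert (Hd1 : IZR (fst e1) * IZR (snd e2) - IZR (snd e1) * IZR (fst e2) = 1).
  { rewrite <- !mult_IZR, <- minus_IZR. f_equal. exact Hd. }
  assert (E1 : s = (s' * IZR (fst e1) + t' * IZR (fst e2), s' * IZR (snd e1) + t' * IZR (snd e2))).
  { destruct s as [x y]. unfold vadd, rcomb, toR in E; cbn [fst snd] in E. injection E as E1 E2. f_equal; lra. }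
  assert (Hne : forall e, zdet e1 e2 = 1%Z -> e = e1 \/ e = e2 -> e <> (0, 0)%Z).
  { intros e He [-> | ->] E0; rewrite E0 in He; unfold zdet in He; cbn [fst snd] in He; lia. }
  assert (HV : forall e, n1 (toR e) <= 4 * L -> (Z.abs (fst e) <= VL L)%Z /\ (Z.abs (snd e) <= VL L)%Z).
  { intros e He. unfold n1, toR in He; cbn [fst snd] in He. pose proof (Rabs_pos (IZR (fst e))). pose proof (Rabs_pos (IZR (snd e))).
    split; apply VL_bound; lra. }
  assert (Hs : s' <> IZR (Int_part s')).
  { intros Hz. pose proof (HG e2 (- Int_part s')%Z (Hne e2 Hd (or_intror eq_refl)) (proj1 (HV e2 F2)) (proj2 (HV e2 F2))) as K.
    rewrite E1 in K. unfold crossv in K; cbn [fst snd] in K. rewrite opp_IZR, <- Hz in K.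
    replace (IZR (fst e2) * (s' * IZR (snd e1) + t' * IZR (snd e2)) - IZR (snd e2) * (s' * IZR (fst e1) + t' * IZR (fst e2)) - - s')
      with (s' * (1 - (IZR (fst e1) * IZR (snd e2) - IZR (snd e1) * IZR (fst e2)))) in K by ring.
    rewrite Hd1, Rminus_diag, Rmult_0_r, Rabs_R0 in K. lra. }
  assert (Ht : t' <> IZR (Int_part t')).
  { intros Hz. pose proof (HG e1 (Int_part t')%Z (Hne e1 Hd (or_introl eq_refl)) (proj1 (HV e1 F1)) (proj2 (HV e1 F1))) as K.
    rewrite E1 in K. unfold crossv in K; cbn [fst snd] in K. rewrite <- Hz in K.
    replace (IZR (fst e1) * (s' * IZR (snd e1) + t' * IZR (snd e2)) - IZR (snd e1) * (s' * IZR (fst e1) + t' * IZR (fst e2)) - t')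
      with (t' * ((IZR (fst e1) * IZR (snd e2) - IZR (snd e1) * IZR (fst e2)) - 1)) in K by ring.
    rewrite Hd1, Rminus_diag, Rmult_0_r, Rabs_R0 in K. lra. }
  exists (Int_part s'), (Int_part t'), (s' - IZR (Int_part s')), (t' - IZR (Int_part t')).
  pose proof (Int_part_bounds s'). pose proof (Int_part_bounds t').
  split; [lra|]. split; [lra|]. intros i j.
  unfold shifted, sqpt, evec. fold e1 e2. rewrite E1.
  unfold vadd, vsub, toR, rcomb; cbn [fst snd]. rewrite !plus_IZR, !mult_IZR, !minus_IZR. f_equal; ring.
Qed.

Lemma evec_square_inBox k s i j x y m1 m2 : 0 <= fst s <= 1 -> 0 <= snd s <= 1 -> 0 < x < 1 -> 0 < y < 1 ->
  (-1 <= i <= 0)%Z -> (-1 <= j <= 0)%Z ->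
  shifted k s (evec fr k (m1 - i, m2 - j)%Z) = sqp k i j x y -> In (evec fr k (m1 - i, m2 - j)%Z) boxC.
Proof using HF Hfr.
  intros Hs1 Hs2 Hx Hy Hi Hj E. set (p := evec fr k (m1 - i, m2 - j)%Z) in *. clearbody p.
  pose proof (fine_L D L n HF) as HL.
  destruct (frame_coefs D L n HF fr Hfr k) as [_ [_ [_ [_ [_ [_ [F1 F2]]]]]]]. unfold n1, toR in F1, F2; cbn [fst snd] in F1, F2.
  assert (-1 <= IZR i <= 0) by (split; apply IZR_le; lia). assert (-1 <= IZR j <= 0) by (split; apply IZR_le; lia).
  unfold shifted, sqpt, rcomb, vadd, vsub, toR in E; cbn [fst snd] in E. injection E as E1 E2.
  set (x1 := IZR (fst (fst (fr k)))) in *. set (x2 := IZR (fst (snd (fr k)))) in *.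
  set (y1 := IZR (snd (fst (fr k)))) in *. set (y2 := IZR (snd (snd (fr k)))) in *.
  assert (Tm : forall z w a b, -1 <= z <= 1 -> -1 <= w <= 1 -> Rabs a <= 4 * L -> Rabs b <= 4 * L -> Rabs (z * a + w * b) <= 8 * L).
  { intros z w a b Hz Hw Ha Hb. eapply Rle_trans; [apply Rabs_triang|]. rewrite !Rabs_mult.
    assert (Rabs z <= 1) by (apply Rabs_le; lra). assert (Rabs w <= 1) by (apply Rabs_le; lra).
    assert (Rabs z * Rabs a <= 1 * (4 * L)) by (apply Rmult_le_compat; try apply Rabs_pos; assumption).
    assert (Rabs w * Rabs b <= 1 * (4 * L)) by (apply Rmult_le_compat; try apply Rabs_pos; assumption). lra. }
  pose proof (Rabs_pos x1). pose proof (Rabs_pos x2). pose proof (Rabs_pos y1). pose proof (Rabs_pos y2).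
  pose proof (Rabs_le_inv _ _ (Tm (x + IZR i) (y + IZR j) x1 x2 ltac:(lra) ltac:(lra) ltac:(lra) ltac:(lra))).
  pose proof (Rabs_le_inv _ _ (Tm (x + IZR i) (y + IZR j) y1 y2 ltac:(lra) ltac:(lra) ltac:(lra) ltac:(lra))).
  unfold boxC. apply in_zbox.
  - apply le_IZR. destruct (archimed (8 * L + 1)). lra.
  - split; apply abs_IZR_le_iff; apply Rabs_le; lra.
Qed.

Lemma shifted_Good k s p : Good (VL L) 0 s -> Good (VL L) 0 (shifted k s p).
Proof using.
  intros H. replace (shifted k s p) with (vadd s (toR (zsub k p))); [apply Good_shift, H|].
  unfold shifted, vadd, vsub, toR, zsub; cbn [fst snd]. rewrite !minus_IZR. f_equal; ring.
Qed.

(** Only the translates that land in the four squares around [k] can have [k] as a vertex, and those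
    four do belong to the box. *)
Lemma cnt_squares k s d m1 m2 x y : Good (VL L) 0 s -> 0 <= fst s <= 1 -> 0 <= snd s <= 1 -> 0 < x < 1 -> 0 < y < 1 ->
  (forall i j, shifted k s (evec fr k (m1 - i, m2 - j)%Z) = sqp k i j x y) ->
  cnt k s d = lsum squares4 (fun ij => edge_ind (sqp k (fst ij) (snd ij) x y) k (nb fr k d)).
Proof using HF HT Hfr.
  intros HG Hs1 Hs2 Hx Hy E. unfold cnt.
  rewrite (lsum_support boxC (map (fun ij => evec fr k (m1 - fst ij, m2 - snd ij)%Z) squares4)).
  - rewrite lsum_map. apply lsum_ext. intros [i j] _. cbn [fst snd]. rewrite E. reflexivity.
  - apply NoDup_zbox.
  - apply FinFun.Injective_map_NoDup.
    + intros [i j] [i' j'] H. cbn [fst snd] in H. apply (evec_inj D n fr Hfr) in H. injection H as H1 H2. f_equal; lia.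
    + unfold squares4. repeat constructor; simpl; intuition congruence.
  - intros p Hp. apply in_map_iff in Hp. destruct Hp as [[i j] [<- Hij]]. cbn [fst snd]. apply in_squares4 in Hij.
    apply (evec_square_inBox k s i j x y m1 m2); try assumption; try apply Hij. apply E.
  - intros p Hp Hn. apply ind_false. intros [Hk _]. apply Hn. apply in_map_iff.
    destruct (evec_surj D n fr Hfr k p) as [[a b] Ep].
    assert (E2 : shifted k s p = sqp k (m1 - a) (m2 - b) x y).
    { rewrite <- E, Ep. f_equal. f_equal. f_equal; ring. }
    rewrite E2 in Hk. apply vertex_square in Hk; try assumption.
    exists ((m1 - a)%Z, (m2 - b)%Z). cbn [fst snd]. split; [rewrite Ep; f_equal; f_equal; ring|apply in_squares4, Hk].
Qed.

Lemma k_corner k i j : k = crn k i j (- i) (- j).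
Proof using. unfold corner, zcomb. destruct k; cbn [fst snd]. f_equal; ring. Qed.
Lemma nb_corner k i j d : nb fr k d = crn k i j (fst d - i) (snd d - j).
Proof using. unfold nb, corner. f_equal; ring. Qed.

Definition reflect (s : pt) : pt := (1 - fst s, 1 - snd s).

(** Reflection in the cell of the standard lattice and reflection in a square of the frame differ by
    a lattice vector, which only relabels the translates. *)
Lemma reflect_coords k s m1 m2 x y : (forall i j, shifted k s (evec fr k (m1 - i, m2 - j)%Z) = sqp k i j x y) ->
  exists m1' m2', forall i j, shifted k (reflect s) (evec fr k (m1' - i, m2' - j)%Z) = sqp k i j (1 - x) (1 - y).
Proof using Hfr.
  intros E. destruct (evec_surj D n fr Hfr k (1, 1)%Z) as [[I1 I2] EI].
  exists (I1 - m1 - 1)%Z, (I2 - m2 - 1)%Z. intros i j.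
  specialize (E 0%Z 0%Z). unfold shifted, sqpt, rcomb, evec, vadd, vsub, toR, reflect in *; cbn [fst snd] in *.
  injection E as E1 E2. injection EI as J1 J2. apply (f_equal IZR) in J1, J2.
  rewrite !plus_IZR, !mult_IZR, ?minus_IZR in *. f_equal; lra.
Qed.

Lemma reflect_Good s : Good (VL L) 0 s -> Good (VL L) 0 (reflect s).
Proof using. intros H. apply (Good_opp _ _ _ (1, 1)%Z) in H. exact H. Qed.

(** A side at [k] belongs to two of the four squares around [k], and in each the point and its
    reflection count it once together. On average a sample counts it once. *)
Lemma cnt_pair k s d : Good (VL L) 0 s -> 0 <= fst s <= 1 -> 0 <= snd s <= 1 ->
  In d ((1, 0) :: (-1, 0) :: (0, 1) :: (0, -1) :: nil)%Z -> cnt k s d + cnt k (reflect s) d = 2.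
Proof using HF HT Hfr.
  intros HG Hs1 Hs2 Hd. destruct (sample_coords k s HG) as [m1 [m2 [x [y [Hx [Hy E]]]]]].
  destruct (reflect_coords k s m1 m2 x y E) as [m1' [m2' E']].
  pose proof (reflect_Good s HG) as HG'.
  rewrite (cnt_squares k s d m1 m2 x y HG Hs1 Hs2 Hx Hy E).
  rewrite (cnt_squares k (reflect s) d m1' m2' (1 - x) (1 - y) HG' ltac:(unfold reflect; cbn [fst snd]; lra) ltac:(unfold reflect; cbn [fst snd]; lra) ltac:(lra) ltac:(lra) E').
  rewrite <- lsum_plus.
  assert (HGs : forall i j, Good (VL L) 0 (sqp k i j x y)) by (intros i j; rewrite <- E; apply shifted_Good, HG).
  assert (HGs' : forall i j, Good (VL L) 0 (sqp k i j (1 - x) (1 - y))) by (intros i j; rewrite <- E'; apply shifted_Good, HG').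
  assert (K1 : forall i j, (-1 <= i <= 0)%Z -> (-1 <= j <= 0)%Z -> side (- i) (- j) (fst d - i) (snd d - j) ->
     edge_ind (sqp k i j x y) k (nb fr k d) + edge_ind (sqp k i j (1 - x) (1 - y)) k (nb fr k d) = 1).
  { intros i j Hi Hj Hsd. rewrite (nb_corner k i j d). rewrite (k_corner k i j) at 2 5. apply side_pair; auto. }
  assert (K0 : forall i j, (-1 <= i <= 0)%Z -> (-1 <= j <= 0)%Z -> ~ (insq (fst d - i) /\ insq (snd d - j)) ->
     edge_ind (sqp k i j x y) k (nb fr k d) + edge_ind (sqp k i j (1 - x) (1 - y)) k (nb fr k d) = 0).
  { intros i j Hi Hj Hsd. rewrite (nb_corner k i j d). rewrite (k_corner k i j) at 2 5.
    rewrite !no_edge; auto; try lra. }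
  unfold squares4, lsum; cbn [fst snd].
  unfold side, insq in K1, K0. simpl in Hd. destruct Hd as [<-|[<-|[<-|[<-|[]]]]]; cbn [fst snd] in K1, K0.
  - rewrite (K1 0 0)%Z, (K1 0 (-1))%Z, (K0 (-1) 0)%Z, (K0 (-1) (-1))%Z by lia. ring.
  - rewrite (K0 0 0)%Z, (K0 0 (-1))%Z, (K1 (-1) 0)%Z, (K1 (-1) (-1))%Z by lia. ring.
  - rewrite (K1 0 0)%Z, (K0 0 (-1))%Z, (K1 (-1) 0)%Z, (K0 (-1) (-1))%Z by lia. ring.
  - rewrite (K0 0 0)%Z, (K1 0 (-1))%Z, (K0 (-1) 0)%Z, (K1 (-1) (-1))%Z by lia. ring.
Qed.

(** The diagonal belongs to a single square, where both triangles of the favoured diagonal contain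
    it; so no averaging is required. *)
Lemma cnt_diagonal k s d : Good (VL L) 0 s -> 0 <= fst s <= 1 -> 0 <= snd s <= 1 ->
  In d ((1, 1) :: (-1, -1) :: nil)%Z -> cB D n fr k <= bsmall L n \/ cnt k s d = 1.
Proof using HF HT Hfr.
  intros HG Hs1 Hs2 Hd. destruct (sample_coords k s HG) as [m1 [m2 [x [y [Hx [Hy E]]]]]].
  rewrite (cnt_squares k s d m1 m2 x y HG Hs1 Hs2 Hx Hy E).
  assert (HGs : forall i j, Good (VL L) 0 (sqp k i j x y)) by (intros i j; rewrite <- E; apply shifted_Good, HG).
  assert (K0 : forall i j, (-1 <= i <= 0)%Z -> (-1 <= j <= 0)%Z -> ~ (insq (fst d - i) /\ insq (snd d - j)) ->
     edge_ind (sqp k i j x y) k (nb fr k d) = 0).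
  { intros i j Hi Hj Hsd. rewrite (nb_corner k i j d). rewrite (k_corner k i j) at 2. apply no_edge; auto. }
  unfold squares4, lsum; cbn [fst snd].
  unfold insq in K0. simpl in Hd. destruct Hd as [<-|[<-|[]]]; cbn [fst snd] in K0.
  - destruct (diagonal_edge k 0 0 x y ltac:(lia) ltac:(lia) Hx Hy (HGs _ _)) as [Hb|[Hb _]]; [left; exact Hb|right].
    rewrite (K0 0 (-1))%Z, (K0 (-1) 0)%Z, (K0 (-1) (-1))%Z by lia.
    rewrite (nb_corner k 0 0). rewrite (k_corner k 0 0) at 2. cbn [fst snd].
    change (1 - 0)%Z with 1%Z. change (- 0)%Z with 0%Z. rewrite Hb. ring.
  - destruct (diagonal_edge k (-1) (-1) x y ltac:(lia) ltac:(lia) Hx Hy (HGs _ _)) as [Hb|[_ Hb]]; [left; exact Hb|right].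
    rewrite (K0 0 (-1))%Z, (K0 (-1) 0)%Z, (K0 0 0)%Z by lia.
    rewrite (nb_corner k (-1) (-1)). rewrite (k_corner k (-1) (-1)) at 2. cbn [fst snd].
    change (-1 - -1)%Z with 0%Z. change (- -1)%Z with 1%Z. rewrite Hb. ring.
Qed.

Definition unit_sample (m i j : nat) : pt := ((INR i + / 2) / INR m, (INR j + / 2) / INR m).
Definition good_count (m : nat) : R := Sum2 m (fun i j => ind (Good (VL L) 0 (unit_sample m i j))).
Definition edge_count (m : nat) (k d : zpt) : R :=
  Sum2 m (fun i j => ind (Good (VL L) 0 (unit_sample m i j)) * cnt k (unit_sample m i j) d).
(** A diagonal with small [B] has weight at most [/ 2 * L * bsmall L n]; the last factor bounds the
    discrepancy between its count and the right one, per sample. *)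
Definition ctol : R := / 2 * L * bsmall L n * (1 + INR (length boxC)).

Lemma unit_sample_range m i : (i < m)%nat -> 0 <= (INR i + / 2) / INR m <= 1.
Proof using.
  intros Hi. assert (Hm : 0 < INR m) by (apply lt_0_INR; lia). pose proof (pos_INR i).
  assert (INR i + 1 <= INR m) by (rewrite <- S_INR; apply le_INR; lia).
  split.
  - apply Rmult_le_pos; [lra|left; apply Rinv_0_lt_compat, Hm].
  - apply (Rmult_le_reg_r (INR m)); [exact Hm|]. unfold Rdiv. rewrite Rmult_assoc, Rinv_l by lra. lra.
Qed.

Lemma unit_sample_reflect m i j : (i < m)%nat -> (j < m)%nat -> unit_sample m (m - 1 - i) (m - 1 - j) = reflect (unit_sample m i j).
Proof using.
  intros Hi Hj. assert (Hm : 0 < INR m) by (apply lt_0_INR; lia). unfold unit_sample, reflect; cbn [fst snd].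
  assert (E : forall a, (a < m)%nat -> INR (m - 1 - a) = INR m - 1 - INR a).
  { intros a Ha. rewrite !minus_INR by lia. simpl. ring. }
  rewrite !E by assumption. f_equal; field; lra.
Qed.

Lemma cnt_bounds k s d : 0 <= cnt k s d <= INR (length boxC).
Proof using.
  unfold cnt. split; [apply lsum_nonneg; intros; apply ind_bounds|].
  apply Rle_trans with (lsum boxC (fun _ => 1)); [apply lsum_le; intros; apply ind_bounds|rewrite lsum_const; lra].
Qed.

Lemma edge_count_strong m k d : In d ((1, 0) :: (-1, 0) :: (0, 1) :: (0, -1) :: nil)%Z -> edge_count m k d = good_count m.
Proof using HF HT Hfr.
  intros Hd. enough (2 * edge_count m k d = 2 * good_count m) by lra.
  transitivity (edge_count m k d + edge_count m k d); [ring|].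
  (* Reversing both indices replaces every sample by its reflection, so the two copies add up to the
     pairs of [cnt_pair]. *)
  unfold edge_count at 2. rewrite Sum2_rev. unfold edge_count, good_count. rewrite <- Sum2_plus, <- Sum2_scal.
  apply Sum2_ext. intros i j Hi Hj. rewrite (unit_sample_reflect m i j Hi Hj). set (s := unit_sample m i j).
  assert (Eg : ind (Good (VL L) 0 (reflect s)) = ind (Good (VL L) 0 s)).
  { apply ind_iff. split; intros H; apply reflect_Good in H; [|exact H].
    replace (reflect (reflect s)) with s in H; [exact H|]. unfold reflect; destruct s; cbn [fst snd]. f_equal; ring. }
  rewrite Eg, <- Rmult_plus_distr_l. destruct (classic (Good (VL L) 0 s)) as [HG|HG].
  - rewrite (cnt_pair k s d HG); [ring| | |exact Hd]; apply unit_sample_range; assumption.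
  - rewrite ind_false by exact HG. ring.
Qed.

(** The count is exact for the sides. For the stencil diagonal it is exact unless [B] is small, and
    then the weight itself is small; the other diagonal has weight 0. *)
Lemma edge_count_error m k d : In d dirs8 -> Rabs (gam D n fr k d * (edge_count m k d - good_count m)) <= INR m * INR m * ctol.
Proof using HF HT Hfr.
  intros Hd. pose proof (fine_L D L n HF) as HL. pose proof (bsmall_nonneg D L n HF) as Hbs.
  pose proof (pos_INR (length boxC)) as Hlb. pose proof (pos_INR m) as Hm0.
  assert (Hct : 0 <= ctol) by (unfold ctol; apply Rmult_le_pos; [apply Rmult_le_pos; [lra|exact Hbs]|lra]).
  assert (Hz : 0 <= INR m * INR m * ctol) by (apply Rmult_le_pos; [apply Rmult_le_pos; assumption|exact Hct]).
  destruct (gc_values (cA D n fr k) (cB D n fr k) (cC D n fr k)) as [_ [_ [[V5 V6] [V7 V8]]]].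
  assert (Hst : In d ((1, 0) :: (-1, 0) :: (0, 1) :: (0, -1) :: nil)%Z -> Rabs (gam D n fr k d * (edge_count m k d - good_count m)) <= INR m * INR m * ctol).
  { intros H. rewrite (edge_count_strong m k d H), Rminus_diag, Rmult_0_r, Rabs_R0. exact Hz. }
  assert (Hdg : gc (cA D n fr k) (cB D n fr k) (cC D n fr k) d = cB D n fr k -> In d ((1, 1) :: (-1, -1) :: nil)%Z -> Rabs (gam D n fr k d * (edge_count m k d - good_count m)) <= INR m * INR m * ctol).
  { intros Eg H. destruct (Rle_lt_dec (cB D n fr k) (bsmall L n)) as [Hb|Hb].
    - rewrite Rabs_mult. destruct (de_bounds D L n HF k) as [D1 D2]. destruct (frame_coefs D L n HF fr Hfr k) as [_ [HB _]].
      assert (G : 0 <= gam D n fr k d <= / 2 * L * bsmall L n).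
      { split; [apply (gam_nonneg D L n HF fr Hfr)|]. unfold gam. rewrite Eg. apply Rmult_le_compat; try lra. nra. }
      rewrite (Rabs_pos_eq (gam D n fr k d)) by apply G.
      assert (C1 : 0 <= edge_count m k d <= INR m * INR m * INR (length boxC)).
      { unfold edge_count. split.
        - rewrite <- (Rmult_0_r (INR m * INR m)), <- Sum2_const. apply Sum2_le. intros. apply Rmult_le_pos; [apply ind_bounds|apply cnt_bounds].
        - rewrite <- Sum2_const. apply Sum2_le. intros i j _ _. destruct (ind_bounds (Good (VL L) 0 (unit_sample m i j))). destruct (cnt_bounds k (unit_sample m i j) d).
          rewrite <- (Rmult_1_l (INR (length boxC))). apply Rmult_le_compat; assumption. }
      assert (C2 : 0 <= good_count m <= INR m * INR m * 1).
      { unfold good_count. split.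
        - rewrite <- (Rmult_0_r (INR m * INR m)), <- Sum2_const. apply Sum2_le. intros. apply ind_bounds.
        - rewrite <- Sum2_const. apply Sum2_le. intros. apply ind_bounds. }
      replace (INR m * INR m * ctol) with ((/ 2 * L * bsmall L n) * (INR m * INR m * (1 + INR (length boxC)))) by (unfold ctol; ring).
      apply Rmult_le_compat; [apply G|apply Rabs_pos|apply G|]. apply Rabs_le. lra.
    - replace (edge_count m k d) with (good_count m); [rewrite Rminus_diag, Rmult_0_r, Rabs_R0; exact Hz|].
      unfold edge_count, good_count. apply Sum2_ext. intros i j Hi Hj. set (s := unit_sample m i j).
      destruct (classic (Good (VL L) 0 s)) as [HG|HG]; [|rewrite ind_false by exact HG; ring].
      destruct (cnt_diagonal k s d HG) as [Hc|Hc]; [apply unit_sample_range; assumption|apply unit_sample_range; assumption|exact H|lra|].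
      rewrite Hc. ring. }
  assert (Hz0 : gc (cA D n fr k) (cB D n fr k) (cC D n fr k) d = 0 -> Rabs (gam D n fr k d * (edge_count m k d - good_count m)) <= INR m * INR m * ctol).
  { intros E. unfold gam. rewrite E, Rmult_0_r, Rmult_0_l, Rabs_R0. exact Hz. }
  unfold dirs8 in Hd. simpl in Hd. destruct Hd as [<-|[<-|[<-|[<-|[<-|[<-|[<-|[<-|[]]]]]]]]].
  1-4: apply Hst; simpl; tauto.
  - apply Hdg; [exact V5|simpl; tauto].
  - apply Hdg; [exact V6|simpl; tauto].
  - apply Hz0, V7.
  - apply Hz0, V8.
Qed.
End Counts.

(** * Convergence of the Riemann sums *)

Lemma Sum_ge_term N f i : (forall j, 0 <= f j) -> (i < N)%nat -> f i <= Sum N f.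
Proof.
  intros Hf. induction N as [|N IH]; intros Hi; [lia|]. simpl.
  assert (H0 : 0 <= Sum N f).
  { rewrite <- (Rmult_0_r (INR N)), <- Sum_const. apply Sum_le. intros; apply Hf. }
  destruct (Nat.eq_dec i N) as [->|Hne]; [lra|]. pose proof (Hf N). specialize (IH ltac:(lia)). lra.
Qed.

Definition zmodn (n : nat) (k : zpt) : zpt := (fst k mod Z.of_nat n, snd k mod Z.of_nat n)%Z.

Lemma zmodn_spec n k : (1 <= n)%nat -> exists m, k = zshift (zmodn n k) (Z.of_nat n * fst m, Z.of_nat n * snd m)%Z.
Proof.
  intros Hn. exists (fst k / Z.of_nat n, snd k / Z.of_nat n)%Z. destruct k as [x y]. unfold zshift, zmodn; cbn [fst snd].
  f_equal; rewrite Z.add_comm; apply Z.div_mod; lia.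
Qed.

Lemma zmodn_shift n k m : zmodn n (zshift k (Z.of_nat n * fst m, Z.of_nat n * snd m)%Z) = zmodn n k.
Proof.
  unfold zmodn, zshift; cbn [fst snd]. f_equal; rewrite Z.mul_comm; apply Z_mod_plus_full.
Qed.

Lemma periodic_le_ZS n f k : (1 <= n)%nat -> zper n f -> (forall k, 0 <= f k) -> f k <= ZS n f.
Proof.
  intros Hn Hp Hf. destruct (zmodn_spec n k Hn) as [m E]. rewrite E, Hp.
  assert (H1 : (0 <= fst (zmodn n k) < Z.of_nat n)%Z) by (apply Z.mod_pos_bound; lia).
  assert (H2 : (0 <= snd (zmodn n k) < Z.of_nat n)%Z) by (apply Z.mod_pos_bound; lia).
  set (k' := zmodn n k) in *. destruct k' as [x y]. cbn [fst snd] in *.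
  unfold ZS, Sum2.
  eapply Rle_trans; [|apply (Sum_ge_term n (fun i => Sum n (fun j => f (Z.of_nat i, Z.of_nat j))) (Z.to_nat x)); [|lia]].
  - eapply Rle_trans; [|apply (Sum_ge_term n (fun j => f (Z.of_nat (Z.to_nat x), Z.of_nat j)) (Z.to_nat y)); [intros; apply Hf|lia]].
    right. f_equal. f_equal; lia.
  - intros j. rewrite <- (Rmult_0_r (INR n)), <- Sum_const. apply Sum_le. intros; apply Hf.
Qed.

Definition RS (f : pt -> R) (N : nat) : R :=
  Sum2 N (fun i j => f ((INR i + / 2) / INR N, (INR j + / 2) / INR N)) / (INR N * INR N).

Lemma riemann_mid_RS f N : riemann_mid f N = RS f (S N).
Proof.
  unfold riemann_mid, RS, Sum2. rewrite sum_f_R0_Sum. f_equal; [|ring].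
  apply Sum_ext. intros i _. apply sum_f_R0_Sum.
Qed.

Section Riemann.
Context (D : pt -> sym2) (L : R) (n : nat) (HF : fine D L n).
Context (T : tri -> Prop) (HT : isADT D n T).
Context (u : Z -> Z -> R) (Hu : periodic_grid n u).

Definition gval (k : zpt) : R := u (fst k) (snd k).

Lemma gval_periodic : zper n gval.
Proof using Hu.
  assert (H1 : forall i j m, u (i + Z.of_nat n * m)%Z j = u i j).
  { assert (P : forall i j (m : nat), u (i + Z.of_nat n * Z.of_nat m)%Z j = u i j).
    { intros i j m. induction m as [|m IH]; [f_equal; lia|]. rewrite <- IH, <- (proj1 (Hu (i + Z.of_nat n * Z.of_nat m)%Z j)). f_equal. lia. }
    intros i j m. destruct (Z_lt_le_dec m 0) as [Hm|Hm].
    - rewrite <- (P (i + Z.of_nat n * m)%Z j (Z.to_nat (- m))). f_equal. lia.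
    - rewrite <- (P i j (Z.to_nat m)). f_equal. lia. }
  assert (H2 : forall i j m, u i (j + Z.of_nat n * m)%Z = u i j).
  { assert (P : forall i j (m : nat), u i (j + Z.of_nat n * Z.of_nat m)%Z = u i j).
    { intros i j m. induction m as [|m IH]; [f_equal; lia|]. rewrite <- IH, <- (proj2 (Hu i (j + Z.of_nat n * Z.of_nat m)%Z)). f_equal. lia. }
    intros i j m. destruct (Z_lt_le_dec m 0) as [Hm|Hm].
    - rewrite <- (P i (j + Z.of_nat n * m)%Z (Z.to_nat (- m))). f_equal. lia.
    - rewrite <- (P i j (Z.to_nat m)). f_equal. lia. }
  intros k m. unfold gval, zshift; cbn [fst snd]. rewrite H1, H2. reflexivity.
Qed.

(** A sum in place of a maximum is enough: this bound enters only terms that vanish as the number of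
    samples grows. *)
Definition umax : R := ZS n (fun k => Rabs (gval k)).
Lemma umax_bound k : Rabs (gval k) <= umax.
Proof using HF Hu.
  apply (periodic_le_ZS n (fun k => Rabs (gval k)) k); [apply (fine_n D L n HF)| |intros; apply Rabs_pos].
  intros k' m. rewrite gval_periodic. reflexivity.
Qed.

Lemma tri_grad_scaled a b c G : tri_grad n u (a, b, c) G ->
  dot (vscale (/ INR n) G) (toR (zsub b a)) = gval b - gval a /\ dot (vscale (/ INR n) G) (toR (zsub c a)) = gval c - gval a.
Proof using HF.
  destruct (fine_n D L n HF) as [_ Hn]. intros [H1 H2]. unfold gval. rewrite <- H1, <- H2.
  unfold dot, vscale, vsub, hpt, toR, zsub; cbn [fst snd]. rewrite !minus_IZR. split; field; lra.
Qed.

Definition gmax : R := 32 * L * umax.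

Lemma umax_nonneg : 0 <= umax.
Proof using HF Hu. eapply Rle_trans; [apply Rabs_pos|apply (umax_bound (0, 0)%Z)]. Qed.

Lemma gradient_bound a b c g : T (a, b, c) -> dot g (toR (zsub b a)) = gval b - gval a -> dot g (toR (zsub c a)) = gval c - gval a ->
  n1 g <= gmax.
Proof using HF HT Hu.
  intros Ht H1 H2. pose proof (tri_unimodular D L n HF T HT a b c Ht) as Hd. apply (f_equal IZR) in Hd. rewrite mult_IZR in Hd.
  pose proof (tdet_abs a b c (tri_unimodular D L n HF T HT a b c Ht)) as Hda.
  destruct (tri_edge D L n HF T HT a b c a b Ht ltac:(simpl; tauto) ltac:(simpl; tauto)) as [B1 B2].
  destruct (tri_edge D L n HF T HT a b c a c Ht ltac:(simpl; tauto) ltac:(simpl; tauto)) as [B3 B4].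
  set (x1 := IZR (fst (zsub b a))) in *. set (y1 := IZR (snd (zsub b a))) in *. set (x2 := IZR (fst (zsub c a))) in *. set (y2 := IZR (snd (zsub c a))) in *.
  assert (Ed : IZR (tdet a b c) = x1 * y2 - y1 * x2) by (unfold tdet, zdet; rewrite minus_IZR, !mult_IZR; reflexivity).
  rewrite Ed in Hd, Hda. unfold dot in H1, H2. change (fst (toR (zsub b a))) with x1 in H1. change (snd (toR (zsub b a))) with y1 in H1.
  change (fst (toR (zsub c a))) with x2 in H2. change (snd (toR (zsub c a))) with y2 in H2.
  set (d1 := gval b - gval a) in *. set (d2 := gval c - gval a) in *. set (dt := x1 * y2 - y1 * x2) in *.
  destruct g as [g1 g2]. cbn [fst snd] in *. unfold n1; cbn [fst snd].
  assert (G1 : g1 = dt * (d1 * y2 - d2 * y1)) by (rewrite <- H1, <- H2; transitivity (dt * dt * g1); [rewrite Hd; ring|unfold dt; ring]).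
  assert (G2 : g2 = dt * (d2 * x1 - d1 * x2)) by (rewrite <- H1, <- H2; transitivity (dt * dt * g2); [rewrite Hd; ring|unfold dt; ring]).
  assert (Hdd : Rabs d1 <= 2 * umax /\ Rabs d2 <= 2 * umax).
  { pose proof (umax_bound a). pose proof (umax_bound b). pose proof (umax_bound c). unfold d1, d2.
    split; (eapply Rle_trans; [apply Rabs_triang|]; rewrite Rabs_Ropp; lra). }
  pose proof umax_nonneg as Hu0. pose proof (fine_L D L n HF) as HL.
  assert (W : forall p q r s, Rabs p <= 2 * umax -> Rabs q <= 4 * L -> Rabs r <= 2 * umax -> Rabs s <= 4 * L -> Rabs (dt * (p * q - r * s)) <= 16 * L * umax).
  { intros p q r s P1 P2 P3 P4. rewrite Rabs_mult, Hda, Rmult_1_l. eapply Rle_trans; [apply Rabs_triang|]. rewrite Rabs_Ropp, !Rabs_mult.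
    assert (Rabs p * Rabs q <= (2 * umax) * (4 * L)) by (apply Rmult_le_compat; try apply Rabs_pos; assumption).
    assert (Rabs r * Rabs s <= (2 * umax) * (4 * L)) by (apply Rmult_le_compat; try apply Rabs_pos; assumption). lra. }
  destruct Hdd. rewrite G1, G2. unfold gmax.
  pose proof (W d1 y2 d2 y1 ltac:(assumption) ltac:(assumption) ltac:(assumption) ltac:(assumption)).
  pose proof (W d2 x1 d1 x2 ltac:(assumption) ltac:(assumption) ltac:(assumption) ltac:(assumption)). lra.
Qed.

Definition scaled_grad (G : pt -> pt) (X : pt) : pt := vscale (/ INR n) (G (unscale n X)).
Definition Phi (G : pt -> pt) (X : pt) : R := bform (D (unscale n X)) (scaled_grad G X) (scaled_grad G X).

Lemma Phi_unscale G x : bform (D x) (G x) (G x) = INR n * INR n * Phi G (vscale (INR n) x).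
Proof using HF.
  destruct (fine_n D L n HF) as [_ Hn]. unfold Phi, scaled_grad. rewrite (unscale_vscale D L n HF).
  destruct (D x) as [[a b] c]. unfold bform, vscale; cbn [fst snd]. field. lra.
Qed.

Lemma admissible_tri G X : admissible_grad n T u G -> exists a b c, T (a, b, c) /\ inTri n (a, b, c) X /\
  tri_grad n u (a, b, c) (G (unscale n X)) /\
  dot (scaled_grad G X) (toR (zsub b a)) = gval b - gval a /\ dot (scaled_grad G X) (toR (zsub c a)) = gval c - gval a.
Proof using HF.
  intros HG. destruct (HG (unscale n X)) as [[[a b] c] [Ht [HX Hg]]]. exists a, b, c.
  split; [exact Ht|]. split; [exact HX|]. split; [exact Hg|]. apply (tri_grad_scaled a b c _ Hg).
Qed.

Definition emax : R := L * (gmax * gmax).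

Lemma gmax_nonneg : 0 <= gmax.
Proof using HF Hu. pose proof umax_nonneg. pose proof (fine_L D L n HF). unfold gmax. apply Rmult_le_pos; lra. Qed.

Lemma Phi_bounds G X : admissible_grad n T u G -> 0 <= Phi G X <= emax.
Proof using HF HT Hu.
  intros HG. destruct (admissible_tri G X HG) as [a [b [c [Ht [HX [_ [G1 G2]]]]]]].
  pose proof (gradient_bound a b c _ Ht G1 G2) as Hb. pose proof (fine_L D L n HF) as HL.
  pose proof HF as [[_ [_ [_ [_ [_ [_ [_ Hpos]]]]]]] _].
  destruct (Hpos (unscale n X) (scaled_grad G X)) as [P1 P2]. unfold Phi. split; [exact P1|]. eapply Rle_trans; [exact P2|].
  unfold emax. apply Rmult_le_compat_l; [lra|]. unfold dot, n1 in *. set (x := fst (scaled_grad G X)) in *. set (y := snd (scaled_grad G X)) in *.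
  pose proof (Rabs_pos x). pose proof (Rabs_pos y).
  assert (Rabs x * Rabs x = x * x) by (rewrite <- Rabs_mult; apply Rabs_pos_eq; apply (Rle_0_sqr x)).
  assert (Rabs y * Rabs y = y * y) by (rewrite <- Rabs_mult; apply Rabs_pos_eq; apply (Rle_0_sqr y)).
  assert ((Rabs x + Rabs y) * (Rabs x + Rabs y) <= gmax * gmax) by (apply Rmult_le_compat; lra).
  assert (0 <= Rabs x * Rabs y) by (apply Rmult_le_pos; assumption). nra.
Qed.

(** The first summand keeps a nearby point off the lattice lines, the second keeps it inside the
    same triangle. *)
Definition Kgood : R := IZR (VL L) + 4 * L.

Lemma VL_ge : 4 * L <= IZR (VL L).
Proof using. unfold VL. destruct (archimed (4 * L)). lra. Qed.

Lemma Good_nearby X Y r : 0 <= r -> Good (VL L) (2 * IZR (VL L) * r) X ->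
  Rabs (fst X - fst Y) <= r -> Rabs (snd X - snd Y) <= r -> Good (VL L) 0 Y.
Proof using.
  intros Hr HG H1 H2 v c Hv V1 V2. specialize (HG v c Hv V1 V2). apply Rabs_IZR_le in V1. apply Rabs_IZR_le in V2.
  assert (K : Rabs (crossv v X - crossv v Y) <= 2 * IZR (VL L) * r).
  { unfold crossv. replace (IZR (fst v) * snd X - IZR (snd v) * fst X - (IZR (fst v) * snd Y - IZR (snd v) * fst Y))
     with (IZR (fst v) * (snd X - snd Y) + - (IZR (snd v) * (fst X - fst Y))) by ring.
    eapply Rle_trans; [apply Rabs_triang|]. rewrite Rabs_Ropp, !Rabs_mult.
    assert (Rabs (IZR (fst v)) * Rabs (snd X - snd Y) <= IZR (VL L) * r) by (apply Rmult_le_compat; try apply Rabs_pos; assumption).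
    assert (Rabs (IZR (snd v)) * Rabs (fst X - fst Y) <= IZR (VL L) * r) by (apply Rmult_le_compat; try apply Rabs_pos; assumption). lra. }
  pose proof (Rabs_triang (crossv v X - crossv v Y) (crossv v Y - IZR c)) as Tr.
  replace (crossv v X - crossv v Y + (crossv v Y - IZR c)) with (crossv v X - IZR c) in Tr by ring. lra.
Qed.

(** Two admissible gradients are compared at once, so that the same estimate gives convergence and
    independence of the choice made on the edges. *)
Lemma scaled_grad_constant G G' X Y r : admissible_grad n T u G -> admissible_grad n T u G' -> 0 <= r ->
  Good (VL L) (2 * Kgood * r) X -> Rabs (fst X - fst Y) <= r -> Rabs (snd X - snd Y) <= r -> scaled_grad G X = scaled_grad G' Y.
Proof using HF HT.
  intros HG HG' Hr HGd H1 H2. pose proof (fine_L D L n HF) as HL. pose proof VL_ge as HV.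
  destruct (admissible_tri G X HG) as [a [b [c [Ht [HX [Hg _]]]]]].
  destruct (admissible_tri G' Y HG') as [a' [b' [c' [Ht' [HY [Hg' _]]]]]].
  assert (0 <= L * r) by (apply Rmult_le_pos; lra). assert (0 <= IZR (VL L) * r) by (apply Rmult_le_pos; lra).
  assert (GY : Good (VL L) 0 Y).
  { apply (Good_nearby X Y r Hr); try assumption. eapply Good_weaken; [|exact HGd]. unfold Kgood. lra. }
  assert (P : pos_bary (a, b, c) Y).
  { apply (good_interior D L n HF T HT (a, b, c) (2 * Kgood * r) r X Y Ht HX HGd Hr); try assumption. unfold Kgood. lra. }
  assert (Z0 : forall x, Rabs (x - x) <= 0) by (intros x; rewrite Rminus_diag, Rabs_R0; lra).
  pose proof (good_interior D L n HF T HT (a', b', c') 0 0 Y Y Ht' HY GY ltac:(lra) ltac:(lra) (Z0 _) (Z0 _)) as P'.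
  unfold scaled_grad. f_equal.
  apply (tri_grad_same_vertices D L n HF T HT u (a, b, c) (a', b', c') _ _ Ht Ht'); try assumption.
  apply (overlap_same_vertices D L n HF T HT _ _ (unscale n Y) Ht Ht'); apply (pos_bary_interior D L n HF T HT); assumption.
Qed.

(** The gradient is the same at both points, so only the variation of the field contributes. *)
Lemma Phi_nearby G G' X Y r : admissible_grad n T u G -> admissible_grad n T u G' -> 0 <= r ->
  Good (VL L) (2 * Kgood * r) X -> Rabs (fst X - fst Y) <= r -> Rabs (snd X - snd Y) <= r ->
  Rabs (Phi G X - Phi G' Y) <= 2 * r * emax.
Proof using HF HT Hu.
  intros HG HG' Hr HGd H1 H2. pose proof (scaled_grad_constant G G' X Y r HG HG' Hr HGd H1 H2) as E.
  unfold Phi. rewrite <- E. destruct (admissible_tri G X HG) as [a [b [c [Ht [_ [_ [G1 G2]]]]]]].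
  pose proof (gradient_bound a b c _ Ht G1 G2) as Hb. set (g := scaled_grad G X) in *.
  pose proof HF as [[HL [_ [Hlip _]]] [Hn1 _]]. pose proof (n1_pos g) as Hg0. pose proof gmax_nonneg as Hgm.
  eapply Rle_trans; [apply mclose_bform, Hlip|].
  assert (N : n1 (vsub (unscale n X) (unscale n Y)) <= 2 * r).
  { assert (Hh : 0 < / INR n <= 1).
    { assert (1 <= INR n) by (apply (le_INR 1); exact Hn1). split; [apply Rinv_0_lt_compat; lra|]. rewrite <- Rinv_1. apply Rinv_le_contravar; lra. }
    unfold n1, vsub, unscale, vscale; cbn [fst snd]. rewrite <- !Rmult_minus_distr_l, !Rabs_mult, !(Rabs_pos_eq (/ INR n)) by lra.
    pose proof (Rabs_pos (fst X - fst Y)). pose proof (Rabs_pos (snd X - snd Y)).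
    assert (/ INR n * Rabs (fst X - fst Y) <= 1 * r) by (apply Rmult_le_compat; lra).
    assert (/ INR n * Rabs (snd X - snd Y) <= 1 * r) by (apply Rmult_le_compat; lra). lra. }
  unfold emax. replace (2 * r * (L * (gmax * gmax))) with (L * (2 * r) * gmax * gmax) by ring.
  pose proof (n1_pos (vsub (unscale n X) (unscale n Y))).
  assert (L * n1 (vsub (unscale n X) (unscale n Y)) <= L * (2 * r)) by (apply Rmult_le_compat_l; lra).
  assert (0 <= L * n1 (vsub (unscale n X) (unscale n Y))) by (apply Rmult_le_pos; lra).
  apply Rmult_le_compat; try lra; [apply Rmult_le_pos; lra|]. apply Rmult_le_compat; lra.
Qed.

Definition PS (G : pt -> pt) (N : nat) : R := Sum2 N (fun i j => Phi G (sample n N i j)) / (INR N * INR N).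

Lemma RS_PS G N : RS (fun x => bform (D x) (G x) (G x)) N = INR n * INR n * PS G N.
Proof using HF.
  unfold RS, PS, Rdiv. rewrite <- Rmult_assoc, <- Sum2_scal. f_equal. apply Sum2_ext. intros i j _ _. apply Phi_unscale.
Qed.

Lemma emax_nonneg : 0 <= emax.
Proof using HF Hu. pose proof gmax_nonneg. pose proof (fine_L D L n HF). unfold emax. apply Rmult_le_pos; [lra|apply Rmult_le_pos; assumption]. Qed.

(** Splitting each sample cell into M^2 cells changes the density by O(1/N) where the sample is
    good, and only O(N) of the N^2 samples are not. The constant depends neither on [M] nor on the
    gradients. *)
Lemma PS_refine : exists C, 0 <= C /\ forall G G' N M, admissible_grad n T u G -> admissible_grad n T u G' -> (1 <= N)%nat -> (1 <= M)%nat ->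
  Rabs (PS G N - PS G' (N * M)) <= C / INR N.
Proof using HF HT Hu.
  destruct (fine_n D L n HF) as [Hn1 Hn]. pose proof (fine_L D L n HF) as HL. pose proof emax_nonneg as He.
  assert (HVL : (0 <= VL L)%Z) by (apply le_IZR; pose proof VL_ge; lra).
  destruct (bad_count (VL L) Kgood n HVL Hn1) as [C0 [HC0 Hbad]].
  exists (INR n * emax + C0 * (2 * emax)). split; [apply Rplus_le_le_0_compat; apply Rmult_le_pos; lra|].
  intros G G' N M HG HG' HN HM. assert (HNp : 0 < INR N) by (apply lt_0_INR; lia). assert (HMp : 0 < INR M) by (apply lt_0_INR; lia).
  assert (HNi : 0 < / INR N) by (apply Rinv_0_lt_compat; exact HNp).
  (* Half the side of a scaled sample cell, the largest coordinate distance from its midpoint;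
     [2 * Kgood * r] is then the threshold of [bad_count]. *)
  set (r := INR n * / 2 / INR N). assert (Hr : 0 <= r) by (unfold r; apply Rmult_le_pos; lra).
  assert (E : PS G N - PS G' (N * M) = Sum2 N (fun i j => Sum2 M (fun i' j' => Phi G (sample n N i j) - Phi G' (sample n (N * M) (i * M + i') (j * M + j')))) / (INR N * INR N * (INR M * INR M))).
  { transitivity ((INR M * INR M * Sum2 N (fun i j => Phi G (sample n N i j)) -
       Sum2 N (fun i j => Sum2 M (fun i' j' => Phi G' (sample n (N * M) (i * M + i') (j * M + j'))))) / (INR N * INR N * (INR M * INR M))).
    - unfold PS. rewrite (Sum2_mul N M (fun i j => Phi G' (sample n (N * M) i j))), mult_INR. field. lra.
    - f_equal. rewrite <- Sum2_scal, <- Sum2_minus. apply Sum2_ext. intros i j _ _. rewrite Sum2_minus, Sum2_const. reflexivity. }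
  rewrite E. unfold Rdiv. rewrite Rabs_mult, (Rabs_pos_eq (/ _)) by (left; apply Rinv_0_lt_compat; repeat apply Rmult_lt_0_compat; assumption).
  assert (Hin : forall i i', (i' < M)%nat -> Rabs (INR n * ((INR i + / 2) / INR N) - INR n * ((INR (i * M + i') + / 2) / INR (N * M))) <= r).
  { intros i i' Hi'. rewrite plus_INR, !mult_INR.
    replace (INR n * ((INR i + / 2) / INR N) - INR n * ((INR i * INR M + INR i' + / 2) / (INR N * INR M)))
      with (INR n / INR N * (/ 2 - (INR i' + / 2) / INR M)) by (field; lra).
    assert (Hq : 0 <= INR n / INR N) by (apply Rmult_le_pos; lra).
    rewrite Rabs_mult, (Rabs_pos_eq (INR n / INR N)) by exact Hq.
    replace r with (INR n / INR N * / 2) by (unfold r; field; lra). apply Rmult_le_compat_l; [exact Hq|].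
    pose proof (unit_sample_range M i' Hi'). apply Rabs_le. lra. }
  assert (Hterm : forall i j, (i < N)%nat -> (j < N)%nat -> Rabs (Sum2 M (fun i' j' => Phi G (sample n N i j) - Phi G' (sample n (N * M) (i * M + i') (j * M + j')))) <=
     INR M * INR M * (2 * r * emax + 2 * emax * ind (~ Good (VL L) (Kgood * INR n / INR N) (sample n N i j)))).
  { intros i j Hi Hj. eapply Rle_trans; [apply Sum2_abs|]. rewrite <- Sum2_const. apply Sum2_le. intros i' j' Hi' Hj'.
    assert (H2r : 0 <= 2 * r * emax) by (apply Rmult_le_pos; lra).
    destruct (classic (Good (VL L) (Kgood * INR n / INR N) (sample n N i j))) as [Hg|Hg].
    - rewrite ind_false by tauto. rewrite Rmult_0_r, Rplus_0_r.
      apply (Phi_nearby G G' _ _ r HG HG' Hr).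
      + replace (2 * Kgood * r) with (Kgood * INR n / INR N) by (unfold r; field; lra). exact Hg.
      + apply (Hin i i' Hi').
      + apply (Hin j j' Hj').
    - rewrite ind_true by exact Hg. destruct (Phi_bounds G (sample n N i j) HG). destruct (Phi_bounds G' (sample n (N * M) (i * M + i') (j * M + j')) HG').
      apply Rabs_le. lra. }
  set (Sg := Sum2 N (fun i j => Sum2 M _)) in *.
  assert (HS : Rabs Sg <= INR M * INR M * (INR N * INR N * (2 * r * emax) + 2 * emax * (C0 * INR N))).
  { eapply Rle_trans; [apply Sum2_abs|]. eapply Rle_trans; [apply (Sum2_le N _ _ Hterm)|].
    rewrite Sum2_scal, Sum2_plus, Sum2_const, Sum2_scal.
    apply Rmult_le_compat_l; [apply Rmult_le_pos; lra|]. apply Rplus_le_compat_l. apply Rmult_le_compat_l; [lra|]. apply Hbad, HN. }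
  apply (Rmult_le_compat_r (/ (INR N * INR N * (INR M * INR M)))) in HS; [|left; apply Rinv_0_lt_compat; repeat apply Rmult_lt_0_compat; assumption].
  eapply Rle_trans; [exact HS|]. right. unfold r. field. lra.
Qed.

Lemma PS_limit : (exists G, admissible_grad n T u G) -> exists I C, 0 <= C /\ forall G N, admissible_grad n T u G -> (1 <= N)%nat -> Rabs (PS G N - I) <= C / INR N.
Proof using HF HT Hu.
  intros [G0 HG0]. destruct PS_refine as [C [HC Href]].
  (* Both sums are compared with the common refinement [N * M]. *)
  assert (Hcmp : forall G G' N M, admissible_grad n T u G -> admissible_grad n T u G' -> (1 <= N)%nat -> (1 <= M)%nat ->
     Rabs (PS G N - PS G' M) <= C / INR N + C / INR M).
  { intros G G' N M HG HG' HN HM. pose proof (Href G G N M HG HG HN HM) as K1. pose proof (Href G' G M N HG' HG HM HN) as K2.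
    rewrite (Nat.mul_comm M N) in K2. apply Rabs_le_inv in K1. apply Rabs_le_inv in K2. apply Rabs_le. lra. }
  assert (Hsm : forall e, 0 < e -> exists N0, (1 <= N0)%nat /\ forall N, (N >= N0)%nat -> C / INR N < e).
  { intros e He. destruct (INR_unbounded (C / e)) as [N0 HN0]. exists (S N0). split; [lia|]. intros N HN.
    assert (INR N0 < INR N) by (apply lt_INR; lia). assert (0 <= C / e) by (apply Rmult_le_pos; [lra|left; apply Rinv_0_lt_compat, He]).
    assert (HNp : 0 < INR N) by lra. apply (Rmult_lt_reg_r (INR N)); [exact HNp|]. unfold Rdiv. rewrite Rmult_assoc, Rinv_l, Rmult_1_r by lra.
    apply (Rmult_lt_reg_r (/ e)); [apply Rinv_0_lt_compat, He|]. rewrite (Rmult_comm e), Rmult_assoc, Rinv_r, Rmult_1_r by lra. unfold Rdiv in *. lra. }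
  assert (Hcau : Cauchy_crit (fun N => PS G0 (S N))).
  { intros e He. destruct (Hsm (e / 2)) as [N0 [HN1 HN0]]; [lra|]. exists N0. intros p q Hp Hq. unfold Rdist.
    pose proof (Hcmp G0 G0 (S p) (S q) HG0 HG0 ltac:(lia) ltac:(lia)). pose proof (HN0 (S p) ltac:(lia)). pose proof (HN0 (S q) ltac:(lia)). lra. }
  destruct (R_complete _ Hcau) as [I HI]. exists I, C. split; [exact HC|]. intros G N HG HN.
  apply Rnot_lt_le. intros Hlt. set (e := (Rabs (PS G N - I) - C / INR N) / 2). assert (He : 0 < e) by (unfold e; lra).
  destruct (HI e He) as [N1 H1]. destruct (Hsm e He) as [N2 [_ H2]].
  pose proof (H1 (N1 + N2)%nat ltac:(lia)) as K1. pose proof (H2 (S (N1 + N2)) ltac:(lia)) as K2. unfold Rdist in K1.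
  pose proof (Hcmp G G0 N (S (N1 + N2)) HG HG0 HN ltac:(lia)) as K3.
  pose proof (Rabs_triang (PS G N - PS G0 (S (N1 + N2))) (PS G0 (S (N1 + N2)) - I)) as Tr.
  replace (PS G N - PS G0 (S (N1 + N2)) + (PS G0 (S (N1 + N2)) - I)) with (PS G N - I) in Tr by ring. unfold e in *. lra.
Qed.
End Riemann.

(** * Comparison of the energies *)

Definition zmul (n : nat) (m : zpt) : zpt := (Z.of_nat n * fst m, Z.of_nat n * snd m)%Z.

Section Comparison.
Context (D : pt -> sym2) (L : R) (n : nat) (HF : fine D L n) (Hper : forall z k, D (vadd z (toR k)) = D z).
Context (fr : zpt -> zpt * zpt) (Hfr : forall k, FrameAt D n k (fst (fr k)) (snd (fr k))).
Context (Hfp : forall k m, fr (zshift k (zmul n m)) = fr k).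
Context (T : tri -> Prop) (HT : isADT D n T) (u : Z -> Z -> R) (Hu : periodic_grid n u).

Notation U := (gval u).

(** Covers [phi] and [psi] at once, so that main term and error term are transported by the same
    lemma. *)
Definition edge_weighted (w : zpt -> zpt -> R) (X : pt) (k : zpt) : R :=
  lsum dirs8 (fun d => edge_ind n T X k (nb fr k d) * w k d).

Lemma hpt_shift k m : hpt n (zshift k (zmul n m)) = vadd (hpt n k) (toR m).
Proof using HF.
  destruct (fine_n D L n HF) as [_ Hn]. unfold hpt, zshift, zmul, vadd, toR; cbn [fst snd].
  rewrite !plus_IZR, !mult_IZR, <- INR_IZR_INZ. f_equal; field; lra.
Qed.

Lemma gam_shift k m d : gam D n fr (zshift k (zmul n m)) d = gam D n fr k d.
Proof using HF Hper Hfp.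
  unfold gam, de, cA, cB, cC, coefA, coefB, deltaD, MM, deltaD. rewrite Hfp, hpt_shift, Hper. reflexivity.
Qed.

Lemma nb_shift k m d : nb fr (zshift k (zmul n m)) d = zshift (nb fr k d) (zmul n m).
Proof using Hfp. unfold nb. rewrite Hfp. apply zcomb_zshift. Qed.

Lemma dU_shift k m d : dU fr U (zshift k (zmul n m)) d = dU fr U k d.
Proof using Hfp Hu. unfold dU. rewrite nb_shift. rewrite !(gval_periodic n u Hu _ m). reflexivity. Qed.

Lemma edge_weighted_shift w X k m : (forall k m d, w (zshift k (zmul n m)) d = w k d) ->
  edge_weighted w (vadd X (toR (zmul n m))) (zshift k (zmul n m)) = edge_weighted w X k.
Proof using HF Hfp HT.
  intros Hw. unfold edge_weighted. apply lsum_ext. intros d _. rewrite Hw. f_equal. unfold edge_ind. apply ind_iff.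
  rewrite nb_shift. unfold zmul. rewrite !(Vt_shift D L n HF T HT). reflexivity.
Qed.

(* Mass transport: a periodic sum over points [k + s] of contributions from the nearby
   vertices [k + p] is the sum over vertices [k] of contributions from nearby points. *)
Lemma edge_weighted_transport w s : (forall k m d, w (zshift k (zmul n m)) d = w k d) ->
  ZS n (fun k => lsum (boxC L) (fun p => edge_weighted w (vadd (toR k) s) (zshift k p))) =
  ZS n (fun k => lsum dirs8 (fun d => w k d * cnt L n fr T k s d)).
Proof using HF Hfp HT.
  intros Hw. rewrite ZS_lsum.
  rewrite (lsum_ext (boxC L) _ (fun p => ZS n (fun k => edge_weighted w (shifted k s p) k))).
  - rewrite <- ZS_lsum. apply ZS_ext. intros k. unfold edge_weighted. rewrite lsum_exchange. apply lsum_ext. intros d _.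
    unfold cnt. rewrite <- lsum_scal. apply lsum_ext. intros p _. ring.
  (* For a fixed offset [p] the vertex is renamed from [k + p] to [k], which periodicity of the
     summand permits. *)
  - intros p _. rewrite <- (ZS_shift n (fun k => edge_weighted w (shifted k s p) k) p).
    + apply ZS_ext. intros k. f_equal. unfold shifted, vadd, vsub, toR, zshift; cbn [fst snd]. rewrite !plus_IZR. f_equal; ring.
    + intros k m. fold (zmul n m). rewrite <- (edge_weighted_shift w (shifted k s p) k m Hw). f_equal.
      unfold shifted, vadd, vsub, toR, zshift, zmul; cbn [fst snd]. rewrite !plus_IZR. f_equal; ring.
Qed.

Lemma edge_weighted_outside w X k : ~ Vt n T X k -> edge_weighted w X k = 0.
Proof using.
  intros H. unfold edge_weighted. rewrite (lsum_ext dirs8 _ (fun _ => 0)); [rewrite lsum_const; ring|].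
  intros d _. unfold edge_ind. rewrite ind_false by tauto. ring.
Qed.

Lemma zsub_inj a b k : zsub a k = zsub b k -> a = b.
Proof using. unfold zsub. intros E. injection E as E1 E2. destruct a, b; cbn [fst snd] in *. f_equal; lia. Qed.

Lemma zshift_zsub a k : zshift k (zsub a k) = a.
Proof using. unfold zshift, zsub; destruct a; cbn [fst snd]. f_equal; ring. Qed.

Lemma edge_weighted_box w a b c k s : T (a, b, c) -> inTri n (a, b, c) (vadd (toR k) s) -> Good (VL L) 0 (vadd (toR k) s) ->
  0 <= fst s <= 1 -> 0 <= snd s <= 1 ->
  lsum (boxC L) (fun p => edge_weighted w (vadd (toR k) s) (zshift k p)) =
  edge_weighted w (vadd (toR k) s) a + edge_weighted w (vadd (toR k) s) b + edge_weighted w (vadd (toR k) s) c.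
Proof using HF HT.
  intros Ht HX HG Hs1 Hs2. set (X := vadd (toR k) s) in *. pose proof (fine_L D L n HF) as HL.
  destruct (tdet_distinct _ _ _ (tri_unimodular D L n HF T HT a b c Ht)) as [N1 [N2 N3]].
  rewrite (lsum_support (boxC L) (zsub a k :: zsub b k :: zsub c k :: nil)).
  - cbn [lsum]. rewrite !zshift_zsub. ring.
  - apply NoDup_zbox.
  - repeat constructor; simpl; intros H; repeat destruct H as [H|H]; try contradiction; apply zsub_inj in H; congruence.
  - assert (W : forall p, tri_vert (a, b, c) p -> In (zsub p k) (boxC L)).
    { intros p Hp. destruct (tri_near D L n HF T HT a b c p X Ht HX Hp) as [B1 B2].
      unfold X, vadd, toR in B1, B2; cbn [fst snd] in B1, B2. apply Rabs_le_inv in B1. apply Rabs_le_inv in B2.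
      unfold boxC. apply in_zbox.
      - apply le_IZR. destruct (archimed (8 * L + 1)). lra.
      - unfold zsub; cbn [fst snd]. split; apply abs_IZR_le_iff; rewrite minus_IZR; apply Rabs_le; lra. }
    intros p [<-|[<-|[<-|[]]]]; apply W; simpl; tauto.
  - intros p _ Hn. apply edge_weighted_outside. rewrite (Vt_good D L n HF T HT _ _ _ Ht HX HG). simpl. intros H. apply Hn. simpl.
    assert (Ep : forall q, zshift k p = q -> zsub q k = p).
    { intros q <-. unfold zsub, zshift; destruct p; cbn [fst snd]. f_equal; ring. }
    destruct H as [H|[H|H]]; apply Ep in H; tauto.
Qed.

Notation wE := (fun k d => gam D n fr k d * dU fr U k d).
Notation wU := (fun k d => dU fr U k d).

Lemma Phi_edges G k s : admissible_grad n T u G -> Good (VL L) 0 s -> 0 <= fst s <= 1 -> 0 <= snd s <= 1 ->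
  Rabs (Phi D n G (vadd (toR k) s) - lsum (boxC L) (fun p => edge_weighted wE (vadd (toR k) s) (zshift k p))) <=
  wtol L n * lsum (boxC L) (fun p => edge_weighted wU (vadd (toR k) s) (zshift k p)).
Proof using HF HT Hfr.
  intros HG Hs Hs1 Hs2. destruct (admissible_tri D L n HF T u G (vadd (toR k) s) HG) as [a [b [c [Ht [HX [_ [G1 G2]]]]]]].
  assert (HGX : Good (VL L) 0 (vadd (toR k) s)).
  { replace (vadd (toR k) s) with (vadd s (toR k)); [apply Good_shift, Hs|]. unfold vadd; cbn [fst snd]. f_equal; ring. }
  rewrite !(edge_weighted_box _ a b c k s Ht HX HGX Hs1 Hs2).
  apply (pointwise_energy D L n HF fr Hfr T HT U a b c _ _ Ht HX HGX G1 G2).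
Qed.

Definition Sgrad : R := ZS n (fun k => lsum dirs8 (dU fr U k)).
Definition Esten : R := ZS n (sten D n fr U).
Definition Etot (G : pt -> pt) (m : nat) : R := ZS n (fun k => Sum2 m (fun i j => Phi D n G (vadd (toR k) (unit_sample m i j)))).

Lemma sten_shift k m : sten D n fr U (zshift k (zmul n m)) = sten D n fr U k.
Proof using HF Hper Hfp Hu.
  unfold sten. apply lsum_ext. intros d _. rewrite gam_shift, dU_shift. reflexivity.
Qed.

Lemma Sgrad_bound : Sgrad <= 250 * L * L * INR (length (boxL L)) * Esten.
Proof using HF Hfr Hper Hfp Hu.
  unfold Sgrad, Esten. eapply Rle_trans; [apply ZS_le; intros k; apply (local_energy_bound D L n HF fr Hfr U k)|].
  rewrite ZS_scal, ZS_lsum, Rmult_assoc.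
  rewrite (lsum_ext _ _ (fun _ => ZS n (sten D n fr U))).
  - rewrite lsum_const. lra.
  - intros r _. apply ZS_shift. intros k m. apply sten_shift.
Qed.

Lemma Sgrad_nonneg : 0 <= Sgrad.
Proof using.
  unfold Sgrad. replace 0 with (ZS n (fun _ => 0)) by (unfold ZS; rewrite Sum2_const; ring).
  apply ZS_le. intros k. apply lsum_nonneg. intros. apply pow2_ge_0.
Qed.
Lemma Esten_nonneg : 0 <= Esten.
Proof using HF Hfr.
  unfold Esten. replace 0 with (ZS n (fun _ => 0)) by (unfold ZS; rewrite Sum2_const; ring).
  apply ZS_le. intros k. apply (sten_nonneg D L n HF fr Hfr).
Qed.

Lemma ZS_abs f : Rabs (ZS n f) <= ZS n (fun k => Rabs (f k)).
Proof using. apply Sum2_abs. Qed.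

(** The three errors are the pointwise one of the weights ([wtol]), that of the edge counts
    ([ctol]), and the samples that are not good, where only the bound [emax] on the density is
    available. The main term carries the number of good samples because the others are left out of
    the counts. *)
Lemma Etot_comparison G m : admissible_grad n T u G ->
  Rabs (Etot G m - good_count L m * Esten) <=
    INR m * INR m * (wtol L n * INR (length (boxC L)) + ctol L n) * Sgrad +
    INR n * INR n * emax L n u * (INR m * INR m - good_count L m).
Proof using HF HT Hfr Hper Hfp Hu.
  intros HG. pose proof (pos_INR m) as Hm. pose proof Sgrad_nonneg as HS0.
  set (gi := fun i j => ind (Good (VL L) 0 (unit_sample m i j))).
  (* The total over the good samples of the [w]-weights of the edges at each; after transport it
     becomes a sum over lattice edges weighted by their counts. *)
  set (A := fun w => Sum2 m (fun i j => gi i j * ZS n (fun k => lsum (boxC L) (fun p => edge_weighted w (vadd (toR k) (unit_sample m i j)) (zshift k p))))).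
  assert (HA : forall w, (forall k m d, w (zshift k (zmul n m)) d = w k d) -> A w = ZS n (fun k => lsum dirs8 (fun d => w k d * edge_count L n fr T m k d))).
  { intros w Hw. unfold A.
    rewrite (Sum2_ext m _ (fun i j => ZS n (fun k => gi i j * lsum dirs8 (fun d => w k d * cnt L n fr T k (unit_sample m i j) d)))).
    - rewrite <- (ZS_Sum2_exchange n m (fun k i j => gi i j * lsum dirs8 (fun d => w k d * cnt L n fr T k (unit_sample m i j) d))).
      apply ZS_ext. intros k.
      rewrite (Sum2_ext m _ (fun i j => lsum dirs8 (fun d => w k d * (gi i j * cnt L n fr T k (unit_sample m i j) d)))).
      + rewrite Sum2_lsum. apply lsum_ext. intros d _. rewrite Sum2_scal. reflexivity.
      + intros i j _ _. rewrite <- lsum_scal. apply lsum_ext. intros; ring.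
    - intros i j _ _. rewrite ZS_scal, (edge_weighted_transport w _ Hw). reflexivity. }
  assert (HwE : forall k m d, wE (zshift k (zmul n m)) d = wE k d) by (intros; cbv beta; rewrite gam_shift, dU_shift; reflexivity).
  assert (HwU : forall k m d, wU (zshift k (zmul n m)) d = wU k d) by (intros; apply dU_shift).
  assert (K1 : Rabs (A wE - good_count L m * Esten) <= INR m * INR m * ctol L n * Sgrad).
  { rewrite (HA _ HwE). unfold Esten. rewrite <- ZS_scal.
    replace (ZS n (fun k => lsum dirs8 (fun d => wE k d * edge_count L n fr T m k d)) - ZS n (fun k => good_count L m * sten D n fr U k))
      with (ZS n (fun k => lsum dirs8 (fun d => dU fr U k d * (gam D n fr k d * (edge_count L n fr T m k d - good_count L m))))).
    - eapply Rle_trans; [apply ZS_abs|]. unfold Sgrad. rewrite <- ZS_scal. apply ZS_le. intros k.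
      rewrite <- lsum_scal.
      assert (Habs : forall l (f : zpt -> R), Rabs (lsum l f) <= lsum l (fun d => Rabs (f d))).
      { clear. induction l as [|x l IH]; intros f; simpl; [rewrite Rabs_R0; lra|]. eapply Rle_trans; [apply Rabs_triang|]. specialize (IH f). lra. }
      eapply Rle_trans; [apply Habs|]. apply lsum_le. intros d Hd.
      rewrite Rabs_mult, (Rabs_pos_eq (dU fr U k d)) by apply pow2_ge_0. rewrite (Rmult_comm (INR m * INR m * ctol L n)).
      apply Rmult_le_compat_l; [apply pow2_ge_0|]. apply (edge_count_error D L n HF fr Hfr T HT m k d Hd).
    - unfold ZS. rewrite <- Sum2_minus. apply Sum2_ext. intros i j _ _. unfold sten. rewrite <- lsum_scal.
      match goal with |- _ = ?a - ?b => replace (a - b) with (a + -1 * b) by ring end. rewrite <- lsum_scal, <- lsum_plus.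
      apply lsum_ext. intros; ring. }
  assert (K2 : A wU <= INR m * INR m * INR (length (boxC L)) * Sgrad).
  { rewrite (HA _ HwU). unfold Sgrad. rewrite <- ZS_scal. apply ZS_le. intros k. rewrite <- lsum_scal. apply lsum_le. intros d _.
    rewrite Rmult_comm. apply Rmult_le_compat_r; [apply pow2_ge_0|]. unfold edge_count. rewrite <- Sum2_const. apply Sum2_le. intros i j _ _.
    destruct (cnt_bounds L n fr T k (unit_sample m i j) d). destruct (ind_bounds (Good (VL L) 0 (unit_sample m i j))).
    rewrite <- (Rmult_1_l (INR (length (boxC L)))). apply Rmult_le_compat; assumption. }
  pose proof (emax_nonneg D L n HF u Hu) as He.
  assert (K3 : Rabs (Etot G m - A wE) <= wtol L n * A wU + INR n * INR n * emax L n u * (INR m * INR m - good_count L m)).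
  { assert (E1 : INR n * INR n * emax L n u * (INR m * INR m - good_count L m) = Sum2 m (fun i j => INR n * INR n * emax L n u * (1 - gi i j))).
    { rewrite Sum2_scal, Sum2_minus, Sum2_const. unfold good_count, gi. ring. }
    rewrite E1. unfold Etot. rewrite (ZS_Sum2_exchange n m (fun k i j => Phi D n G (vadd (toR k) (unit_sample m i j)))).
    unfold A. rewrite <- Sum2_minus, <- Sum2_scal, <- Sum2_plus. eapply Rle_trans; [apply Sum2_abs|]. apply Sum2_le. intros i j Hi Hj.
    set (s := unit_sample m i j).
    assert (Hs : 0 <= fst s <= 1 /\ 0 <= snd s <= 1) by (split; apply unit_sample_range; assumption).
    unfold gi. fold s. destruct (classic (Good (VL L) 0 s)) as [HGs|HGs].
    - rewrite ind_true by exact HGs. rewrite Rminus_diag, Rmult_0_r, Rplus_0_r, !Rmult_1_l. rewrite <- ZS_scal.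
      replace (ZS n (fun k => Phi D n G (vadd (toR k) s)) - ZS n (fun k => lsum (boxC L) (fun p => edge_weighted wE (vadd (toR k) s) (zshift k p))))
        with (ZS n (fun k => Phi D n G (vadd (toR k) s) - lsum (boxC L) (fun p => edge_weighted wE (vadd (toR k) s) (zshift k p)))).
      + eapply Rle_trans; [apply ZS_abs|]. apply ZS_le. intros k. apply Phi_edges; try assumption; apply Hs.
      + unfold ZS. rewrite <- Sum2_minus. reflexivity.
    - rewrite ind_false by exact HGs. rewrite !Rmult_0_l, Rmult_0_r, Rminus_0_r, Rplus_0_l, Rminus_0_r, Rmult_1_r.
      eapply Rle_trans; [apply ZS_abs|]. unfold ZS. rewrite <- Sum2_const. apply Sum2_le. intros a b _ _.
      destruct (Phi_bounds D L n HF T HT u Hu G (vadd (toR (Z.of_nat a, Z.of_nat b)) s) HG). rewrite Rabs_pos_eq; assumption. }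
  assert (Hw : 0 <= wtol L n).
  { destruct (wtol_hh D L n HF) as [Kw [Hk [Ek _]]]. rewrite Ek. destruct (hh_small D L n HF). apply Rmult_le_pos; lra. }
  assert (wtol L n * A wU <= wtol L n * (INR m * INR m * INR (length (boxC L)) * Sgrad)) by (apply Rmult_le_compat_l; assumption).
  apply Rabs_le_inv in K1. apply Rabs_le_inv in K3. apply Rabs_le. lra.
Qed.

(** With n m samples per side of the period, every lattice cell carries the same m by m pattern of
    offsets; this is what makes the transport over the lattice applicable. *)
Lemma PS_Etot G m : (1 <= m)%nat -> INR n * INR n * PS D n G (n * m) = Etot G m / (INR m * INR m).
Proof using HF.
  intros Hm. destruct (fine_n D L n HF) as [_ Hn]. assert (Hmp : 0 < INR m) by (apply lt_0_INR; lia).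
  unfold PS, Etot. rewrite Sum2_mul, mult_INR.
  replace (Sum2 n (fun i j => Sum2 m (fun i' j' => Phi D n G (sample n (n * m) (i * m + i') (j * m + j')))))
    with (ZS n (fun k => Sum2 m (fun i j => Phi D n G (vadd (toR k) (unit_sample m i j))))); [field; lra|].
  unfold ZS. apply Sum2_ext. intros i j _ _. apply Sum2_ext. intros i' j' _ _. f_equal.
  unfold vadd, toR, unit_sample, sample; cbn [fst snd]. rewrite !plus_INR, !mult_INR, <- !INR_IZR_INZ. f_equal; field; lra.
Qed.

Lemma bad_fraction : exists C, 0 <= C /\ forall m, (1 <= m)%nat -> 0 <= INR m * INR m - good_count L m <= C * INR m.
Proof using HF.
  pose proof (fine_L D L n HF) as HL. pose proof (VL_ge L) as HV.
  assert (HVL : (0 <= VL L)%Z) by (apply le_IZR; lra).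
  destruct (bad_count (VL L) 1 1 HVL (le_n _)) as [C [HC Hb]]. exists C. split; [exact HC|]. intros m Hm.
  assert (Hmp : 0 < INR m) by (apply lt_0_INR; lia).
  assert (E : INR m * INR m - good_count L m = Sum2 m (fun i j => 1 - ind (Good (VL L) 0 (unit_sample m i j)))).
  { rewrite Sum2_minus, Sum2_const. unfold good_count. ring. }
  rewrite E. split.
  - apply Rle_trans with (Sum2 m (fun _ _ => 0)); [rewrite Sum2_const; lra|].
    apply Sum2_le. intros i j _ _. destruct (ind_bounds (Good (VL L) 0 (unit_sample m i j))). lra.
  - eapply Rle_trans; [|apply (Hb m Hm)]. apply Sum2_le. intros i j _ _.
    assert (Es : sample 1 m i j = unit_sample m i j) by (unfold sample, unit_sample; simpl INR; f_equal; ring). rewrite Es.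
    destruct (classic (Good (VL L) 0 (unit_sample m i j))) as [HG|HG].
    + rewrite ind_true by exact HG. destruct (ind_bounds (~ Good (VL L) (1 * INR 1 / INR m) (unit_sample m i j))). lra.
    + rewrite ind_false by exact HG. rewrite ind_true; [lra|]. intros HG'. apply HG. eapply Good_weaken; [|exact HG'].
      simpl INR. apply Rmult_le_pos; [lra|left; apply Rinv_0_lt_compat; exact Hmp].
Qed.

(** Here n is fixed and m tends to infinity: the sampling error, the missing good samples and the
    bound [emax] only enter through K / m, while the remaining tolerance does not depend on m. *)
Lemma energy_comparison I C : 0 <= C -> (forall G N, admissible_grad n T u G -> (1 <= N)%nat -> Rabs (PS D n G N - I) <= C / INR N) ->
  (exists G, admissible_grad n T u G) ->
  Rabs (INR n * INR n * I - Esten) <= (wtol L n * INR (length (boxC L)) + ctol L n) * Sgrad.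
Proof using HF HT Hfr Hper Hfp Hu.
  intros HC HI [G HG]. destruct bad_fraction as [C1 [HC1 Hbf]]. destruct (fine_n D L n HF) as [Hn1 Hn].
  pose proof Esten_nonneg as HE0. pose proof (emax_nonneg D L n HF u Hu) as He0.
  set (tol := (wtol L n * INR (length (boxC L)) + ctol L n) * Sgrad).
  set (K := INR n * C + C1 * Esten + INR n * INR n * emax L n u * C1).
  assert (HK : 0 <= K).
  { unfold K. assert (0 <= INR n * C) by (apply Rmult_le_pos; lra). assert (0 <= C1 * Esten) by (apply Rmult_le_pos; assumption).
    assert (0 <= INR n * INR n * emax L n u * C1) by (apply Rmult_le_pos; [apply Rmult_le_pos; [apply Rmult_le_pos; lra|exact He0]|exact HC1]). lra. }
  assert (Hm : forall m, (1 <= m)%nat -> Rabs (INR n * INR n * I - Esten) <= tol + K / INR m).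
  { intros m Hm. assert (Hmp : 0 < INR m) by (apply lt_0_INR; lia).
    pose proof (HI G (n * m)%nat HG ltac:(nia)) as P1. rewrite mult_INR in P1.
    pose proof (Etot_comparison G m HG) as P2. pose proof (PS_Etot G m Hm) as P3. pose proof (Hbf m Hm) as P4.
    set (g := good_count L m) in *. set (e := Etot G m) in *. set (p := PS D n G (n * m)) in *.
    assert (Q1 : Rabs (INR n * INR n * I - INR n * INR n * p) <= INR n * C / INR m).
    { rewrite <- Rmult_minus_distr_l, Rabs_mult, Rabs_pos_eq, Rabs_minus_sym by (apply Rmult_le_pos; lra).
      replace (INR n * C / INR m) with (INR n * INR n * (C / (INR n * INR m))) by (field; lra).
      apply Rmult_le_compat_l; [apply Rmult_le_pos; lra|exact P1]. }
    rewrite P3 in Q1.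
    assert (Q2 : Rabs (e / (INR m * INR m) - Esten) <= tol + (C1 * Esten + INR n * INR n * emax L n u * C1) / INR m).
    { replace (e / (INR m * INR m) - Esten) with (((e - g * Esten) + - ((INR m * INR m - g) * Esten)) / (INR m * INR m)) by (field; lra).
      unfold Rdiv at 1. rewrite Rabs_mult, (Rabs_pos_eq (/ (INR m * INR m))) by (left; apply Rinv_0_lt_compat; apply Rmult_lt_0_compat; assumption).
      replace (tol + (C1 * Esten + INR n * INR n * emax L n u * C1) / INR m)
       with ((INR m * INR m * tol + (C1 * INR m) * Esten + INR n * INR n * emax L n u * (C1 * INR m)) * / (INR m * INR m)) by (field; lra).
      apply Rmult_le_compat_r; [left; apply Rinv_0_lt_compat; apply Rmult_lt_0_compat; assumption|].
      eapply Rle_trans; [apply Rabs_triang|]. rewrite Rabs_Ropp, Rabs_mult, (Rabs_pos_eq Esten), (Rabs_pos_eq (INR m * INR m - g)) by lra.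
      assert ((INR m * INR m - g) * Esten <= (C1 * INR m) * Esten) by (apply Rmult_le_compat_r; lra).
      assert (INR n * INR n * emax L n u * (INR m * INR m - g) <= INR n * INR n * emax L n u * (C1 * INR m)).
      { apply Rmult_le_compat_l; [apply Rmult_le_pos; [apply Rmult_le_pos; lra|exact He0]|lra]. }
      unfold tol. lra. }
    apply Rabs_le_inv in Q1. apply Rabs_le_inv in Q2.
    replace (K / INR m) with (INR n * C / INR m + (C1 * Esten + INR n * INR n * emax L n u * C1) / INR m) by (unfold K; field; lra).
    apply Rabs_le. lra. }
  apply Rnot_lt_le. intros Hlt. set (d := Rabs (INR n * INR n * I - Esten) - tol). assert (Hd : 0 < d) by (unfold d; lra).
  destruct (INR_unbounded (K / d)) as [m0 Hm0]. pose proof (Hm (S m0) ltac:(lia)) as H.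
  assert (Hs : K / INR (S m0) < d).
  { assert (0 <= K / d) by (apply Rmult_le_pos; [exact HK|left; apply Rinv_0_lt_compat, Hd]). rewrite S_INR.
    apply (Rmult_lt_reg_r (INR m0 + 1)); [lra|]. unfold Rdiv at 1. rewrite Rmult_assoc, Rinv_l, Rmult_1_r by lra.
    apply (Rmult_lt_reg_r (/ d)); [apply Rinv_0_lt_compat, Hd|]. rewrite (Rmult_comm d), Rmult_assoc, Rinv_r, Rmult_1_r by lra. unfold Rdiv in *. lra. }
  unfold d in Hs. lra.
Qed.
End Comparison.

(** * From the given stencils and triangulations to the energy bounds *)

Lemma admissible_grad_exists D L n T u : fine D L n -> isADT D n T -> exists G, admissible_grad n T u G.
Proof.
  intros HF [HT1 [HT2 _]]. destruct (polygonization D L n HF) as [_ [Hcov _]].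
  assert (H : forall x, exists g t, T t /\ tri_set n t x /\ tri_grad n u t g).
  { intros x. destruct (Hcov x) as [q [Hq Hx]]. destruct (proj1 (HT2 q Hq) x Hx) as [t [Ht [_ Htx]]].
    destruct (HT1 t Ht) as [Hd _]. destruct t as [[a b] c]. unfold tri_nondeg in Hd. unfold tri_grad.
    set (v := vsub (hpt n b) (hpt n a)) in *. set (w := vsub (hpt n c) (hpt n a)) in *. cbv zeta in Hd.
    set (p := u (fst b) (snd b) - u (fst a) (snd a)). set (r := u (fst c) (snd c) - u (fst a) (snd a)).
    (* Cramer's rule for the two equations of [tri_grad]. *)
    exists ((p * snd w - r * snd v) / (fst v * snd w - snd v * fst w), (r * fst v - p * fst w) / (fst v * snd w - snd v * fst w)).
    exists (a, b, c). split; [exact Ht|]. split; [exact Htx|]. unfold dot; cbn [fst snd]. fold v w p r. split; field; exact Hd. }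
  exists (fun x => proj1_sig (constructive_indefinite_description _ (H x))). intros x.
  exact (proj2_sig (constructive_indefinite_description _ (H x))).
Qed.

(** The choice [sb] is an arbitrary function of the point, while transport needs periodic frames.
    Since [Eh] evaluates [sb] only at the representatives in one period, the frame of [k] is taken
    from its residue modulo n; periodicity of the field makes it valid at [k]. *)
Lemma stencil_frames_periodic D L n sb : fine D L n -> (forall z k, D (vadd z (toR k)) = D z) ->
  (forall z, superbase (sb z) /\ obtuse (MM D z) (sb z)) ->
  exists fr : zpt -> zpt * zpt, (forall k, FrameAt D n k (fst (fr k)) (snd (fr k))) /\
    (forall k m, fr (zshift k (zmul n m)) = fr k) /\ forall u, Eh D sb n u = Esten D n fr u.
Proof.
  intros HF Hper Hsb. destruct (fine_n D L n HF) as [Hn Hnp]. pose proof HF as [HU _].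
  assert (H : forall z, exists e, Frame (MM D z) (fst e) (snd e) /\ forall u i j,
    stencil_term D sb u z i j = edge_sum (deltaD D z) (bform (MM D z) (toR (fst e)) (toR (fst e)))
      (- bform (MM D z) (toR (fst e)) (toR (snd e))) (bform (MM D z) (toR (snd e)) (toR (snd e))) (gval u) (i, j) (fst e) (snd e)).
  { intros z. destruct (Hsb z) as [H1 H2]. destruct (stencil_frame D L sb z HU H1 H2) as [e1 [e2 He]]. exists (e1, e2). exact He. }
  pose (f := fun z => proj1_sig (constructive_indefinite_description _ (H z))).
  assert (Hf := fun z => proj2_sig (constructive_indefinite_description _ (H z))). cbv beta in Hf. fold f in Hf.
  exists (fun k => f (hpt n (zmodn n k))). split; [|split].
  - intros k. destruct (zmodn_spec n k Hn) as [m Ek]. fold (zmul n m) in Ek. unfold FrameAt.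
    replace (MM D (hpt n k)) with (MM D (hpt n (zmodn n k))); [apply Hf|].
    rewrite Ek at 2. rewrite (hpt_shift D L n HF). unfold MM, deltaD. rewrite Hper. reflexivity.
  - intros k m. unfold zmul. rewrite zmodn_shift. reflexivity.
  - intros u. unfold Eh, Esten, ZS, Sum2. rewrite sum_f_R0_Sum. replace (S (n - 1)) with n by lia.
    apply Sum_ext. intros i Hi. rewrite sum_f_R0_Sum. replace (S (n - 1)) with n by lia. apply Sum_ext. intros j Hj.
    assert (Ez : zmodn n (Z.of_nat i, Z.of_nat j) = (Z.of_nat i, Z.of_nat j)).
    { unfold zmodn; cbn [fst snd]. rewrite !Z.mod_small by lia. reflexivity. }
    assert (Eh : hpt n (Z.of_nat i, Z.of_nat j) = (INR i / INR n, INR j / INR n)).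
    { unfold hpt; cbn [fst snd]. rewrite <- !INR_IZR_INZ. reflexivity. }
    rewrite (proj2 (Hf _)). unfold sten, gam, dU, nb, edge_sum, de, cA, cB, cC, coefA, coefB. rewrite Ez, Eh. reflexivity.
Qed.

Lemma fine_of_mesh D L n : uniform_bounds D L -> (1 <= n)%nat -> / INR n <= / (10000 * (4 * big L) ^ 6 * (128 * L ^ 4 * (4 * big L))) -> fine D L n.
Proof.
  intros HU Hn Hh. split; [exact HU|]. split; [exact Hn|]. pose proof (proj1 HU) as HL. destruct (big_bounds L HL) as [Hb1 Hb2].
  assert (0 < L ^ 4) by (apply pow_lt; lra). assert (0 < (4 * big L) ^ 6) by (apply pow_lt; lra).
  unfold loceps, Rdiv. rewrite <- Rmult_assoc.
  set (K := 10000 * (4 * big L) ^ 6 * (128 * L ^ 4 * (4 * big L))) in *.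
  assert (HK : 0 < K) by (unfold K; repeat apply Rmult_lt_0_compat; lra).
  apply Rle_trans with (K * / K); [apply Rmult_le_compat_l; lra|rewrite Rinv_r; lra].
Qed.

(** Every tolerance is exactly a constant times 1/n, and the lengths of the boxes depend on [L]
    alone. *)
Lemma comparison_constant L : 1 <= L -> exists c, 0 < c /\ forall D n, fine D L n ->
  (wtol L n * INR (length (boxC L)) + ctol L n) * (250 * L * L * INR (length (boxL L))) <= c / INR n.
Proof.
  intros HL. destruct (big_bounds L HL) as [Hb1 Hb2].
  set (w := 32 * (big L ^ 2 * (128 * L ^ 4 * (4 * big L)))).
  set (c := ((256 * L ^ 4 + L * w) * INR (length (boxC L)) + / 2 * L * w * (1 + INR (length (boxC L)))) * (250 * L * L * INR (length (boxL L)))).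
  pose proof (pos_INR (length (boxC L))) as P1. pose proof (pos_INR (length (boxL L))) as P2.
  assert (Hw : 0 <= w).
  { unfold w. assert (0 <= L ^ 4) by (apply pow_le; lra). assert (0 <= big L ^ 2) by (apply pow_le; lra). repeat apply Rmult_le_pos; lra. }
  assert (Hc : 0 <= c).
  { unfold c. assert (0 <= L ^ 4) by (apply pow_le; lra). assert (0 <= L * w) by (apply Rmult_le_pos; lra).
    apply Rmult_le_pos; [apply Rplus_le_le_0_compat|repeat apply Rmult_le_pos; lra].
    - apply Rmult_le_pos; lra.
    - apply Rmult_le_pos; lra. }
  (* The added 1 only makes the constant strictly positive. *)
  exists (c + 1). split; [lra|]. intros D n HF. destruct (fine_n D L n HF) as [_ Hn].
  assert (0 < / INR n) by (apply Rinv_0_lt_compat; exact Hn).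
  replace ((wtol L n * INR (length (boxC L)) + ctol L n) * (250 * L * L * INR (length (boxL L)))) with (c * / INR n).
  - apply Rmult_le_compat_r; lra.
  - unfold c, wtol, ctol, bsmall, loceps, hh, w, Rdiv. ring.
Qed.

Theorem mainTheorem1 (D : pt -> sym2)
  (HSPD : forall z, SPD (D z))
  (Hper : forall z (k : zpt), D (vadd z (toR k)) = D z)
  (HLip : exists L, forall z w, mdist (D z) (D w) <= L * pdist z w) :
  exists h0 c, 0 < h0 /\ 0 < c /\
    forall n : nat, (1 <= n)%nat -> / INR n <= h0 ->
      Qh_polygonization D n /\
      forall sb : pt -> zpt * zpt * zpt,
        (forall z, superbase (sb z) /\ obtuse (MM D z) (sb z)) ->
        forall T : tri -> Prop, isADT D n T ->
        forall u : Z -> Z -> R, periodic_grid n u ->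
        exists I, Eprime_is D n T u I /\
          (1 - c / INR n) * Eh D sb n u <= I /\ I <= (1 + c / INR n) * Eh D sb n u.
Proof.
  destruct (uniform_bounds_exist D HSPD Hper HLip) as [L HU]. pose proof (proj1 HU) as HL.
  destruct (comparison_constant L HL) as [c [Hc Hcn]]. destruct (big_bounds L HL) as [Hb1 Hb2].
  (* The threshold is the smallness condition of [fine] solved for 1/n. *)
  exists (/ (10000 * (4 * big L) ^ 6 * (128 * L ^ 4 * (4 * big L)))), c. split.
  { assert (0 < L ^ 4) by (apply pow_lt; lra). assert (0 < (4 * big L) ^ 6) by (apply pow_lt; lra).
    apply Rinv_0_lt_compat. repeat apply Rmult_lt_0_compat; lra. }
  split; [exact Hc|]. intros n Hn Hh. pose proof (fine_of_mesh D L n HU Hn Hh) as HF.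
  split; [exact (polygonization D L n HF)|]. intros sb Hsb T HT u Hu.
  destruct (stencil_frames_periodic D L n sb HF Hper Hsb) as [fr [Hfr [Hfp HE]]].
  pose proof (admissible_grad_exists D L n T u HF HT) as HG.
  destruct (PS_limit D L n HF T HT u Hu HG) as [J [C [HC HJ]]].
  pose proof (energy_comparison D L n HF Hper fr Hfr Hfp T HT u Hu J C HC HJ HG) as Hcmp.
  pose proof (Sgrad_bound D L n HF Hper fr Hfr Hfp u Hu) as HS.
  pose proof (Esten_nonneg D L n HF fr Hfr u) as HE0. rewrite HE.
  (* [J] is the mean of the scaled density; undoing the scaling of the gradient by 1/n gives the
     factor n^2. *)
  exists (INR n * INR n * J). split.
  - intros G HG' e He. destruct (fine_n D L n HF) as [_ Hnp].
    set (K := INR n * INR n * C). assert (HK : 0 <= K) by (unfold K; apply Rmult_le_pos; [apply Rmult_le_pos|]; lra).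
    destruct (INR_unbounded (K / e)) as [N0 HN0]. exists N0. intros N HN. unfold R_dist.
    rewrite riemann_mid_RS, (RS_PS D L n HF), <- Rmult_minus_distr_l, Rabs_mult, Rabs_pos_eq by (apply Rmult_le_pos; lra).
    apply Rle_lt_trans with (INR n * INR n * (C / INR (S N))).
    + apply Rmult_le_compat_l; [apply Rmult_le_pos; lra|apply HJ; [exact HG'|lia]].
    + replace (INR n * INR n * (C / INR (S N))) with (K / INR (S N)) by (unfold K, Rdiv; ring).
      assert (INR N0 <= INR N) by (apply le_INR; lia). rewrite S_INR.
      assert (0 <= K / e) by (apply Rmult_le_pos; [exact HK|left; apply Rinv_0_lt_compat, He]).
      assert (K = K / e * e) by (field; lra).
      apply (Rmult_lt_reg_r (INR N + 1)); [lra|]. unfold Rdiv at 1. rewrite Rmult_assoc, Rinv_l, Rmult_1_r by lra.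
      apply Rle_lt_trans with (K / e * e); [lra|]. rewrite Rmult_comm. apply Rmult_lt_compat_l; lra.
  - set (E := Esten D n fr u) in *. set (S := Sgrad n fr u) in *.
    set (t := wtol L n * INR (length (boxC L)) + ctol L n) in *.
    assert (Ht : 0 <= t).
    { unfold t. assert (0 <= bsmall L n) by (apply (bsmall_nonneg D); exact HF).
      destruct (wtol_hh D L n HF) as [Kw [Hk [Ek _]]]. destruct (hh_small D L n HF). pose proof (pos_INR (length (boxC L))).
      rewrite Ek. unfold ctol. apply Rplus_le_le_0_compat.
      - apply Rmult_le_pos; [apply Rmult_le_pos; lra|assumption].
      - apply Rmult_le_pos; [apply Rmult_le_pos; lra|lra]. }
    assert (t * S <= t * (250 * L * L * INR (length (boxL L))) * E).
    { rewrite Rmult_assoc. apply Rmult_le_compat_l; assumption. }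
    assert (t * (250 * L * L * INR (length (boxL L))) * E <= c / INR n * E) by (apply Rmult_le_compat_r; [exact HE0|exact (Hcn D n HF)]).
    apply Rabs_le_inv in Hcmp. lra.
Qed.
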